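(* Let $N\le 3$ and let $\Omega\subset\mathbb{R}^N$, $X$ and $\mathcal{E}_1$ be as in the context, for either one of the two boundary conditions (Dirichlet or Navier). Then for any $\omega\in\mathbb{R}$ and $\kappa>0$, the equation $$\Delta^2 u-\omega^2\Delta u+\kappa\,\mathrm{div}\left(|\nabla u|^2\nabla u\right)=0\quad\text{in }\Omega$$ under the chosen boundary condition has a ground state solution $u$ satisfying $\mathcal{E}_1(u)>0$, which is a critical point of $\mathcal{E}_1$ of saddle type.
   Context: $\Omega\subset\mathbb{R}^N$, $N\ge 1$, is a bounded domain with boundary of class $C^{4,\eta}$ for some $\eta\in(0,1)$. Two boundary conditions are considered. Dirichlet: $u=\partial u/\partial\nu=0$ on $\partial\Omega$, with $X:=W^{2,2}_0(\Omega)$. Navier: $u=\Delta u=0$ on $\partial\Omega$, with $X:=W^{2,2}(\Omega)\cap W^{1,2}_0(\Omega)$ and the additional assumption that $\partial\Omega$ satisfies a uniform outer ball condition (there is $r>0$ such that every boundary point lies on the boundary of an open ball of radius $r$ contained in $\mathbb{R}^N\setminus\overline{\Omega}$). $X$ is a Hilbert space with norm $\|\Delta u\|_{L^2}$. The energy functional is $$\mathcal{E}_1(u)=\frac12\int_\Omega|\Delta u|^2dx+\frac{\omega^2}{2}\int_\Omega|\nabla u|^2dx-\frac{\kappa}{4}\int_\Omega|\nabla u|^4dx,\qquad u\in X .$$ A (weak) solution is a critical point $u\in X$ of $\mathcal{E}_1$. A ground state solution is a nonzero weak solution $u$ with $\mathcal{E}_1(u)\le\mathcal{E}_1(v)$ for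 every nonzero weak solution $v$. A critical point $u$ of a functional $E$ on a normed space is of saddle type if it is neither a local minimizer nor a local maximizer, i.e. every neighborhood of $u$ contains $v,w$ with $E(v)<E(u)<E(w)$. *)

(* Defs.v *)
From HB Require Import structures.
From mathcomp Require Import all_boot all_order all_algebra.
From mathcomp Require Import all_classical all_reals all_analysis.

Set Implicit Arguments.
Unset Strict Implicit.
Unset Printing Implicit Defensive.

Import Order.TTheory GRing.Theory Num.Theory.
Import numFieldNormedType.Exports.

Local Open Scope classical_set_scope.
Local Open Scope ring_scope.

(** * Lebesgue measure on [R^N = 'rV[R]_N]

    MathComp-Analysis only has Lebesgue measure on the line.  ['rV[R]_N] gets
    the sigma-algebra generated by the coordinates, i.e. the Borel sets, and
    the measure is the iterated product; [lebesgue_rV_box] gives its value on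
    boxes, which determines it. *)

Definition rV_display : measure_display. Proof. exact: default_measure_display. Qed.

Section rV_measurable.
Context {R : realType} (n : nat).

Let coord : 'I_n -> 'rV[R]_n -> R := fun i x => x ord0 i.

Let rV_set0 : g_sigma_preimage coord set0.
Proof. exact: sigma_algebra0. Qed.

Let rV_setC A : g_sigma_preimage coord A -> g_sigma_preimage coord (~` A).
Proof. exact: sigma_algebraC. Qed.

Let rV_bigcup (F : (set 'rV[R]_n)^nat) :
  (forall i, g_sigma_preimage coord (F i)) ->
  g_sigma_preimage coord (\bigcup_i F i).
Proof. exact: sigma_algebra_bigcup. Qed.

HB.instance Definition _ := @isMeasurable.Build rV_display
  'rV[R]_n (g_sigma_preimage coord) rV_set0 rV_setC rV_bigcup.

Lemma measurable_rV_coord (i : 'I_n) :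
  measurable_fun setT (fun x : 'rV[R]_n => x ord0 i).
Proof.
move=> _ Y mY; rewrite setTI; apply: sub_sigma_algebra => /=.
rewrite -bigcup_seq/=; exists i => /=; first by rewrite mem_index_enum.
by exists Y => //; rewrite setTI.
Qed.

Lemma measurable_fun_rVP d (T : measurableType d) (f : T -> 'rV[R]_n) :
  (forall i, measurable_fun setT (fun t => f t ord0 i)) ->
  measurable_fun setT f.
Proof.
move=> mf; have prefS :
    g_sigma_preimage (fun i => coord i \o f) `<=` measurable.
  apply: smallest_sub; first exact: sigma_algebra_measurable.
  rewrite -bigcup_seq; apply: bigcup_sub => i _.
  by move=> A [B mB <-]; exact: mf.
rewrite g_sigma_preimage_comp in prefS.
by move=> _ A mA; apply: prefS; exists A.
Qed.

End rV_measurable.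

Section rV_cons.
Context {R : realType} (n : nat).

Definition rV_cons (p : measurableTypeR R * 'rV[R]_n) : 'rV[R]_n.+1 :=
  row_mx (const_mx p.1 : 'rV[R]_1) p.2.

Definition rV_uncons (x : 'rV[R]_n.+1) : measurableTypeR R * 'rV[R]_n :=
  (x ord0 ord0, \row_j x ord0 (lift ord0 j)).

Lemma rV_cons0 p : rV_cons p ord0 ord0 = p.1.
Proof.
rewrite /rV_cons mxE; case: splitP => [j _|k] /=; last by [].
by rewrite mxE.
Qed.

Lemma rV_consS p j : rV_cons p ord0 (lift ord0 j) = p.2 ord0 j.
Proof.
rewrite /rV_cons mxE; case: splitP => [k|k] /=.
  by rewrite ord1 /bump leq0n.
by rewrite /bump leq0n !add1n => -[] /val_inj ->.
Qed.

Lemma rV_consK : cancel rV_cons rV_uncons.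
Proof.
move=> [x v]; rewrite /rV_uncons rV_cons0; congr pair.
by apply/rowP => j; rewrite mxE rV_consS.
Qed.

Lemma measurable_rV_cons : measurable_fun setT rV_cons.
Proof.
apply: measurable_fun_rVP => i; case: (unliftP ord0 i) => [j|] ->.
  under eq_fun do rewrite rV_consS.
  apply: (@measurableT_comp _ _ _ _ _ _ (fun v : 'rV[R]_n => v ord0 j)) => //.
  exact: measurable_rV_coord.
under eq_fun do rewrite rV_cons0.
exact: measurable_fst.
Qed.

Lemma measurable_rV_uncons : measurable_fun setT rV_uncons.
Proof.
apply/measurable_fun_pair; first exact: measurable_rV_coord.
apply: measurable_fun_rVP => i; under eq_fun do rewrite mxE.
exact: measurable_rV_coord.
Qed.

Variable m : {sigma_finite_measure set 'rV[R]_n -> \bar R}.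

Definition lebesgue_rV_step : set 'rV[R]_n.+1 -> \bar R :=
  pushforward (@lebesgue_measure R \x m)%E rV_cons.

Let step_measure : {measure set 'rV[R]_n.+1 -> \bar R} :=
  measure_function_pushforward__canonical__measure_function_Measure
    (@lebesgue_measure R \x m)%E measurable_rV_cons.

HB.instance Definition _ := Measure.copy lebesgue_rV_step step_measure.

Let lebesgue_rV_step_sigma_finite : sigma_finite setT lebesgue_rV_step.
Proof.
have /sigma_finiteP[F [TF ndF Foo]] := sigma_finiteT (@lebesgue_measure R).
have /sigma_finiteP[G [TG ndG Goo]] := sigma_finiteT m.
exists (fun k => rV_uncons @^-1` (F k `*` G k)).
  rewrite -preimage_bigcup (_ : \bigcup_k _ = setT) ?preimage_setT//.
  apply/seteqP; split=> // -[x v] _.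
  have [k _ Fx] : (\bigcup_k F k) x by rewrite -TF.
  have [l _ Gv] : (\bigcup_k G k) v by rewrite -TG.
  exists (maxn k l) => //; split => /=.
    by move: x Fx; exact/subsetPset/ndF/leq_maxl.
  by move: v Gv; exact/subsetPset/ndG/leq_maxr.
move=> k; have [mF Fk] := Foo k; have [mG Gk] := Goo k; split.
  rewrite -[X in measurable X]setTI; apply: measurable_rV_uncons => //.
  exact: measurableX.
have -> : lebesgue_rV_step (rV_uncons @^-1` (F k `*` G k)) =
    (@lebesgue_measure R \x m)%E (F k `*` G k).
  congr product_measure1; apply/seteqP.
  by split=> p; rewrite /preimage /mkset rV_consK.
by rewrite product_measure1E// lte_mul_pinfty// ge0_fin_numE.
Qed.

HB.instance Definition _ :=
  Measure_isSigmaFinite.Build _ _ _ lebesgue_rV_step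
    lebesgue_rV_step_sigma_finite.

End rV_cons.

Fixpoint lebesgue_rV (R : realType) (n : nat) :
    {sigma_finite_measure set 'rV[R]_n -> \bar R} :=
  match n with
  | 0 => \d_(0 : 'rV[R]_0)
  | n'.+1 => lebesgue_rV_step (lebesgue_rV R n')
  end.

Lemma lebesgue_rV_box (R : realType) (n : nat) (A : 'I_n -> set R) :
  (forall i, measurable (A i)) ->
  lebesgue_rV R n [set x | forall i, A i (x ord0 i)] =
  (\prod_(i < n) lebesgue_measure (A i))%E.
Proof.
elim: n A => [|n IHn] A mA.
  by rewrite big_ord0 /= diracE mem_set// => -[].
rewrite big_ord_recl /= /lebesgue_rV_step /pushforward.
have mB : measurable [set v : 'rV[R]_n | forall i, A (lift ord0 i) (v ord0 i)].
  rewrite (_ : [set _ | _] = \bigcap_(i in [set: 'I_n])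
      ((fun v : 'rV[R]_n => v ord0 i) @^-1` A (lift ord0 i))).
    apply: fin_bigcap_measurable => // i _.
    by rewrite -[X in measurable X]setTI; exact: measurable_rV_coord.
  by apply/seteqP; split=> v /= h i => [_|]; exact: h.
rewrite (_ : _ @^-1` _ = A ord0 `*`
    [set v : 'rV[R]_n | forall i, A (lift ord0 i) (v ord0 i)]).
  rewrite product_measure1E; [|exact: mA|exact: mB].
  congr (_ * _)%E.
  by apply: (IHn (fun i => A (lift ord0 i))) => i; exact: mA.
apply/seteqP; split=> p /=.
  move=> h; split; first by have := h ord0; rewrite rV_cons0.
  by move=> i; have := h (lift ord0 i); rewrite rV_consS.
by move=> [h0 hS] i; case: (unliftP ord0 i) => [j|] ->;
  rewrite ?rV_consS ?rV_cons0.
Qed.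

(** * Domains with Hölder boundary *)

Section domains.
Context {R : realType} {N : nat}.
Implicit Types (x y : 'rV[R]_N) (f : 'rV[R]_N -> R) (Omega : set 'rV[R]_N).

(* The library norm on ['rV[R]_N] is the max norm. *)
Definition enorm x : R := Num.sqrt (\sum_i x ord0 i ^+ 2).

Definition pderiv (i : 'I_N) f : 'rV[R]_N -> R :=
  fun x => 'D_(delta_mx ord0 i) f x.

Definition pderivs (s : seq 'I_N) f : 'rV[R]_N -> R := foldr pderiv f s.

Definition Ck (k : nat) f :=
  forall s : seq 'I_N, (size s <= k)%N ->
    continuous (pderivs s f) /\
    ((size s < k)%N ->
      forall i x, derivable (pderivs s f) x (delta_mx ord0 i)).

Definition Ck_holder (k : nat) (eta : R) f :=
  Ck k f /\
  forall s : seq 'I_N, size s = k ->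
    exists C : R, forall x y,
      `|pderivs s f x - pderivs s f y| <= C * enorm (x - y) `^ eta.

Definition boundary Omega := closure Omega `\` interior Omega.

Definition bounded_domain Omega :=
  [/\ Omega !=set0, open Omega, connected Omega & bounded_set Omega].

Definition uniform_outer_ball Omega :=
  exists2 r : R, 0 < r &
    forall x, boundary Omega x ->
      exists2 c, enorm (x - c) = r &
        [set y | enorm (y - c) < r] `<=` ~` closure Omega.

End domains.

(* Up to relabelling and reorienting the coordinate axes, [Omega] is locally
   the strict epigraph of a C^{k,eta} function of the other N - 1 variables.
   Only gamma near one point matters, so bounds on gamma and its lower-order
   derivatives need not be required: after a cutoff they hold globally. *)
Definition Ck_holder_boundary (R : realType) (N k : nat) (eta : R)
    (Omega : set 'rV[R]_N) :=
  forall x0, boundary Omega x0 ->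
    exists (r : R) (i : 'I_N) (b : bool) (gamma : 'rV[R]_N.-1 -> R),
      [/\ 0 < r, Ck_holder k eta gamma &
        forall x, enorm (x - x0) < r ->
          (Omega x <-> gamma (col' i x) < (-1) ^+ b * x ord0 i)].

(** * Sobolev spaces

    Elements are represented by functions on [R^N], of which only the
    restriction to [Omega] matters, up to a.e. equality. *)

Section sobolev.
Context {R : realType} {N : nat}.
Variable Omega : set 'rV[R]_N.
Implicit Types (u v phi : 'rV[R]_N -> R) (s : seq 'I_N).

Local Notation mu := (lebesgue_rV R N).

Definition test_function phi :=
  [/\ forall k, Ck k phi, compact (closure [set x | phi x != 0]) &
      closure [set x | phi x != 0] `<=` Omega].

Definition locally_integrable_on u :=
  measurable_fun Omega u /\
  forall K, compact K -> K `<=` Omega -> mu.-integrable K (EFin \o u).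

Definition is_weak_deriv s u v :=
  [/\ locally_integrable_on u, locally_integrable_on v &
    forall phi, test_function phi ->
      \int[mu]_(x in Omega) (u x * pderivs s phi x) =
      (-1) ^+ size s * \int[mu]_(x in Omega) (v x * phi x)].

(* A chosen representative; junk when [u] has no weak derivative along [s]. *)
Definition weak_deriv s u : 'rV[R]_N -> R :=
  xget (cst 0) [set v | is_weak_deriv s u v].

Definition L2 u :=
  measurable_fun Omega u /\ (\int[mu]_(x in Omega) (u x ^+ 2)%:E < +oo)%E.

(* W^{m,2}(Omega) *)
Definition W2 (m : nat) u :=
  forall s, (size s <= m)%N -> exists2 v, is_weak_deriv s u v & L2 v.

Definition W2_norm (m : nat) u : R :=
  Num.sqrt (\sum_(k < m.+1) \sum_(s : k.-tuple 'I_N)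
    \int[mu]_(x in Omega) (weak_deriv s u x ^+ 2)).

(* W^{m,2}_0(Omega) *)
Definition W2_0 (m : nat) u :=
  W2 m u /\
  forall e : R, 0 < e ->
    exists2 phi, test_function phi & W2_norm m (u - phi) < e.

Definition laplacian u : 'rV[R]_N -> R :=
  fun x => \sum_i weak_deriv [:: i; i] u x.

Definition grad_norm u : 'rV[R]_N -> R :=
  fun x => Num.sqrt (\sum_i weak_deriv [:: i] u x ^+ 2).

Definition ae_zero u := {ae mu, forall x, Omega x -> u x = 0}.

End sobolev.

(** * Critical points in a (semi)normed space [X] with (semi)norm [nrm]

    [X] is a subgroup of an ambient space [V]; [nrm] separates points of [X]
    only up to the identification made in [X]. *)

Section critical_points.
Context {R : realType} {V : zmodType}.
Variables (X : set V) (nrm : V -> R) (E : V -> R).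

(* E is Fréchet differentiable at u with E'(u) = 0. *)
Definition critical_point (u : V) :=
  X u /\
  forall e : R, 0 < e -> exists2 d : R, 0 < d &
    forall h, X h -> nrm h < d -> `|E (u + h) - E u| <= e * nrm h.

Definition saddle_type (u : V) :=
  critical_point u /\
  forall r : R, 0 < r -> exists v w : V,
    [/\ X v, nrm (v - u) < r, X w & nrm (w - u) < r] /\ E v < E u < E w.

End critical_points.

(** * The biharmonic problem *)

Inductive boundary_condition := Dirichlet | Navier.

Section problem.
Context {R : realType} {N : nat}.
Variables (Omega : set 'rV[R]_N) (bc : boundary_condition).
Implicit Types u : 'rV[R]_N -> R.

Local Notation mu := (lebesgue_rV R N).

Definition energy_space : set ('rV[R]_N -> R) :=
  match bc with
  | Dirichlet => W2_0 Omega 2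
  | Navier => W2 Omega 2 `&` W2_0 Omega 1
  end.

Definition energy_norm u : R :=
  Num.sqrt (\int[mu]_(x in Omega) (laplacian Omega u x ^+ 2)).

Variables omega kappa : R.

Definition energy u : R :=
  2^-1 * \int[mu]_(x in Omega) (laplacian Omega u x ^+ 2)
  + omega ^+ 2 / 2 * \int[mu]_(x in Omega) (grad_norm Omega u x ^+ 2)
  - kappa / 4 * \int[mu]_(x in Omega) (grad_norm Omega u x ^+ 4).

(* Weak solution of
     Delta^2 u - omega^2 Delta u + kappa div (|grad u|^2 grad u) = 0
   under the boundary condition [bc]. *)
Definition weak_solution u :=
  critical_point energy_space energy_norm energy u.

Definition ground_state u :=
  [/\ weak_solution u, ~ ae_zero Omega u &
    forall v, weak_solution v -> ~ ae_zero Omega v -> energy u <= energy v].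

End problem.

(* Submission.v *)
Require Import Defs.
From mathcomp Require Import all_boot all_order all_algebra.
From mathcomp Require Import all_classical all_reals all_analysis.
From mathcomp Require Import measurable_realfun ring lra.

Set Implicit Arguments.
Unset Strict Implicit.
Unset Printing Implicit Defensive.

Import Order.TTheory GRing.Theory Num.Theory.
Import numFieldNormedType.Exports.

Local Open Scope classical_set_scope.
Local Open Scope ring_scope.

(** Let [a u] be the quadratic form int |Delta u|^2 + omega^2 int |grad u|^2 and [b u] the quartic
    form kappa int |grad u|^4, so that the energy is a/2 - b/4. Let S be the supremum of b on the
    set a = 1; by homogeneity b <= S a^2 on the whole space. If u1 attains S, then u = S^(-1/2) u1
    has a = b = 1/S. The inequality b <= S a^2 is an equality at u, so the first variations of both
    sides agree there; this says that u is critical, with energy 1/(4S) > 0. Differentiating along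
    the ray through a critical v gives a v = b v, hence a v >= 1/S when v is nonzero, and the energy
    a v / 4 is at least that of u. The energy decreases from u along its own ray. It increases in a
    direction h in which the L^4 norm of the gradient is tiny compared with the energy norm, because
    there the quadratic part wins. Compactness supplies such directions from an infinite family of
    disjoint bumps. This argument is [ground_state_saddle], carried out for abstract forms.

    That S is attained is shown without weak convergence. By the parallelogram identity, a
    maximising sequence that is Cauchy for the L^4 norm of the gradient is Cauchy for the energy
    norm ([midpoint]), and compactness provides a subsequence of the first kind.

    Two analytic facts feed the abstract argument. The first, [hessian_estimate], bounds a function
    of W^{2,2} with zero trace and all its derivatives up to order two by the L^2 norm of its
    Laplacian. Near a point of the closure, Omega is {theta > 0}. Differentiation along fields
    tangent to the level sets of theta preserves the zero trace ([tang_trace]), so a tangential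
    derivative can be mollified into a test function and inserted in the weak form of the equation.
    The second derivatives that remain are then recovered from the Laplacian.

    The second fact, [L4_compactness], is the compact embedding of W^{1,2} into L^4 in dimension at
    most three, in the form of an Ehrling inequality: the L^4 norm is at most a small multiple of
    the W^{1,2} norm plus finitely many bounded functionals. The difference of mollifications at the
    scales 16^(-l) and 16^(-l-1) is a sum of convolutions of the partial derivatives with explicit
    kernels, and these map L^2 to L^4 with norm O(2^(-l)) ([telk_n4]). Finitely many functionals
    describe the coarse mollification up to a small error ([convol_net]).

    In both facts the mollifiers live on boxes placed inside a cone on one side of the boundary.
    Convolution then stays within Omega, and neither flattening of the boundary nor an extension
    operator occurs. *)

Section rV_entries.
Context {V : zmodType} {K : pzRingType} {n : nat}.

Lemma rV_entryD (x y : 'rV[V]_n) i : (x + y) ord0 i = x ord0 i + y ord0 i.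
Proof. by rewrite mxE. Qed.

Lemma rV_entryN (x : 'rV[V]_n) i : (- x) ord0 i = - x ord0 i.
Proof. by rewrite mxE. Qed.

Lemma rV_entryZ (a : K) (x : 'rV[K]_n) i : (a *: x) ord0 i = a * x ord0 i.
Proof. by rewrite mxE. Qed.

Lemma rV_entry_delta (i j : 'I_n) :
  (delta_mx ord0 i : 'rV[K]_n) ord0 j = (j == i)%:R.
Proof. by rewrite mxE eqxx. Qed.

Lemma rV_entry0 i : (0 : 'rV[V]_n) ord0 i = 0.
Proof. by rewrite mxE. Qed.

End rV_entries.

Definition rVE := (@rV_entryD, @rV_entryN, @rV_entryZ, @rV_entry_delta, @rV_entry0).

(** * Topology and Borel sets of row vectors under the max norm *)

Section rV_topology.
Context {R : realType} {n : nat}.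
Implicit Types (x y z : 'rV[R]_n) (A : set 'rV[R]_n).

Lemma rV_norm_lt x (e : R) : 0 < e ->
  (`|x| < e <-> forall i, `|x ord0 i| < e).
Proof.
move=> e0; rewrite /Num.norm /= mx_normrE; split=> [h i|h].
  by apply: le_lt_trans h; exact: (le_bigmax _ (fun k => `|x k.1 k.2|) (ord0, i)).
by apply: bigmax_lt => // -[i j] _ /=; rewrite ord1; exact: h.
Qed.

Lemma rV_norm_le x (e : R) : 0 <= e ->
  (`|x| <= e <-> forall i, `|x ord0 i| <= e).
Proof.
move=> e0; rewrite /Num.norm /= mx_normrE; split=> [h i|h].
  by apply: le_trans h; exact: (le_bigmax _ (fun k => `|x k.1 k.2|) (ord0, i)).
by apply: bigmax_le => // -[i j] _ /=; rewrite ord1; exact: h.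
Qed.

Lemma rV_coord_le x i : `|x ord0 i| <= `|x|.
Proof. by move: i; apply/rV_norm_le. Qed.

Lemma rV_openP A : open A <-> forall x, A x ->
  exists2 e : R, 0 < e & forall y, `|y - x| < e -> A y.
Proof.
rewrite openE; split=> h x Ax; have := h x Ax; rewrite /interior.
  move=> /nbhs_ballP[e /= e0 he]; exists e => // y yx; apply: he.
  by rewrite -ball_normE /= distrC.
move=> [e e0 he]; apply/nbhs_ballP; exists e => //= y.
by rewrite -ball_normE /= distrC; exact: he.
Qed.

Lemma rV_continuousP (f : 'rV[R]_n -> R) : continuous f <->
  forall x (e : R), 0 < e -> exists2 d : R, 0 < d &
    forall y, `|y - x| < d -> `|f y - f x| < e.
Proof.
split=> [cf x e e0|h x].
  have /cvgrPdist_lt /(_ _ e0) := cf x.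
  move=> /nbhs_ballP[d /= d0 hd]; exists d => // y yx.
  by rewrite distrC; apply: hd; rewrite -ball_normE /= distrC.
apply/(@cvgrPdist_lt _ R^o _ _ (nbhs_filter x)) => e e0.
have [d d0 hd] := h x e e0.
apply/nbhs_ballP; exists d => //= y; rewrite -ball_normE /= distrC => yx.
by rewrite distrC; exact: hd.
Qed.

(** The sigma-algebra is generated by the coordinates, so an open set is exhausted by the countably
    many cubes with rational centre and radius that it contains. *)
Lemma measurable_rV_open A : open A -> measurable A.
Proof.
move=> /rV_openP oA.
pose S (q : 'rV[rat]_n * rat) :=
  [set y : 'rV[R]_n | forall i, `|y ord0 i - ratr (q.1 ord0 i)| < ratr q.2].
pose B q : set 'rV[R]_n := [set y | S q `<=` A /\ S q y].
rewrite (_ : A = \bigcup_q B q).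
  apply: countable_bigcupT_measurable => [|q]; first exact: countableP.
  have [SA|nSA] := pselect (S q `<=` A); last first.
    by rewrite (_ : B q = set0) //; apply/seteqP; split=> // y [].
  rewrite (_ : B q = \bigcap_(i in [set: 'I_n])
     ((fun y : 'rV[R]_n => y ord0 i) @^-1` (ball (ratr (q.1 ord0 i) : R) (ratr q.2)))).
    apply: fin_bigcap_measurable => // i _; rewrite -[X in measurable X]setTI.
    by apply: measurable_rV_coord => //; exact: measurable_ball.
  apply/seteqP; split=> y /= => [[_ h] i _|h].
    by rewrite -ball_normE /= distrC.
  by split=> // i; have := h i I; rewrite -ball_normE /= distrC.
apply/seteqP; split=> [x Ax|x [q _ [h Sx]]]; last exact: h.
have [e e0 he] := oA x Ax.
have [r] := rat_in_itvoo (divr_gt0 e0 (ltr0n R 2)).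
rewrite in_itv /= => /andP[r0 re].
have /choice[q hq] : forall i : 'I_n, exists q : rat, `|x ord0 i - ratr q| < ratr r.
  move=> i; have : x ord0 i < x ord0 i + ratr r by rewrite ltrDl.
  move=> /rat_in_itvoo[q]; rewrite in_itv /= => /andP[h1 h2].
  by exists q; rewrite distrC gtr0_norm ?subr_gt0// ltrBlDl.
exists (\row_i q i, r) => //; split=> [y /= hy|i /=]; last by rewrite mxE; exact: hq.
apply: he.
apply/rV_norm_lt => // i; rewrite !mxE; have := hy i; rewrite mxE => {}hy.
rewrite (splitr e) -(subrKA (ratr (q i))); apply: le_lt_trans (ler_normD _ _) _.
rewrite ltrD//; first exact: lt_trans re.
by rewrite distrC; exact: lt_trans re.
Qed.

Lemma measurable_rV_continuous (f : 'rV[R]_n -> R) :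
  continuous f -> measurable_fun setT f.
Proof.
move=> cf; apply: (measurability _ (RGenOInfty.measurableE R)).
move=> _ [_ [a ->] <-]; rewrite setTI; apply: measurable_rV_open.
by apply: open_comp => // x _; exact: cf.
Qed.

(** For each coordinate, the sets of reals whose preimage belongs to the sigma-algebra of the open
    sets form a sigma-algebra containing the open sets of the line, hence all Borel sets. This opens
    the way to a Dynkin-class argument on open sets. *)
Lemma rV_measurable_sub_open A : measurable A -> <<s (@open 'rV[R]_n) >> A.
Proof.
apply: smallest_sub; first exact: smallest_sigma_algebra.
rewrite -bigcup_seq; apply: bigcup_sub => i _ B [C mC <-]; rewrite setTI.
have sC : <<s (@open R) >> C.
  have : (@RGenOpens.G R).-sigma.-measurable C.
    by have <- := RGenOpens.measurableE R; exact: mC.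
  apply: smallest_sub => [|_ [a [b ->]]]; first exact: smallest_sigma_algebra.
  by apply: sub_sigma_algebra; exact: itv_open.
apply: (@smallest_sub _ (sigma_algebra [set: R]) open
  [set C | <<s (@open 'rV[R]_n) >> ((fun x : 'rV[R]_n => x ord0 i) @^-1` C)]) sC.
  split => /=.
  - by rewrite preimage_set0; exact: sigma_algebra0.
  - by move=> D hD; rewrite setTD preimage_setC; exact: sigma_algebraC.
  - by move=> D hD; rewrite preimage_bigcup; exact: sigma_algebra_bigcup.
move=> D oD /=; apply: sub_sigma_algebra.
by apply: open_comp => // x _; exact: coord_continuous.
Qed.

End rV_topology.

(** * Lebesgue measure of boxes and Fubini on row vectors *)

Section rV_measure.
Context {R : realType}.

Lemma lebesgue_rV_cube n (x : 'rV[R]_n) (a b : 'I_n -> R) : (forall i, a i <= b i) ->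
  lebesgue_rV R n [set y | forall i, a i <= y ord0 i - x ord0 i <= b i] =
  (\prod_(i < n) (b i - a i))%:E.
Proof.
move=> ab; rewrite -prodEFin.
transitivity (lebesgue_rV R n [set y | forall i,
    `[x ord0 i + a i, x ord0 i + b i]%classic (y ord0 i)]).
  congr (lebesgue_rV R n _); apply/seteqP; split=> y /= h i; have := h i;
    by rewrite in_itv /= ?lerBrDl ?lerBlDl.
rewrite (lebesgue_rV_box (A := fun i => `[x ord0 i + a i, x ord0 i + b i]%classic))//.
apply: eq_bigr => i _.
rewrite lebesgue_measure_itv /= lte_fin ltrD2l.
case: ltP => [_|ba]; first by rewrite -EFinD opprD addrACA subrr add0r.
by rewrite (_ : b i = a i) ?subrr//; apply/eqP; rewrite eq_le ab ba.
Qed.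

Lemma bounded_rV_set n (A : set 'rV[R]_n) : bounded_set A ->
  exists2 M : R, 0 < M & forall x, A x -> `|x| <= M.
Proof.
case=> M [_ hM]; exists (Num.max M 0 + 1).
  by rewrite ltr_wpDl// le_max lexx orbT.
move=> x Ax; apply: hM => //; rewrite ltr_pwDr// le_max lexx //.
Qed.

Lemma lebesgue_rV_bounded n (A : set 'rV[R]_n) : measurable A -> bounded_set A ->
  (lebesgue_rV R n A < +oo)%E.
Proof.
move=> mA /bounded_rV_set[M M0 hM].
pose B := [set y : 'rV[R]_n | forall i, - M <= y ord0 i - (0 : 'rV[R]_n) ord0 i <= M].
have mB : measurable B.
  rewrite (_ : B = \bigcap_(i in [set: 'I_n])
     ((fun y : 'rV[R]_n => y ord0 i) @^-1` `[- M, M])).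
    apply: fin_bigcap_measurable => // i _; rewrite -[X in measurable X]setTI.
    exact: measurable_rV_coord.
  by apply/seteqP; split=> y /= h i => [_|]; have := h i;
    rewrite /= in_itv /= mxE subr0 // => /(_ I).
apply: (@le_lt_trans _ _ (lebesgue_rV R n B)).
  apply: le_measure; rewrite ?inE// => x Ax i; rewrite mxE subr0 -ler_norml.
  exact: le_trans (rV_coord_le _ _) (hM x Ax).
rewrite lebesgue_rV_cube ?ltry// => i.
by rewrite -subr_ge0 opprK addr_ge0 ?ltW.
Qed.

End rV_measure.

Section rV_fubini.
Context {R : realType}.

Lemma ge0_integral_rVS n (f : 'rV[R]_n.+1 -> \bar R) :
  measurable_fun setT f -> (forall x, (0 <= f x)%E) ->
  (\int[lebesgue_rV R n.+1]_x f x =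
   \int[lebesgue_measure]_t \int[lebesgue_rV R n]_v f (rV_cons (t, v)))%E.
Proof.
move=> mf f0.
transitivity (\int[(@lebesgue_measure R \x lebesgue_rV R n)%E]_p f (rV_cons p))%E.
  have := ge0_integral_pushforward (@measurable_rV_cons R n)
    (@lebesgue_measure R \x lebesgue_rV R n)%E measurableT mf (fun x _ => f0 x).
  by rewrite preimage_setT.
by rewrite fubini_tonelli1//; apply: measurableT_comp => //; exact: measurable_rV_cons.
Qed.

Lemma integrable_rV_cons n (f : 'rV[R]_n.+1 -> R) :
  (lebesgue_rV R n.+1).-integrable setT (EFin \o f) ->
  (@lebesgue_measure R \x lebesgue_rV R n)%E.-integrable setT
    (EFin \o (f \o @rV_cons R n)).
Proof.
move=> /integrableP[mf fi]; apply/integrableP; split.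
  by apply: (measurableT_comp mf); exact: measurable_rV_cons.
have := ge0_integral_pushforward (@measurable_rV_cons R n)
  (@lebesgue_measure R \x lebesgue_rV R n)%E measurableT
  (measurableT_comp (@abse_measurable R setT) mf).
by move=> /(_ (fun _ _ => abse_ge0 _)) <-.
Qed.

Lemma integral_rV_cons n (f : 'rV[R]_n.+1 -> R) :
  (lebesgue_rV R n.+1).-integrable setT (EFin \o f) ->
  (\int[lebesgue_rV R n.+1]_x (f x)%:E =
   \int[(@lebesgue_measure R \x lebesgue_rV R n)%E]_p (f (rV_cons p))%:E)%E.
Proof.
move=> fi; apply: (integral_pushforward (@measurable_rV_cons R n)) => //.
- by case/integrableP : fi.
- exact: integrable_rV_cons.
Qed.

(** Tonelli, one coordinate at a time; it is what gives product mollifiers their unit mass. *)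
Lemma ge0_integral_rV_prod n (f : 'I_n -> R -> R) :
  (forall i, measurable_fun setT (f i)) -> (forall i t, 0 <= f i t) ->
  (\int[lebesgue_rV R n]_x (\prod_i f i (x ord0 i))%:E =
   \prod_i \int[lebesgue_measure]_t (f i t)%:E)%E.
Proof.
elim: n f => [|n IH] f mf f0.
  rewrite big_ord0; under eq_integral do rewrite big_ord0.
  by rewrite /= integral_dirac// diracT mul1e.
have mfx m (g : 'I_m -> R -> R) : (forall i, measurable_fun setT (g i)) ->
    measurable_fun setT (fun x : 'rV[R]_m => \prod_i g i (x ord0 i)).
  move=> mg; apply: measurable_prod => i _.
  by apply: (measurableT_comp (mg i)); exact: measurable_rV_coord.
rewrite ge0_integral_rVS; first last.
- by move=> x; rewrite lee_fin prodr_ge0.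
- by apply/measurable_EFinP; exact: mfx.
rewrite big_ord_recl -IH//.
pose P (v : 'rV[R]_n) := \prod_i f (lift ord0 i) (v ord0 i).
have mP : measurable_fun setT (EFin \o P).
  by apply/measurable_EFinP; exact: (mfx _ (fun i => f (lift ord0 i)) (fun i => mf _)).
have P0 v : (0 <= (P v)%:E)%E by rewrite lee_fin prodr_ge0.
transitivity (\int[lebesgue_measure]_t ((f ord0 t)%:E * \int[lebesgue_rV R n]_v (P v)%:E))%E.
  apply: eq_integral => t _; rewrite -ge0_integralZl// ?lee_fin//.
  apply: eq_integral => v _; rewrite big_ord_recl rV_cons0 -EFinM; congr (_ * _)%:E.
  by apply: eq_bigr => i _; rewrite rV_consS.
rewrite ge0_integralZr//.
- by apply/(measurable_EFinP _ (f ord0)); exact: mf.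
- by move=> x _; rewrite lee_fin.
- by apply: integral_ge0 => x _.
Qed.

End rV_fubini.

(** * Integrals of compactly supported derivatives *)

Section integral_derivative.
Context {R : realType}.

Lemma is_derive_line n (g g' : 'rV[R]_n -> R) (x v : 'rV[R]_n) :
  (forall y, is_derive y v g (g' y)) ->
  forall t : R, is_derive t 1 (fun s : R => g (x + s *: v)) (g' (x + t *: v)).
Proof.
move=> hg t; have [dg <-] := hg (x + t *: v).
have E : (fun h : R => h^-1 *: (g (x + (h *: 1 + t) *: v) - g (x + t *: v))) =
    (fun h => h^-1 *: (g (h *: v + (x + t *: v)) - g (x + t *: v))).
  by apply/funext => h; congr (_ *: (g _ - _)); rewrite [h *: 1]mulr1 scalerDl addrCA addrA.
by split; [rewrite /derivable E | rewrite /derive E].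
Qed.

Lemma integral_derivative0 (g g' : R -> R) (M : R) :
  (forall t : R, is_derive t 1 g (g' t)) -> continuous g' ->
  (forall t, M < `|t| -> g t = 0) -> (forall t, M < `|t| -> g' t = 0) ->
  (\int[lebesgue_measure]_t (g' t)%:E = 0)%E.
Proof.
move=> hg cg' g0 g'0; pose K : R := `|M| + 1.
have MK : M < K by rewrite ltr_pwDr// ler_norm.
have K0 : 0 < K by rewrite ltr_wpDl.
have KK : - K < K by rewrite -subr_gt0 opprK addr_gt0.
transitivity (\int[lebesgue_measure]_(t in `[(- K)%R, K]) (g' t)%:E)%E.
  rewrite [RHS]integral_mkcond; apply: eq_integral => t _.
  rewrite patchE; case: ifPn => //; rewrite notin_setE /= in_itv /= -ler_norml => /negP.
  by rewrite -ltNge => h; rewrite g'0 //; exact: lt_trans h.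
have dg t : derivable g t 1 by have [] := hg t.
have cg : continuous g by move=> t; apply: differentiable_continuous; exact/derivable1_diffP.
rewrite (@continuous_FTC2 _ g' g)//.
- by rewrite (g0 K) ?gtr0_norm// (g0 (- K)) ?normrN ?gtr0_norm// -EFinB subrr.
- exact: continuous_subspaceT.
- split; first by move=> t _; exact: dg.
  + by apply: cvg_at_right_filter; exact: cg.
  + by apply: cvg_at_left_filter; exact: cg.
- by move=> t _; rewrite derive1E; have [] := hg t.
Qed.

Lemma continuous_rV_cons n (g : 'rV[R]_n.+1 -> R) : continuous g ->
  (forall t, continuous (fun v => g (rV_cons (t, v)))) /\
  (forall v, continuous (fun t : R => g (rV_cons (t, v)))).
Proof.
move=> /rV_continuousP cg; split=> [t|v].
  apply/rV_continuousP => v e e0; have [d d0 hd] := cg (rV_cons (t, v)) e e0.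
  exists d => // w vw; apply: hd; apply/rV_norm_lt => // i; rewrite !rVE.
  case: (unliftP ord0 i) => [j|] ->; rewrite ?rV_consS ?rV_cons0 /=.
    by have := (rV_norm_lt _ d0).1 vw j; rewrite !rVE.
  by rewrite subrr normr0.
move=> t; apply/cvgrPdist_lt => e e0; have [d d0 hd] := cg (rV_cons (t, v)) e e0.
apply/nbhs_ballP; exists d => //= s ts; rewrite distrC; apply: hd.
apply/rV_norm_lt => // i; rewrite !rVE.
case: (unliftP ord0 i) => [j|] ->; rewrite ?rV_consS ?rV_cons0 /= ?subrr ?normr0//.
by rewrite distrC.
Qed.

(** Fubini reduces the integral to one dimension. If [i] is the first coordinate, the fundamental
    theorem of calculus applies on each line; otherwise the slices over the first coordinate fall
    under the induction hypothesis. *)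
Lemma integral_rV_pderiv0 n (i : 'I_n) (g g' : 'rV[R]_n -> R) (M C : R) :
  (forall x, is_derive x (delta_mx ord0 i) g (g' x)) -> continuous g' ->
  (forall x, M < `|x| -> g x = 0) -> (forall x, M < `|x| -> g' x = 0) ->
  (forall x, `|g' x| <= C) ->
  (\int[lebesgue_rV R n]_x (g' x)%:E = 0)%E.
Proof.
elim: n i g g' => [[]//|n IH] i g g' hg cg' g0 g'0 g'C.
have mg' : measurable_fun setT g' by exact: measurable_rV_continuous.
have ig' : (lebesgue_rV R n.+1).-integrable setT (EFin \o g').
  (* Integrability: [g'] is bounded and vanishes outside this open ball of finite measure. *)
  pose B := [set x : 'rV[R]_n.+1 | `|x| < `|M| + 1].
  have oB : open B.
    apply/rV_openP => x Bx; exists (`|M| + 1 - `|x|); first by rewrite subr_gt0.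
    move=> y yx; rewrite /B /= -(subrK x y); apply: le_lt_trans (ler_normD _ _) _.
    by rewrite -ltrBrDr.
  have mB := measurable_rV_open oB.
  rewrite (_ : EFin \o g' = (EFin \o g') \_ B).
    apply/(integrable_mkcond _ mB); apply: measurable_bounded_integrable => //.
    - apply: lebesgue_rV_bounded => //; exists (`|M| + 1); split=> // x Mx y /= By.
      by apply: ltW; exact: lt_trans Mx.
    - exact: measurable_funS mg'.
    - by exists C; split=> [|x Cx y _]; [exact: num_real|apply: le_trans (ltW Cx)].
  apply/funext => x; rewrite patchE; case: ifPn => //; rewrite notin_setE /B /= => /negP.
  rewrite -leNgt => h; rewrite g'0//; apply: lt_le_trans h.
  by rewrite ltr_pwDr// ler_norm.
have ic := integrable_rV_cons ig'.
have ccg := continuous_rV_cons cg'.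
have consd (t s : R) (v w : 'rV[R]_n) :
    rV_cons (t, v) + s *: rV_cons (0, w) = rV_cons (t, v + s *: w).
  apply/rowP => k; rewrite !rVE; case: (unliftP ord0 k) => [j|] ->;
    rewrite ?rV_consS ?rV_cons0 /= ?rVE ?rV_consS ?rV_cons0 /= ?mulr0 ?addr0//.
have consn t (v : 'rV[R]_n) : M < `|v| -> M < `|rV_cons (t, v)|.
  move=> Mv; have [M0|M0] := leP 0 M; last exact: lt_le_trans M0 _.
  rewrite ltNge; apply: contraTN Mv => /(rV_norm_le _ M0) h; rewrite -leNgt.
  by apply/rV_norm_le => // j; have := h (lift ord0 j); rewrite rV_consS.
have consn0 t (v : 'rV[R]_n) : M < `|t| -> M < `|rV_cons (t, v)|.
  move=> Mt; apply: lt_le_trans Mt _.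
  by have := rV_coord_le (rV_cons (t, v)) ord0; rewrite rV_cons0.
rewrite integral_rV_cons//; case: (unliftP ord0 i) => [j|] Ei.
  rewrite -integral12_prod_meas1//; apply: integral0_eq => t _.
  apply: (IH j (fun v => g (rV_cons (t, v))) (fun v => g' (rV_cons (t, v)))) => //.
  - move=> v; have [dg <-] := hg (rV_cons (t, v)).
    have E : (fun h : R => h^-1 *: (g (rV_cons (t, h *: delta_mx ord0 j + v)) -
        g (rV_cons (t, v)))) = (fun h : R => h^-1 *: (g (h *: delta_mx ord0 i +
        rV_cons (t, v)) - g (rV_cons (t, v)))).
      apply/funext => h; congr (_ *: (g _ - _)).
      rewrite [RHS]addrC (_ : delta_mx _ _ = rV_cons (0, delta_mx ord0 j)).
        by rewrite consd addrC.
      apply/rowP => k; rewrite Ei; case: (unliftP ord0 k) => [l|] ->;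
        rewrite ?rV_consS ?rV_cons0 !rVE //=.
    by split; [rewrite /derivable E | rewrite /derive E].
  - exact: ccg.1.
  - by move=> v Mv; apply: g0; exact: consn.
  - by move=> v Mv; apply: g'0; exact: consn.
rewrite -integral21_prod_meas1//; apply: integral0_eq => v _.
apply: (@integral_derivative0 (fun t => g (rV_cons (t, v)))
  (fun t => g' (rV_cons (t, v))) M).
- move=> t; have := is_derive_line (rV_cons (0, v)) hg t; rewrite Ei.
  have E s : rV_cons (0, v) + s *: delta_mx ord0 ord0 = rV_cons (s, v).
    apply/rowP => k; rewrite !rVE; case: (unliftP ord0 k) => [l|] ->;
      rewrite ?rV_consS ?rV_cons0 //= ?mulr0 ?mulr1 ?addr0 ?add0r//.
  by under eq_fun do rewrite E; rewrite E.
- exact: ccg.2.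
- by move=> t Mt; apply: g0; exact: consn0.
- by move=> t Mt; apply: g'0; exact: consn0.
Qed.

End integral_derivative.

(** Differentiability from an explicit quadratic remainder; this is how derivatives pass under the
    integral sign in [hasd_conv]. No sign is assumed for [C], whence [|C| + 1] in the proof. *)
Lemma is_derive_quadratic (R : realType) (V : normedModType R) (f : V -> R)
    (x v : V) (l C d : R) : 0 < d ->
  (forall h, `|h| < d -> `|f (x + h *: v) - f x - h * l| <= C * h ^+ 2) ->
  is_derive x v f l.
Proof.
move=> d0 hf; have cv : h^-1 *: (f (h *: v + x) - f x) @[h --> 0^'] --> (l : R^o).
  apply/cvgrPdist_le => e e0.
  have C0 : 0 < `|C| + 1 by rewrite ltr_wpDl.
  have m0 : 0 < Num.min d (e / (`|C| + 1)) by rewrite lt_min d0 divr_gt0.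
  apply/nbhs_ballP; exists (Num.min d (e / (`|C| + 1))) => //= h.
  rewrite /ball /= sub0r normrN lt_min => /andP[hd he] hn0.
  have h0 : 0 < `|h| by rewrite normr_gt0.
  rewrite distrC -(ler_pM2l h0) -normrM mulrBr [X in `|X - _|]mulrA mulfV// mul1r addrC [_ *: _ + _]addrC.
  rewrite addrC; apply: le_trans (hf _ hd) _; rewrite -real_normK ?num_real// expr2 mulrA mulrC.
  rewrite ler_wpM2l//; apply: le_trans (_ : (`|C| + 1) * `|h| <= _).
    by rewrite ler_wpM2r// (le_trans (ler_norm _))// lerDl.
  by rewrite mulrC -ler_pdivlMr// ltW.
by split; [apply/cvg_ex; exists l | apply: cvg_lim].
Qed.

(** * Smooth functions of one variable and a smooth step *)

Section smooth1.
Context {R : realType}.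
Implicit Types (f g : R -> R).

Fixpoint Cn1 (n : nat) f : Prop :=
  match n with
  | 0 => continuous f
  | n'.+1 => (forall t : R, derivable f t 1) /\ Cn1 n' (derive1 f)
  end.

Definition smooth1 f := forall n, Cn1 n f.

Lemma Cn1S n f f' : (forall t : R, is_derive t 1 f (f' t)) -> Cn1 n f' -> Cn1 n.+1 f.
Proof.
move=> df cf'; split; first by move=> t; have [] := df t.
suff -> : derive1 f = f' by [].
by apply/funext => t; rewrite derive1E; have [_ ->] := df t.
Qed.

Lemma smooth1_is_derive f : smooth1 f ->
  forall t : R, is_derive t 1 f (derive1 f t).
Proof. by move=> /(_ 1%N)[df _] t; split; [exact: df | rewrite derive1E]. Qed.

Lemma smooth1_derive1 f : smooth1 f -> smooth1 (derive1 f).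
Proof. by move=> sf n; have [] := sf n.+1. Qed.

Lemma smooth1_continuous f : smooth1 f -> continuous f.
Proof. by move=> /(_ 0%N). Qed.

Lemma Cn1W n f : Cn1 n.+1 f -> Cn1 n f.
Proof.
elim: n f => [f [df _] t|n IH f [df /IH hf]]; last by split.
by apply: differentiable_continuous; exact/derivable1_diffP.
Qed.

Lemma Cn1_is_derive n f : Cn1 n.+1 f -> forall t : R, is_derive t 1 f (derive1 f t).
Proof. by move=> [df _] t; split; [exact: df | rewrite derive1E]. Qed.

Lemma Cn1_cst n c : Cn1 n (cst c).
Proof.
elim: n c => [|n IH] c; first by move=> t; exact: cvg_cst.
by apply: (@Cn1S _ _ (cst 0)) => // t; exact: is_derive_cst.
Qed.

Lemma Cn1D n f g : Cn1 n f -> Cn1 n g -> Cn1 n (f \+ g).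
Proof.
elim: n f g => [|n IH] f g Hf Hg; first by move=> t; apply: cvgD; [exact: Hf|exact: Hg].
apply: (@Cn1S _ _ (derive1 f \+ derive1 g)) => [t|]; last by apply: IH; [case: Hf|case: Hg].
by apply: is_deriveD; [exact: Cn1_is_derive Hf t|exact: Cn1_is_derive Hg t].
Qed.

Lemma Cn1M n f g : Cn1 n f -> Cn1 n g -> Cn1 n (f \* g).
Proof.
elim: n f g => [|n IH] f g Hf Hg; first by move=> t; apply: cvgM; [exact: Hf|exact: Hg].
apply: (@Cn1S _ _ ((f \* derive1 g) \+ (g \* derive1 f))) => [t|].
  apply: is_derive_eq.
    by apply: is_deriveM; [exact: Cn1_is_derive Hf t|exact: Cn1_is_derive Hg t].
  by [].
by apply: Cn1D; apply: IH; try exact: Cn1W; [case: Hg|case: Hf].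
Qed.

Lemma Cn1_inv n f : (forall t, f t != 0) -> Cn1 n f -> Cn1 n (fun t => (f t)^-1).
Proof.
move=> f0; elim: n => [|n IH] Hf; first by move=> t; apply: cvgV => //; exact: Hf.
pose g := (fun t => - 1) \* (derive1 f \* ((fun t => (f t)^-1) \* (fun t => (f t)^-1))).
apply: (@Cn1S _ _ g) => [t|]; last first.
  apply: Cn1M; first exact: Cn1_cst.
  by apply: Cn1M; [case: Hf|apply: Cn1M; apply: IH; exact: Cn1W].
have [ex dv] := Cn1_is_derive Hf t; split; first exact: derivableV.
by rewrite deriveV// dv /g /= mulN1r -invfM -expr2 mulrC scaleNr.
Qed.

Lemma is_derive_affine (a b t : R) : is_derive t 1 (fun t => a * t + b) a.
Proof.
apply: (@is_derive_quadratic _ _ _ _ _ _ 0 1) => // h _.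
by rewrite mul0r [h *: 1]mulr1 normr_le0; apply/eqP; ring.
Qed.

Lemma Cn1_affine n f (a b : R) : Cn1 n f -> Cn1 n (fun t => f (a * t + b)).
Proof.
elim: n f => [|n IH] f Hf.
  move=> t; apply: (@continuous_comp _ _ _ (fun t => a * t + b) f); last exact: Hf.
  by apply: cvgD; [apply: cvgMr; exact: cvg_id|exact: cvg_cst].
apply: (@Cn1S _ _ (cst a \* (fun t => derive1 f (a * t + b)))) => [t|]; last first.
  by apply: Cn1M; [exact: Cn1_cst|apply: IH; case: Hf].
rewrite /= mulrC; apply: (is_derive1_comp (g := fun t => a * t + b)).
  exact: Cn1_is_derive Hf _.
exact: is_derive_affine.
Qed.

Lemma smooth1_cst c : smooth1 (cst c). Proof. by move=> n; exact: Cn1_cst. Qed.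

Lemma smooth1D f g : smooth1 f -> smooth1 g -> smooth1 (f \+ g).
Proof. by move=> hf hg n; exact: Cn1D. Qed.

Lemma smooth1M f g : smooth1 f -> smooth1 g -> smooth1 (f \* g).
Proof. by move=> hf hg n; exact: Cn1M. Qed.

Lemma smooth1_affine f (a b : R) : smooth1 f -> smooth1 (fun t => f (a * t + b)).
Proof. by move=> hf n; exact: Cn1_affine. Qed.

Lemma smooth1_comp_derive f (a b : R) : smooth1 f ->
  forall t : R, is_derive t 1 (fun t => f (a * t + b)) (a * derive1 f (a * t + b)).
Proof.
move=> sf t; rewrite mulrC; apply: (is_derive1_comp (g := fun t => a * t + b)).
  exact: smooth1_is_derive.
exact: is_derive_affine.
Qed.

(** The function t^(-k) exp(-1/t), continued by zero. The derivative of one member of the family is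
    a linear combination of later members, so all of them are smooth by a single induction. *)
Definition flat_exp (k : nat) (t : R) : R :=
  if 0 < t then t^-1 ^+ k * expR (- t^-1) else 0.

Lemma flat_exp_ge0 k t : 0 <= flat_exp k t.
Proof.
by rewrite /flat_exp; case: ifP => // t0; rewrite mulr_ge0 ?expR_ge0// exprn_ge0// invr_ge0 ltW.
Qed.

Lemma flat_expS k t : flat_exp k t = t * flat_exp k.+1 t.
Proof.
rewrite /flat_exp; case: ifPn => [t0|]; last by rewrite mulr0.
by rewrite exprS mulrA mulrA divff ?gt_eqF// mul1r.
Qed.

(** From exp(1/t) >= 1 + t^(-(k+1)) / (k+1)!. *)
Lemma flat_exp_le k t : flat_exp k.+1 t <= k.+1`!%:R.
Proof.
rewrite /flat_exp; case: ifPn => [t0|_]; last exact: ler0n.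
rewrite expRN ler_pdivrMr ?expR_gt0//.
have it0 : 0 <= t^-1 by rewrite invr_ge0 ltW.
have := expR_ge1Dxn k it0; rewrite -lerBrDl => h.
have F0 : 0 < (k.+1`!%:R : R) by rewrite ltr0n fact_gt0.
rewrite -ler_pdivrMl// mulrC; apply: le_trans h _.
by rewrite gerBl.
Qed.

(** For t > 0 this is calculus. For t <= 0 the value at t + h is (t + h)^2 times a bounded member of
    the family, and (t + h)^2 <= h^2 when t + h > 0, so the remainder is quadratic. *)
Lemma is_derive_flat_exp k (t : R) :
  is_derive t 1 (flat_exp k) (flat_exp k.+2 t - k%:R * flat_exp k.+1 t).
Proof.
have [t0|t0] := ltP 0 t.
  apply: (@near_eq_is_derive R R R (fun s : R => s^-1 ^+ k * expR (- s^-1)) _ t 1).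
    by apply: filterS (lt_nbhsr t0) => s s0; rewrite /flat_exp s0.
  have tn0 : t != 0 by rewrite gt_eqF.
  have iv : is_derive t (1 : R) (fun s : R => s^-1) (- t ^- 2).
    split; first exact: derivableV.
    by rewrite deriveV// derive_id [_ *: _]mulr1.
  have h1 : is_derive t (1 : R) (fun s : R => s^-1 ^+ k) (k%:R * t^-1 ^+ k.-1 * - t ^- 2).
    elim: k => [|k IH]; first by rewrite !mul0r; exact: is_derive_cst.
    have -> : (fun s : R => s^-1 ^+ k.+1) = (fun s => s^-1) \* (fun s => s^-1 ^+ k).
      by apply/funext => s; rewrite exprS.
    apply: (is_derive_eq (is_deriveM iv IH)).
    rewrite -![_ *: _]/(_ * _) /= -exprVn; case: (k) => [|k']; rewrite ?mul0r ?mulr0 ?add0r /= ?expr0 ?mul1r//.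
    by rewrite !exprS; ring.
  have h2 : is_derive t (1 : R) (fun s : R => expR (- s^-1)) (expR (- t^-1) * t ^- 2).
    apply: (is_derive1_comp (f := expR) (g := fun s : R => - s^-1)).
    by rewrite -[X in is_derive _ _ _ X]opprK; exact: is_deriveN.
  apply: (is_derive_eq (is_deriveM h1 h2)).
  rewrite /flat_exp t0 -![_ *: _]/(_ * _) -exprVn.
  case: k {h1} => [|k]; first by rewrite /= ?expr0; ring.
  rewrite /= !exprS; ring.
have E0 j s : s <= 0 -> flat_exp j s = 0 by rewrite /flat_exp; case: ltP.
rewrite !(E0 _ t)// mulr0 subr0.
apply: (@is_derive_quadratic _ _ _ _ _ _ (k.+2)`!%:R 1) => // h _.
rewrite mulr0 subr0 (E0 _ t)// subr0 [h *: 1]mulr1.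
rewrite ger0_norm ?flat_exp_ge0// flat_expS flat_expS mulrA -expr2.
have [th|th] := leP (t + h) 0.
  by rewrite E0// mulr0 mulr_ge0// ?ler0n ?sqr_ge0.
rewrite mulrC ler_pM ?flat_exp_ge0 ?sqr_ge0 ?flat_exp_le//.
have h0 : 0 <= h by lra.
by rewrite -subr_ge0 subr_sqr mulr_ge0//; lra.
Qed.

Lemma smooth1_flat_exp k : smooth1 (flat_exp k).
Proof.
move=> n; elim: n k => [|n IH] k.
  move=> t; apply: differentiable_continuous; apply/derivable1_diffP.
  by have [] := is_derive_flat_exp k t.
apply: (Cn1S (is_derive_flat_exp k)); apply: Cn1D => //.
have -> : (fun t => - (k%:R * flat_exp k.+1 t)) = cst (- k%:R) \* flat_exp k.+1.
  by apply/funext => t; rewrite /= mulNr.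
by apply: Cn1M => //; exact: Cn1_cst.
Qed.

Lemma flat_exp_gt0 (t : R) : 0 < t -> 0 < flat_exp 0 t.
Proof. by move=> t0; rewrite /flat_exp t0 expr0 mul1r expR_gt0. Qed.

Lemma flat_exp_eq0 k (t : R) : t <= 0 -> flat_exp k t = 0.
Proof. by rewrite /flat_exp; case: ltP. Qed.

Definition step (t : R) : R := flat_exp 0 t / (flat_exp 0 t + flat_exp 0 (1 - t)).

Let den_gt0 t : 0 < flat_exp 0 t + flat_exp 0 (1 - t).
Proof.
have [t0|t0] := ltP 0 t; first by rewrite ltr_pwDl ?flat_exp_gt0 ?flat_exp_ge0.
by rewrite ltr_wpDl ?flat_exp_ge0// flat_exp_gt0//; lra.
Qed.

Lemma step_ge0 t : 0 <= step t.
Proof. by rewrite divr_ge0 ?flat_exp_ge0// ltW. Qed.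

Lemma step_le1 t : step t <= 1.
Proof. by rewrite ler_pdivrMr// mul1r lerDl flat_exp_ge0. Qed.

Lemma step_eq0 t : t <= 0 -> step t = 0.
Proof. by move=> t0; rewrite /step flat_exp_eq0// mul0r. Qed.

Lemma step_eq1 t : 1 <= t -> step t = 1.
Proof.
move=> t1; rewrite /step (@flat_exp_eq0 _ (1 - t)) ?subr_le0// addr0 divff// gt_eqF//.
by rewrite flat_exp_gt0//; lra.
Qed.

Lemma smooth1_step : smooth1 step.
Proof.
have E : (fun t => flat_exp 0 (1 - t)) = (fun t => flat_exp 0 (-1 * t + 1)).
  by apply/funext => t; congr flat_exp; ring.
move=> n; apply: (@Cn1M n (flat_exp 0)); first exact: smooth1_flat_exp.
apply: Cn1_inv => [t|]; first by rewrite gt_eqF.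
apply: Cn1D; first exact: smooth1_flat_exp.
by rewrite E; apply: Cn1_affine; exact: smooth1_flat_exp.
Qed.

Lemma step_homo (s t : R) : s <= t -> step s <= step t.
Proof.
have mono (a b : R) : a <= b -> flat_exp 0 a <= flat_exp 0 b.
  move=> ab; have [a0|a0] := leP a 0; first by rewrite flat_exp_eq0// flat_exp_ge0.
  have b0 : 0 < b by exact: lt_le_trans ab.
  by rewrite /flat_exp a0 b0 !expr0 !mul1r ler_expR lerN2 lef_pV2 ?posrE.
move=> st; rewrite /step ler_pdivrMr// mulrAC ler_pdivlMr//.
have h1 := mono _ _ st; have : 1 - t <= 1 - s by lra.
move=> /mono h2; rewrite !mulrDr; apply: lerD; first by rewrite mulrC.
by apply: ler_pM; rewrite ?flat_exp_ge0.
Qed.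

Lemma derive1_step_ge0 t : 0 <= derive1 step t.
Proof.
rewrite derive1E /derive; apply: limr_ge.
  by have [] := smooth1_is_derive smooth1_step t.
apply: (@filterS _ _ (dnbhs_filter 0) _ _ _ filterT) => h _.
have [h0|h0] := leP 0 h.
  by rewrite mulr_ge0 ?invr_ge0// subr_ge0 step_homo//= [h *: 1]mulr1 lerDr.
rewrite mulr_le0 ?invr_le0 ?(ltW h0)// subr_le0 step_homo//= [h *: 1]mulr1 gerDr ltW//.
Qed.

Lemma derive1_out (f : R -> R) (A : set R) (c : R) : open A ->
  (forall t, A t -> f t = c) -> forall t, A t -> derive1 f t = 0.
Proof.
move=> oA fc t At; rewrite derive1E.
rewrite (@near_eq_derive R R R f (cst c) t 1) ?derive_cst//.
by apply: filterS (open_nbhs_nbhs (conj oA At)) => s As; rewrite fc.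
Qed.

Lemma derive1_step_eq0 t : t < 0 \/ 1 < t -> derive1 step t = 0.
Proof.
case=> h.
  apply: (@derive1_out step `]-oo, 0[ 0) => [|r|] /=; first exact: interval_open.
    by rewrite in_itv /= => /ltW /step_eq0.
  by rewrite in_itv.
apply: (@derive1_out step `]1, +oo[ 1) => [|r|] /=; first exact: interval_open.
  by rewrite in_itv /= andbT => /ltW /step_eq1.
by rewrite in_itv /= andbT.
Qed.

End smooth1.

(** * Partial derivatives and the classes C^k *)

Section directional.
Context {R : realType} {n : nat}.
Implicit Types (f g : 'rV[R]_n -> R).

Lemma is_derive_lineP f (x v : 'rV[R]_n) (l : R) :
  is_derive x v f l <-> is_derive (0 : R) 1 (fun t : R => f (x + t *: v)) l.
Proof.
have E : (fun h : R => h^-1 *: (f (x + (h *: 1 + 0) *: v) - f (x + 0 *: v))) =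
    (fun h => h^-1 *: (f (h *: v + x) - f x)).
  apply/funext => h; congr (_ *: (f _ - f _)); last by rewrite scale0r addr0.
  by rewrite [h *: 1]mulr1 addr0 addrC.
split=> -[dg <-].
  by split; [rewrite /derivable E | rewrite /derive E].
by split; [move: dg; rewrite /derivable E | rewrite /derive E].
Qed.

Lemma is_derive_comp_real (P : R -> R) f (x v : 'rV[R]_n) (a b : R) :
  is_derive (f x) 1 P a -> is_derive x v f b -> is_derive x v (P \o f) (a * b).
Proof.
move=> dP /is_derive_lineP df; apply/is_derive_lineP.
apply: (@is_derive1_comp R P (fun t : R => f (x + t *: v))) => //.
by rewrite scale0r addr0.
Qed.

Lemma is_derive_prod_real f g (x v : 'rV[R]_n) (a b : R) :
  is_derive x v f a -> is_derive x v g b ->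
  is_derive x v (f \* g) (a * g x + f x * b).
Proof.
move=> df dg; apply: (is_derive_eq (is_deriveM df dg)).
by rewrite -![_ *: _]/(_ * _) addrC [g x * _]mulrC.
Qed.

Definition hasd (i : 'I_n) f f' := forall x, is_derive x (delta_mx ord0 i) f (f' x).

Lemma hasd_pderiv i f f' : hasd i f f' -> pderiv i f = f'.
Proof. by move=> h; apply/funext => x; have [_ <-] := h x. Qed.

Lemma hasdD i f g f' g' : hasd i f f' -> hasd i g g' -> hasd i (f \+ g) (f' \+ g').
Proof. by move=> hf hg x; exact: is_deriveD. Qed.

Lemma hasdM i f g f' g' : hasd i f f' -> hasd i g g' ->
  hasd i (f \* g) ((f' \* g) \+ (f \* g')).
Proof. by move=> hf hg x; exact: is_derive_prod_real. Qed.

Lemma hasd_cst i (c : R) : hasd i (cst c) (cst 0).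
Proof. by move=> x; exact: is_derive_cst. Qed.

Lemma hasdZ i f f' (c : R) : hasd i f f' ->
  hasd i (fun x => c * f x) (fun x => c * f' x).
Proof. by move=> hf x; exact: is_deriveZ. Qed.

Lemma hasd_comp (P P' : R -> R) i f f' : (forall t : R, is_derive t 1 P (P' t)) ->
  hasd i f f' -> hasd i (P \o f) (fun x => P' (f x) * f' x).
Proof. by move=> dP df x; apply: is_derive_comp_real. Qed.

Lemma hasd_coord i j : hasd i (fun x => x ord0 j) (cst (i == j)%:R).
Proof.
move=> x; apply: (@is_derive_quadratic _ _ _ _ _ _ 0 1) => // h _.
by rewrite mul0r !rVE /= [_ == i]eq_sym normr_le0; apply/eqP; ring.
Qed.

Lemma pderiv_out i f (A : set 'rV[R]_n) : open A ->
  (forall x, A x -> f x = 0) -> forall x, A x -> pderiv i f x = 0.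
Proof.
move=> oA f0 x Ax; rewrite /pderiv.
rewrite (@near_eq_derive _ _ R f (cst 0) x) ?derive_cst//.
by apply: filterS (open_nbhs_nbhs (conj oA Ax)) => s As; rewrite f0.
Qed.

End directional.

Section Ck_calculus.
Context {R : realType} {N : nat}.
Implicit Types (f g : 'rV[R]_N -> R) (i : 'I_N).

(** The last letter of a word of derivatives acts first, so peeling it off turns [Ck] into a
    recursion on the order. The closure properties below are inductions on this form. *)
Lemma CkSP k f : Ck k.+1 f <->
  continuous f /\ forall i, hasd i f (pderiv i f) /\ Ck k (pderiv i f).
Proof.
split=> [Cf|[cf h] s].
  split=> [|i]; first by have [] := Cf [::] isT.
  split=> [x|s sk].
    by split=> //; have [_ /(_ isT i x)] := Cf [::] isT.
  have := Cf (rcons s i); rewrite size_rcons ltnS => /(_ sk).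
  by rewrite /pderivs foldr_rcons.
case/lastP: s => [_|s i]; first by split=> //= _ i x; have [/(_ x)[]] := h i.
rewrite size_rcons ltnS => sk; rewrite /pderivs foldr_rcons.
by have [_ /(_ s sk)] := h i.
Qed.

Lemma Ck0P f : Ck 0 f <-> continuous f.
Proof. by split=> [/(_ [::] isT)[]//|cf [|//] _]; split. Qed.

Lemma CkS k f (f' : 'I_N -> 'rV[R]_N -> R) : continuous f ->
  (forall i, hasd i f (f' i)) -> (forall i, Ck k (f' i)) -> Ck k.+1 f.
Proof.
by move=> cf hf Cf'; apply/CkSP; split=> // i; rewrite (hasd_pderiv (hf i)).
Qed.

Lemma CkW k l f : (k <= l)%N -> Ck l f -> Ck k f.
Proof.
move=> kl Cf s sk; have [c h] := Cf s (leq_trans sk kl).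
by split=> // sk'; apply: h; exact: leq_trans kl.
Qed.

Lemma Ck_continuous k f : Ck k f -> continuous f.
Proof. by move=> /(CkW (leq0n _))/Ck0P. Qed.

Lemma Ck_hasd k f i : Ck k.+1 f -> hasd i f (pderiv i f).
Proof. by move=> /CkSP[_ /(_ i)[]]. Qed.

Lemma Ck_pderiv k f i : Ck k.+1 f -> Ck k (pderiv i f).
Proof. by move=> /CkSP[_ /(_ i)[]]. Qed.

Lemma Ck_cst k c : Ck k (cst c : 'rV[R]_N -> R).
Proof.
have cc (d : R) : continuous (cst d : 'rV[R]_N -> R) by exact: cst_continuous.
elim: k c => [|k IH] c; first exact/Ck0P.
by apply: (@CkS _ _ (fun=> cst 0)) => // i; exact: hasd_cst.
Qed.

Lemma rV_continuousD f g : continuous f -> continuous g -> continuous (f \+ g).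
Proof. by move=> cf cg x; apply: continuousD; [exact: cf|exact: cg]. Qed.

Lemma rV_continuousM f g : continuous f -> continuous g -> continuous (f \* g).
Proof. by move=> cf cg x; apply: continuousM; [exact: cf|exact: cg]. Qed.

Lemma CkD k f g : Ck k f -> Ck k g -> Ck k (f \+ g).
Proof.
elim: k f g => [|k IH] f g hf hg.
  by apply/Ck0P; exact: (rV_continuousD (Ck_continuous hf) (Ck_continuous hg)).
apply: (@CkS _ _ (fun i => pderiv i f \+ pderiv i g)) => [|i|i].
- exact: (rV_continuousD (Ck_continuous hf) (Ck_continuous hg)).
- exact: (hasdD (Ck_hasd i hf) (Ck_hasd i hg)).
- exact: (IH _ _ (Ck_pderiv i hf) (Ck_pderiv i hg)).
Qed.

Lemma CkM k f g : Ck k f -> Ck k g -> Ck k (f \* g).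
Proof.
elim: k f g => [|k IH] f g hf hg.
  by apply/Ck0P; exact: (rV_continuousM (Ck_continuous hf) (Ck_continuous hg)).
apply: (@CkS _ _ (fun i => (pderiv i f \* g) \+ (f \* pderiv i g))) => [|i|i].
- exact: (rV_continuousM (Ck_continuous hf) (Ck_continuous hg)).
- exact: (hasdM (Ck_hasd i hf) (Ck_hasd i hg)).
- have [hf' hg'] := (CkW (leqnSn _) hf, CkW (leqnSn _) hg).
  by apply: CkD; [exact: (IH _ _ (Ck_pderiv i hf) hg')|exact: (IH _ _ hf' (Ck_pderiv i hg))].
Qed.

Lemma Ck_comp k (P : R -> R) f : Cn1 k P -> Ck k f -> Ck k (P \o f).
Proof.
elim: k P f => [|k IH] P f hP hf.
  by apply/Ck0P => x; apply: continuous_comp; [exact: (Ck_continuous hf)|exact: hP].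
apply: (@CkS _ _ (fun i => (derive1 P \o f) \* pderiv i f)) => [|i|i].
- move=> x; apply: continuous_comp; first exact: (Ck_continuous hf).
  have [d _] := hP; apply: differentiable_continuous; exact/derivable1_diffP.
- by apply: hasd_comp; [exact: (Cn1_is_derive hP)|exact: (Ck_hasd i hf)].
- apply: CkM; last exact: (Ck_pderiv i hf).
  by apply: IH; [case: hP|exact: CkW (leqnSn _) hf].
Qed.

Lemma Ck_coord k j : Ck k (fun x : 'rV[R]_N => x ord0 j).
Proof.
have c : continuous (fun x : 'rV[R]_N => x ord0 j) by exact: coord_continuous.
case: k => [|k]; first exact/Ck0P.
apply: (@CkS _ _ (fun i => cst (i == j)%:R)) => // i; first exact: hasd_coord.
exact: Ck_cst.
Qed.

Lemma Ck_prod k (I : Type) (r : seq I) (F : I -> 'rV[R]_N -> R) :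
  (forall a, Ck k (F a)) -> Ck k (fun x => \prod_(a <- r) F a x).
Proof.
move=> CF; elim: r => [|a r IH].
  by under eq_fun do rewrite big_nil; exact: Ck_cst.
by under eq_fun do rewrite big_cons; exact: CkM.
Qed.

Lemma Ck_sum k (I : Type) (r : seq I) (F : I -> 'rV[R]_N -> R) :
  (forall a, Ck k (F a)) -> Ck k (fun x => \sum_(a <- r) F a x).
Proof.
move=> CF; elim: r => [|a r IH].
  by under eq_fun do rewrite big_nil; exact: Ck_cst.
by under eq_fun do rewrite big_cons; exact: CkD.
Qed.

(** Products of functions of one coordinate each. A partial derivative only updates one factor
    ([updf]), so the class is stable under differentiation. *)
Definition prodf (F : 'I_N -> R -> R) (x : 'rV[R]_N) : R := \prod_i F i (x ord0 i).

Definition updf (F : 'I_N -> R -> R) (i : 'I_N) (f : R -> R) : 'I_N -> R -> R :=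
  fun j => if j == i then f else F j.

Lemma Ck_prodf k F : (forall i, smooth1 (F i)) -> Ck k (prodf F).
Proof.
move=> sF; apply: Ck_prod => i.
by apply: (Ck_comp (f := fun x => x ord0 i)); [exact: sF|exact: Ck_coord].
Qed.

Lemma prodf_updE F i (h : R -> R) x :
  prodf (updf F i h) x = h (x ord0 i) * \prod_(j | j != i) F j (x ord0 j).
Proof.
rewrite /prodf (bigD1 i)//= /updf eqxx; congr (_ * _).
by apply: eq_bigr => j /negPf ->.
Qed.

Lemma hasd_prodf F i (h : R -> R) : (forall t : R, is_derive t 1 (F i) (h t)) ->
  hasd i (prodf F) (prodf (updf F i h)).
Proof.
move=> dF x; rewrite prodf_updE; apply/is_derive_lineP.
have E : (fun t : R => prodf F (x + t *: delta_mx ord0 i)) =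
    (fun t => (\prod_(j | j != i) F j (x ord0 j)) * F i (1 * t + x ord0 i)).
  apply/funext => t; rewrite /prodf (bigD1 i)//= mulrC; congr (_ * _).
    by apply: eq_bigr => j ji; rewrite !rVE (negPf ji) mulr0 addr0.
  by rewrite !rVE eqxx mulr1 mul1r addrC.
rewrite E mulrC; apply: is_deriveZ.
rewrite -[h _]mulr1; apply: (is_derive1_comp (g := fun t => 1 * t + x ord0 i)).
  by rewrite mulr0 add0r.
exact: is_derive_affine.
Qed.

End Ck_calculus.

(** * The space L^2: Cauchy-Schwarz and completeness *)

Lemma quadratic_discriminant (R : realFieldType) (a b c : R) : 0 <= a -> 0 <= c ->
  (forall t, 0 <= a + 2 * t * b + t ^+ 2 * c) -> b ^+ 2 <= a * c.
Proof.
move=> a0 c0 q; have [c_0|cn0] := eqVneq c 0.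
  have [b0|b0] := eqVneq b 0; first by rewrite b0 expr0n /= mulr_ge0.
  have := q (- (a + 1) / (2 * b)); rewrite c_0 mulr0 addr0.
  rewrite (_ : 2 * _ * b = - (a + 1)); last by field.
  by rewrite opprD addrA subrr sub0r oppr_ge0 ler10.
have cp : 0 < c by rewrite lt_def cn0.
have := q (- b / c); rewrite (_ : _ + _ = (a * c - b ^+ 2) / c); last by field.
by rewrite pmulr_lge0 ?invr_gt0// subr_ge0.
Qed.

Section L2_theory.
Context {R : realType} {N : nat} (Omega : set 'rV[R]_N).
Hypothesis mO : measurable Omega.
Implicit Types (u v w f g : 'rV[R]_N -> R).
Local Notation mu := (lebesgue_rV R N).
Local Notation L2 := (L2 Omega).

Definition ip u v : R := \int[mu]_(x in Omega) (u x * v x).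
Definition n2 u : R := Num.sqrt (ip u u).
Definition aeq u v := {ae mu, forall x, Omega x -> u x = v x}.

Lemma L2_measurable u : L2 u -> measurable_fun Omega u.
Proof. by case. Qed.

Lemma L2_sqr_integrable u : L2 u -> mu.-integrable Omega (EFin \o (fun x => u x ^+ 2)).
Proof.
move=> [mu_ iu]; apply/integrableP; split.
  by apply/measurable_EFinP; exact: measurable_funX.
under eq_integral do rewrite /= ger0_norm ?sqr_ge0//.
exact: iu.
Qed.

Lemma L2_sqrP u : measurable_fun Omega u ->
  mu.-integrable Omega (EFin \o (fun x => u x ^+ 2)) -> L2 u.
Proof.
move=> mu_ /integrableP[_ iu]; split=> //; apply: le_lt_trans iu.
by under [in leRHS]eq_integral do rewrite /= ger0_norm ?sqr_ge0//.
Qed.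

Lemma L2_mul_integrable u v : L2 u -> L2 v ->
  mu.-integrable Omega (EFin \o (fun x => u x * v x)).
Proof.
move=> Lu Lv.
have h := integrableD mO (L2_sqr_integrable Lu) (L2_sqr_integrable Lv).
apply: le_integrable h => //.
  by apply/measurable_EFinP; apply: measurable_funM; exact: L2_measurable.
move=> x _ /=; rewrite lee_fin [leRHS]ger0_norm ?addr_ge0 ?sqr_ge0// normrM.
rewrite -[u x ^+ 2]real_normK ?num_real// -[v x ^+ 2]real_normK ?num_real//.
have := sqr_ge0 (`|u x| - `|v x|); have := normr_ge0 (u x); have := normr_ge0 (v x).
nra.
Qed.

Lemma L2_le (C : R) u v : L2 v -> measurable_fun Omega u ->
  (forall x, Omega x -> `|u x| <= C * `|v x|) -> L2 u.
Proof.
move=> Lv mu_ uv; apply: L2_sqrP => //.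
have h := integrableZl mO (C ^+ 2) (L2_sqr_integrable Lv).
apply: le_integrable h => //; first by apply/measurable_EFinP; exact: measurable_funX.
move=> x Ox /=; rewrite lee_fin (ger0_norm (sqr_ge0 (u x))).
rewrite (ger0_norm (mulr_ge0 (sqr_ge0 C) (sqr_ge0 (v x)))).
rewrite -(real_normK (num_real (u x))) -(real_normK (num_real (v x))) -exprMn.
rewrite ler_pXn2r ?nnegrE//; first exact: uv.
exact: le_trans (normr_ge0 _) (uv _ Ox).
Qed.

Lemma L2Z c u : L2 u -> L2 (fun x => c * u x).
Proof.
move=> Lu; apply: (L2_le (C := `|c|) Lu) => [|x _]; last by rewrite normrM.
by apply: measurable_funM => //; exact: L2_measurable.
Qed.

Lemma L2N u : L2 u -> L2 (fun x => - u x).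
Proof. by move=> /(L2Z (-1)); under eq_fun do rewrite mulN1r. Qed.

Lemma L2D u v : L2 u -> L2 v -> L2 (fun x => u x + v x).
Proof.
move=> Lu Lv; apply: L2_sqrP.
  by apply: measurable_funD; exact: L2_measurable.
have h := integrableZl mO 2 (integrableD mO (L2_sqr_integrable Lu) (L2_sqr_integrable Lv)).
apply: le_integrable h => //.
  by apply/measurable_EFinP; apply: measurable_funX; apply: measurable_funD; exact: L2_measurable.
move=> x _ /=; rewrite lee_fin ger0_norm ?sqr_ge0// ger0_norm ?mulr_ge0 ?addr_ge0 ?sqr_ge0//.
have := sqr_ge0 (u x - v x); nra.
Qed.

Lemma L2B u v : L2 u -> L2 v -> L2 (fun x => u x - v x).
Proof. by move=> Lu /L2N; exact: L2D. Qed.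

Lemma L20 : L2 (fun=> 0).
Proof. by apply: L2_sqrP => //; rewrite /= expr0n; exact: integrable0. Qed.

Lemma L2_sum (I : Type) (r : seq I) (F : I -> 'rV[R]_N -> R) :
  (forall i, L2 (F i)) -> L2 (fun x => \sum_(i <- r) F i x).
Proof.
move=> LF; elim: r => [|i r IH]; first by under eq_fun do rewrite big_nil; exact: L20.
by under eq_fun do rewrite big_cons; exact: L2D.
Qed.

Lemma L2M (C : R) (c : _ -> R) u : measurable_fun Omega c -> (forall x, Omega x -> `|c x| <= C) ->
  L2 u -> L2 (fun x => c x * u x).
Proof.
move=> mc hc Lu; apply: (L2_le (C := C) Lu) => [|x Ox].
  by apply: measurable_funM => //; exact: L2_measurable.
by rewrite normrM ler_wpM2r// hc.
Qed.

Lemma ipC u v : ip u v = ip v u.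
Proof. by apply: eq_Rintegral => x _; rewrite mulrC. Qed.

Lemma eq_ip u v u' v' : (forall x, Omega x -> u x = u' x) ->
  (forall x, Omega x -> v x = v' x) -> ip u v = ip u' v'.
Proof. by move=> uu vv; apply: eq_Rintegral => x /[!inE] Ox; rewrite uu ?vv. Qed.

Lemma ipDl u v w : L2 u -> L2 v -> L2 w -> ip (fun x => u x + v x) w = ip u w + ip v w.
Proof.
move=> Lu Lv Lw; rewrite /ip -RintegralD//; last 2 first.
- exact: L2_mul_integrable Lu Lw.
- exact: L2_mul_integrable Lv Lw.
by apply: eq_Rintegral => x _; rewrite mulrDl.
Qed.

Lemma ipZl c u w : L2 u -> L2 w -> ip (fun x => c * u x) w = c * ip u w.
Proof.
move=> Lu Lw; rewrite /ip -RintegralZl//; last exact: L2_mul_integrable.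
by apply: eq_Rintegral => x _; rewrite mulrA.
Qed.

Lemma ipDr u v w : L2 u -> L2 v -> L2 w -> ip w (fun x => u x + v x) = ip w u + ip w v.
Proof. by move=> Lu Lv Lw; rewrite ipC ipDl// ipC (ipC v). Qed.

Lemma ipZr c u w : L2 u -> L2 w -> ip w (fun x => c * u x) = c * ip w u.
Proof. by move=> Lu Lw; rewrite ipC ipZl// ipC. Qed.

Lemma ipNl u w : L2 u -> L2 w -> ip (fun x => - u x) w = - ip u w.
Proof.
by move=> Lu Lw; rewrite -mulN1r -ipZl//; apply: eq_ip => // x _; rewrite mulN1r.
Qed.

Lemma ipNr u w : L2 u -> L2 w -> ip w (fun x => - u x) = - ip w u.
Proof. by move=> Lu Lw; rewrite ipC ipNl// ipC. Qed.

Lemma ipBl u v w : L2 u -> L2 v -> L2 w -> ip (fun x => u x - v x) w = ip u w - ip v w.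
Proof. by move=> Lu Lv Lw; rewrite -ipNl//; apply: ipDl => //; exact: L2N. Qed.

Lemma ipBr u v w : L2 u -> L2 v -> L2 w -> ip w (fun x => u x - v x) = ip w u - ip w v.
Proof. by move=> Lu Lv Lw; rewrite ipC ipBl// ipC (ipC v). Qed.

Lemma ip_ge0 u : 0 <= ip u u.
Proof. by apply: Rintegral_ge0 => x _; rewrite -expr2 sqr_ge0. Qed.

Lemma n2_ge0 u : 0 <= n2 u.
Proof. exact: sqrtr_ge0. Qed.

Lemma n2_sqr u : n2 u ^+ 2 = ip u u.
Proof. by rewrite sqr_sqrtr// ip_ge0. Qed.

Lemma cauchy_schwarz u v : L2 u -> L2 v -> `|ip u v| <= n2 u * n2 v.
Proof.
move=> Lu Lv; rewrite -sqrtrM ?ip_ge0// -sqrtr_sqr ler_wsqrtr//.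
apply: quadratic_discriminant => [||t]; try exact: ip_ge0.
have := ip_ge0 (fun x => u x + t * v x).
have Lt := L2Z t Lv; have Lut := L2D Lu Lt.
by rewrite ipDl// !ipDr// !ipZl// !ipZr// (ipC v u); lra.
Qed.

Lemma n2D u v : L2 u -> L2 v -> n2 (fun x => u x + v x) <= n2 u + n2 v.
Proof.
move=> Lu Lv; rewrite -(@ler_pXn2r _ 2)// ?nnegrE ?addr_ge0 ?n2_ge0//.
have Luv := L2D Lu Lv.
rewrite sqrrD !n2_sqr ipDl// !ipDr// (ipC v u).
have := le_trans (ler_norm _) (cauchy_schwarz Lu Lv); lra.
Qed.

Lemma n2Z c u : L2 u -> n2 (fun x => c * u x) = `|c| * n2 u.
Proof.
move=> Lu; have Lc := L2Z c Lu.
by rewrite /n2 ipZl// ipZr// mulrA -expr2 sqrtrM ?sqr_ge0// sqrtr_sqr.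
Qed.

Lemma n2N u : n2 (fun x => - u x) = n2 u.
Proof. by congr Num.sqrt; apply: eq_Rintegral => x _; rewrite mulrNN. Qed.

Lemma eq_n2 u v : (forall x, Omega x -> u x = v x) -> n2 u = n2 v.
Proof. by move=> uv; rewrite /n2 (eq_ip uv uv). Qed.

Lemma n2B u v : L2 u -> L2 v -> n2 (fun x => u x - v x) <= n2 u + n2 v.
Proof. by move=> Lu Lv; rewrite -(n2N v); apply: n2D => //; exact: L2N. Qed.

Lemma n2_sub_trans u v w : L2 u -> L2 v -> L2 w ->
  n2 (fun x => u x - w x) <= n2 (fun x => u x - v x) + n2 (fun x => v x - w x).
Proof.
move=> Lu Lv Lw; have := n2D (L2B Lu Lv) (L2B Lv Lw).
by rewrite (@eq_n2 _ (fun x => u x - w x)) // => x _; rewrite subrKA.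
Qed.

Lemma n2_subC u v : n2 (fun x => u x - v x) = n2 (fun x => v x - u x).
Proof. by rewrite -n2N; apply: eq_n2 => x _; rewrite opprB. Qed.

Lemma n2_0 : n2 (fun=> 0) = 0.
Proof. by rewrite /n2 /ip; under eq_Rintegral do rewrite mulr0; rewrite /Rintegral integral0 sqrtr0. Qed.

Lemma n2_le (C : R) u v : 0 <= C -> L2 v -> measurable_fun Omega u ->
  (forall x, Omega x -> `|u x| <= C * `|v x|) -> n2 u <= C * n2 v.
Proof.
move=> C0 Lv mu_ uv; have Lu := L2_le Lv mu_ uv.
rewrite -(ger0_norm C0) -n2Z// /n2 ler_wsqrtr//; apply: le_Rintegral => //.
- exact: L2_mul_integrable.
- by apply: L2_mul_integrable; exact: L2Z.
move=> x Ox; rewrite -!expr2 -(real_normK (num_real (u x))) -(real_normK (num_real (C * v x))).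
rewrite ler_pXn2r ?nnegrE// normrM (ger0_norm C0); exact: uv.
Qed.

Lemma n2M (C : R) (c : _ -> R) u : 0 <= C -> measurable_fun Omega c ->
  (forall x, Omega x -> `|c x| <= C) -> L2 u -> n2 (fun x => c x * u x) <= C * n2 u.
Proof.
move=> C0 mc hc Lu; apply: n2_le => // [|x Ox].
  by apply: measurable_funM => //; exact: L2_measurable.
by rewrite normrM ler_wpM2r// hc.
Qed.

Lemma n2_sum (I : Type) (r : seq I) (F : I -> 'rV[R]_N -> R) :
  (forall i, L2 (F i)) -> n2 (fun x => \sum_(i <- r) F i x) <= \sum_(i <- r) n2 (F i).
Proof.
move=> LF; elim: r => [|i r IH].
  by rewrite big_nil; under eq_n2 do rewrite big_nil; rewrite n2_0.
rewrite big_cons; under eq_n2 do rewrite big_cons.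
by apply: le_trans (n2D (LF i) (L2_sum r LF)) _; rewrite lerD2l.
Qed.

Lemma aeq_refl u : aeq u u.
Proof. by apply: aeW. Qed.

Lemma aeq_sym u v : aeq u v -> aeq v u.
Proof. by apply: filterS => x h /h. Qed.

Lemma aeq_Rintegral u v : measurable_fun Omega u -> measurable_fun Omega v ->
  aeq u v -> \int[mu]_(x in Omega) u x = \int[mu]_(x in Omega) v x.
Proof.
move=> mu_ mv uv; rewrite /Rintegral; congr fine; apply: ae_eq_integral => //.
- exact/measurable_EFinP.
- exact/measurable_EFinP.
by apply: filterS uv => x h Ox; rewrite h.
Qed.

Lemma aeq_ip u v u' v' : L2 u -> L2 v -> L2 u' -> L2 v' -> aeq u u' -> aeq v v' ->
  ip u v = ip u' v'.
Proof.
move=> Lu Lv Lu' Lv' uu vv; apply: aeq_Rintegral.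
- by apply: measurable_funM; exact: L2_measurable.
- by apply: measurable_funM; exact: L2_measurable.
by move: uu vv; apply: filterS2 => x h1 h2 Ox; rewrite h1 ?h2.
Qed.

Lemma aeq_n2 u v : L2 u -> L2 v -> aeq u v -> n2 u = n2 v.
Proof. by move=> Lu Lv uv; rewrite /n2 (aeq_ip Lu Lu Lv Lv). Qed.

Lemma aeq_L2 u v : measurable_fun Omega v -> aeq u v -> L2 u -> L2 v.
Proof.
move=> mv uv [mu_ iu]; split=> //.
rewrite -(@ae_eq_integral _ _ _ mu Omega (fun x => (v x ^+ 2)%:E) (fun x => (u x ^+ 2)%:E))//.
- by apply/(measurable_EFinP _ (fun x => u x ^+ 2)); exact: measurable_funX.
- by apply/(measurable_EFinP _ (fun x => v x ^+ 2)); exact: measurable_funX.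
by apply: filterS uv => x h Ox; rewrite h.
Qed.

Lemma n2_eq0 u : L2 u -> n2 u = 0 -> aeq u (fun=> 0).
Proof.
move=> Lu /eqP; rewrite sqrtr_eq0 => h.
have {}h : ip u u = 0 by apply/eqP; rewrite eq_le h ip_ge0.
have iu := L2_mul_integrable Lu Lu.
have e0 : (\int[mu]_(x in Omega) `|(u x * u x)%:E| = 0)%E.
  transitivity (\int[mu]_(x in Omega) (u x * u x)%:E)%E.
    by apply: eq_integral => x _; rewrite gee0_abs// lee_fin -expr2 sqr_ge0.
  move: h; rewrite /ip /Rintegral => h.
  by rewrite -[LHS]fineK ?h//; exact: integrable_fin_num iu.
have := (ae_eq_integral_abs mu mO (measurable_int _ iu)).1 e0.
apply: filterS => x /[apply] /= /eqP; rewrite eqe mulf_eq0 orbb => /eqP; exact.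
Qed.

End L2_theory.

Section L2_complete.
Context {R : realType} {N : nat} (Omega : set 'rV[R]_N).
Hypothesis mO : measurable Omega.
Implicit Types (u v w f g : 'rV[R]_N -> R).
Local Notation mu := (lebesgue_rV R N).
Local Notation L2 := (L2 Omega).
Local Notation n2 := (n2 Omega).

Lemma integral_sqr_n2 u : L2 u -> (\int[mu]_(x in Omega) (u x ^+ 2)%:E = (n2 u ^+ 2)%:E)%E.
Proof.
move=> Lu; rewrite n2_sqr /ip /Rintegral fineK; last first.
  by apply: integrable_fin_num => //; exact: (L2_mul_integrable mO Lu Lu).
by apply: eq_integral => x _; rewrite expr2.
Qed.

Lemma L2_n2_le u (C : R) : 0 <= C -> measurable_fun Omega u ->
  (\int[mu]_(x in Omega) (u x ^+ 2)%:E <= (C ^+ 2)%:E)%E -> L2 u /\ n2 u <= C.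
Proof.
move=> C0 mu_ h; have Lu : L2 u by split=> //; apply: le_lt_trans h _; rewrite ltry.
split=> //; move: h; rewrite integral_sqr_n2// lee_fin => h.
by rewrite -(@ler_pXn2r _ 2) ?nnegrE ?n2_ge0.
Qed.

Lemma cvgn_EFin (a : nat -> R) (l : R) :
  a @ \oo --> l -> (fun k => (a k)%:E) @ \oo --> l%:E.
Proof. by move=> al; apply: cvg_EFin => //; exact: nearW. Qed.

(** The bound is asked only from rank [K] on, because the sequences to which this is applied satisfy
    it only eventually. *)
Lemma fatou_bound (h_ : nat -> 'rV[R]_N -> R) (h : 'rV[R]_N -> R) (M : R) (K : nat) :
  (forall k, measurable_fun Omega (h_ k)) -> measurable_fun Omega h ->
  (forall k x, Omega x -> 0 <= h_ k x) -> (forall x, Omega x -> 0 <= h x) ->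
  {ae mu, forall x, Omega x -> h_ k x @[k --> \oo] --> h x} ->
  (forall k, (K <= k)%N -> (\int[mu]_(x in Omega) (h_ k x)%:E <= M%:E)%E) ->
  (\int[mu]_(x in Omega) (h x)%:E <= M%:E)%E.
Proof.
move=> mh_ mh h_0 h0 hcvg hM.
have mE k : measurable_fun Omega (fun x => (h_ k x)%:E).
  by apply/(measurable_EFinP _ (h_ k)); exact: mh_.
have F := fatou mu mO mE (fun k x Ox => (h_0 k x Ox : (0 <= (h_ k x)%:E)%E)).
apply: le_trans (le_trans F _).
  apply: ae_ge0_le_integral => //.
  - by apply/(measurable_EFinP _ h).
  - move=> x Ox; rewrite limn_einf_lim; apply: lime_ge; first exact: is_cvg_einfs.
    apply: nearW => n; apply: le_ereal_inf_tmp => _ [k _ <-]; rewrite lee_fin; exact: h_0.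
  - apply: measurableT_comp => //; apply: measurable_fun_limn_esup => k.
    exact: measurableT_comp.
  apply: filterS hcvg => x /[apply] hx.
  rewrite is_cvg_limn_einfE; last by apply/cvg_ex; exists (h x)%:E; exact: cvgn_EFin.
  by rewrite (cvg_lim _ (cvgn_EFin hx)).
rewrite limn_einf_lim; apply: lime_le; first exact: is_cvg_einfs.
near=> n; apply: le_trans (hM n _); last by near: n; exact: nbhs_infty_ge.
by apply: ereal_inf_lbound; exists n => //=.
Unshelve. all: by end_near. Qed.

(** Riesz-Fischer. Along a subsequence with increments at most 2^(-k), the sums of absolute
    increments are bounded in L^2 and increasing, hence finite almost everywhere, which gives
    pointwise convergence. Fatou turns the pointwise limit into an L^2 limit. The subsequence is
    part of the conclusion since almost everywhere limits are needed later. *)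
Lemma L2_cauchy_complete (u : nat -> 'rV[R]_N -> R) : (forall n, L2 (u n)) ->
  (forall e : R, 0 < e -> exists K, forall m n, (K <= m)%N -> (K <= n)%N ->
    n2 (fun x => u m x - u n x) < e) ->
  exists2 U, L2 U & exists phi : nat -> nat,
  [/\ forall k, (phi k < phi k.+1)%N,
    {ae mu, forall x, Omega x -> u (phi k) x @[k --> \oo] --> U x} &
    forall e : R, 0 < e -> exists K, forall n, (K <= n)%N -> n2 (fun x => u n x - U x) < e].
Proof.
move=> Lu cu.
have h2 k : 0 < (2^-1 : R) ^+ k by rewrite exprn_gt0.
have /choice[kk hkk] : forall k, exists K, forall m n, (K <= m)%N -> (K <= n)%N ->
    n2 (fun x => u m x - u n x) < 2^-1 ^+ k by move=> k; exact: cu.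
pose phi := fix phi k := match k with 0 => kk 0%N | k'.+1 => maxn (kk k'.+1) (phi k').+1 end.
have phiS k : (phi k < phi k.+1)%N by rewrite /= leq_maxr.
have phik k : (kk k <= phi k)%N by case: k => //= k; exact: leq_maxl.
have phi_ge k : (k <= phi k)%N.
  by elim: k => // k IH; exact: leq_ltn_trans (phiS k).
pose d k x : R := `|u (phi k.+1) x - u (phi k) x|.
have Lsub k : L2 (fun x => u (phi k.+1) x - u (phi k) x) by apply: L2B.
have Ld k : L2 (d k).
  apply: (L2_le (C := 1) mO (Lsub k)) => [|x _].
    by apply: measurableT_comp => //; exact: L2_measurable (Lsub k).
  by rewrite mul1r normr_id.
have nd k : n2 (d k) <= 2^-1 ^+ k.
  rewrite (_ : n2 (d k) = n2 (fun x => u (phi k.+1) x - u (phi k) x)).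
    apply: ltW; apply: hkk; last exact: phik.
    exact: leq_trans (phik k) (ltnW (phiS k)).
  by rewrite /Submission.n2 /ip; congr Num.sqrt; apply: eq_Rintegral => x _; rewrite -normrM ger0_norm// -expr2 sqr_ge0.
pose S K x : R := \sum_(0 <= k < K) d k x.
have LS K : L2 (S K) by exact: (L2_sum mO _ Ld).
have S0 K x : 0 <= S K x by apply: sumr_ge0 => k _; exact: normr_ge0.
have SS K x : S K.+1 x = S K x + d K x by rewrite /S big_nat_recr.
have Sle x : {homo S ^~ x : m n / (m <= n)%N >-> m <= n}.
  by apply/nondecreasing_seqP => k; rewrite SS lerDl normr_ge0.
have nS K : n2 (S K) <= 2.
  apply: le_trans (n2_sum mO _ Ld) _; apply: le_trans (ler_sum _ (fun k _ => nd k)) _.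
  have -> : \sum_(0 <= k < K) (2^-1 : R) ^+ k = 2 - 2 * 2^-1 ^+ K.
    elim: K => [|K IH]; first by rewrite big_geq// expr0; ring.
    by rewrite big_nat_recr//= IH exprS; field.
  by rewrite gerBl mulr_ge0// ltW.
pose G x := limn (fun K => ((S K x) ^+ 2)%:E).
have mSE K : measurable_fun Omega (fun x => ((S K x) ^+ 2)%:E).
  apply/(measurable_EFinP _ (fun x => S K x ^+ 2)).
  by apply: measurable_funX; exact: L2_measurable (LS K).
have homoE x : {homo (fun K => ((S K x) ^+ 2)%:E) : m n / (m <= n)%N >-> (m <= n)%E}.
  by move=> m n mn; rewrite lee_fin ler_pXn2r ?nnegrE//; exact: Sle.
have cvG x : cvgn (fun K => ((S K x) ^+ 2)%:E).
  by apply: ereal_nondecreasing_is_cvgn => m n; exact: homoE.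
have iG : (\int[mu]_(x in Omega) G x <= 4%:E)%E.
  rewrite monotone_convergence//; last by move=> n x _; rewrite lee_fin sqr_ge0.
  apply: lime_le.
    apply: ereal_nondecreasing_is_cvgn => m n mn; apply: ge0_le_integral => //.
    - by move=> x _; rewrite lee_fin sqr_ge0.
    - by move=> x _; exact: homoE.
  apply: nearW => K; rewrite integral_sqr_n2// lee_fin (_ : 4 = 2 ^+ 2 :> R); last by ring.
  by rewrite ler_pXn2r ?nnegrE// n2_ge0.
have G0 x : (0 <= G x)%E by apply: lime_ge => //; apply: nearW => K; rewrite lee_fin sqr_ge0.
have mG : measurable_fun Omega G.
  rewrite /G; under eq_fun do rewrite -is_cvg_limn_esupE//.
  exact: measurable_fun_limn_esup.
have intG : mu.-integrable Omega G.
  apply/integrableP; split=> //; under eq_integral do rewrite gee0_abs//.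
  by apply: le_lt_trans iG _; rewrite ltry.
have cvae : {ae mu, forall x, Omega x -> cvgn (fun k => u (phi k) x)}.
  have := integrable_ae mO intG; apply: filterS => x /[apply] Gfin.
  have bS K : S K x <= 1 + fine (G x).
    have : (S K x) ^+ 2 <= fine (G x).
      rewrite -lee_fin fineK//; apply: lime_ge => //.
      by exists K => // n /= Kn; exact: homoE.
    have := S0 K x; have := sqr_ge0 (S K x - 1); nra.
  have cS : cvgn (S ^~ x).
    apply: nondecreasing_is_cvgn; first exact: Sle.
    by exists (1 + fine (G x)) => _ [K _ <-].
  have uS K : `|u (phi K) x - u (phi 0) x| <= S K x.
    elim: K => [|K IH]; first by rewrite subrr normr0.
    rewrite SS -(subrKA (u (phi K) x)) addrC.
    by apply: le_trans (ler_normD _ _) _; rewrite lerD.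
  (* Adding the sums of absolute increments makes the sequence nondecreasing, so that convergence
     reduces to boundedness. *)
  have cuS : cvgn ((fun k => u (phi k) x) \+ S ^~ x).
    apply: nondecreasing_is_cvgn.
      apply/nondecreasing_seqP => k /=; rewrite SS.
      have := ler_norm (u (phi k) x - u (phi k.+1) x); rewrite distrC -/(d k x); lra.
    exists (u (phi 0) x + 2 * (1 + fine (G x))) => _ [K _ <-] /=.
    have := uS K; rewrite ler_norml => /andP[_]; have := bS K; lra.
  rewrite (_ : (fun _ => _) = ((fun k => u (phi k) x) \+ S ^~ x) \- S ^~ x).
    exact: is_cvgB.
  by apply/funext => k /=; rewrite addrK.
(* The upper limit is defined and measurable everywhere, while the limit exists only almost
   everywhere. *)
pose U x : R := fine (limn_esup (fun k => (u (phi k) x)%:E)).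
have mU : measurable_fun Omega U.
  apply: measurableT_comp => //.
  apply: measurable_fun_limn_esup => k.
  by apply/(measurable_EFinP _ (u (phi k))); exact: L2_measurable (Lu _).
have cvU : {ae mu, forall x, Omega x -> u (phi k) x @[k --> \oo] --> U x}.
  apply: filterS cvae => x /[apply] cx.
  suff -> : U x = limn (fun k => u (phi k) x) by [].
  rewrite /U is_cvg_limn_esupE; first by rewrite (cvg_lim _ (cvgn_EFin cx)).
  by apply/cvg_ex; exists (limn (fun k => u (phi k) x))%:E; exact: cvgn_EFin.
(* Fatou in [k] for the squares of [u n - u (phi k)], with [n] fixed. *)
have close (e : R) : 0 < e -> exists K, forall n, (K <= n)%N ->
    L2 (fun x => u n x - U x) /\ n2 (fun x => u n x - U x) <= e.
  move=> e0; have [K hK] := cu e e0; exists K => n Kn.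
  apply: L2_n2_le; [exact: ltW| |].
    by apply: measurable_funB => //; exact: L2_measurable.
  apply: (@fatou_bound (fun k x => (u n x - u (phi k) x) ^+ 2) _ _ K).
  - by move=> k; apply: measurable_funX; exact: L2_measurable (L2B mO (Lu _) (Lu _)).
  - by apply: measurable_funX; apply: measurable_funB => //; exact: L2_measurable.
  - by move=> k x _; exact: sqr_ge0.
  - by move=> x _; exact: sqr_ge0.
  - apply: filterS cvU => x /[apply] cx.
    rewrite expr2; under eq_fun do rewrite expr2.
    by apply: cvgM; apply: cvgB => //; exact: cvg_cst.
  move=> k Kk; rewrite integral_sqr_n2//; last exact: L2B.
  rewrite lee_fin ler_pXn2r ?nnegrE ?n2_ge0 ?(ltW e0)//; apply/ltW/hK => //.
  exact: leq_trans (phi_ge k).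
have [K1 /(_ K1 (leqnn _))[LK1 _]] := close 1 ltr01.
have LU : L2 U.
  have := L2B mO (Lu K1) LK1.
  by under eq_fun do rewrite opprB addrC subrK.
exists U => //; exists phi; split=> // e e0.
have [K hK] := close _ (divr_gt0 e0 (ltr0n R 2)); exists K => n Kn.
by have [_ h] := hK n Kn; apply: le_lt_trans h _; rewrite ltr_pdivrMr// mulr2n mulrDr mulr1 ltrDl.
Qed.

End L2_complete.

(** * Test functions and integration by parts *)

Section compact_supports.
Context {R : realType} {N : nat}.
Implicit Types (f g phi : 'rV[R]_N -> R) (K Omega : set 'rV[R]_N).

Lemma rV_compact_closed K : compact K -> closed K.
Proof. by move=> cK; apply: compact_closed => //; exact: norm_hausdorff. Qed.

Lemma rV_compact_bound K : compact K -> exists2 M : R, 0 < M & forall x, K x -> `|x| <= M.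
Proof. by move=> cK; apply: bounded_rV_set; exact: compact_bounded. Qed.

Lemma compact_support_bounded f K : continuous f -> compact K ->
  (forall x, ~ K x -> f x = 0) -> exists2 C : R, 0 < C & forall x, `|f x| <= C.
Proof.
move=> cf cK f0.
have /compact_bounded : compact (f @` K).
  by apply: continuous_compact => //; exact: continuous_subspaceT.
move=> /ex_strict_bound_gt0[C C0 hC]; exists C => // x.
have [Kx|nKx] := pselect (K x); last by rewrite f0// normr0 ltW.
by apply: ltW; apply: hC; exists x.
Qed.

Lemma continuous_bounded_on f K : continuous f -> compact K ->
  exists2 C : R, 0 < C & forall x, K x -> `|f x| <= C.
Proof.
move=> cf cK.
have /compact_bounded : compact (f @` K).
  by apply: continuous_compact => //; exact: continuous_subspaceT.
by move=> /ex_strict_bound_gt0[C C0 hC]; exists C => // x Kx; apply/ltW/hC; exists x.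
Qed.

Lemma rV_bounded_closed_ball (M : R) : compact [set x : 'rV[R]_N | `|x| <= M].
Proof.
apply: bounded_closed_compact.
  by exists M; split=> [|x Mx y /= yM]; [exact: num_real|exact: le_trans (ltW Mx)].
have cn : continuous (fun x : 'rV[R]_N => `|x|) by move=> x; exact: norm_continuous.
rewrite (_ : mkset _ = (fun x : 'rV[R]_N => `|x|) @^-1` `]-oo, M]).
  by apply: preimage_closed => //; exact: interval_closed.
by apply/seteqP; split=> x /=; rewrite in_itv.
Qed.

Lemma testfP Omega f K : (forall k, Ck k f) -> compact K -> K `<=` Omega ->
  (forall x, ~ K x -> f x = 0) -> test_function Omega f.
Proof.
move=> sf cK KO f0; have cl : closure [set x | f x != 0] `<=` K.
  rewrite ((closure_id K).1 (rV_compact_closed cK)).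
  by apply: closure_subset => x /= fx; apply: contrapT => /f0 /eqP; exact/negP.
split=> //; last exact: subset_trans KO.
by apply: subclosed_compact cK cl; exact: closed_closure.
Qed.

Lemma test_supp Omega phi : test_function Omega phi ->
  exists K, [/\ compact K, K `<=` Omega & forall x, ~ K x -> phi x = 0].
Proof.
move=> [sp cp pO]; exists (closure [set x | phi x != 0]); split=> // x nx.
by apply: contrapT => /eqP px; apply: nx; exact: subset_closure.
Qed.

Lemma pderiv_supp i f K : closed K -> (forall x, ~ K x -> f x = 0) ->
  forall x, ~ K x -> pderiv i f x = 0.
Proof. by move=> cK f0; apply: pderiv_out => //; exact: closed_openC. Qed.

Lemma test_pderiv Omega i phi : test_function Omega phi ->
  test_function Omega (pderiv i phi).
Proof.
move=> tp; have [sp _ _] := tp; have [K [cK KO K0]] := test_supp tp.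
apply: (testfP _ cK KO) => [k|]; first exact: Ck_pderiv.
by apply: pderiv_supp K0; exact: rV_compact_closed.
Qed.

Lemma test_pderivs Omega s phi : test_function Omega phi ->
  test_function Omega (pderivs s phi).
Proof. by move=> tp; elim: s => //= i s; exact: test_pderiv. Qed.

Lemma testM Omega f phi : (forall k, Ck k f) -> test_function Omega phi ->
  test_function Omega (f \* phi).
Proof.
move=> sf tp; have [sp _ _] := tp; have [K [cK KO K0]] := test_supp tp.
by apply: (testfP _ cK KO) => [k|x /K0 /= ->]; [exact: CkM|rewrite mulr0].
Qed.

Lemma testD Omega f g : test_function Omega f -> test_function Omega g ->
  test_function Omega (f \+ g).
Proof.
move=> tf tg; have [sf _ _] := tf; have [sg _ _] := tg.
have [K [cK KO K0]] := test_supp tf; have [L [cL LO L0]] := test_supp tg.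
apply: (@testfP _ _ (K `|` L)) => [k|||x /not_orP[nK nL] /=]; first exact: CkD.
- exact: compactU.
- by move=> x [/KO|/LO].
by rewrite K0// L0// addr0.
Qed.

Lemma testZ Omega c f : test_function Omega f -> test_function Omega (fun x => c * f x).
Proof. by move=> tf; apply: (@testM _ (cst c)) => // k; exact: Ck_cst. Qed.

Lemma integral_pderiv_eq0 i f f' K : hasd i f f' -> continuous f' -> compact K ->
  (forall x, ~ K x -> f x = 0) -> (\int[lebesgue_rV R N]_x (f' x)%:E = 0)%E.
Proof.
move=> df cf' cK f0.
have f'0 x : ~ K x -> f' x = 0.
  by rewrite -(hasd_pderiv df); apply: pderiv_supp f0 _; exact: rV_compact_closed.
have [M M0 hM] := rV_compact_bound cK.
have nK x : M < `|x| -> ~ K x by move=> Mx /hM; rewrite leNgt Mx.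
have [C C0 hC] := compact_support_bounded cf' cK f'0.
apply: (@integral_rV_pderiv0 _ _ i f f' M C) => //.
- by move=> x /nK; exact: f0.
- by move=> x /nK; exact: f'0.
Qed.

End compact_supports.

Section ibp.
Context {R : realType} {N : nat} (Omega : set 'rV[R]_N).
Hypothesis oO : open Omega.
Hypothesis bO : bounded_set Omega.
Implicit Types (f g phi : 'rV[R]_N -> R) (K : set 'rV[R]_N).
Local Notation mu := (lebesgue_rV R N).
Local Notation ip := (ip Omega).

Let mO : measurable Omega. Proof. exact: measurable_rV_open. Qed.

Lemma finite_O : (mu Omega < +oo)%E.
Proof. exact: lebesgue_rV_bounded. Qed.

Lemma measurable_continuous_on f : continuous f -> measurable_fun Omega f.
Proof. by move=> cf; apply: measurable_funS (measurable_rV_continuous cf). Qed.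

Lemma L2_cst c : L2 Omega (cst c).
Proof.
apply: L2_sqrP => //; apply: measurable_bounded_integrable => //; first exact: finite_O.
  exact: (measurable_cst (c ^+ 2)).
by exists (c ^+ 2); split=> [|M cM x _]; [exact: num_real|rewrite /= ger0_norm ?sqr_ge0// ltW].
Qed.

Lemma L2_bounded f (C : R) : measurable_fun Omega f ->
  (forall x, Omega x -> `|f x| <= C) -> L2 Omega f.
Proof.
move=> mf fC; apply: (L2_le (C := C) mO (L2_cst 1)) => // x Ox.
by rewrite /= normr1 mulr1 fC.
Qed.

Lemma bounded_closure_compact : compact (closure Omega).
Proof.
have [M M0 hM] := bounded_rV_set bO.
apply: (subclosed_compact _ (@rV_bounded_closed_ball R N M)); first exact: closed_closure.
rewrite ((closure_id _).1 (rV_compact_closed (@rV_bounded_closed_ball R N M))).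
exact: closure_subset.
Qed.

Lemma continuous_bounded_O f : continuous f ->
  exists2 C : R, 0 < C & forall x, Omega x -> `|f x| <= C.
Proof.
move=> cf; have [C C0 hC] := continuous_bounded_on cf bounded_closure_compact.
by exists C => // x Ox; apply: hC; exact: subset_closure.
Qed.

Lemma L2_continuous f : continuous f -> L2 Omega f.
Proof.
move=> cf; have [C _ hC] := continuous_bounded_O cf.
by apply: L2_bounded hC; exact: measurable_continuous_on.
Qed.

Lemma L2_continuousM f g : continuous f -> L2 Omega g -> L2 Omega (fun x => f x * g x).
Proof.
move=> cf; have [C _ hC] := continuous_bounded_O cf.
by exact: (L2M mO (measurable_continuous_on cf) hC).
Qed.

Lemma integration_by_parts i f g f' g' K : hasd i f f' -> hasd i g g' ->
  continuous f -> continuous g -> continuous f' -> continuous g' -> compact K -> K `<=` Omega ->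
  (forall x, ~ K x -> f x = 0) -> ip f' g = - ip f g'.
Proof.
move=> df dg cf cg cf' cg' cK KO f0.
have dfg := hasdM df dg.
have cfg : continuous ((f' \* g) \+ (f \* g')).
  by apply: rV_continuousD; apply: rV_continuousM.
have fg0 x : ~ K x -> (f \* g) x = 0 by move=> /f0 /= ->; rewrite mul0r.
have := integral_pderiv_eq0 dfg cfg cK fg0.
have f'0 x : ~ K x -> f' x = 0.
  by rewrite -(hasd_pderiv df); apply: pderiv_supp f0 _; exact: rV_compact_closed.
have -> : (\int[mu]_x (((f' \* g) \+ (f \* g')) x)%:E =
    \int[mu]_(x in Omega) (((f' \* g) \+ (f \* g')) x)%:E)%E.
  rewrite [RHS]integral_mkcond; apply: eq_integral => x _; rewrite patchE.
  case: ifPn => //; rewrite notin_setE => nO /=.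
  have nK : ~ K x by move=> /KO.
  by rewrite f'0// f0// !mul0r addr0.
move=> h0; apply/eqP; rewrite -subr_eq0 opprK /Submission.ip -RintegralD//; last 2 first.
- by apply: (L2_mul_integrable mO); exact: L2_continuous.
- by apply: (L2_mul_integrable mO); exact: L2_continuous.
by rewrite /Rintegral h0.
Qed.

End ibp.

(** * Product kernels, convolution and the Schur test *)

Lemma prod_telescope (R : comPzRingType) n (a b : 'I_n -> R) :
  \prod_i a i - \prod_i b i = \sum_(i < n)
    \prod_(j < n) (if (j < i)%N then a j else if j == i then a i - b i else b j).
Proof.
elim: n a b => [|n IH] a b; first by rewrite !big_ord0 subrr.
rewrite !big_ord_recl /= ?eqxx.
under [X in _ = _ + X]eq_bigr => i _.
  rewrite big_ord_recl /=.
  under eq_bigr => j _ do rewrite /bump /= !add1n ltnS (inj_eq lift_inj).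
  over.
rewrite -mulr_sumr -(IH (fun i => a (lift ord0 i)) (fun i => b (lift ord0 i))).
ring.
Qed.

Section dominated.
Context {R : realType} {N : nat} (Omega : set 'rV[R]_N).
Hypothesis mO : measurable Omega.
Local Notation mu := (lebesgue_rV R N).

Lemma L2_dominated (h : nat -> 'rV[R]_N -> R) (g : 'rV[R]_N -> R) :
  (forall k, measurable_fun Omega (h k)) -> L2 Omega g ->
  (forall k x, Omega x -> `|h k x| <= `|g x|) ->
  (forall x, Omega x -> h k x @[k --> \oo] --> (0 : R)) ->
  forall e : R, 0 < e -> exists K, forall k, (K <= k)%N -> n2 Omega (h k) < e.
Proof.
move=> mh Lg hg h0 e e0.
have Lh k : L2 Omega (h k).
  by apply: (L2_le (C := 1) mO Lg) => // x Ox; rewrite mul1r; exact: hg.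
have mE k : measurable_fun Omega (fun x => (h k x ^+ 2)%:E).
  by apply/(measurable_EFinP _ (fun x => h k x ^+ 2)); exact: measurable_funX.
have h1 : {ae mu, forall x, Omega x -> (h k x ^+ 2)%:E @[k --> \oo] --> 0%E}.
  apply: aeW => x Ox; apply: cvgn_EFin; rewrite -[0](mul0r (0 : R)).
  by under eq_fun do rewrite expr2; apply: cvgM; exact: h0.
have h2 : {ae mu, forall x k, Omega x -> (`|(h k x ^+ 2)%:E| <= (EFin \o (fun x => g x ^+ 2)%R) x)%E}.
  apply: aeW => x k Ox /=; rewrite lee_fin ger0_norm ?sqr_ge0//.
  rewrite -(real_normK (num_real (h k x))) -(real_normK (num_real (g x))).
  by rewrite ler_pXn2r ?nnegrE//; exact: hg.
have [_ _] := @dominated_convergence _ _ _ mu Omega mO _ _ _ mE (measurable_cst 0%E) h1 (L2_sqr_integrable Lg) h2.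
rewrite integral0.
under eq_fun do rewrite (integral_sqr_n2 mO (Lh _)).
move=> /fine_cvg /cvgrPdist_lt /(_ _ (exprn_gt0 2 e0))[K _ hK].
exists K => k Kk; have := hK k Kk; rewrite /= sub0r normrN ger0_norm ?sqr_ge0//.
by rewrite ltr_pXn2r ?nnegrE ?n2_ge0// ltW.
Qed.

End dominated.

Section real_functions.
Context {R : realType}.

Lemma lipschitz_derive (f f' : R -> R) (C : R) :
  (forall t : R, is_derive t 1 f (f' t)) -> (forall t, `|f' t| <= C) ->
  forall a b, `|f b - f a| <= C * `|b - a|.
Proof.
move=> df f'C; have cf : continuous f.
  by move=> t; apply: differentiable_continuous; apply/derivable1_diffP; have [] := df t.
have main a b : a < b -> `|f b - f a| <= C * `|b - a|.
  move=> ab; have [c _ ->] := MVT ab (fun x _ => df x) (continuous_subspaceT cf).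
  by rewrite normrM ler_wpM2r.
move=> a b; have [ab|ba|->] := ltgtP a b; first exact: main.
  by rewrite distrC [`|b - a|]distrC; exact: main.
by rewrite !subrr normr0 mulr0.
Qed.

(** The mean value theorem for s -> f(s) - f'(a) s, whose derivative f' - f'(a) is at most C |h|
    between a and a + h. *)
Lemma taylor_quadratic (f f' f'' : R -> R) (C : R) :
  (forall t : R, is_derive t 1 f (f' t)) -> (forall t : R, is_derive t 1 f' (f'' t)) ->
  (forall t, `|f'' t| <= C) ->
  forall a h, `|f (a + h) - f a - h * f' a| <= C * h ^+ 2.
Proof.
move=> df df' f''C a h; have C0 : 0 <= C := le_trans (normr_ge0 _) (f''C 0).
have lip := lipschitz_derive df' f''C.
have dg (t : R) : is_derive t 1 (fun s => f s + (- f' a) * s) (f' t - f' a).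
  apply: (is_derive_eq (is_deriveD (df t) (is_deriveZ (- f' a) (is_derive_id t 1)))).
  by rewrite [_ *: _]mulr1.
have cg : continuous (fun s => f s + (- f' a) * s).
  by move=> t; apply: differentiable_continuous; apply/derivable1_diffP; have [] := dg t.
have -> : f (a + h) - f a - h * f' a = (f (a + h) + (- f' a) * (a + h)) - (f a + (- f' a) * a).
  by ring.
rewrite -(real_normK (num_real h)).
have bnd c : `|c - a| <= `|h| -> `|f' c - f' a| <= C * `|h|.
  by move=> ch; apply: le_trans (lip _ _) _; rewrite ler_wpM2l.
have [h0|h0|->] := ltgtP h 0.
- have ab : a + h < a by rewrite gtrDl.
  have [c /= hc E] := MVT ab (fun x _ => dg x) (continuous_subspaceT cg).
  rewrite distrC E opprD addNKr normrM normrN expr2 mulrA ler_wpM2r// bnd//.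
  move: hc; rewrite in_itv /= => /andP[c1 c2].
  by rewrite (ltr0_norm h0) ler_norml; apply/andP; split; lra.
- have ab : a < a + h by rewrite ltrDl.
  have [c /= hc E] := MVT ab (fun x _ => dg x) (continuous_subspaceT cg).
  rewrite E addrAC subrr add0r normrM expr2 mulrA ler_wpM2r// bnd//.
  move: hc; rewrite in_itv /= => /andP[c1 c2].
  by rewrite (gtr0_norm h0) ler_norml; apply/andP; split; lra.
- by rewrite addr0 subrr normr0 expr0n mulr0.
Qed.

Lemma bounded_support (f : R -> R) (M : R) : continuous f ->
  (forall t, M < `|t| -> f t = 0) -> exists2 C : R, 0 < C & forall t, `|f t| <= C.
Proof.
move=> cf f0; have /compact_bounded : compact (f @` `[- `|M|, `|M|]).
  by apply: continuous_compact; [exact: continuous_subspaceT|exact: segment_compact].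
move=> /ex_strict_bound_gt0[C C0 hC]; exists C => // t.
have [tM|Mt] := leP `|t| `|M|.
  by apply/ltW/hC; exists t => //=; rewrite in_itv /= -ler_norml.
by rewrite f0 ?normr0 ?ltW//; apply: le_lt_trans (ler_norm _) Mt.
Qed.

Lemma derive1_support (f : R -> R) (M : R) :
  (forall t, M < `|t| -> f t = 0) -> forall t, M < `|t| -> derive1 f t = 0.
Proof.
move=> f0; apply: (@derive1_out _ f [set t : R | M < `|t|] 0) => //.
rewrite (_ : mkset _ = (fun t : R => `|t|) @^-1` `]M, +oo[%classic).
  by apply: open_comp; [move=> x _; exact: norm_continuous|exact: interval_open].
by apply/seteqP; split=> t /=; rewrite in_itv /= andbT.
Qed.

Lemma integral_derivative (g g' : R -> R) (M K : R) : M < K -> 0 < K ->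
  (forall t : R, is_derive t 1 g (g' t)) -> continuous g' ->
  (forall t, M < `|t| -> g' t = 0) ->
  (\int[lebesgue_measure]_t (g' t)%:E = (g K - g (- K))%:E)%E.
Proof.
move=> MK K0 hg cg' g'0.
have KK : - K < K by rewrite -subr_gt0 opprK addr_gt0.
transitivity (\int[lebesgue_measure]_(t in `[(- K)%R, K]) (g' t)%:E)%E.
  rewrite [RHS]integral_mkcond; apply: eq_integral => t _.
  rewrite patchE; case: ifPn => //; rewrite notin_setE /= in_itv /= -ler_norml => /negP.
  by rewrite -ltNge => h; rewrite g'0 //; exact: lt_trans h.
have dg t : derivable g t 1 by have [] := hg t.
have cg : continuous g by move=> t; apply: differentiable_continuous; exact/derivable1_diffP.
rewrite (@continuous_FTC2 _ g' g)//.
- exact: continuous_subspaceT.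
- split; first by move=> t _; exact: dg.
  + by apply: cvg_at_right_filter; exact: cg.
  + by apply: cvg_at_left_filter; exact: cg.
- by move=> t _; rewrite derive1E; have [] := hg t.
Qed.

End real_functions.

Section kernels.
Context {R : realType} {N : nat}.
Implicit Types (F : 'I_N -> R -> R).

Definition smooth_kernel F := (forall i, smooth1 (F i)) /\
  exists M : R, forall i t, M < `|t| -> F i t = 0.

Definition shiftf F (x : 'rV[R]_N) : 'I_N -> R -> R := fun i t => F i (x ord0 i - t).

Lemma prodf_shiftE F x y : prodf (shiftf F x) y = prodf F (x - y).
Proof. by rewrite /prodf; apply: eq_bigr => i _; rewrite /shiftf !rVE. Qed.

Lemma kernel_bound F : smooth_kernel F -> exists2 C : R, 1 <= C & forall i t, `|F i t| <= C.
Proof.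
move=> [sF [M F0]].
have /choice[C hC] : forall i, exists C : R, 0 < C /\ forall t, `|F i t| <= C.
  move=> i; have [C C0 hC] := bounded_support (smooth1_continuous (sF i)) (F0 i).
  by exists C.
exists (1 + \sum_i C i) => [|i t].
  by rewrite lerDl sumr_ge0// => i _; apply/ltW; have [] := hC i.
apply: le_trans ((hC i).2 t) _; rewrite (bigD1 i)//= addrCA lerDl addr_ge0// sumr_ge0//.
by move=> j _; apply/ltW; have [] := hC j.
Qed.

Lemma kernel_upd F i : smooth_kernel F -> smooth_kernel (updf F i (derive1 (F i))).
Proof.
move=> [sF [M F0]]; split=> [j|].
  by rewrite /updf; case: eqVneq => _ //; exact: smooth1_derive1.
exists M => j t Mt; rewrite /updf; case: eqVneq => _; last exact: F0.
exact: derive1_support (F0 i) _ Mt.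
Qed.

Lemma smooth1_shift F x : (forall i, smooth1 (F i)) -> forall i, smooth1 (shiftf F x i).
Proof.
move=> sF i; rewrite (_ : shiftf F x i = fun t => F i (-1 * t + x ord0 i)).
  exact: smooth1_affine.
by apply/funext => t; rewrite /shiftf mulN1r addrC.
Qed.

Lemma continuous_prodf F : (forall i, smooth1 (F i)) -> continuous (prodf F).
Proof. by move=> sF; exact: (Ck_continuous (Ck_prodf (k := 0%N) sF)). Qed.

Lemma prodr_bound (I : finType) (P : pred I) (f : I -> R) (C : R) : 1 <= C ->
  (forall i, `|f i| <= C) -> `|\prod_(i | P i) f i| <= C ^+ #|I|.
Proof.
move=> C1 hf; rewrite normr_prod; apply: (@le_trans _ _ (\prod_(i | P i) C)).
  by apply: ler_prod => i _; rewrite normr_ge0 hf.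
rewrite prodr_const ler_weXn2l//; exact: max_card.
Qed.

Lemma prodf_bound F C x : 1 <= C -> (forall i t, `|F i t| <= C) -> `|prodf F x| <= C ^+ N.
Proof. by move=> C1 hF; have := prodr_bound predT C1 (fun i => hF i (x ord0 i)); rewrite card_ord. Qed.

(** [prod_telescope] changes one factor at a time, and every factor is bounded and Lipschitz. *)
Lemma prodf_lipschitz F : smooth_kernel F -> exists2 L : R, 0 <= L &
  forall x y, `|prodf F x - prodf F y| <= L * `|x - y|.
Proof.
move=> kF; have [sF _] := kF; have [C C1 hC] := kernel_bound kF.
have kF' i := kernel_bound (kernel_upd i kF).
have /choice[D hD] : forall i, exists D : R, 0 <= D /\ forall s t, `|F i s - F i t| <= D * `|s - t|.
  move=> i; have [D D1 hD] := kF' i; exists D; split; first exact: le_trans D1.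
  move=> s t; apply: lipschitz_derive => r; first exact: smooth1_is_derive.
  by have := hD i r; rewrite /updf eqxx.
exists (\sum_i C ^+ N * D i).
  by apply: sumr_ge0 => i _; rewrite mulr_ge0 ?exprn_ge0 ?(le_trans _ C1)//; have [] := hD i.
move=> x y; rewrite /prodf prod_telescope mulr_suml; apply: le_trans (ler_norm_sum _ _ _) _.
apply: ler_sum => i _; rewrite (bigD1 i)//= ltnn eqxx normrM mulrC -mulrA.
apply: ler_pM => //.
  pose f (j : 'I_N) : R :=
    if (j < i)%N then F j (x ord0 j) else if j == i then C else F j (y ord0 j).
  have fC j : `|f j| <= C.
    rewrite /f; case: ifP => // _; case: ifP => // _.
    by rewrite ger0_norm// (le_trans _ C1).
  have := prodr_bound (fun j => j != i) C1 fC; rewrite card_ord.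
  by rewrite (eq_bigr f) // => j /negPf ji; rewrite /f ji.
apply: le_trans ((hD i).2 _ _) _; rewrite ler_wpM2l//; first by have [] := hD i.
by have := rV_coord_le (x - y) i; rewrite !rVE.
Qed.

End kernels.

Section convolution.
Context {R : realType} {N : nat} (Omega : set 'rV[R]_N).
Hypothesis oO : open Omega.
Hypothesis bO : bounded_set Omega.
Implicit Types (u v g : 'rV[R]_N -> R) (F : 'I_N -> R -> R).
Local Notation mu := (lebesgue_rV R N).
Local Notation L2 := (L2 Omega).

Let mO : measurable Omega. Proof. exact: measurable_rV_open. Qed.

(** Since the integral runs over [Omega] only, this is convolution with [u] extended by zero.
    Differentiating it moves the derivative to the kernel, whatever the regularity of [u]. *)
Definition convol F u (x : 'rV[R]_N) : R := ip Omega (prodf (shiftf F x)) u.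

Definition n1 u : R := \int[mu]_(x in Omega) `|u x|.

Lemma L2_integrable u : L2 u -> mu.-integrable Omega (EFin \o u).
Proof.
move=> Lu; have := L2_mul_integrable mO Lu (L2_cst oO bO 1).
by apply: eq_integrable => // x _ /=; rewrite mulr1.
Qed.

Lemma n1_ge0 u : 0 <= n1 u.
Proof. exact: Rintegral_ge0. Qed.

Lemma ip_n1 g u (B : R) : measurable_fun Omega g -> (forall x, Omega x -> `|g x| <= B) ->
  L2 u -> `|ip Omega g u| <= B * n1 u.
Proof.
move=> mg gB Lu; have Lg := L2_bounded oO bO mg gB.
have igu := L2_mul_integrable mO Lg Lu.
apply: le_trans (le_normr_Rintegral mO igu) _.
rewrite /n1 -RintegralZl//; last exact: (integrable_norm (L2_integrable Lu)).
apply: le_Rintegral => //.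
- exact: (integrable_norm igu).
- exact: (integrableZl mO B (integrable_norm (L2_integrable Lu))).
by move=> x Ox; rewrite normrM ler_wpM2r// gB.
Qed.

Lemma L2_shift F x : (forall i, smooth1 (F i)) -> L2 (prodf (shiftf F x)).
Proof. by move=> sF; apply: (L2_continuous oO bO); apply/continuous_prodf/smooth1_shift. Qed.

Lemma prodf_shift_upd F i f x h y :
  prodf (shiftf (updf F i f) (x + h *: delta_mx ord0 i)) y =
  f (x ord0 i + h - y ord0 i) * \prod_(j | j != i) F j (x ord0 j - y ord0 j).
Proof.
rewrite prodf_shiftE prodf_updE !rVE eqxx mulr1; congr (_ * _).
by apply: eq_bigr => j ji; rewrite !rVE (negPf ji) mulr0 addr0.
Qed.

Lemma prodf_shift_upd0 F i f x y :
  prodf (shiftf (updf F i f) x) y =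
  f (x ord0 i - y ord0 i) * \prod_(j | j != i) F j (x ord0 j - y ord0 j).
Proof.
rewrite prodf_shiftE prodf_updE !rVE; congr (_ * _).
by apply: eq_bigr => j ji; rewrite !rVE.
Qed.

(** The Taylor remainder of the kernel in the direction [i] is O(h^2) uniformly, and it is
    integrated against |u|. *)
Lemma hasd_conv F u i : smooth_kernel F -> L2 u ->
  hasd i (convol F u) (convol (updf F i (derive1 (F i))) u).
Proof.
move=> kF Lu x; have kF' := kernel_upd i kF; have kF'' := kernel_upd i kF'.
have [C C1 hC] := kernel_bound kF; have [C2 C21 hC2] := kernel_bound kF''.
have [sF _] := kF; have [sF' _] := kF'.
have d1 : forall t : R, is_derive t 1 (F i) (derive1 (F i) t) := smooth1_is_derive (sF i).
have d2 : forall t : R, is_derive t 1 (derive1 (F i)) (derive1 (derive1 (F i)) t).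
  exact: (smooth1_is_derive (smooth1_derive1 (sF i))).
have b2 t : `|derive1 (derive1 (F i)) t| <= C2.
  by have := hC2 i t; rewrite /updf !eqxx.
apply: (@is_derive_quadratic _ _ _ _ _ _ (C2 * C ^+ N * n1 u) 1) => // h _.
(* Writing [F] as an update of itself isolates the factor in the variable [i]; the other factors are
   common to the three terms. *)
have uE : F = updf F i (F i) by apply/funext => j; rewrite /updf; case: eqVneq => // ->.
have LF y := L2_shift y sF; have LF' y := L2_shift y sF'.
have LZ := L2Z mO h (LF' x).
rewrite /convol -ipBl// -ipZl// -ipBl//; last exact: L2B.
apply: le_trans (ip_n1 (B := C2 * C ^+ N * h ^+ 2) _ _ Lu) _; last by rewrite mulrAC.
  by apply: L2_measurable; apply: L2B => //; exact: L2B.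
move=> y _; have E z : prodf (shiftf F z) y = prodf (shiftf (updf F i (F i)) z) y by rewrite -uE.
rewrite (E (x + _)) (E x).
rewrite prodf_shift_upd !prodf_shift_upd0 mulrA -!mulrBl normrM.
rewrite [leRHS]mulrAC; apply: ler_pM => //.
  by rewrite [x ord0 i + h - _]addrAC; exact: (taylor_quadratic d1 d2 b2).
by have := prodr_bound (fun j => j != i) C1 (fun j => hC j (x ord0 j - y ord0 j)); rewrite card_ord.
Qed.

Lemma continuous_conv F u : smooth_kernel F -> L2 u -> continuous (convol F u).
Proof.
move=> kF Lu; have [L L0 hL] := prodf_lipschitz kF; have [sF _] := kF.
have LF y := L2_shift y sF.
apply/rV_continuousP => x e e0.
have D0 : 0 < L * n1 u + 1 by rewrite ltr_wpDl// mulr_ge0// n1_ge0.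
exists (e / (L * n1 u + 1)); first exact: divr_gt0.
move=> y yx; rewrite /convol -ipBl//.
apply: le_lt_trans (ip_n1 (B := L * `|y - x|) _ _ Lu) _.
- by apply: L2_measurable; exact: L2B.
- by move=> z _; rewrite !prodf_shiftE; apply: le_trans (hL _ _) _; rewrite opprB addrA subrK.
rewrite mulrAC; move: yx; rewrite ltr_pdivlMr// => yx; apply: le_lt_trans yx.
by rewrite mulrC ler_wpM2l// lerDl.
Qed.

Lemma Ck_conv k F u : smooth_kernel F -> L2 u -> Ck k (convol F u).
Proof.
move=> + Lu; elim: k F => [|k IH] F kF; first by apply/Ck0P; exact: continuous_conv.
apply: (@CkS _ _ _ _ (fun i => convol (updf F i (derive1 (F i))) u)).
- by exact: continuous_conv.
- by move=> i; exact: hasd_conv.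
- by move=> i; apply: IH; exact: kernel_upd.
Qed.

Lemma pderiv_conv F u i : smooth_kernel F -> L2 u ->
  pderiv i (convol F u) = convol (updf F i (derive1 (F i))) u.
Proof. by move=> kF Lu; apply: hasd_pderiv; exact: hasd_conv. Qed.

End convolution.

Section schur.
Context {R : realType} {N : nat} (Omega : set 'rV[R]_N).
Hypothesis oO : open Omega.
Hypothesis bO : bounded_set Omega.
Implicit Types (u v g : 'rV[R]_N -> R) (F : 'I_N -> R -> R).
Local Notation mu := (lebesgue_rV R N).
Local Notation L2 := (L2 Omega).
Local Notation n2 := (n2 Omega).
Local Notation convol := (convol Omega).

Let mO : measurable Omega. Proof. exact: measurable_rV_open. Qed.

Lemma le_integral_cube (g : 'rV[R]_N -> R) (x : 'rV[R]_N) (a b : 'I_N -> R) (C : R) : 0 <= C ->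
  (forall i, a i <= b i) -> measurable_fun Omega g -> (forall y, Omega y -> 0 <= g y) ->
  (forall y, Omega y -> g y <= C) ->
  (forall y, Omega y -> g y != 0 -> forall i, a i <= y ord0 i - x ord0 i <= b i) ->
  (\int[mu]_(y in Omega) (g y)%:E <= (C * \prod_i (b i - a i))%:E)%E.
Proof.
move=> C0 ab mg g0 gC gsupp.
pose Q := [set y : 'rV[R]_N | forall i, a i <= y ord0 i - x ord0 i <= b i].
have mQ : measurable Q.
  rewrite (_ : Q = \bigcap_(i in [set: 'I_N])
     ((fun y : 'rV[R]_N => y ord0 i) @^-1` `[x ord0 i + a i, x ord0 i + b i])).
    apply: fin_bigcap_measurable => // i _; rewrite -[X in measurable X]setTI.
    exact: measurable_rV_coord.
  by apply/seteqP; split=> y /= h i => [_|]; have := h i;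
    rewrite /= in_itv /= lerBrDl lerBlDl // => /(_ I).
have -> : (\int[mu]_(y in Omega) (g y)%:E = \int[mu]_(y in Omega `&` Q) (g y)%:E)%E.
  rewrite integral_mkcond [RHS]integral_mkcond; apply: eq_integral => y _.
  rewrite !patchE in_setI; case: ifPn => //= /[!inE] Oy; case: ifPn => //.
  rewrite notin_setE => nQ; congr _%:E; apply: contrapT => gy; apply: nQ.
  by apply: gsupp => //; exact/eqP.
apply: (@le_trans _ _ (\int[mu]_(y in Omega `&` Q) (cst C%:E) y)%E).
  apply: ge0_le_integral => //.
  - exact: measurableI.
  - by move=> y [Oy _]; rewrite lee_fin g0.
  - by apply/measurable_EFinP; apply: measurable_funS mg.
  - by move=> y [Oy _]; rewrite lee_fin gC.
rewrite integral_cst; last exact: measurableI.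
rewrite EFinM -(lebesgue_rV_cube x ab); apply: lee_wpmul2l; rewrite ?lee_fin//.
by apply: le_measure; rewrite ?inE//; exact: measurableI.
Qed.

Definition row_mass F (x : 'rV[R]_N) := (\int[mu]_(y in Omega) `|prodf (shiftf F x) y|%:E)%E.
Definition col_mass F (y : 'rV[R]_N) := (\int[mu]_(x in Omega) `|prodf (shiftf F x) y|%:E)%E.

Lemma continuous_shift_col F y : (forall i, smooth1 (F i)) ->
  continuous (fun x => prodf (shiftf F x) y).
Proof.
move=> sF; rewrite (_ : (fun x => _) = prodf (fun i t => F i (1 * t + - y ord0 i))).
  by apply: continuous_prodf => i; exact: smooth1_affine.
by apply/funext => x; rewrite /prodf; apply: eq_bigr => i _; rewrite /shiftf mul1r.
Qed.

Lemma measurable_normr_continuous g : continuous g ->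
  measurable_fun setT (fun y => `|g y|).
Proof. by move=> cg; apply: measurableT_comp => //; exact: measurable_rV_continuous. Qed.

Lemma mass_box F (a b C : 'I_N -> R) : (forall i, smooth1 (F i)) ->
  (forall i, a i <= b i) -> (forall i t, F i t != 0 -> a i <= t <= b i) ->
  (forall i t, `|F i t| <= C i) ->
  (forall x, (row_mass F x <= ((\prod_i C i) * \prod_i (b i - a i))%:E)%E) /\
  (forall y, (col_mass F y <= ((\prod_i C i) * \prod_i (b i - a i))%:E)%E).
Proof.
move=> sF ab hF hC.
have C0 i : 0 <= C i := le_trans (normr_ge0 _) (hC i 0).
have Kb x y : `|prodf (shiftf F x) y| <= \prod_i C i.
  rewrite normr_prod; apply: ler_prod => i _; rewrite normr_ge0; exact: hC.
have Ks x y : `|prodf (shiftf F x) y| != 0 -> forall i, a i <= x ord0 i - y ord0 i <= b i.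
  rewrite normr_eq0 => h i; apply: hF; apply: contra_neq h => h.
  by rewrite /prodf (bigD1 i)//= /shiftf h mul0r.
split=> [x|y].
  rewrite (_ : \prod_i (b i - a i) = \prod_i (- a i - - b i)); last first.
    by apply: eq_bigr => i _; rewrite opprK addrC.
  apply: (@le_integral_cube _ x); rewrite ?prodr_ge0//.
  - by move=> i; rewrite lerN2.
  - by apply: measurable_funS (measurable_normr_continuous _) => //; apply/continuous_prodf/smooth1_shift.
  - by move=> y _ /Ks h i; have /andP[h1 h2] := h i; apply/andP; split; lra.
apply: (@le_integral_cube _ y); rewrite ?prodr_ge0//.
- by apply: measurable_funS (measurable_normr_continuous _) => //; exact: continuous_shift_col.
- by move=> x _ /Ks.
Qed.

(** Cauchy-Schwarz for the weight k = |kernel|: the discriminant of the nonnegative quadratic int k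
    (|u| + t)^2 in t. *)
Lemma conv_sqr_le F (A : R) u x : smooth_kernel F -> L2 u -> (row_mass F x <= A%:E)%E ->
  ((convol F u x ^+ 2)%:E <=
   A%:E * \int[mu]_(y in Omega) (`|prodf (shiftf F x) y| * u y ^+ 2)%:E)%E.
Proof.
move=> kF Lu hA; have [sF _] := kF; have [C C1 hC] := kernel_bound kF.
set k := fun y => `|prodf (shiftf F x) y|.
have k0 y : 0 <= k y by exact: normr_ge0.
have kC y : `|k y| <= C ^+ N by rewrite normr_id prodf_shiftE prodf_bound.
have mk : measurable_fun Omega k.
  by apply: measurable_funS (measurable_normr_continuous _) => //; apply/continuous_prodf/smooth1_shift.
have Lk : L2 k := L2_bounded oO bO mk (fun y _ => kC y).
have mau : measurable_fun Omega (fun y => `|u y|).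
  by apply: measurableT_comp => //; exact: L2_measurable Lu.
have Lau : L2 (fun y => `|u y|).
  by apply: (L2_le (C := 1) mO Lu) => // y _; rewrite mul1r normr_id.
have i3 := L2_integrable oO bO Lk.
have i2 := L2_mul_integrable mO Lk Lau.
have i1 : mu.-integrable Omega (EFin \o (fun y => k y * u y ^+ 2)).
  have h := integrableZl mO (C ^+ N) (L2_sqr_integrable Lu).
  apply: le_integrable h => //.
    apply/measurable_EFinP; apply: measurable_funM => //.
    by apply: measurable_funX; exact: L2_measurable Lu.
  move=> y _ /=; rewrite lee_fin !normrM ler_wpM2r//.
  by apply: le_trans (kC y) _; rewrite ler_norm.
have Pb : `|convol F u x| <= \int[mu]_(y in Omega) (k y * `|u y|).
  have h := L2_mul_integrable mO (L2_shift oO bO x sF) Lu.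
  apply: le_trans (le_normr_Rintegral mO h) _.
  by under eq_Rintegral do rewrite normrM.
have D : (\int[mu]_(y in Omega) (k y * `|u y|)) ^+ 2 <=
    (\int[mu]_(y in Omega) (k y * u y ^+ 2)) * \int[mu]_(y in Omega) k y.
  apply: quadratic_discriminant => [||t].
  - by apply: Rintegral_ge0 => y _; rewrite mulr_ge0// sqr_ge0.
  - exact: Rintegral_ge0.
  have i2t := integrableZl mO (2 * t) i2; have i3t := integrableZl mO (t ^+ 2) i3.
  rewrite [2 * t * _](_ : _ = \int[mu]_(y in Omega) (2 * t * (k y * `|u y|))); last first.
    by rewrite RintegralZl.
  rewrite [t ^+ 2 * _](_ : _ = \int[mu]_(y in Omega) (t ^+ 2 * k y)); last first.
    by rewrite RintegralZl.
  rewrite -RintegralD// -RintegralD//; last exact: (integrableD mO i1 i2t).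
  apply: Rintegral_ge0 => y _; rewrite -(real_normK (num_real (u y))).
  have -> : k y * `|u y| ^+ 2 + 2 * t * (k y * `|u y|) + t ^+ 2 * k y = k y * (`|u y| + t) ^+ 2 by ring.
  by rewrite mulr_ge0// sqr_ge0.
have Q0 : 0 <= \int[mu]_(y in Omega) (k y * u y ^+ 2).
  by apply: Rintegral_ge0 => y _; rewrite mulr_ge0// sqr_ge0.
have -> : (\int[mu]_(y in Omega) (`|prodf (shiftf F x) y| * u y ^+ 2)%:E =
    (\int[mu]_(y in Omega) (k y * u y ^+ 2))%:E)%E.
  by rewrite /Rintegral fineK//; exact: integrable_fin_num i1.
rewrite -EFinM lee_fin -(real_normK (num_real (convol F u x))).
apply: (@le_trans _ _ ((\int[mu]_(y in Omega) (k y * `|u y|)) ^+ 2)).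
  by rewrite ler_pXn2r ?nnegrE// (le_trans _ Pb).
apply: le_trans D _; rewrite mulrC ler_wpM2r//.
rewrite -lee_fin; apply: le_trans hA; rewrite /Rintegral fineK//.
exact: integrable_fin_num i3.
Qed.

(** Besides the exchange of integrals, this records that both inner integrals are measurable, which
    monotonicity of the outer integrals requires. *)
Lemma tonelli_kernel F (w : 'rV[R]_N -> R) : (forall i, smooth1 (F i)) ->
  measurable_fun Omega w -> (forall y, Omega y -> 0 <= w y) ->
  (\int[mu]_(x in Omega) \int[mu]_(y in Omega) (`|prodf (shiftf F x) y| * w y)%:E =
   \int[mu]_(y in Omega) ((w y)%:E * col_mass F y))%E /\
  (measurable_fun Omega (fun x => \int[mu]_(y in Omega) (`|prodf (shiftf F x) y| * w y)%:E)%E /\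
   measurable_fun Omega (fun y => (w y)%:E * col_mass F y)%E).
Proof.
move=> sF mw w0.
pose f (p : 'rV[R]_N * 'rV[R]_N) : \bar R :=
  ((\1_Omega p.1 * (`|prodf (shiftf F p.1) p.2|)) * (w \_ Omega) p.2)%:E.
have wO0 y : 0 <= (w \_ Omega) y.
  by rewrite patchE; case: ifPn => // /[!inE]; exact: w0.
have mK : measurable_fun [set: 'rV[R]_N * 'rV[R]_N] (fun p => prodf (shiftf F p.1) p.2).
  apply: measurable_prod => i _; rewrite /shiftf.
  apply: (measurableT_comp (f := F i) (g := fun p : 'rV[R]_N * 'rV[R]_N => p.1 ord0 i - p.2 ord0 i)).
    by apply: continuous_measurable_fun; exact: smooth1_continuous.
  apply: measurable_funB.
    by apply: (measurableT_comp (f := fun x : 'rV[R]_N => x ord0 i)) => //; exact: measurable_rV_coord.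
  by apply: (measurableT_comp (f := fun x : 'rV[R]_N => x ord0 i)) => //; exact: measurable_rV_coord.
have mf : measurable_fun setT f.
  apply/measurable_EFinP; apply: measurable_funM; first apply: measurable_funM.
  - by apply: (measurableT_comp (f := \1_Omega : 'rV[R]_N -> R)) => //; exact: measurable_indic.
  - exact: measurableT_comp.
  - apply: (measurableT_comp (f := w \_ Omega)) => //.
    by apply/(measurable_restrict _ mO measurableT); rewrite setTI.
have f0 p : (0 <= f p)%E by rewrite lee_fin !mulr_ge0// indicE ler0n.
have E1 x : fubini_F mu f x = (((fun x =>
    \int[mu]_(y in Omega) (`|prodf (shiftf F x) y| * w y)%:E) \_ Omega) x)%E.
  rewrite /fubini_F patchE; case: ifPn => [Ox|nOx].
    rewrite [RHS]integral_mkcond; apply: eq_integral => y _; rewrite /f /= indicE Ox mul1r !patchE.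
    by case: ifPn => // _; rewrite mulr0.
  by apply: integral0_eq => y _; rewrite /f /= indicE (negPf nOx) !mul0r.
have E2 y : fubini_G mu f y = (((fun y => (w y)%:E * col_mass F y) \_ Omega) y)%E.
  rewrite /fubini_G patchE; case: ifPn => [Oy|nOy]; last first.
    by apply: integral0_eq => x _; rewrite /f /= patchE (negPf nOy) mulr0.
  rewrite /col_mass [X in (_ * X)%E]integral_mkcond -ge0_integralZl//.
  - apply: eq_integral => x _; rewrite /f /= !patchE Oy indicE.
    by case: ifPn => _; rewrite ?mul1r ?mul0r ?mule0// mulrC EFinM.
  - apply/(measurable_restrict _ mO measurableT); rewrite setTI.
    apply/(measurable_EFinP _ (fun x => `|prodf (shiftf F x) y|)).
    by apply: measurable_funS (measurable_normr_continuous _) => //; exact: continuous_shift_col.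
  - by move=> x _; rewrite patchE; case: ifP.
  - by move: Oy; rewrite inE => /w0; rewrite lee_fin.
split.
  rewrite integral_mkcond [RHS]integral_mkcond.
  transitivity (\int[mu]_x fubini_F mu f x)%E; first by apply: eq_integral => x _; rewrite E1.
  transitivity (\int[mu]_y fubini_G mu f y)%E; last by apply: eq_integral => y _; rewrite E2.
  exact: fubini_tonelli.
split.
  have := measurable_fun_fubini_tonelli_F (m2 := mu) f mf f0.
  rewrite (_ : fubini_F _ _ = ((fun x =>
      \int[mu]_(y in Omega) (`|prodf (shiftf F x) y| * w y)%:E) \_ Omega)%E); last by apply/funext.
  by move/(measurable_restrict _ mO measurableT); rewrite setTI.
have := measurable_fun_fubini_tonelli_G (m1 := mu) f mf f0.
rewrite (_ : fubini_G _ _ = ((fun y => (w y)%:E * col_mass F y) \_ Omega)%E); last by apply/funext.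
by move/(measurable_restrict _ mO measurableT); rewrite setTI.
Qed.

(** Schur's test: integrate [conv_sqr_le] in x, exchange the integrals, and use the column bound. *)
Lemma schur F (A : R) u : smooth_kernel F -> 0 <= A ->
  (forall x, (row_mass F x <= A%:E)%E) -> (forall y, (col_mass F y <= A%:E)%E) ->
  L2 u -> n2 (convol F u) <= A * n2 u.
Proof.
move=> kF A0 hr hc Lu; have [sF _] := kF.
have Lc : L2 (convol F u) by apply: (L2_continuous oO bO); exact: continuous_conv.
have mu2 : measurable_fun Omega (fun y => u y ^+ 2).
  by apply: measurable_funX; exact: L2_measurable Lu.
have [T [mT mT2]] := tonelli_kernel sF mu2 (fun y _ => sqr_ge0 (u y)).
rewrite -(@ler_pXn2r _ 2)// ?nnegrE ?n2_ge0 ?mulr_ge0 ?n2_ge0//.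
rewrite -lee_fin -(integral_sqr_n2 mO Lc) exprMn EFinM -(integral_sqr_n2 mO Lu).
have I0 x : (0 <= \int[mu]_(y in Omega) (`|prodf (shiftf F x) y| * u y ^+ 2)%:E)%E.
  by apply: integral_ge0 => y _; rewrite lee_fin mulr_ge0// sqr_ge0.
have cm0 y : (0 <= col_mass F y)%E by apply: integral_ge0 => x _; rewrite lee_fin.
have mc : measurable_fun Omega (fun x => (convol F u x ^+ 2)%:E).
  apply/(measurable_EFinP _ (fun x => convol F u x ^+ 2)).
  by apply: measurable_funX; exact: L2_measurable Lc.
have muE : measurable_fun Omega (fun x => (u x ^+ 2)%:E) by apply/(measurable_EFinP _ (fun x => u x ^+ 2)).
apply: (@le_trans _ _ (\int[mu]_(x in Omega) (A%:E *
    \int[mu]_(y in Omega) (`|prodf (shiftf F x) y| * u y ^+ 2)%:E))%E).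
  apply: ge0_le_integral => //.
  - by move=> x _; rewrite lee_fin sqr_ge0.
  - exact: measurable_funeM.
  - by move=> x _; exact: conv_sqr_le.
rewrite ge0_integralZl//= T expr2 EFinM -muleA; apply: lee_wpmul2l => //.
rewrite -ge0_integralZl//; last by move=> x _; rewrite lee_fin sqr_ge0.
apply: ge0_le_integral => //.
- by move=> x _; rewrite mule_ge0// lee_fin sqr_ge0.
- exact: measurable_funeM.
- by move=> x _; rewrite muleC; apply: lee_wpmul2r => //; rewrite lee_fin sqr_ge0.
Qed.

End schur.

(** * Mollifiers supported on boxes that may avoid the origin *)

Section ramps.
Context {R : realType}.
Implicit Types (a b lam s t : R).

(** The ramp climbs from 0 to 1 while [lam * t] runs from [a] to [b]. Its derivative [bumpeta] is
    therefore a nonnegative bump of mass one supported where [lam * t] lies in [a, b]. *)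
Definition ramp a b lam t : R := step (lam / (b - a) * t + - a / (b - a)).
Definition bumpeta a b lam t : R :=
  lam / (b - a) * derive1 step (lam / (b - a) * t + - a / (b - a)).

Lemma is_derive_ramp a b lam t : is_derive t 1 (ramp a b lam) (bumpeta a b lam t).
Proof. by apply: smooth1_comp_derive; exact: smooth1_step. Qed.

Lemma smooth1_ramp a b lam : smooth1 (ramp a b lam).
Proof. by apply: smooth1_affine; exact: smooth1_step. Qed.

Lemma smooth1_bumpeta a b lam : smooth1 (bumpeta a b lam).
Proof.
apply: (@smooth1M _ (cst (lam / (b - a)))); first exact: smooth1_cst.
by apply: smooth1_affine; apply: smooth1_derive1; exact: smooth1_step.
Qed.

Lemma derive1_ramp a b lam : derive1 (ramp a b lam) = bumpeta a b lam.
Proof. by apply/funext => t; rewrite derive1E; have [_ ->] := is_derive_ramp a b lam t. Qed.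

Lemma ramp_ge0 a b lam t : 0 <= ramp a b lam t. Proof. exact: step_ge0. Qed.
Lemma ramp_le1 a b lam t : ramp a b lam t <= 1. Proof. exact: step_le1. Qed.

Let argE a b lam t : lam / (b - a) * t + - a / (b - a) = (lam * t - a) / (b - a).
Proof. by rewrite mulrBl mulNr mulrAC. Qed.

Lemma ramp_eq0 a b lam t : a < b -> lam * t <= a -> ramp a b lam t = 0.
Proof.
move=> ab h; apply: step_eq0; rewrite argE pmulr_lle0 ?invr_gt0 ?subr_gt0//.
by rewrite subr_le0.
Qed.

Lemma ramp_eq1 a b lam t : a < b -> b <= lam * t -> ramp a b lam t = 1.
Proof.
move=> ab h; apply: step_eq1; rewrite argE ler_pdivlMr ?subr_gt0// mul1r.
by rewrite lerD2r.
Qed.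

Lemma bumpeta_ge0 a b lam t : a < b -> 0 < lam -> 0 <= bumpeta a b lam t.
Proof.
by move=> ab l0; rewrite mulr_ge0 ?derive1_step_ge0// divr_ge0 ?subr_ge0// ltW.
Qed.

Lemma bumpeta_supp a b lam t : a < b -> bumpeta a b lam t != 0 -> a <= lam * t <= b.
Proof.
move=> ab; apply: contra_neqT; rewrite negb_and -!ltNge => h.
rewrite /bumpeta derive1_step_eq0 ?mulr0// argE.
have ba : 0 < b - a by rewrite subr_gt0.
case/orP: h => h; [left|right]; first by rewrite pmulr_llt0 ?invr_gt0// subr_lt0.
by rewrite ltr_pdivlMr// mul1r ltrD2r.
Qed.

Lemma derive1_step_bound : exists2 D : R, 0 < D & forall t, `|derive1 step t| <= D.
Proof.
apply: (@bounded_support _ _ 1).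
  by apply: smooth1_continuous; apply: smooth1_derive1; exact: smooth1_step.
move=> t h; apply: derive1_step_eq0; have [t0|t0] := ltP t 0; [by left|right].
by rewrite ger0_norm in h.
Qed.

Lemma bumpeta_le a b lam D t : a < b -> 0 < lam -> (forall t, `|derive1 step t| <= D) ->
  `|bumpeta a b lam t| <= lam / (b - a) * D.
Proof.
move=> ab l0 hD; have c0 : 0 <= lam / (b - a) by rewrite divr_ge0 ?subr_ge0// ltW.
by rewrite normrM (ger0_norm c0) ler_wpM2l.
Qed.

Lemma bumpeta_mass a b lam s : a < b -> 0 < lam ->
  (\int[lebesgue_measure]_t (bumpeta a b lam (s - t))%:E = 1%E)%E /\
  (\int[lebesgue_measure]_t (bumpeta a b lam (t - s))%:E = 1%E)%E.
Proof.
move=> ab l0; pose M := `|s| + (`|a| + `|b|) / lam.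
have M0 : 0 <= M by rewrite addr_ge0// divr_ge0 ?addr_ge0// ltW.
have MK : M < M + 1 by rewrite ltrDl.
have K0 : 0 < M + 1 by rewrite ltr_wpDl.
have na := ler_norm (- a); have nb := ler_norm b; rewrite normrN in na.
have na' := ler_norm a; have nb' := ler_norm (- b); rewrite normrN in nb'.
have lM r : `|r| <= `|s| + (M + 1) -> True by [].
have big r : (`|a| + `|b|) / lam <= r -> a <= lam * r /\ b <= lam * r.
  by rewrite ler_pdivrMr// mulrC; split; lra.
have small r : (`|a| + `|b|) / lam <= - r -> lam * r <= a /\ lam * r <= b.
  by rewrite ler_pdivrMr// mulrC mulrN; split; lra.
have ns := ler_norm s; have ns' := ler_norm (- s); rewrite normrN in ns'.
have out r : M < `|r| -> bumpeta a b lam (s - r) = 0 /\ bumpeta a b lam (r - s) = 0.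
  move=> Mr; have key q : (`|a| + `|b|) / lam < `|q| -> bumpeta a b lam q = 0.
    move=> hq; apply/eqP; apply: contraT => /(bumpeta_supp ab)/andP[h1 h2].
    have [q0|q0] := leP 0 q; move: hq; rewrite ?(ger0_norm q0) ?(ltr0_norm q0) ltr_pdivrMr// mulrC ?mulrN => hq; lra.
  have h : (`|a| + `|b|) / lam < `|s - r|.
    have := ler_normB r s; have := lerB_dist r s; rewrite distrC; move: Mr; rewrite /M; lra.
  by rewrite !key// distrC.
split.
- have hd (t : R) : is_derive t 1 (fun t => - ramp a b lam (-1 * t + s)) (bumpeta a b lam (s - t)).
    rewrite -[bumpeta _ _ _ _]opprK -(mulN1r (bumpeta _ _ _ _)).
    apply: is_deriveN; rewrite [s - t](_ : _ = -1 * t + s); last by ring.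
    rewrite -derive1_ramp; apply: smooth1_comp_derive; exact: smooth1_ramp.
  have hc : continuous (fun t => bumpeta a b lam (s - t)).
    rewrite (_ : (fun t => _) = (fun t => bumpeta a b lam (-1 * t + s))).
      by apply: smooth1_continuous; apply: smooth1_affine; exact: smooth1_bumpeta.
    by apply/funext => t; congr bumpeta; ring.
  rewrite (integral_derivative MK K0 hd hc (fun t h => (out t h).1)).
  rewrite (@ramp_eq0 a b lam (_ + s))//; last by apply: (small _ _).1; rewrite /M; lra.
  rewrite (@ramp_eq1 a b lam)//; last by apply: (big _ _).2; rewrite /M; lra.
  by rewrite oppr0 opprK add0r.
- have hd (t : R) : is_derive t 1 (fun t => ramp a b lam (1 * t + - s)) (bumpeta a b lam (t - s)).
    rewrite -[bumpeta _ _ _ _]mul1r [t - s](_ : _ = 1 * t + - s); last by ring.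
    rewrite -derive1_ramp; apply: smooth1_comp_derive; exact: smooth1_ramp.
  have hc : continuous (fun t => bumpeta a b lam (t - s)).
    rewrite (_ : (fun t => _) = (fun t => bumpeta a b lam (1 * t + - s))).
      by apply: smooth1_continuous; apply: smooth1_affine; exact: smooth1_bumpeta.
    by apply/funext => t; congr bumpeta; ring.
  rewrite (integral_derivative MK K0 hd hc (fun t h => (out t h).2)).
  rewrite (@ramp_eq1 a b lam)//; last by apply: (big _ _).2; rewrite /M; lra.
  by rewrite (@ramp_eq0 a b lam)// ?subr0//; apply: (small _ _).1; rewrite /M; lra.
Qed.

End ramps.

Section mollifiers.
Context {R : realType} {N : nat}.
Variables (a b : 'I_N -> R).
Hypothesis ab : forall i, a i < b i.

(** The L^4 estimates produce the fourth root of the scale; with base 16 it is 2^k, and all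
    exponents remain integers. *)
Definition scale (k : nat) : R := 16 ^+ k.

Lemma scale_gt0 k : 0 < scale k. Proof. by rewrite exprn_gt0. Qed.
Lemma scale_ge1 k : 1 <= scale k. Proof. by rewrite exprn_ege1//; lra. Qed.

Lemma scale_large (c : R) : exists K, forall k, (K <= k)%N -> c < scale k.
Proof.
have [K hK] : exists K : nat, c < K%:R.
  exists (Num.truncn `|c|).+1; apply: le_lt_trans (ler_norm c) _.
  by rewrite truncnS_gt.
exists K => k Kk; apply: lt_le_trans hK _; rewrite /scale -natrX ler_nat.
by apply: leq_trans Kk _; apply: ltnW; exact: ltn_expl.
Qed.

(** The support is the box with sides [a_i, b_i] / 16^k. The freedom to place this box away from the
    origin lets a mollification push supports to a chosen side of the boundary. *)
Definition moll (k : nat) : 'I_N -> R -> R := fun i => bumpeta (a i) (b i) (scale k).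

Lemma moll_smooth k i : smooth1 (moll k i). Proof. exact: smooth1_bumpeta. Qed.

Lemma moll_ge0 k i t : 0 <= moll k i t.
Proof. by apply: bumpeta_ge0 => //; exact: scale_gt0. Qed.

Lemma prodf_moll_ge0 k x : 0 <= prodf (moll k) x.
Proof. by apply: prodr_ge0 => i _; exact: moll_ge0. Qed.

Lemma moll_supp k i t : moll k i t != 0 -> a i <= scale k * t <= b i.
Proof. exact: bumpeta_supp. Qed.

Lemma prodf_moll_supp k x : prodf (moll k) x != 0 ->
  forall i, a i <= scale k * x ord0 i <= b i.
Proof.
move=> h i; apply: (@moll_supp k); apply: contra_neq h => h.
by rewrite /prodf (bigD1 i)//= h mul0r.
Qed.

Definition mrad : R := \sum_i (`|a i| + `|b i|).

Lemma mrad_ge0 : 0 <= mrad.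
Proof. by apply: sumr_ge0 => i _; rewrite addr_ge0. Qed.

Lemma prodf_moll_small k x : prodf (moll k) x != 0 -> scale k * `|x| <= mrad.
Proof.
move=> h; have s0 := scale_gt0 k; rewrite mulrC -ler_pdivlMr//.
apply/rV_norm_le; first by rewrite divr_ge0 ?mrad_ge0 ?(ltW s0).
move=> i; rewrite ler_pdivlMr// -(gtr0_norm s0) -normrM mulrC.
have /andP[h1 h2] := prodf_moll_supp h i.
apply: (@le_trans _ _ (`|a i| + `|b i|)).
  have := ler_norm (- a i); have := ler_norm (b i); rewrite normrN.
  have := normr_ge0 (a i); have := normr_ge0 (b i).
  by move=> *; rewrite ler_norml; apply/andP; split; lra.
by rewrite /mrad (bigD1 i)//= lerDl sumr_ge0// => j _; rewrite addr_ge0.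
Qed.

Lemma moll_kernel k : smooth_kernel (moll k).
Proof.
split; first by move=> i; exact: moll_smooth.
exists mrad => i t mt; apply/eqP; apply: contraTT mt => /moll_supp/andP[h1 h2].
rewrite -leNgt; apply: (@le_trans _ _ (`|a i| + `|b i|)).
  have s1 := scale_ge1 k; have s0 := scale_gt0 k.
  apply: (@le_trans _ _ `|scale k * t|); first by rewrite normrM (gtr0_norm s0) ler_peMl.
  have := ler_norm (- a i); have := ler_norm (b i); rewrite normrN.
  have := normr_ge0 (a i); have := normr_ge0 (b i).
  by move=> *; rewrite ler_norml; apply/andP; split; lra.
by rewrite /mrad (bigD1 i)//= lerDl sumr_ge0// => j _; rewrite addr_ge0.
Qed.

Lemma moll_mass k (x : 'rV[R]_N) :
  (\int[lebesgue_rV R N]_y (prodf (shiftf (moll k) x) y)%:E = 1)%E /\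
  (\int[lebesgue_rV R N]_y (prodf (shiftf (moll k) y) x)%:E = 1)%E.
Proof.
have mm i : measurable_fun setT (moll k i).
  by apply: continuous_measurable_fun; apply: smooth1_continuous; exact: moll_smooth.
split.
  rewrite (ge0_integral_rV_prod (f := shiftf (moll k) x)); last 2 first.
  - by move=> i; apply: continuous_measurable_fun; apply: smooth1_continuous; exact: smooth1_shift (moll_smooth k) i.
  - by move=> i t; exact: moll_ge0.
  by rewrite big1// => i _; have [h _] := bumpeta_mass (x ord0 i) (ab i) (scale_gt0 k).
rewrite (ge0_integral_rV_prod (f := fun i t => moll k i (t - x ord0 i))); last 2 first.
- move=> i; rewrite (_ : (fun t => _) = (fun t => moll k i (1 * t + - x ord0 i))).
    apply: continuous_measurable_fun; apply: smooth1_continuous; apply: smooth1_affine.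
    exact: moll_smooth.
  by apply/funext => t; rewrite mul1r.
- by move=> i t; exact: moll_ge0.
by rewrite big1// => i _; have [_ h] := bumpeta_mass (x ord0 i) (ab i) (scale_gt0 k).
Qed.

End mollifiers.

Lemma cvgn_eps (R : realType) (f : nat -> R) (l : R) :
  (forall e : R, 0 < e -> exists K, forall k, (K <= k)%N -> `|f k - l| < e) ->
  f @ \oo --> l.
Proof.
move=> h; apply/cvgrPdist_lt => e /h[K hK]; exists K => // k Kk.
by rewrite /= distrC; exact: hK.
Qed.

(** * Mollifications converge in L^2 *)

Section approximate_identity.
Context {R : realType} {N : nat} (Omega : set 'rV[R]_N).
Hypothesis oO : open Omega.
Hypothesis bO : bounded_set Omega.
Variables (a b : 'I_N -> R).
Hypothesis ab : forall i, a i < b i.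
Implicit Types (u v g : 'rV[R]_N -> R).
Local Notation mu := (lebesgue_rV R N).
Local Notation L2 := (L2 Omega).
Local Notation n2 := (n2 Omega).
Local Notation T k := (convol Omega (moll a b k)).

Let mO : measurable Omega. Proof. exact: measurable_rV_open. Qed.

Lemma moll_abs k (x y : 'rV[R]_N) :
  `|prodf (shiftf (moll a b k) x) y| = prodf (shiftf (moll a b k) x) y.
Proof. by rewrite ger0_norm// prodf_shiftE; exact: prodf_moll_ge0. Qed.

Lemma moll_row_mass k x : (row_mass Omega (moll a b k) x <= 1)%E.
Proof.
rewrite -(moll_mass ab k x).1 /row_mass; under eq_integral do rewrite moll_abs.
apply: ge0_subset_integral => //.
  apply/(measurable_EFinP _ (prodf (shiftf (moll a b k) x))).
  by apply: measurable_rV_continuous; apply: continuous_prodf; apply: smooth1_shift => i; exact: moll_smooth.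
by move=> y _; rewrite lee_fin -moll_abs.
Qed.

Lemma moll_col_mass k y : (col_mass Omega (moll a b k) y <= 1)%E.
Proof.
rewrite -(moll_mass ab k y).2 /col_mass; under eq_integral do rewrite moll_abs.
apply: ge0_subset_integral => //.
  apply/(measurable_EFinP _ (fun x => prodf (shiftf (moll a b k) x) y)).
  by apply: measurable_rV_continuous; apply: continuous_shift_col => i; exact: moll_smooth.
by move=> x _; rewrite lee_fin -moll_abs.
Qed.

Lemma continuous_moll k u : L2 u -> continuous (T k u).
Proof. by move=> Lu; apply: (continuous_conv oO bO) => //; exact: moll_kernel. Qed.

Lemma L2_moll k u : L2 u -> L2 (T k u).
Proof. by move=> Lu; apply: (L2_continuous oO bO); exact: continuous_moll. Qed.

Lemma n2_moll k u : L2 u -> n2 (T k u) <= n2 u.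
Proof.
move=> Lu; rewrite -[leRHS]mul1r; apply: (schur oO bO) => //; first exact: moll_kernel.
- exact: moll_row_mass.
- exact: moll_col_mass.
Qed.

Lemma moll_linear k u v (c d : R) x : L2 u -> L2 v ->
  T k (fun x => c * u x + d * v x) x = c * T k u x + d * T k v x.
Proof.
move=> Lu Lv; rewrite /convol ipDr//; try exact: L2Z.
- by rewrite !ipZr//; apply: L2_shift => // i; exact: moll_smooth.
- by apply: L2_shift => // i; exact: moll_smooth.
Qed.

Definition moll_cvg u := L2 u /\ forall e : R, 0 < e ->
  exists K, forall k, (K <= k)%N -> n2 (fun x => T k u x - u x) < e.

Lemma moll_cvg_lin u v (c d : R) : moll_cvg u -> moll_cvg v ->
  moll_cvg (fun x => c * u x + d * v x).
Proof.
move=> [Lu hu] [Lv hv]; split; first by apply: L2D => //; exact: L2Z.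
move=> e e0; have D0 : 0 < `|c| + `|d| + 1 by rewrite ltr_wpDl// addr_ge0.
have e1 : 0 < e / (`|c| + `|d| + 1) by rewrite divr_gt0.
have [K hK] := hu _ e1; have [L hL] := hv _ e1.
exists (maxn K L) => k; rewrite geq_max => /andP[/hK h1 /hL h2].
have Lu1 := L2B mO (L2_moll k Lu) Lu; have Lv1 := L2B mO (L2_moll k Lv) Lv.
rewrite (@eq_n2 _ _ _ _ (fun x => c * (T k u x - u x) + d * (T k v x - v x))); last first.
  by move=> x _; rewrite moll_linear//; ring.
apply: le_lt_trans (n2D mO (L2Z mO c Lu1) (L2Z mO d Lv1)) _.
rewrite !n2Z//; apply: le_lt_trans (lerD (ler_wpM2l (normr_ge0 c) (ltW h1)) (ler_wpM2l (normr_ge0 d) (ltW h2))) _.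
by rewrite -mulrDl mulrA ltr_pdivrMr// [_ * e]mulrC ltr_pM2l// ltrDl.
Qed.

(** Mollification does not increase the L^2 norm, so convergence passes to L^2 limits by a
    three-term estimate. *)
Lemma moll_cvg_closed u : L2 u -> (forall e : R, 0 < e ->
  exists2 v, moll_cvg v & n2 (fun x => u x - v x) < e) -> moll_cvg u.
Proof.
move=> Lu h; split=> // e e0; have e3 : 0 < e / 3 by lra.
have [v [Lv hv] uv] := h _ e3; have [K hK] := hv _ e3; exists K => k /hK hk.
have Luv := L2B mO Lu Lv.
rewrite (@eq_n2 _ _ _ _ (fun x => T k (fun x => u x - v x) x + ((T k v x - v x) - (u x - v x)))); last first.
  move=> x _; have := @moll_linear k u v 1 (-1) x Lu Lv.
  under [X in T k X]eq_fun do rewrite mul1r mulN1r.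
  by move=> ->; ring.
have Lvv := L2B mO (L2_moll k Lv) Lv.
apply: le_lt_trans (n2D mO (L2_moll k Luv) (L2B mO Lvv Luv)) _.
have := n2B mO Lvv Luv; have := n2_moll k Luv; lra.
Qed.

(** Put t = [T k \1_U], which lies in [0, 1], and h = 1_U (1 - t). Pointwise (t - 1_U)^2 <= (t -
    1_U) + 2 h. The integral of t - 1_U is nonpositive because columns have mass at most one. On
    [Omega], h tends boundedly to zero, because around a point of U the kernel ends up inside U and
    [Omega], where t = 1. *)
Lemma moll_cvg_open (U : set 'rV[R]_N) : open U -> moll_cvg (\1_U).
Proof.
move=> oU; have mU : measurable_fun Omega (\1_U : 'rV[R]_N -> R).
  by apply: measurable_indic; exact: measurable_rV_open.
have i01 x : 0 <= (\1_U x : R) <= 1 by rewrite indicE; case: (_ \in _); rewrite ?lexx ?ler01.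
have LU : L2 (\1_U).
  by apply: (L2_bounded oO bO (C := 1)) => // x _; have /andP[h1 h2] := i01 x; rewrite ger0_norm.
split=> // e e0.
pose h k x : R := \1_U x * (1 - T k \1_U x).
have iK k x : (mu.-integrable Omega (EFin \o (fun y => prodf (shiftf (moll a b k) x) y * \1_U y))).
  by apply: L2_mul_integrable => //; apply: L2_shift => // i; exact: moll_smooth.
have k0 k x y : 0 <= prodf (shiftf (moll a b k) x) y by rewrite -moll_abs.
have T0 k x : 0 <= T k \1_U x.
  by apply: Rintegral_ge0 => y _; rewrite mulr_ge0//; have /andP[] := i01 y.
have T1 k x : T k \1_U x <= 1.
  rewrite -lee_fin /convol /ip /Rintegral fineK; last exact: (integrable_fin_num mO (iK k x)).
  apply: le_trans (moll_row_mass k x); apply: ge0_le_integral => //.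
  - by move=> y _; rewrite lee_fin mulr_ge0//; have /andP[] := i01 y.
  - by case/integrableP : (iK k x).
  - apply/measurable_EFinP; apply: measurable_funS (measurable_normr_continuous _) => //.
    by apply/continuous_prodf/smooth1_shift => i; exact: moll_smooth.
  move=> y _; rewrite lee_fin moll_abs ler_piMr//; by have /andP[] := i01 y.
have LT k := L2_moll k LU.
have h01 k x : 0 <= h k x <= 1.
  have /andP[i0 i1] := i01 x; have := T0 k x; have := T1 k x; rewrite /h => t1 t0.
  by rewrite mulr_ge0 ?subr_ge0//= mulr_ile1 ?subr_ge0// gerBl.
have Lh k : L2 (h k).
  have := L2M mO (C := 1) mU _ (L2B mO (L2_cst oO bO 1) (LT k)); apply.
  by move=> x _; have /andP[j0 j1] := i01 x; rewrite ger0_norm.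
have hcv x : Omega x -> h k x @[k --> \oo] --> (0 : R).
  move=> Ox; rewrite /h indicE; case: (boolP (x \in U)) => [Ux|_]; last first.
    by under eq_fun do rewrite mul0r; exact: cvg_cst.
  have [e1 e10 he1] := (rV_openP _).1 (openI oU oO) x (conj (set_mem Ux) Ox).
  have [K hK] := scale_large (mrad a b / e1).
  apply: cvgn_eps => e3 e30; exists K => k Kk; have {}hK := hK k Kk.
  suff -> : T k \1_U x = 1 by rewrite subrr mulr0 subr0 normr0.
  apply/EFin_inj; rewrite -(moll_mass ab k x).1 /convol /ip /Rintegral.
  rewrite fineK; last exact: (integrable_fin_num mO (iK k x)).
  rewrite integral_mkcond; apply: eq_integral => y _; rewrite patchE.
  have [->|ny] := eqVneq (prodf (shiftf (moll a b k) x) y) 0.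
    by case: ifP => _ //; rewrite mul0r.
  have [Uy Oy] : (U `&` Omega) y.
    apply: he1; rewrite distrC; move: ny; rewrite prodf_shiftE => /(prodf_moll_small ab) h3.
    rewrite -(ltr_pM2l (scale_gt0 k)); apply: le_lt_trans h3 _.
    by rewrite -ltr_pdivrMr.
  by rewrite mem_set// indicE mem_set// mulr1.
have hdom k x : Omega x -> `|h k x| <= `|(cst 1 : 'rV[R]_N -> R) x|.
  by move=> _; have /andP[j0 j1] := h01 k x; rewrite /= normr1 ger0_norm.
(* Chosen so that twice the norm of [h k] times the norm of the constant 1 stays below e^2. *)
have e2 : 0 < e ^+ 2 / (2 * (n2 (cst 1) + 1)).
  by rewrite divr_gt0 ?exprn_gt0// mulr_gt0// ltr_wpDl// n2_ge0.
have [K hK] := L2_dominated mO (fun k => L2_measurable (Lh k)) (L2_cst oO bO 1) hdom hcv e2.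
exists K => k /hK hk.
rewrite -(@ltr_pXn2r _ 2)// ?nnegrE ?n2_ge0 ?(ltW e0)// n2_sqr.
have LD := L2B mO (LT k) LU; have L1 := L2_cst oO bO 1.
apply: (@le_lt_trans _ _ (2 * ip Omega (h k) (cst 1))); last first.
  have := le_trans (ler_norm _) (cauchy_schwarz mO (Lh k) L1) => cs.
  have n0 := n2_ge0 Omega (cst 1).
  move: hk; rewrite ltr_pdivlMr; last by rewrite mulr_gt0// ltr_wpDl.
  move: (n2 (cst 1)) (n2 (h k)) (n2_ge0 Omega (h k)) cs n0 => p q q0 cs n0 hk; nra.
have mass : ip Omega (T k \1_U) (cst 1) <= ip Omega \1_U (cst 1).
  rewrite -lee_fin /ip /Rintegral !fineK; last 2 first.
  - exact: integrable_fin_num (L2_mul_integrable mO LU L1).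
  - exact: integrable_fin_num (L2_mul_integrable mO (LT k) L1).
  have [E _] := tonelli_kernel oO (moll_smooth a b k) mU (fun y _ => (andP (i01 y)).1).
  rewrite (_ : (\int[mu]_(x in Omega) _ = \int[mu]_(x in Omega) \int[mu]_(y in Omega)
     (`|prodf (shiftf (moll a b k) x) y| * \1_U y)%:E)%E); last first.
    apply: eq_integral => x _; rewrite mulr1 /convol /ip /Rintegral.
    rewrite fineK; last exact: (integrable_fin_num mO (iK k x)).
    by apply: eq_integral => y _; rewrite moll_abs.
  rewrite E; have [_ [_ mC]] := tonelli_kernel oO (moll_smooth a b k) mU (fun y _ => (andP (i01 y)).1).
  apply: ge0_le_integral => //.
  - move=> y _; apply: mule_ge0; last by apply: integral_ge0 => x _.
    by have /andP[] := i01 y.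
  - by apply/measurable_EFinP; apply: measurable_funM.
  move=> y _; rewrite /= EFinM; apply: lee_wpmul2l; last exact: moll_col_mass.
  by have /andP[] := i01 y.
have -> : 2 * ip Omega (h k) (cst 1) = ip Omega (fun x => 2 * h k x) (cst 1).
  by rewrite ipZl.
have L2h := L2Z mO 2 (Lh k).
suff : ip Omega (fun x => T k \1_U x - \1_U x) (fun x => T k \1_U x - \1_U x) <=
   ip Omega (fun x => (T k \1_U x - \1_U x) + 2 * h k x) (cst 1).
  rewrite (ipDl mO LD L2h L1) (ipBl mO (LT k) LU L1); lra.
apply: le_Rintegral => //.
- exact: L2_mul_integrable.
- by apply: L2_mul_integrable => //; exact: L2D.
move=> x _; rewrite /= mulr1 /h; have := T0 k x; have := T1 k x.
by rewrite indicE; case: (x \in U) => /=; move: (T k _ x) => t; nra.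
Qed.

End approximate_identity.

Import HBNNSimple.

Section moll_convergence.
Context {R : realType} {N : nat} (Omega : set 'rV[R]_N).
Hypothesis oO : open Omega.
Hypothesis bO : bounded_set Omega.
Variables (a b : 'I_N -> R).
Hypothesis ab : forall i, a i < b i.
Implicit Types (u v g : 'rV[R]_N -> R).
Local Notation mu := (lebesgue_rV R N).
Local Notation L2 := (L2 Omega).
Local Notation n2 := (n2 Omega).
Local Notation moll_cvg := (moll_cvg Omega a b).

Let mO : measurable Omega. Proof. exact: measurable_rV_open. Qed.

Lemma moll_cvg0 : moll_cvg (fun=> 0).
Proof.
have h := moll_cvg_open oO bO ab (@openT 'rV[R]_N).
have := moll_cvg_lin oO bO ab 0 0 h h.
by under eq_fun do rewrite !mul0r addr0.
Qed.

Lemma moll_cvg_sum (I : Type) (r : seq I) (c : I -> R) (F : I -> 'rV[R]_N -> R) :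
  (forall i, moll_cvg (F i)) -> moll_cvg (fun x => \sum_(i <- r) c i * F i x).
Proof.
move=> hF; elim: r => [|i r IH]; first by under eq_fun do rewrite big_nil; exact: moll_cvg0.
under eq_fun do rewrite big_cons.
by have := moll_cvg_lin oO bO ab (c i) 1 (hF i) IH; under eq_fun do rewrite mul1r.
Qed.

(** The measurable sets with this property form a Dynkin class containing the open sets, which are
    stable under intersection. Disjoint unions pass to the limit by dominated convergence. *)
Lemma moll_cvg_indic A : measurable A -> moll_cvg (\1_A).
Proof.
pose H := [set A : set 'rV[R]_N | measurable A /\ moll_cvg (\1_A)].
suff : <<s (@open 'rV[R]_N) >> `<=` H.
  by move=> h /rV_measurable_sub_open/h[].
rewrite -(setI_closed_g_dynkin_g_sigma_algebra (@openI 'rV[R]_N)).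
apply: smallest_sub; last first.
  by move=> U oU; split; [exact: measurable_rV_open|exact: moll_cvg_open].
split.
- by split; [exact: measurableT|exact: (moll_cvg_open oO bO ab (@openT _))].
- move=> B [mB hB]; split; first exact: measurableC.
  have := moll_cvg_lin oO bO ab 1 (-1) (moll_cvg_open oO bO ab (@openT _)) hB.
  suff -> : (fun x => 1 * \1_[set: 'rV[R]_N] x + -1 * \1_B x) = (\1_(~` B) : 'rV[R]_N -> R) by [].
  by apply/funext => x; rewrite !indicE in_setC in_setT; case: (x \in B); rewrite /= ?mulr1 ?mulr0; ring.
move=> F tF hF; have mF i : measurable (F i) by have [] := hF i.
split; first exact: bigcupT_measurable.
have mU : measurable (\bigcup_k F k) by exact: bigcupT_measurable.
have Lind A' : measurable A' -> L2 (\1_A').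
  move=> mA; apply: (L2_bounded oO bO (C := 1)); first exact: measurable_indic.
  by move=> x _; rewrite indicE; case: (_ \in _); rewrite ?normr1 ?normr0.
apply: (moll_cvg_closed oO bO ab) => [|e e0]; first exact: Lind.
pose S k x : R := \sum_(0 <= i < k) 1 * \1_(F i) x.
have hS k : moll_cvg (S k) by apply: moll_cvg_sum => i; have [] := hF i.
have LS k : L2 (S k) by have [] := hS k.
have LU := Lind _ mU.
have Sval k x : (S k x = 0 \/ S k x = 1) /\ (S k x <= \1_(\bigcup_i F i) x).
  have [[i _ Fix]|nU] := pselect ((\bigcup_i F i) x); last first.
    have z i : \1_(F i) x = 0 :> R.
      by rewrite indicE memNset// => Fi; apply: nU; exists i.
    rewrite /S big1; last by move=> i _; rewrite z mulr0.
    by split; [left|rewrite indicE ler0n].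
  have z j : j != i -> \1_(F j) x = 0 :> R.
    move=> ji; rewrite indicE memNset// => Fj; move/eqP: ji; apply.
    by apply: tF => //; exists x.
  have o : \1_(\bigcup_i F i) x = 1 :> R by rewrite indicE mem_set//; exists i.
  have oi : \1_(F i) x = 1 :> R by rewrite indicE mem_set.
  rewrite o /S; have [ik|ki] := ltnP i k.
    rewrite (@bigD1_seq _ _ _ _ _ i) ?mem_index_iota ?iota_uniq//= oi mulr1 big1.
      by rewrite addr0; split; [right|].
    by move=> j ji; rewrite z// mulr0.
  rewrite big_nat_cond big1; first by split; [left|].
  by move=> j /andP[/andP[_ jk] _]; rewrite z ?mulr0// ltn_eqF//; exact: leq_trans ki.
have [|||K hK] := @L2_dominated _ _ _ mO (fun k x => \1_(\bigcup_i F i) x - S k x) _ _ LU _ _ e e0.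
- by move=> k; apply: L2_measurable; exact: L2B.
- move=> k x _; have [h1 h2] := Sval k x; rewrite ger0_norm ?subr_ge0// ger0_norm ?indicE ?ler0n//.
  by rewrite gerBl; case: h1 => ->; rewrite ?ler01.
- move=> x _; have [[i _ Fix]|nU] := pselect ((\bigcup_i F i) x); last first.
    rewrite (_ : (fun k => _) = cst 0); first exact: cvg_cst.
    apply/funext => k; have [h1 h2] := Sval k x; move: h2; rewrite indicE memNset// => h2.
    by case: h1 h2 => ->; rewrite ?subr0// ler10.
  apply: cvgn_eps => e1 e10; exists i.+1 => k ik.
  suff -> : S k x = 1 by rewrite indicE mem_set ?subrr ?normr0//; exists i.
  have [[h1|//] _] := Sval k x; exfalso.
  have : \1_(F i) x <= S k x.
    rewrite /S (@bigD1_seq _ _ _ _ _ i) ?mem_index_iota ?iota_uniq//= mul1r lerDl.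
    by apply: sumr_ge0 => j _; rewrite mul1r indicE ler0n.
  by rewrite h1 indicE mem_set// ler10.
by exists (S K) => //; exact: hK.
Qed.

(** Nonnegative functions are dominated limits of simple ones; in general u = (|u| + u) - |u|. *)
Lemma moll_cvg_L2 u : L2 u -> moll_cvg u.
Proof.
have nn w : L2 w -> (forall x, Omega x -> 0 <= w x) -> moll_cvg w.
  move=> Lw w0; have mw : measurable_fun Omega (EFin \o w).
    by apply/measurable_EFinP; exact: L2_measurable Lw.
  pose g n : 'rV[R]_N -> R := nnsfun_approx mO mw n.
  have hg n : moll_cvg (g n).
    rewrite /g; move: (nnsfun_approx mO mw n) => f.
    rewrite (_ : (f : _ -> R) = fun x => \sum_(y <- finmap.enum_fset (fset_set (range f))) y * \1_(f @^-1` [set y]) x).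
      by apply: moll_cvg_sum => y; apply: moll_cvg_indic; exact: measurable_sfunP.
    by apply/funext => x; rewrite fimfunE fsbig_finite.
  have wE x : Omega x -> (0 <= (EFin \o w) x)%E by move=> Ox; rewrite lee_fin w0.
  have gle n x : Omega x -> 0 <= g n x <= w x.
    move=> Ox; rewrite fun_ge0 /=; have := @le_approx _ _ _ Omega (EFin \o w) n x wE Ox.
    by rewrite /g nnsfun_approxE lee_fin.
  apply: (moll_cvg_closed oO bO ab) => // e e0.
  have Lg n : L2 (g n) by have [] := hg n.
  have [|||K hK] := @L2_dominated _ _ _ mO (fun k x => w x - g k x) _ _ Lw _ _ e e0.
  - by move=> k; apply: L2_measurable; exact: L2B.
  - by move=> k x Ox; have /andP[h1 h2] := gle k x Ox; rewrite ger0_norm ?subr_ge0// ger0_norm ?w0// gerBl.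
  - move=> x Ox; rewrite -[X in _ --> X](subrr (w x)); apply: cvgB; first exact: cvg_cst.
    have /fine_cvg := cvg_nnsfun_approx mO mw wE Ox; exact.
  by exists (g K) => //; exact: hK.
move=> Lu; have mu_ := L2_measurable Lu.
have Lp : L2 (fun x => `|u x|).
  by apply: (L2_le (C := 1) mO Lu) => [|x _]; [exact: measurableT_comp|rewrite mul1r normr_id].
have p1 : moll_cvg (fun x => `|u x| + u x).
  apply: nn => [|x _]; first exact: L2D.
  by have := ler_norm (- u x); rewrite normrN; lra.
have p2 : moll_cvg (fun x => `|u x|) by apply: nn.
have := moll_cvg_lin oO bO ab 1 (-1) p1 p2.
by under eq_fun do rewrite mul1r mulN1r addrAC subrr add0r.
Qed.

End moll_convergence.

(** * Weak derivatives and the fundamental lemma *)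

Section ae_tools.
Context {R : realType} {N : nat} (Omega : set 'rV[R]_N).
Local Notation mu := (lebesgue_rV R N).
Hypothesis mO : measurable Omega.

(** Completeness provides a subsequence converging almost everywhere to some L^2 limit, and that
    limit must agree with [w] almost everywhere. *)
Lemma L2_ae_subseq (f : nat -> 'rV[R]_N -> R) (w : 'rV[R]_N -> R) :
  (forall k, L2 Omega (f k)) -> L2 Omega w ->
  (forall e : R, 0 < e -> exists K, forall k, (K <= k)%N -> n2 Omega (fun x => f k x - w x) < e) ->
  exists phi : nat -> nat, (forall k, (phi k < phi k.+1)%N) /\
    {ae mu, forall x, Omega x -> f (phi k) x @[k --> \oo] --> w x}.
Proof.
move=> Lf Lw hf.
have [e e0|U LU [phi [phiS cU hU]]] := @L2_cauchy_complete _ _ _ mO f Lf _.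
  have [K hK] := hf _ (divr_gt0 e0 (ltr0n R 2)); exists K => m n Km Kn.
  apply: le_lt_trans (n2_sub_trans mO (Lf m) Lw (Lf n)) _.
  by rewrite (splitr e) ltrD ?hK// n2_subC hK.
exists phi; split=> //; suff Uw : aeq Omega U w.
  by move: cU Uw; apply: filterS2 => x h1 h2 Ox; rewrite -h2//; exact: h1.
have LUw := L2B mO LU Lw.
have : n2 Omega (fun x => U x - w x) = 0.
  apply/eqP; rewrite eq_le n2_ge0 andbT leNgt; apply/negP => e0.
  have e2 := divr_gt0 e0 (ltr0n R 2).
  have [K1 h1] := hf _ e2; have [K2 h2] := hU _ e2.
  have tri := n2_sub_trans mO LU (Lf (maxn K1 K2)) Lw.
  have d1 := h1 _ (leq_maxl K1 K2); have := h2 _ (leq_maxr K1 K2).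
  by rewrite n2_subC => d2; lra.
by move=> /(n2_eq0 mO LUw); apply: filterS => x h /h /eqP; rewrite subr_eq0 => /eqP.
Qed.

(** Every point of [A] lies in a rational cube on which [Q] holds almost everywhere. There are
    countably many such cubes, so the exceptional points lie in a countable union of null sets. *)
Lemma ae_local (A : set 'rV[R]_N) (Q : 'rV[R]_N -> Prop) :
  (forall x, A x -> exists2 e : R, 0 < e & {ae mu, forall y, `|y - x| < e -> Q y}) ->
  {ae mu, forall y, A y -> Q y}.
Proof.
move=> h.
pose S (q : 'rV[rat]_N * rat) :=
  [set y : 'rV[R]_N | forall i, `|y ord0 i - ratr (q.1 ord0 i)| < ratr q.2].
pose B q := [set y | S q y /\ ~ Q y /\ {ae mu, forall y, S q y -> Q y}].
have nB q : mu.-negligible (B q).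
  have [hq|nq] := pselect {ae mu, forall y, S q y -> Q y}.
    by apply: negligibleS hq => y [Sy [nQ _]] /(_ Sy).
  rewrite (_ : B q = set0); first exact: negligible_set0.
  by apply/seteqP; split=> // y [_ [_ /nq]].
pose C n := if unpickle n is Some q then B q else set0.
have nC n : mu.-negligible (C n).
  by rewrite /C; case: unpickle => // ; exact: negligible_set0.
apply: negligibleS (negligible_bigcup nC) => x /= nAQ.
have Ax : A x by apply: contrapT => nA; apply: nAQ.
have nQ : ~ Q x by move=> Qx; apply: nAQ.
have [e e0 he] := h x Ax.
have [r] := rat_in_itvoo (divr_gt0 e0 (ltr0n R 2)).
rewrite in_itv /= => /andP[r0 re].
have /choice[q hq] : forall i : 'I_N, exists q : rat, `|x ord0 i - ratr q| < ratr r.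
  move=> i; have : x ord0 i < x ord0 i + ratr r by rewrite ltrDl.
  move=> /rat_in_itvoo[q]; rewrite in_itv /= => /andP[h1 h2].
  by exists q; rewrite distrC gtr0_norm ?subr_gt0// ltrBlDl.
exists (pickle (\row_i q i, r)) => //; rewrite /C pickleK; split; last split=> //.
  by move=> i /=; rewrite mxE; exact: hq.
apply: filterS he => y Qy Sy; apply: Qy; apply/rV_norm_lt => // i.
rewrite !rVE; have := Sy i; rewrite /= mxE => hy.
rewrite (splitr e) -(subrKA (ratr (q i))); apply: le_lt_trans (ler_normD _ _) _.
rewrite ltrD//; first exact: lt_trans re.
by rewrite distrC; apply: lt_trans re; exact: hq.
Qed.

End ae_tools.

Section weak_derivatives.
Context {R : realType} {N : nat} (Omega : set 'rV[R]_N).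
Hypothesis oO : open Omega.
Hypothesis bO : bounded_set Omega.
Implicit Types (u v f g phi : 'rV[R]_N -> R) (i : 'I_N).
Local Notation mu := (lebesgue_rV R N).
Local Notation L2 := (L2 Omega).
Local Notation n2 := (n2 Omega).
Local Notation ip := (ip Omega).

Let mO : measurable Omega. Proof. exact: measurable_rV_open. Qed.

Lemma measurable_rV_compact (K : set 'rV[R]_N) : compact K -> measurable K.
Proof.
move=> cK; rewrite -(setCK K); apply: measurableC; apply: measurable_rV_open.
by apply: closed_openC; exact: rV_compact_closed.
Qed.

Lemma rV_ball_compact (x0 : 'rV[R]_N) (r : R) : compact [set y : 'rV[R]_N | `|y - x0| <= r].
Proof.
apply: bounded_closed_compact.
  exists (r + `|x0|); split=> [|M hM y /= hy]; first exact: num_real.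
  by rewrite -(subrK x0 y); apply: le_trans (ler_normD _ _) _; lra.
have cn : continuous (fun y : 'rV[R]_N => `|y - x0|).
  by move=> y; apply: continuous_comp; [apply: continuousB; [exact: cvg_id|exact: cst_continuous]|exact: norm_continuous].
rewrite (_ : mkset _ = (fun y : 'rV[R]_N => `|y - x0|) @^-1` `]-oo, r]).
  by apply: preimage_closed => //; exact: interval_closed.
by apply/seteqP; split=> y /=; rewrite in_itv.
Qed.

Lemma measurable_sgr : measurable_fun setT (@Num.sg R).
Proof.
rewrite (_ : @Num.sg R = fun t => \1_(`]0, +oo[ : set R) t - \1_(`]-oo, 0[ : set R) t).
  by apply: measurable_funB; apply: measurable_indic; exact: measurable_itv.
apply/funext => t; rewrite !indicE !mem_setE !in_itv /= andbT.
by case: sgrP => _; rewrite ?subr0 ?sub0r.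
Qed.

Lemma hasd_shift (F : 'I_N -> R -> R) x i : (forall j, smooth1 (F j)) ->
  hasd i (prodf (shiftf F x)) (fun y => - prodf (shiftf (updf F i (derive1 (F i))) x) y).
Proof.
move=> sF y; have h (t : R) : is_derive t 1 (shiftf F x i) (- derive1 (F i) (x ord0 i - t)).
  have := smooth1_comp_derive (-1) (x ord0 i) (sF i) t; rewrite mulN1r.
  rewrite (_ : (fun t => F i (-1 * t + x ord0 i)) = shiftf F x i).
    by rewrite (_ : -1 * t + x ord0 i = x ord0 i - t) //; ring.
  by apply/funext => s; rewrite /shiftf; congr (F i _); ring.
have := hasd_prodf h y; rewrite !prodf_updE.
rewrite (_ : - prodf _ y = - derive1 (F i) (x ord0 i - y ord0 i) *
   \prod_(j | j != i) shiftf F x j (y ord0 j)) //.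
rewrite prodf_shiftE prodf_updE !rVE mulNr; congr (- (_ * _)).
by apply: eq_bigr => j _; rewrite /shiftf !rVE.
Qed.

Lemma compact_margin (K : set 'rV[R]_N) : compact K -> K `<=` Omega ->
  exists2 d : R, 0 < d & forall x y, K x -> `|y - x| <= d -> Omega y.
Proof.
move=> cK KO; have := (compact_near_coveringP K).1 cK R (0 : R)^'+
  (fun d x => forall y, `|y - x| <= d -> Omega y) _.
case=> [x Kx|]; last first.
  move=> d /= d0 h; exists (d / 2) => [|x y Kx yx]; first exact: divr_gt0.
  have : ball_ Num.norm 0 d (d / 2) by rewrite /= sub0r normrN gtr0_norm ?divr_gt0//; lra.
  by move=> /h /(_ (divr_gt0 d0 (ltr0n R 2))) /(_ x Kx y yx).
have [e e0 he] := (rV_openP _).1 oO x (KO x Kx).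
exists ([set x' | `|x' - x| < e / 2], [set d : R | d < e / 2]) => /=.
  split; last exact: nbhs_right_lt (divr_gt0 e0 (ltr0n R 2)).
  apply/nbhs_ballP; exists (e / 2) => /=; first exact: divr_gt0.
  by move=> z; rewrite -ball_normE /= distrC.
move=> [x' d] [/= xx' de] y yx'; apply: he; rewrite -(subrKA x').
by apply: le_lt_trans (ler_normD _ _) _; rewrite (splitr e) ltrD// (le_lt_trans yx').
Qed.

Lemma testf_margin f (K : set 'rV[R]_N) (d : R) : 0 < d -> (forall k, Ck k f) ->
  (forall x y, K x -> `|y - x| <= d -> Omega y) ->
  (forall y, f y != 0 -> exists2 x, K x & `|y - x| <= d / 2) -> test_function Omega f.
Proof.
move=> d0 sf KO fK; have d2 := divr_gt0 d0 (ltr0n R 2).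
have cl : closure [set x | f x != 0] `<=` Omega.
  move=> y /(_ (ball y (d / 2))) [|z [/= fz]]; first exact: nbhsx_ballx.
  rewrite -ball_normE /= => yz; have [x Kx zx] := fK z fz; apply: (KO x) => //.
  rewrite -(subrKA z) (splitr d); apply: le_trans (ler_normD _ _) _.
  by rewrite lerD// ltW.
split=> //; apply: bounded_closed_compact; last exact: closed_closure.
have [M M0 hM] := bounded_rV_set bO.
by exists M; split=> [|x Mx y /cl/hM]; [exact: num_real|move=> /le_trans; apply; exact: ltW].
Qed.

Definition wd i u v := forall phi, test_function Omega phi ->
  ip u (pderiv i phi) = - ip v phi.

(** Here [f] need not vanish on the boundary, so the absence of a boundary term encodes two facts at
    once: [v] is the weak derivative of [u], and [u] has zero trace. *)
Definition wd0 i u v := forall f f', hasd i f f' -> continuous f -> continuous f' ->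
  ip u f' = - ip v f.

Lemma test_L2 phi : test_function Omega phi -> L2 phi.
Proof. by move=> [sp _ _]; apply: (L2_continuous oO bO); exact: (Ck_continuous (sp 0%N)). Qed.

Lemma test_continuous phi : test_function Omega phi -> continuous phi.
Proof. by move=> [sp _ _]; exact: (Ck_continuous (sp 0%N)). Qed.

Lemma test_hasd i phi : test_function Omega phi -> hasd i phi (pderiv i phi).
Proof. by move=> [sp _ _]; exact: Ck_hasd (sp 1%N). Qed.

Let am1 : 'I_N -> R := fun=> -1.
Let b1 : 'I_N -> R := fun=> 1.
Let ab i : am1 i < b1 i. Proof. by rewrite /am1 /b1; lra. Qed.
Local Notation T k := (convol Omega (moll am1 b1 k)).

Lemma convol_pderiv F x i f f' (K : set 'rV[R]_N) : smooth_kernel F ->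
  hasd i f f' -> continuous f -> continuous f' -> compact K -> K `<=` Omega ->
  (forall y, ~ K y -> f y = 0) ->
  convol Omega (updf F i (derive1 (F i))) f x = convol Omega F f' x.
Proof.
move=> kF df cf cf' cK KO f0; have [sF _] := kF; have [sF' _] := kernel_upd i kF.
have c1 := continuous_prodf (smooth1_shift x sF).
have c2 : continuous (fun y => - prodf (shiftf (updf F i (derive1 (F i))) x) y).
  by move=> y; apply: continuousN; exact: (continuous_prodf (smooth1_shift x sF')).
have Lf := L2_continuous oO bO cf; have Lk := L2_shift oO bO x sF'.
rewrite /convol [RHS]ipC.
rewrite (integration_by_parts oO bO df (hasd_shift x i sF) cf c1 cf' c2 cK KO f0).
by rewrite ipNr// opprK ipC.
Qed.

Lemma ip_moll_cvg u f : L2 u -> L2 f -> forall e : R, 0 < e ->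
  exists K, forall k, (K <= k)%N -> `|ip u (T k f) - ip u f| < e.
Proof.
move=> Lu Lf e e0; have [_ h] := moll_cvg_L2 oO bO ab Lf.
have D0 : 0 < n2 u + 1 by rewrite ltr_wpDl// n2_ge0.
have [K hK] := h _ (divr_gt0 e0 D0); exists K => k /hK.
rewrite ltr_pdivlMr// => hk; have LT := L2_moll oO bO ab k Lf.
rewrite -ipBr//; apply: le_lt_trans (cauchy_schwarz mO Lu (L2B mO LT Lf)) _.
by apply: le_lt_trans hk; rewrite mulrC ler_wpM2l ?n2_ge0// lerDl.
Qed.

Lemma moll_support f (K : set 'rV[R]_N) (d : R) : 0 < d ->
  (forall y, ~ K y -> f y = 0) ->
  exists k0, forall k, (k0 <= k)%N -> forall x, T k f x != 0 -> exists2 y, K y & `|x - y| <= d.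
Proof.
move=> d0 f0; have [k0 hk0] := scale_large (mrad am1 b1 / d).
exists k0 => k /hk0 hk x; apply: contra_neqP => nK.
rewrite /convol /Submission.ip /Rintegral integral0_eq// => y _.
have [->|ny] := eqVneq (prodf (shiftf (moll am1 b1 k) x) y) 0; first by rewrite mul0r.
rewrite f0 ?mulr0// => Ky; apply: nK; exists y => //.
move: ny; rewrite prodf_shiftE => /(prodf_moll_small ab) h.
rewrite -(ler_pM2l (scale_gt0 k)); apply: le_trans h _.
by rewrite -ler_pdivrMr// ltW.
Qed.

(** Mollifications of [f] are eventually test functions supported in [Omega], and their derivatives
    are the mollifications of [f']; the weak identity passes to the limit. *)
Lemma wd_C1 i u v f f' (K : set 'rV[R]_N) : L2 u -> L2 v -> wd i u v ->
  hasd i f f' -> continuous f -> continuous f' -> compact K -> K `<=` Omega ->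
  (forall y, ~ K y -> f y = 0) -> ip u f' = - ip v f.
Proof.
move=> Lu Lv uv df cf cf' cK KO f0.
have Lf := L2_continuous oO bO cf; have Lf' := L2_continuous oO bO cf'.
have [d d0 hd] := compact_margin cK KO.
have [k0 hk0] := moll_support (divr_gt0 d0 (ltr0n R 2)) f0.
apply/eqP; rewrite -subr_eq0 opprK -normr_eq0 eq_le normr_ge0 andbT leNgt; apply/negP => e0.
set e := `|_| in e0; have e2 := divr_gt0 e0 (ltr0n R 2).
have [K1 h1] := ip_moll_cvg Lu Lf' e2; have [K2 h2] := ip_moll_cvg Lv Lf e2.
pose k := maxn k0 (maxn K1 K2).
have {}h1 := h1 k (leq_trans (leq_maxl _ _) (leq_maxr _ _)).
have {}h2 := h2 k (leq_trans (leq_maxr _ _) (leq_maxr _ _)).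
have tT : test_function Omega (T k f).
  apply: (testf_margin d0 _ hd) => [l|y]; last exact: (hk0 _ (leq_maxl _ _)).
  exact: (Ck_conv oO bO (moll_kernel ab k) Lf).
have := uv _ tT.
rewrite (pderiv_conv oO bO i (moll_kernel ab k) Lf).
rewrite (_ : convol _ _ _ = T k f'); last first.
  by apply/funext => x; exact: (convol_pderiv x (moll_kernel ab k) df cf cf' cK KO f0).
move=> E; move: h1 h2; rewrite E ltr_distlC ltr_distlC => /andP[p1 p2] /andP[q1 q2].
suff : e < e by rewrite ltxx.
by rewrite {1}/e ltr_norml; apply/andP; split; lra.
Qed.

(** Around a point, [v] is tested with mollifications of [w], the sign of [v] cut to a ball B. They
    are bounded by one and converge to [w] almost everywhere along a subsequence, so dominated
    convergence gives int_B |v| = 0; [ae_local] concludes. *)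
Lemma flcv v : locally_integrable_on Omega v ->
  (forall phi, test_function Omega phi -> \int[mu]_(x in Omega) (v x * phi x) = 0) ->
  {ae mu, forall x, Omega x -> v x = 0}.
Proof.
move=> [mv iv] v0; apply: ae_local => x0 Ox0.
have [e e0 he] := (rV_openP _).1 oO x0 Ox0.
pose d := e / 4; have d0 : 0 < d by rewrite divr_gt0.
pose B := [set y : 'rV[R]_N | `|y - x0| <= d].
pose K := [set y : 'rV[R]_N | `|y - x0| <= 3 * d].
have bcl := @rV_ball_compact x0.
have KO : K `<=` Omega by move=> y Ky; apply: he; apply: le_lt_trans Ky _; rewrite /d; lra.
have BK : B `<=` K by move=> y /= /le_trans; apply; lra.
have mB : measurable B := measurable_rV_compact (bcl d).
have mK : measurable K := measurable_rV_compact (bcl (3 * d)).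
have ivK := iv K (bcl _) KO.
pose w y : R := \1_B y * Num.sg (v y).
have w1 y : `|w y| <= 1.
  rewrite normrM normr_sg indicE.
  by case: (y \in B); case: (v y != 0); rewrite /= ?normr1 ?normr0; lra.
have mw : measurable_fun Omega w.
  apply: measurable_funM; first exact: measurable_indic.
  by apply: measurableT_comp => //; exact: measurable_sgr.
have Lw : L2 w := L2_bounded oO bO mw (fun y _ => w1 y).
have w0 y : ~ B y -> w y = 0 by move=> nB; rewrite /w indicE memNset// mul0r.
have [k0 hk0] := moll_support d0 w0.
have [_ hcv] := moll_cvg_L2 oO bO ab Lw.
(* The shift by [k0] keeps the supports of all these mollifications inside [K]. *)
have [|phi [phiS cphi]] := @L2_ae_subseq _ _ Omega mO (fun k => T (k + k0)%N w) w (fun k => L2_moll oO bO ab _ Lw) Lw.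
  move=> e1 /hcv[K1 hK1]; exists K1 => k Kk; apply: hK1.
  exact: leq_trans (leq_addr _ _).
have T1 k x : `|T k w x| <= 1.
  have kk := moll_kernel ab k; have [sF _] := kk.
  rewrite -lee_fin; apply: le_trans (moll_row_mass oO ab k x).
  have iK := L2_mul_integrable mO (L2_shift oO bO x sF) Lw.
  apply: le_trans (_ : (\int[mu]_(y in Omega) `|prodf (shiftf (moll am1 b1 k) x) y * w y|%:E <= _)%E).
    rewrite EFin_normr_Rintegral//; apply: le_trans (le_abse_integral _ _ _) _ => //.
    by case/integrableP : iK.
  apply: ge0_le_integral => //.
  - by apply/measurable_EFinP; apply: measurableT_comp => //; case/integrableP : iK => /measurable_EFinP.
  - apply/measurable_EFinP; apply: measurable_funS (measurable_normr_continuous _) => //.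
    by apply/continuous_prodf/smooth1_shift.
  by move=> y _; rewrite lee_fin normrM ler_piMr.
have tT k : (k0 <= k)%N -> test_function Omega (T k w).
  move=> /hk0 hk; apply: (@testf_margin _ B (2 * d)); first by rewrite mulr_gt0.
  - by move=> l; apply: (Ck_conv oO bO); first exact: moll_kernel.
  - move=> x y Bx yx; apply: KO; rewrite /K /= -(subrKA x); apply: le_trans (ler_normD _ _) _.
    by move: Bx; rewrite /B /=; lra.
  - by move=> y /hk[x Bx yx]; exists x => //; rewrite (_ : 2 * d / 2 = d)//; field.
have Tout k x : (k0 <= k)%N -> ~ K x -> T k w x = 0.
  move=> /hk0 hk nK; apply: contrapT => /eqP /hk[y By xy]; apply: nK.
  rewrite /K /= -(subrKA y); apply: le_trans (ler_normD _ _) _.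
  by move: By; rewrite /B /=; lra.
have vphi k : \int[mu]_(x in K) (v x * T (phi k + k0)%N w x) = 0.
  rewrite -(v0 (T (phi k + k0)%N w)); last by apply: tT; exact: leq_addl.
  rewrite Rintegral_mkcond [RHS]Rintegral_mkcond; apply: eq_Rintegral => x _.
  rewrite !patchE; case: (boolP (x \in K)) => xK; first by rewrite mem_set//; apply: KO; exact: set_mem.
  by case: ifP => // _; rewrite Tout ?mulr0 ?leq_addl//; move/negP: xK => h /mem_set.
have mvK : measurable_fun K v by apply: measurable_funS mv.
have cT k : continuous (T k w) by exact: continuous_moll.
have mf k : measurable_fun K (fun x => (v x * T (phi k + k0)%N w x)%:E).
  apply/(measurable_EFinP _ (fun x => v x * T (phi k + k0)%N w x)); apply: measurable_funM => //.
  by apply: measurable_funS (measurable_rV_continuous (cT _)).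
have mvw : measurable_fun K (fun x => (v x * w x)%:E).
  apply/(measurable_EFinP _ (fun x => v x * w x)); apply: measurable_funM => //.
  exact: measurable_funS mw.
have ae1 : {ae mu, forall x, K x -> (v x * T (phi k + k0)%N w x)%:E @[k --> \oo] --> (v x * w x)%:E}.
  move: cphi; apply: filterS => x h Kx; apply: cvgn_EFin; apply: cvgM; first exact: cvg_cst.
  by apply: h; exact: KO.
have ae2 : {ae mu, forall x k, K x -> (`|(v x * T (phi k + k0)%N w x)%:E| <= `|(EFin \o v) x|)%E}.
  by apply: aeW => x k Kx /=; rewrite lee_fin normrM ler_piMr.
have [ivw _ lim] := @dominated_convergence _ _ _ mu K mK _ _ _ mf mvw ae1 (integrable_abse ivK) ae2.
have z : (\int[mu]_(x in K) (v x * w x)%:E = 0)%E.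
  have fz k : (\int[mu]_(x in K) (v x * T (phi k + k0)%N w x)%:E = 0)%E.
    rewrite -[LHS]fineK; first by have := vphi k; rewrite /Rintegral => ->.
    apply: integrable_fin_num => //; apply: le_integrable ivK => //.
    by move=> x Kx /=; rewrite lee_fin normrM ler_piMr.
  move: lim; under eq_fun do rewrite fz.
  by move=> /cvg_lim <- //; rewrite lim_cst.
have z' : (\int[mu]_(x in K) `|(v x * w x)%:E| = 0)%E.
  rewrite -z; apply: eq_integral => x _; rewrite gee0_abs// lee_fin /w mulrCA mulr_ge0//.
  by rewrite mulrC -normrEsg.
have := (ae_eq_integral_abs mu mK mvw).1 z'; move=> hae.
exists d => //; move: hae; apply: filterS => x h xd.
have Bx : B x by rewrite /B /= ltW.
have /= [hx] := h (BK x Bx); apply/eqP; move/eqP: hx.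
by rewrite /w indicE mem_set// mul1r mulf_eq0 sgr_eq0 orbb.
Qed.

End weak_derivatives.

(** * Mean value estimates and symmetry of second derivatives *)

Section mean_value.
Context {R : realType}.

Lemma mvt_global (f df : R -> R) : (forall t : R, is_derive t 1 f (df t)) ->
  forall a b, a <= b -> exists2 c, a <= c <= b & f b - f a = df c * (b - a).
Proof.
move=> hf a b ab; have cf : {within `[a, b], continuous f}.
  by apply: derivable_within_continuous => x _; have [] := hf x.
have [c cab E] := @MVT_segment _ f df a b ab (fun x _ => hf x) cf.
by exists c => //; move: cab; rewrite in_itv.
Qed.

Lemma mvt_abs (f df : R -> R) : (forall t : R, is_derive t 1 f (df t)) ->
  forall d, exists2 c, `|c| <= `|d| /\ 0 <= c * d & `|f d - f 0| = `|df c| * `|d|.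
Proof.
move=> hf d; have [d0|d0] := leP 0 d.
  have [c /andP[c0 cd] E] := mvt_global hf d0; exists c; last by rewrite E normrM subr0.
  by rewrite !ger0_norm// mulr_ge0.
have [c /andP[c0 cd] E] := mvt_global hf (ltW d0); exists c; last by rewrite distrC E normrM sub0r normrN.
by rewrite !ler0_norm ?lerN2 ?(ltW d0)//; split=> //; rewrite mulr_le0 ?(ltW d0).
Qed.

End mean_value.

Section symmetric_derivatives.
Context {R : realType} {N : nat}.
Implicit Types (f : 'rV[R]_N -> R) (i j : 'I_N).
Local Notation e i := (delta_mx ord0 i : 'rV[R]_N).

(** The mean value theorem applied twice. The left side is symmetric in [a] and [b], so with
    continuity of the second derivatives this yields [pderivC]. *)
Lemma second_difference a b f fa fab : hasd a f fa -> hasd b fa fab ->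
  forall x (h : R), 0 <= h -> exists s t : R, [/\ 0 <= s <= h, 0 <= t <= h &
    f (x + h *: e a + h *: e b) - f (x + h *: e a) - f (x + h *: e b) + f x =
    h ^+ 2 * fab (x + s *: e a + t *: e b)].
Proof.
move=> ha hb x h h0.
have d1 (t : R) : is_derive t 1 (fun s : R => f (x + h *: e b + s *: e a) - f (x + s *: e a))
    (fa (x + h *: e b + t *: e a) - fa (x + t *: e a)).
  apply: is_deriveB; first exact: (is_derive_line (x + h *: e b) ha).
  exact: (is_derive_line x ha).
have [s /andP[s0 sh] E1] := mvt_global d1 h0.
have [t /andP[t0 th] E2] := mvt_global (is_derive_line (x + s *: e a) hb) h0.
exists s, t; split; [by rewrite s0|by rewrite t0|].
move: E1 E2; rewrite !scale0r !addr0 !subr0 (addrAC x (h *: e b)) (addrAC x (h *: e b) (s *: e a)).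
by move=> E1 E2; rewrite E2 in E1; rewrite -[X in _ - X + _]subr0 expr2; lra.
Qed.

Lemma pderivC i j f : Ck 2 f -> pderiv i (pderiv j f) = pderiv j (pderiv i f).
Proof.
move=> cf; apply/funext => x; apply/eqP; rewrite -subr_eq0 -normr_eq0 eq_le normr_ge0 andbT.
have c1 a := Ck_pderiv a cf.
have cont a b : continuous (pderiv b (pderiv a f)) := Ck_continuous (Ck_pderiv b (c1 a)).
have h1 := second_difference (Ck_hasd i cf) (Ck_hasd j (c1 i)) x.
have h2 := second_difference (Ck_hasd j cf) (Ck_hasd i (c1 j)) x.
rewrite leNgt; apply/negP; set m := `|_| => m0.
have m2 : 0 < m / 2 by rewrite divr_gt0.
have [d1 d10 k1] := (rV_continuousP _).1 (cont i j) x _ m2.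
have [d2 d20 k2] := (rV_continuousP _).1 (cont j i) x _ m2.
pose d := Num.min d1 d2; have d0 : 0 < d by rewrite lt_min d10.
have dd1 : d <= d1 by rewrite ge_min lexx.
have dd2 : d <= d2 by rewrite ge_min lexx orbT.
pose h : R := d / 4; have hp : 0 < h by rewrite divr_gt0.
have close a b (s t : R) : 0 <= s <= h -> 0 <= t <= h -> `|x + s *: e a + t *: e b - x| < d.
  move=> /andP[s0 sh] /andP[t0 th]; apply/rV_norm_lt => // k; rewrite !rVE.
  have -> : x ord0 k + s * (k == a)%:R + t * (k == b)%:R - x ord0 k = s * (k == a)%:R + t * (k == b)%:R by ring.
  have ul (c : bool) : (0 <= (c%:R : R) <= 1)%R by case: c; rewrite /= ?lexx ?ler01.
  have /andP[p1 p2] := ul (k == a); have /andP[q1 q2] := ul (k == b).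
  rewrite ger0_norm ?addr_ge0 ?mulr_ge0//.
  apply: (@le_lt_trans _ _ (s + t)); first by rewrite lerD// ler_piMr.
  by move: sh th hp; rewrite /h; lra.
have [s [t [s1 t1 E1]]] := h1 h (ltW hp); have [s' [t' [s2 t2 E2]]] := h2 h (ltW hp).
have q1 := k1 _ (lt_le_trans (close i j s t s1 t1) dd1).
have q2 := k2 _ (lt_le_trans (close j i s' t' s2 t2) dd2).
have E : pderiv j (pderiv i f) (x + s *: e i + t *: e j) =
    pderiv i (pderiv j f) (x + s' *: e j + t' *: e i).
  have hn : h ^+ 2 != 0 by apply: lt0r_neq0; exact: exprn_gt0.
  apply: (mulfI hn); apply: (etrans (esym E1)); apply: (etrans _ E2).
  by rewrite (addrAC x (h *: e j) (h *: e i)); congr (_ + _); exact: addrAC.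
have key (u v X Y : R) : u = v -> `|u - Y| < m / 2 -> `|v - X| < m / 2 -> `|X - Y| < m.
  move=> -> p1 p2; rewrite -(subrKA v); apply: le_lt_trans (ler_normD _ _) _.
  by rewrite distrC (splitr m) ltrD.
by have := key _ _ _ _ E q1 q2; rewrite -/m ltxx.
Qed.

(** Go from [x] to [y] one coordinate at a time. The intermediate points [p k] stay in the ball
    because for the max norm it is a cube. *)
Lemma box_lipschitz f (f' : 'I_N -> 'rV[R]_N -> R) (x0 : 'rV[R]_N) (r : R) (L : 'I_N -> R) : 0 <= r ->
  (forall i, hasd i f (f' i)) ->
  (forall i y, `|y - x0| <= r -> `|f' i y| <= L i) ->
  forall x y, `|x - x0| <= r -> `|y - x0| <= r ->
  `|f y - f x| <= \sum_i L i * `|y ord0 i - x ord0 i|.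
Proof.
move=> r0 df hL x y xr yr.
pose p k : 'rV[R]_N := \row_j (if (j < k)%N then y ord0 j else x ord0 j).
have pN : p N = y by apply/rowP => j; rewrite mxE ltn_ord.
have p0 : p 0%N = x by apply/rowP => j; rewrite mxE.
have -> : f y - f x = \sum_(i < N) (f (p i.+1) - f (p i)).
  by rewrite -(big_mkord xpredT (fun k : nat => f (p k.+1) - f (p k))) telescope_sumr// pN p0.
apply: le_trans (ler_norm_sum _ _ _) _; apply: ler_sum => i _.
set d := y ord0 i - x ord0 i.
have pS : p i.+1 = p i + d *: e i.
  apply/rowP => j; rewrite !rVE !mxE ltnS.
  have [->|ne] := eqVneq j i; first by rewrite leqnn ltnn mulr1 /d addrC subrK.
  by rewrite mulr0 addr0 leq_eqVlt (inj_eq val_inj) (negPf ne).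
have [c [cd cp]] := mvt_abs (is_derive_line (p i) (df i)) d.
rewrite scale0r addr0 -pS => ->; rewrite ler_wpM2r//; apply: hL.
apply/rV_norm_le => // j; rewrite !rVE !mxE.
have xj := (rV_norm_le _ r0).1 xr j; have yj := (rV_norm_le _ r0).1 yr j.
rewrite !rVE in xj yj.
have [->|ne] := eqVneq j i; last by rewrite mulr0 addr0; case: ifP.
rewrite ltnn mulr1.
have xi := (rV_norm_le _ r0).1 xr i; have yi := (rV_norm_le _ r0).1 yr i.
move: xi yi; rewrite !rVE !ler_norml => /andP[u1 u2] /andP[v1 v2].
move: cd cp; rewrite /d; have [d0|d0] := leP 0 (y ord0 i - x ord0 i).
  move=> cd cp; have : 0 <= c \/ y ord0 i - x ord0 i = 0.
    have [/eqP->|dn] := boolP (y ord0 i - x ord0 i == 0); first by right.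
    by left; rewrite -(pmulr_lge0 _ (_ : 0 < y ord0 i - x ord0 i))// lt_def dn.
  move=> [c0|E]; first by rewrite !ger0_norm// in cd; apply/andP; split; lra.
  by move: cd; rewrite E normr0 normr_le0 => /eqP->; apply/andP; split; lra.
move=> cd cp; have c0 : c <= 0 by rewrite -(nmulr_lge0 _ d0).
by rewrite !ler0_norm ?(ltW d0)// in cd; apply/andP; split; lra.
Qed.

End symmetric_derivatives.

Section col_composition.
Context {R : realType} {n : nat}.
Implicit Types (g : 'rV[R]_n -> R) (i : 'I_n.+1).

Lemma col'_delta i j (x : 'rV[R]_n.+1) (h : R) :
  col' i (x + h *: delta_mx ord0 (lift i j)) = col' i x + h *: delta_mx ord0 j.
Proof. by apply/rowP => k; rewrite !mxE (inj_eq lift_inj). Qed.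

Lemma col'_delta_out i (x : 'rV[R]_n.+1) (h : R) :
  col' i (x + h *: delta_mx ord0 i) = col' i x.
Proof.
apply/rowP => k; rewrite !mxE [lift i k == i]eq_sym (negPf (neq_lift i k)).
by rewrite andbF mulr0 addr0.
Qed.

Lemma hasd_col' i j g g' : hasd j g g' -> hasd (lift i j) (g \o col' i) (g' \o col' i).
Proof.
move=> hg x; apply/is_derive_lineP; rewrite /comp.
under eq_fun do rewrite col'_delta.
by apply/is_derive_lineP; exact: hg.
Qed.

Lemma hasd_col'_out i g : hasd i (g \o col' i) (cst 0).
Proof.
move=> x; apply/is_derive_lineP; rewrite /comp.
under eq_fun do rewrite col'_delta_out.
exact: is_derive_cst.
Qed.

Lemma continuous_col' i g : continuous g -> continuous (g \o col' i).
Proof.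
move=> cg; apply/rV_continuousP => x e e0.
have [d d0 hd] := (rV_continuousP _).1 cg (col' i x) e e0; exists d => // y yx.
apply: hd; apply/rV_norm_lt => // k; rewrite !mxE.
by have := (rV_norm_lt _ d0).1 yx (lift i k); rewrite !rVE.
Qed.

Lemma Ck_col' k i g : Ck k g -> Ck k (g \o col' i).
Proof.
elim: k g => [|k IH] g; first by rewrite !Ck0P; exact: continuous_col'.
move=> cg; pose f' j := if unlift i j is Some l then pderiv l g \o col' i else cst 0.
apply: (@CkS _ _ k (g \o col' i) f'); first exact: continuous_col' (Ck_continuous cg).
  move=> j; rewrite /f'; case: unliftP => [l|] ->; last exact: hasd_col'_out.
  by apply: hasd_col'; exact: Ck_hasd cg.
by move=> j; rewrite /f'; case: unliftP => [l|] _; [apply: IH; exact: Ck_pderiv|exact: Ck_cst].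
Qed.

End col_composition.

(** * Sobolev spaces, zero trace and the Poincare inequality *)

Section sobolev_spaces.
Context {R : realType} {N : nat} (Omega : set 'rV[R]_N).
Hypothesis oO : open Omega.
Hypothesis bO : bounded_set Omega.
Implicit Types (u v w f g phi psi : 'rV[R]_N -> R) (i j : 'I_N) (s : seq 'I_N) (m : nat).
Local Notation mu := (lebesgue_rV R N).
Local Notation L2 := (L2 Omega).
Local Notation n2 := (n2 Omega).
Local Notation ip := (ip Omega).
Local Notation aeq := (aeq Omega).
Local Notation D := (weak_deriv Omega).
Local Notation test := (test_function Omega).
Local Notation loc := (locally_integrable_on Omega).
Local Notation W2 := (W2 Omega).
Local Notation W2_norm := (W2_norm Omega).

Let mO : measurable Omega. Proof. exact: measurable_rV_open. Qed.

Lemma L2_loc u : L2 u -> loc u.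
Proof.
move=> Lu; split=> [|K cK KO]; first exact: L2_measurable.
apply: (integrableS mO (measurable_rV_compact cK) KO).
exact: L2_integrable.
Qed.

Lemma loc_integrableM u phi : loc u -> test phi ->
  mu.-integrable Omega (EFin \o (fun x => u x * phi x)).
Proof.
move=> [mu_ iu] tp; have [K [cK KO pK]] := test_supp tp.
have cp := test_continuous tp; have [C C0 hC] := compact_support_bounded cp cK pK.
have mK := measurable_rV_compact cK.
have iK : mu.-integrable K (EFin \o (fun x => u x * phi x)).
  apply: (le_integrable mK _ _ (integrableZl mK C (iu K cK KO))).
    apply/(measurable_EFinP _ (fun x => u x * phi x)); apply: measurable_funM.
      exact: measurable_funS mu_.
    by apply: measurable_funS (measurable_rV_continuous cp).
  move=> x Kx /=; rewrite lee_fin !normrM mulrC ler_wpM2r//.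
  by rewrite (gtr0_norm C0).
apply/(integrable_mkcond _ mO); move/(integrable_mkcond _ mK): iK.
apply: eq_integrable => // x _; rewrite !patchE.
case: ifPn => [/set_mem Kx|nK]; first by rewrite mem_set//; exact: KO.
case: ifPn => // _; rewrite /= pK ?mulr0// => Kx.
by move/negP: nK; apply; exact: mem_set.
Qed.

Lemma locB u v : loc u -> loc v -> loc (fun x => u x - v x).
Proof.
move=> [mu_ iu] [mv iv]; split=> [|K cK KO]; first exact: measurable_funB.
have mK := measurable_rV_compact cK.
have := integrableB mK (iu K cK KO) (iv K cK KO).
by apply: eq_integrable => // x _ /=.
Qed.

Lemma weak_deriv_unique s u v v' : is_weak_deriv Omega s u v -> is_weak_deriv Omega s u v' ->
  aeq v v'.
Proof.
move=> [_ lv hv] [_ lv' hv'].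
have := @flcv _ _ _ oO bO _ (locB lv lv') _; move=> h.
have {}h : {ae mu, forall x, Omega x -> v x - v' x = 0}.
  apply: h => phi tp.
  transitivity (\int[mu]_(x in Omega) (v x * phi x - v' x * phi x)).
    by apply: eq_Rintegral => x _; rewrite mulrBl.
  rewrite RintegralB//; [|exact: loc_integrableM..].
  have : (-1 : R) ^+ size s * \int[mu]_(x in Omega) (v x * phi x) =
         (-1) ^+ size s * \int[mu]_(x in Omega) (v' x * phi x) by rewrite -hv// -hv'.
  by move/(mulrI (unitrX _ (unitrN1 R))) => ->; rewrite subrr.
by apply: filterS h => x h /h /eqP; rewrite subr_eq0 => /eqP.
Qed.

Definition wds s u v := forall phi, test phi ->
  ip u (pderivs s phi) = (-1) ^+ size s * ip v phi.

Lemma wds_weak s u v : L2 u -> L2 v -> wds s u v -> is_weak_deriv Omega s u v.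
Proof. by move=> Lu Lv h; split; [exact: L2_loc|exact: L2_loc|]. Qed.

(** [weak_deriv] selects an unspecified weak derivative; by uniqueness it can be traded almost
    everywhere for any explicit one. *)
Lemma weak_derivP s u v : is_weak_deriv Omega s u v -> L2 v ->
  [/\ is_weak_deriv Omega s u (D s u), L2 (D s u) & aeq (D s u) v].
Proof.
move=> h Lv; have hD : is_weak_deriv Omega s u (D s u) by exact: (xgetI (cst 0) h).
have E := weak_deriv_unique h hD; split=> //; last exact: aeq_sym.
by apply: aeq_L2 E Lv => //; case: hD => _ [].
Qed.

Lemma wds_aeq s u v : L2 u -> L2 v -> wds s u v -> aeq (D s u) v.
Proof. by move=> Lu Lv h; have [] := weak_derivP (wds_weak Lu Lv h) Lv. Qed.

Lemma W2_L2 m u : W2 m u -> L2 u.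
Proof.
move=> /(_ [::] isT)[v hv Lv]; have [lu lv E] := hv.
have h : is_weak_deriv Omega [::] u u by split=> // phi tp; rewrite expr0 mul1r.
by apply: aeq_L2 (weak_deriv_unique hv h) Lv => //; case: lu.
Qed.

Lemma W2_wds m s u : W2 m u -> (size s <= m)%N -> L2 (D s u) /\ wds s u (D s u).
Proof. by move=> W sm; have [v hv Lv] := W s sm; have [[_ _ h] L _] := weak_derivP hv Lv. Qed.

Lemma W2I m u : L2 u -> (forall s, (size s <= m)%N -> exists2 v, L2 v & wds s u v) -> W2 m u.
Proof. by move=> Lu h s /h[v Lv hv]; exists v => //; exact: wds_weak. Qed.

Lemma wds_lin s u v u' v' (c d : R) : L2 u -> L2 v -> L2 u' -> L2 v' ->
  wds s u u' -> wds s v v' ->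
  wds s (fun x => c * u x + d * v x) (fun x => c * u' x + d * v' x).
Proof.
move=> Lu Lv Lu' Lv' hu hv phi tp.
have L1 := test_L2 oO bO tp; have L2' := test_L2 oO bO (test_pderivs s tp).
rewrite !(ipDl mO) ?(ipZl mO)//; try exact: (L2Z mO).
by rewrite hu// hv//; ring.
Qed.

Lemma W2_lin m u v (c d : R) : W2 m u -> W2 m v -> W2 m (fun x => c * u x + d * v x).
Proof.
move=> Wu Wv; have Lu := W2_L2 Wu; have Lv := W2_L2 Wv.
apply: W2I => [|s sm]; first by apply: (L2D mO); exact: (L2Z mO).
have [L1 h1] := W2_wds Wu sm; have [K2 h2] := W2_wds Wv sm.
exists (fun x => c * D s u x + d * D s v x); last exact: wds_lin.
by apply: (L2D mO); exact: (L2Z mO).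
Qed.

Lemma weak_deriv_lin m s u v (c d : R) : W2 m u -> W2 m v -> (size s <= m)%N ->
  aeq (D s (fun x => c * u x + d * v x)) (fun x => c * D s u x + d * D s v x).
Proof.
move=> Wu Wv sm; have Lu := W2_L2 Wu; have Lv := W2_L2 Wv.
have [L1 h1] := W2_wds Wu sm; have [K2 h2] := W2_wds Wv sm.
by apply: wds_aeq; [apply: (L2D mO); exact: (L2Z mO)..|exact: wds_lin].
Qed.

Lemma test_ibp i phi psi : test phi -> test psi ->
  ip phi (pderiv i psi) = - ip (pderiv i phi) psi.
Proof.
move=> tp tq; have [K [cK KO pK]] := test_supp tp.
have -> : ip (pderiv i phi) psi = - ip phi (pderiv i psi).
  apply: (integration_by_parts oO bO (test_hasd i tp) (test_hasd i tq) _ _ _ _ cK KO pK);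
    apply: test_continuous; eauto using test_pderiv.
by rewrite opprK.
Qed.

Lemma pderivs_cat s s' phi : pderivs (s ++ s') phi = pderivs s (pderivs s' phi).
Proof. by rewrite /pderivs foldr_cat. Qed.

(** Each integration by parts moves the outermost derivative first, so the word of derivatives comes
    back reversed. *)
Lemma test_wds s phi : test phi -> wds s phi (pderivs (rev s) phi).
Proof.
move=> tp psi tq; elim: s phi tp => [|i s IH] phi tp; first by rewrite mul1r.
rewrite [pderivs (i :: s) psi]/= (test_ibp i tp (test_pderivs s tq)).
rewrite (IH _ (test_pderiv i tp)) rev_cons -cats1 pderivs_cat /=.
by rewrite exprS mulN1r mulNr.
Qed.

Lemma test_W2 m phi : test phi -> W2 m phi.
Proof.
move=> tp; apply: W2I => [|s sm]; first exact: test_L2.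
by exists (pderivs (rev s) phi); [apply/test_L2 => //; exact: test_pderivs|exact: test_wds].
Qed.

Lemma weak_deriv_test s phi : test phi -> aeq (D s phi) (pderivs (rev s) phi).
Proof.
move=> tp; apply: wds_aeq; [exact: test_L2| |exact: test_wds].
by apply/test_L2 => //; exact: test_pderivs.
Qed.

Lemma W2_normE m u :
  W2_norm m u = Num.sqrt (\sum_(k < m.+1) \sum_(s : k.-tuple 'I_N) n2 (D s u) ^+ 2).
Proof.
congr Num.sqrt; apply: eq_bigr => k _; apply: eq_bigr => s _.
by rewrite n2_sqr; apply: eq_Rintegral => x _; rewrite expr2.
Qed.

Lemma W2_norm_ge m s u : (size s <= m)%N -> n2 (D s u) <= W2_norm m u.
Proof.
move=> sm; rewrite W2_normE -[leLHS]ger0_norm ?n2_ge0// -sqrtr_sqr ler_wsqrtr//.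
have sm' : (size s < m.+1)%N by [].
rewrite (bigD1 (Ordinal sm'))//= (bigD1 (in_tuple s))//= -addrA lerDl addr_ge0//.
  by apply: sumr_ge0 => t _; exact: sqr_ge0.
by apply: sumr_ge0 => k _; apply: sumr_ge0 => t _; exact: sqr_ge0.
Qed.

Lemma W2_norm_small m (e : R) : 0 < e -> exists2 d : R, 0 < d &
  forall u, (forall s, (size s <= m)%N -> n2 (D s u) < d) -> W2_norm m u < e.
Proof.
move=> e0; pose c : R := \sum_(k < m.+1) \sum_(s : k.-tuple 'I_N) 1.
have c0 : 0 <= c by apply: sumr_ge0 => k _; apply: sumr_ge0.
exists (e / (c + 1)) => [|u h]; first by rewrite divr_gt0// ltr_wpDl.
have d0 : 0 < e / (c + 1) by rewrite divr_gt0// ltr_wpDl.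
rewrite W2_normE -(gtr0_norm e0) -sqrtr_sqr ltr_sqrt ?exprn_gt0//.
apply: (@le_lt_trans _ _ (c * (e / (c + 1)) ^+ 2)).
  rewrite /c mulr_suml; apply: ler_sum => k _; rewrite mulr_suml; apply: ler_sum => s _.
  rewrite mul1r ler_pXn2r ?nnegrE ?n2_ge0 ?(ltW d0)// ltW// h// size_tuple.
  by have := ltn_ord k.
rewrite expr_div_n mulrA ltr_pdivrMr ?exprn_gt0 ?ltr_wpDl//.
rewrite mulrC ltr_pM2l ?exprn_gt0//.
by have := mulr_ge0 c0 c0; lra.
Qed.

(** The closure of the test functions expressed through smallness of each derivative separately
    instead of the full norm; [W2_0P] identifies it with [W2_0]. *)
Definition test_closure m u := forall d : R, 0 < d ->
  exists2 phi, test phi & forall s, (size s <= m)%N -> n2 (fun x => D s u x - D s phi x) < d.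

Lemma n2_weak_derivB m s u v : W2 m u -> W2 m v -> (size s <= m)%N ->
  n2 (D s (u - v)) = n2 (fun x => D s u x - D s v x).
Proof.
move=> Wu Wv sm; have [L1 _] := W2_wds Wu sm; have [K2 _] := W2_wds Wv sm.
have := weak_deriv_lin 1 (-1) Wu Wv sm; have := W2_lin 1 (-1) Wu Wv.
rewrite (_ : (fun x => 1 * u x + -1 * v x) = u - v); last first.
  by apply/funext => x; rewrite mul1r mulN1r.
move=> Wuv E; have [L3 _] := W2_wds Wuv sm.
apply: (aeq_n2 mO L3 (L2B mO L1 K2)); by apply: filterS E => x h Ox; rewrite h// mul1r mulN1r.
Qed.

Lemma W2_0P m u : W2_0 Omega m u <-> W2 m u /\ test_closure m u.
Proof.
split=> [[Wu h]|[Wu h]]; split=> // e e0.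
  have [phi tp hp] := h e e0; exists phi => // s sm.
  rewrite -(n2_weak_derivB Wu (test_W2 (m := m) tp) sm).
  by apply: le_lt_trans hp; exact: W2_norm_ge.
have [d d0 hd] := W2_norm_small m e0; have [phi tp hp] := h d d0.
exists phi => //; apply: hd => s sm.
by rewrite (n2_weak_derivB Wu (test_W2 (m := m) tp) sm); exact: hp.
Qed.

Lemma W2_0_lin m u v (c d : R) : W2_0 Omega m u -> W2_0 Omega m v ->
  W2_0 Omega m (fun x => c * u x + d * v x).
Proof.
move=> /W2_0P[Wu hu] /W2_0P[Wv hv]; apply/W2_0P; split=> [|e e0]; first exact: W2_lin.
have M0 : 0 < `|c| + `|d| + 1 by rewrite ltr_wpDl ?addr_ge0.
have [phi tp hp] := hu _ (divr_gt0 e0 M0); have [psi tq hq] := hv _ (divr_gt0 e0 M0).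
exists (fun x => c * phi x + d * psi x).
  by apply: testD; exact: testZ.
move=> s sm; have Wp := test_W2 (m := m) tp; have Wq := test_W2 (m := m) tq.
have [L1 _] := W2_wds Wu sm; have [K2 _] := W2_wds Wv sm.
have [L3 _] := W2_wds Wp sm; have [L4 _] := W2_wds Wq sm.
have [L5 _] := W2_wds (W2_lin c d Wu Wv) sm; have [L6 _] := W2_wds (W2_lin c d Wp Wq) sm.
have E : aeq (fun x => D s (fun x => c * u x + d * v x) x - D s (fun x => c * phi x + d * psi x) x)
   (fun x => c * (D s u x - D s phi x) + d * (D s v x - D s psi x)).
  move: (weak_deriv_lin c d Wu Wv sm) (weak_deriv_lin c d Wp Wq sm).
  by apply: filterS2 => x h1 h2 Ox; rewrite h1// h2//; ring.
have L13 := L2B mO L1 L3; have L24 := L2B mO K2 L4.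
have LL := L2D mO (L2Z mO c L13) (L2Z mO d L24).
rewrite (aeq_n2 mO (L2B mO L5 L6) LL E).
apply: le_lt_trans (n2D mO (L2Z mO c L13) (L2Z mO d L24)) _; rewrite !(n2Z mO)//.
have {}hp := hp s sm; have {}hq := hq s sm.
apply: (@le_lt_trans _ _ ((`|c| + `|d|) * (e / (`|c| + `|d| + 1)))).
  rewrite mulrDl; apply: lerD (ler_wpM2l (normr_ge0 c) (ltW hp)) (ler_wpM2l (normr_ge0 d) (ltW hq)).
by rewrite mulrCA gtr_pMr// ltr_pdivrMr// mul1r ltrDl.
Qed.

Lemma W2_0_closed m u : W2 m u -> (forall d : R, 0 < d -> exists2 v, W2_0 Omega m v &
  forall s, (size s <= m)%N -> n2 (fun x => D s u x - D s v x) < d) -> W2_0 Omega m u.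
Proof.
move=> Wu h; apply/W2_0P; split=> // d d0; have d2 := divr_gt0 d0 (ltr0n R 2).
have [v /W2_0P[Wv hv] uv] := h _ d2; have [phi tp hp] := hv _ d2; exists phi => // s sm.
have [L1 _] := W2_wds Wu sm; have [K2 _] := W2_wds Wv sm.
have [L3 _] := W2_wds (test_W2 (m := m) tp) sm.
apply: le_lt_trans (n2_sub_trans mO L1 K2 L3) _.
by rewrite (splitr d); apply: ltrD (uv s sm) (hp s sm).
Qed.

Lemma W2_0W m u : W2_0 Omega m.+1 u -> W2_0 Omega m u.
Proof.
move=> /W2_0P[Wu hu]; apply/W2_0P; split=> [s sm|d /hu[phi tp hp]].
  by apply: Wu; exact: leqW.
by exists phi => // s sm; apply: hp; exact: leqW.
Qed.

Lemma test_W2_0 m phi : test phi -> W2_0 Omega m phi.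
Proof.
move=> tp; apply/W2_0P; split=> [|d d0]; first exact: test_W2.
exists phi => // s sm; rewrite (@eq_n2 _ _ _ _ (fun=> 0)) ?n2_0// => x _.
exact: subrr.
Qed.

Lemma wds_wd i u v : wds [:: i] u v <-> wd Omega i u v.
Proof.
by split=> h phi tp; have := h phi tp; rewrite /= expr1 mulN1r.
Qed.

(** The space W^{1,2}_0 with the derivatives given as data, so that the condition does not depend on
    the choice made by [weak_deriv]. *)
Definition h10 u (d1 : 'I_N -> 'rV[R]_N -> R) := forall e : R, 0 < e ->
  exists2 phi, test phi & n2 (fun x => u x - phi x) < e /\
    forall i, n2 (fun x => d1 i x - pderiv i phi x) < e.

Lemma W2_0_h10 u : W2_0 Omega 1 u -> h10 u (fun i => D [:: i] u).
Proof.
move=> /W2_0P[Wu hu] e e0; have [phi tp hp] := hu e e0; exists phi => //.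
have Lu := W2_L2 Wu; have Lp := test_L2 oO bO tp; have Wp := test_W2 (m := 1) tp; split=> [|i].
  have [L1 h1] := W2_wds Wu (isT : (size ([::] : seq 'I_N) <= 1)%N).
  have [K2 h2] := W2_wds Wp (isT : (size ([::] : seq 'I_N) <= 1)%N).
  have := hp [::] isT; rewrite (aeq_n2 mO (L2B mO L1 K2) (L2B mO Lu Lp))//.
  have E w : L2 w -> aeq (D [::] w) w.
    by move=> Lw; apply: wds_aeq => // psi tq; rewrite expr0 mul1r.
  by move: (E u Lu) (E phi Lp); apply: filterS2 => x q1 q2 Ox; rewrite q1 ?q2.
have [L1 h1] := W2_wds Wu (isT : (size [:: i] <= 1)%N).
have [K2 h2] := W2_wds Wp (isT : (size [:: i] <= 1)%N).
have L3 := test_L2 oO bO (test_pderiv i tp).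
have := hp [:: i] isT; rewrite (aeq_n2 mO (L2B mO L1 K2) (L2B mO L1 L3))//.
by move: (weak_deriv_test [:: i] tp); apply: filterS => x q Ox; rewrite q.
Qed.

(** A W^{2,2} function together with its derivatives: products and limits can then come with their
    own explicit formulas. *)
Definition sobolev2 u d1 (d2 : 'I_N -> 'I_N -> 'rV[R]_N -> R) :=
  [/\ L2 u, forall i, L2 (d1 i), forall i j, L2 (d2 i j), forall i, wd Omega i u (d1 i) &
      forall i j, wd Omega j (d1 i) (d2 i j)].

Lemma W2_sobolev2 u : W2 2 u -> sobolev2 u (fun i => D [:: i] u) (fun i j => D [:: i; j] u).
Proof.
move=> Wu; have h1 i := W2_wds Wu (isT : (size [:: i] <= 2)%N).
have h2 i j := W2_wds Wu (isT : (size [:: i; j] <= 2)%N).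
split=> [|i|i j|i|i j phi tp]; first exact: W2_L2 Wu.
- exact: (h1 i).1.
- exact: (h2 i j).1.
- by apply/wds_wd; exact: (h1 i).2.
have := (h2 i j).2 _ tp; have := (h1 i).2 _ (test_pderiv j tp).
by rewrite /= expr1 mulN1r sqrrN expr1n mul1r => -> <-; rewrite opprK.
Qed.

Lemma sobolev2_W2 u d1 d2 : sobolev2 u d1 d2 ->
  [/\ W2 2 u, forall i, aeq (D [:: i] u) (d1 i) & forall i j, aeq (D [:: i; j] u) (d2 i j)].
Proof.
move=> [Lu L1 L2_ h1 h2].
have w1 i : wds [:: i] u (d1 i) by apply/wds_wd.
have w2 i j : wds [:: i; j] u (d2 i j).
  move=> phi tp; rewrite /= (h1 i _ (test_pderiv j tp)) (h2 i j _ tp).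
  by rewrite opprK sqrrN expr1n mul1r.
split=> [|i|i j]; [|exact: wds_aeq|exact: wds_aeq].
apply: W2I => // -[_|i [_|j [_|//]]]; first by exists u => // phi tp; rewrite expr0 mul1r.
  by exists (d1 i).
by exists (d2 i j).
Qed.

Lemma small_eq0 (x : R) : (forall e : R, 0 < e -> `|x| <= e) -> x = 0.
Proof.
move=> h; apply/eqP; rewrite -normr_eq0 eq_le normr_ge0 andbT leNgt; apply/negP => x0.
by have := h _ (divr_gt0 x0 (ltr0n R 2)); lra.
Qed.

(** The approximating test functions satisfy the identity exactly, and both sides are continuous for
    L^2 convergence of the function and its derivatives. *)
Lemma h10_wd0 u d1 i : L2 u -> (forall i, L2 (d1 i)) -> h10 u d1 -> wd0 Omega i u (d1 i).
Proof.
move=> Lu Ld h f f' df cf cf'; apply/eqP; rewrite -subr_eq0 opprK; apply/eqP.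
have Lf := L2_continuous oO bO cf; have Lf' := L2_continuous oO bO cf'.
apply: small_eq0 => e e0; pose M := n2 f + n2 f' + 1.
have M0 : 0 < M by rewrite ltr_wpDl ?addr_ge0 ?n2_ge0.
have [phi tp [h0 h1]] := h _ (divr_gt0 e0 M0); have {}h1 := h1 i.
have Lp := test_L2 oO bO tp; have Lq := test_L2 oO bO (test_pderiv i tp).
have [K [cK KO pK]] := test_supp tp.
have E : ip (pderiv i phi) f = - ip phi f'.
  apply: (integration_by_parts oO bO (test_hasd i tp) df _ cf _ cf' cK KO pK);
    apply: test_continuous; eauto using test_pderiv.
have -> : ip u f' + ip (d1 i) f =
    ip (fun x => u x - phi x) f' + ip (fun x => d1 i x - pderiv i phi x) f.
  by rewrite !(ipBl mO)// E; ring.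
apply: le_trans (ler_normD _ _) _.
have q1 := cauchy_schwarz mO (L2B mO Lu Lp) Lf'.
have q2 := cauchy_schwarz mO (L2B mO (Ld i) Lq) Lf.
apply: le_trans (lerD q1 q2) _.
apply: (@le_trans _ _ (e / M * n2 f' + e / M * n2 f)).
  by apply: lerD; [apply: ler_wpM2r; [exact: n2_ge0|exact: (ltW h0)]|apply: ler_wpM2r; [exact: n2_ge0|exact: (ltW h1)]].
rewrite -mulrDr mulrAC ler_pdivrMr// ler_wpM2l ?(ltW e0)// /M.
by rewrite (addrC (n2 f')) lerDl.
Qed.

(** Green's identity int |grad u|^2 = - int u Delta u, obtained from the approximating test
    functions. *)
Lemma h10_ip_laplacian u d1 d2 : sobolev2 u d1 d2 -> h10 u d1 ->
  \sum_i ip (d1 i) (d1 i) = - ip u (fun x => \sum_i d2 i i x).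
Proof.
move=> [Lu L1 L2_ h1 h2] h.
have ip_sum w (F : 'I_N -> 'rV[R]_N -> R) : L2 w -> (forall i, L2 (F i)) ->
    ip w (fun x => \sum_i F i x) = \sum_i ip w (F i).
  move=> Lw LF; elim: (index_enum _) => [|i r IH].
    by rewrite big_nil /Submission.ip; under eq_Rintegral do rewrite big_nil mulr0; rewrite /Rintegral integral0.
  rewrite big_cons -IH -(ipDr mO)//; last exact: (L2_sum mO).
  by congr ip; apply/funext => x; rewrite big_cons.
rewrite ip_sum// -sumrN; apply: eq_bigr => i _.
apply/eqP; rewrite -subr_eq0 opprK; apply/eqP; apply: small_eq0 => e e0.
pose M := n2 (d1 i) + n2 (d2 i i) + 1.
have M0 : 0 < M by rewrite ltr_wpDl ?addr_ge0 ?n2_ge0.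
have [phi tp [q0 q1]] := h _ (divr_gt0 e0 M0); have {}q1 := q1 i.
have Lp := test_L2 oO bO tp; have Lq := test_L2 oO bO (test_pderiv i tp).
have E := h2 i i phi tp.
have -> : ip (d1 i) (d1 i) + ip u (d2 i i) =
    ip (d1 i) (fun x => d1 i x - pderiv i phi x) + ip (d2 i i) (fun x => u x - phi x).
  by rewrite !(ipBr mO)// E (ipC _ (d2 i i) u); ring.
apply: le_trans (ler_normD _ _) _.
have r1 := cauchy_schwarz mO (L1 i) (L2B mO (L1 i) Lq).
have r2 := cauchy_schwarz mO (L2_ i i) (L2B mO Lu Lp).
apply: le_trans (lerD r1 r2) _.
apply: (@le_trans _ _ (n2 (d1 i) * (e / M) + n2 (d2 i i) * (e / M))).
  by apply: lerD; [apply: ler_wpM2l; [exact: n2_ge0|exact: (ltW q1)]|apply: ler_wpM2l; [exact: n2_ge0|exact: (ltW q0)]].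
rewrite -mulrDl mulrCA ger_pMr// ler_pdivrMr// mul1r /M.
by rewrite lerDl.
Qed.

(** Integrating phi^2 against the derivative of x_i gives ||phi||^2 = - 2 int x_i phi d_i phi, and
    |x_i| <= M on [Omega]. *)
Lemma test_poincare (i : 'I_N) : exists2 C : R, 0 < C & forall phi, test phi ->
  n2 phi <= C * n2 (pderiv i phi).
Proof.
have [M M0 hM] := bounded_rV_set bO; exists (2 * M) => [|phi tp]; first exact: mulr_gt0.
have [K [cK KO pK]] := test_supp tp.
have Lp := test_L2 oO bO tp; have Lq := test_L2 oO bO (test_pderiv i tp).
have cp := test_continuous tp; have cq := test_continuous (test_pderiv i tp).
have cx : continuous (fun x : 'rV[R]_N => x ord0 i) := Ck_continuous (@Ck_coord _ _ 0 i).
have hp := test_hasd i tp.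
have := integration_by_parts oO bO (hasdM hp hp) (hasd_coord i i) (rV_continuousM cp cp) cx _
   _ cK KO _.
rewrite eqxx => E.
have {}E : ip phi phi = - (2 * ip (fun x => x ord0 i * phi x) (pderiv i phi)).
  rewrite -[LHS]opprK; congr (- _); rewrite -ipZl//; last exact: (L2_continuousM oO bO).
  have -> : ip phi phi = ip (phi \* phi) (cst 1).
    by apply: eq_Rintegral => x _; rewrite /= mulr1.
  rewrite -E; last 3 first.
  - by apply: rV_continuousD; exact: rV_continuousM.
  - exact: cst_continuous.
  - by move=> x nK /=; rewrite pK// mul0r.
  by apply: eq_Rintegral => x _ /=; ring.
have LX := L2_continuousM oO bO cx Lp.
have b : n2 phi ^+ 2 <= 2 * M * n2 (pderiv i phi) * n2 phi.
  rewrite n2_sqr E; apply: le_trans (ler_norm _) _; rewrite normrN normrM ger0_norm//.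
  apply: (@le_trans _ _ (2 * (n2 (fun x => x ord0 i * phi x) * n2 (pderiv i phi)))).
    by rewrite ler_wpM2l//; exact: (cauchy_schwarz mO).
  have : n2 (fun x => x ord0 i * phi x) <= M * n2 phi.
    apply: (n2M mO) => //; first exact: ltW.
      exact: measurable_continuous_on.
    by move=> x Ox; apply: le_trans (rV_coord_le _ _) (hM _ Ox).
  by move=> /(ler_wpM2r (n2_ge0 Omega (pderiv i phi))); lra.
have := n2_ge0 Omega phi; rewrite le_eqVlt => /orP[/eqP<-|n0].
  by rewrite !mulr_ge0 ?n2_ge0 ?(ltW M0).
by rewrite -(ler_pM2r n0) -expr2.
Qed.

Lemma h10_poincare (i : 'I_N) : exists2 C : R, 0 < C & forall u d1, L2 u ->
  (forall i, L2 (d1 i)) -> h10 u d1 -> n2 u <= C * n2 (d1 i).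
Proof.
have [C C0 hC] := test_poincare i; exists C => // u d1 Lu L1 h.
apply/ler_addgt0Pr => e e0.
have M0 : 0 < 1 + C by lra.
have [phi tp [q0 q1]] := h _ (divr_gt0 e0 M0); have {}q1 := q1 i.
have Lp := test_L2 oO bO tp; have Lq := test_L2 oO bO (test_pderiv i tp).
have a1 : n2 u <= n2 (fun x => u x - phi x) + n2 phi.
  rewrite -[leLHS](@eq_n2 _ _ _ (fun x => (u x - phi x) + phi x)); last by move=> x _; rewrite subrK.
  exact: (n2D mO (L2B mO Lu Lp) Lp).
have a2 : n2 (pderiv i phi) <= n2 (fun x => d1 i x - pderiv i phi x) + n2 (d1 i).
  rewrite n2_subC -[leLHS](@eq_n2 _ _ _ (fun x => (pderiv i phi x - d1 i x) + d1 i x)); last by move=> x _; rewrite subrK.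
  exact: (n2D mO (L2B mO Lq (L1 i)) (L1 i)).
have a3 := hC _ tp; have a4 := ler_wpM2l (ltW C0) a2.
have a5 : C * n2 (fun x => d1 i x - pderiv i phi x) <= C * (e / (1 + C)).
  by rewrite ler_wpM2l ?(ltW C0)// ltW.
have a6 : e / (1 + C) + C * (e / (1 + C)) = e by field; lra.
by lra.
Qed.

End sobolev_spaces.

(** * Cutoffs, boundary charts and finite coverings *)

Section cutoffs.
Context {R : realType} {N : nat}.
Implicit Types (x y z : 'rV[R]_N).

Lemma cutoff x0 (r : R) : 0 < r -> exists chi : 'rV[R]_N -> R,
  [/\ forall k, Ck k chi, forall y, `|y - x0| <= r / 2 -> chi y = 1 &
      forall y, chi y != 0 -> `|y - x0| <= r].
Proof.
(* Both arguments of [step] are at least 1 when |t - c| <= r/2, and one of them is at most 0 when |t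
   - c| >= r. *)
move=> r0; pose h (c t : R) : R :=
  step (2 / r * t + (2 - 2 / r * c)) * step (- (2 / r) * t + (2 + 2 / r * c)).
have sh c : smooth1 (h c) by apply: smooth1M; apply: smooth1_affine; exact: smooth1_step.
have c0 : 0 < 2 / r by rewrite divr_gt0.
have cr : 2 / r * r = 2 by field; lra.
exists (prodf (fun j => h (x0 ord0 j))); split=> [k|y yx|y].
- exact: Ck_prodf.
- rewrite /prodf big1// => j _; have := le_trans (rV_coord_le _ j) yx; rewrite !rVE ler_norml => /andP[l1 l2].
  have q1 := ler_wpM2l (ltW c0) l1; have q2 := ler_wpM2l (ltW c0) l2.
  have q3 : 2 / r * (r / 2) = 1 by field; lra.
  by rewrite /h !step_eq1 ?mulr1//; lra.
apply: contra_neqP => /negP; rewrite -ltNge => yr.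
have [j hj] : exists j, r < `|(y - x0) ord0 j|.
  apply: contrapT => nj; move: yr; rewrite ltNge => /negP; apply.
  by apply/rV_norm_le; [exact: ltW|move=> j; rewrite leNgt; apply/negP => ?; apply: nj; exists j].
rewrite /prodf (bigD1 j)//= [h _ _](_ : _ = 0) ?mul0r// /h.
move: hj; rewrite !rVE lter_normr => /orP[] hj; have q := ltW hj; have q1 := ler_wpM2l (ltW c0) q.
  by rewrite [X in _ * X]step_eq0 ?mulr0//; lra.
by rewrite step_eq0 ?mul0r//; lra.
Qed.

End cutoffs.

Section charts.
Context {R : realType}.

Section def.
Context {N : nat} (Omega : set 'rV[R]_N).

(** [theta] is a defining function of [Omega] whose derivative in the direction [i] is the constant
    s = 1 or -1. Interior points fit the definition as well, with [theta] positive near them, so a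
    single local theory serves the whole closure. *)
Definition chart (x0 : 'rV[R]_N) (r : R) (i : 'I_N) (s : R) (theta : 'rV[R]_N -> R) :=
  [/\ 0 < r, Ck 4 theta, forall x, pderiv i theta x = s, s ^+ 2 = 1 &
      forall x, `|x - x0| <= r -> (Omega x <-> 0 < theta x)].

(** Along [i] the derivative of [theta] is exactly [s], and the other derivatives are bounded by
    constants L_j. With A = sum L_j + 1, a step satisfying A t <= s z_i outweighs the variation in
    the other coordinates by at least t. *)
Lemma chart_cone x0 r i s theta : chart x0 r i s theta ->
  exists2 A : R, 1 <= A & forall (x z : 'rV[R]_N) (t : R), 0 <= t -> `|x - x0| <= r / 2 -> `|z| <= r / 2 ->
    (forall j, j != i -> `|z ord0 j| <= t) -> A * t <= s * z ord0 i ->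
    theta x + t <= theta (x + z).
Proof.
move=> [r0 ct ts s2 _].
have cb := @rV_ball_compact _ _ x0 r.
have /choice[L hL] : forall j, exists l : R,
    0 <= l /\ forall x : 'rV[R]_N, `|x - x0| <= r -> `|pderiv j theta x| <= l.
  move=> j; have [C C0 hC] := continuous_bounded_on (Ck_continuous (Ck_pderiv j ct)) cb.
  by exists C; split; [exact: ltW|exact: hC].
pose A : R := \sum_j L j + 1.
have S0 : 0 <= \sum_j L j by apply: sumr_ge0 => j _; case: (hL j).
exists A => [|x z t t0 xr zr zt Az]; first by rewrite /A lerDr.
(* Subtracting s x_i kills the derivative in the direction [i], so only the coordinates j != i enter
   the Lipschitz bound. *)
pose f x := theta x + (- s) * x ord0 i.
pose f' j x := pderiv j theta x + (- s) * (j == i)%:R.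
have df j : hasd j f (f' j) by apply: hasdD; [exact: Ck_hasd ct|apply: hasdZ; exact: hasd_coord].
pose L' j := if j == i then 0 else L j.
have bf j y : `|y - x0| <= r -> `|f' j y| <= L' j.
  rewrite /f' /L' => yr; have [->|ne] := eqVneq j i; first by rewrite ts mulr1 subrr normr0.
  by rewrite mulr0 addr0; exact: (hL j).2.
have xr' : `|x - x0| <= r by apply: le_trans xr _; lra.
have xzr : `|x + z - x0| <= r.
  rewrite addrAC; apply: le_trans (ler_normD _ _) _; lra.
have := box_lipschitz (ltW r0) df bf xr' xzr.
have : \sum_j L' j * `|(x + z) ord0 j - x ord0 j| <= (\sum_j L j) * t.
  rewrite mulr_suml; apply: ler_sum => j _; rewrite !rVE /L'.
  have [L0 _] := hL j; have [->|ne] := eqVneq j i; first by rewrite mul0r mulr_ge0//; have [] := hL i.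
  by rewrite addrAC subrr add0r ler_wpM2l// zt.
move=> b1 b2; have := le_trans b2 b1; rewrite /f !rVE ler_norml => /andP[b3 _].
by move: Az; rewrite /A; lra.
Qed.

End def.

Lemma enorm_le n (x : 'rV[R]_n) : enorm x <= n.+1%:R * `|x|.
Proof.
rewrite /enorm -[leRHS]ger0_norm ?mulr_ge0// -sqrtr_sqr ler_wsqrtr//.
apply: (@le_trans _ _ (\sum_(i < n) `|x| ^+ 2)).
  apply: ler_sum => i _; rewrite -real_normK ?num_real//.
  by rewrite ler_pXn2r ?nnegrE// rV_coord_le.
rewrite sumr_const card_ord exprMn -[leLHS]mulr_natl ler_wpM2r ?sqr_ge0//.
by rewrite -natrX ler_nat expnS expn1 (leq_trans (leqnSn n))// leq_pmulr.
Qed.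

Lemma chart_exists n (Omega : set 'rV[R]_n.+1) (eta : R) : open Omega -> bounded_set Omega ->
  Ck_holder_boundary 4 eta Omega ->
  forall x0, closure Omega x0 -> exists r i s theta, chart Omega x0 r i s theta.
Proof.
move=> oO bO hreg x0 cx; have [Ox|nOx] := pselect (Omega x0).
  have [e e0 he] := (rV_openP _).1 oO x0 Ox; have [M M0 hM] := bounded_rV_set bO.
  have e2 := divr_gt0 e0 (ltr0n R 2).
  (* Interior point: [M] bounds all coordinates on [Omega], so this [theta] is positive on the whole
     ball, which lies in [Omega]. *)
  exists (e / 2), ord0, 1, (fun x => x ord0 ord0 + (M + 1)); split=> //.
  - by apply: CkD; [exact: Ck_coord|exact: Ck_cst].
  - move=> x; have := hasdD (hasd_coord (R := R) (@ord0 n) ord0) (@hasd_cst R _ ord0 (M + 1)).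
    by move=> /hasd_pderiv ->; rewrite /= addr0.
  - exact: expr1n.
  move=> x xr; have Oxx : Omega x by apply: he; lra.
  split=> // _; have := le_trans (rV_coord_le x ord0) (hM _ Oxx); rewrite ler_norml => /andP[]; lra.
have bx : boundary Omega x0 by split=> // /interior_subset.
have [r [i [b [g [r0 [cg _] hg]]]]] := hreg x0 bx.
(* The radius is divided by a dimensional factor because boundary regularity is expressed with the
   Euclidean norm and charts with the max norm. *)
pose c : R := (-1) ^+ b; pose rr : R := r / (2 * n.+2%:R).
have rr0 : 0 < rr by rewrite divr_gt0// mulr_gt0.
exists rr, i, c, (fun x : 'rV[R]_n.+1 => c * x ord0 i + (-1) * g (col' i x)); split=> //.
- apply: CkD.
    by apply: (@CkM _ _ _ (cst c)); [exact: Ck_cst|exact: Ck_coord].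
  by apply: (@CkM _ _ _ (cst (-1))); [exact: Ck_cst|exact: Ck_col'].
- move=> x; have := hasdD (hasdZ c (hasd_coord (R := R) i i)) (hasdZ (-1) (hasd_col'_out i g)).
  by move=> /hasd_pderiv ->; rewrite /= eqxx mulr1 mulr0 addr0.
- by rewrite /c -exprM mulnC exprM sqrrN expr1n expr1n.
move=> x xr; have xe : enorm (x - x0) < r.
  apply: le_lt_trans (enorm_le _) _.
  apply: (@le_lt_trans _ _ (n.+2%:R * rr)); first by rewrite ler_wpM2l.
  have gen (q : R) : q != 0 -> q * (r / (2 * q)) = r / 2 by move=> q0; field.
  by rewrite gen ?pnatr_eq0//; lra.
by rewrite (hg x xe) /= mulN1r subr_gt0.
Qed.

End charts.

Section covering.
Context {R : realType} {N : nat} (Omega : set 'rV[R]_N).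
Hypothesis oO : open Omega.
Hypothesis bO : bounded_set Omega.

(** This replaces a partition of unity: if at each point some F_k equals one, then |v| <= sum_k |F_k
    v|, which is enough to globalise norm estimates. The property [P] is left free because the same
    compactness argument also produces finite nets of points. *)
Lemma cover_cutoffs (P : ('rV[R]_N -> R) -> Prop) :
  (forall x, closure Omega x -> exists2 e : R, 0 < e &
     exists2 chi, P chi & forall y, `|y - x| < e -> chi y = 1) ->
  exists n (F : 'I_n -> 'rV[R]_N -> R), (forall k, P (F k)) /\
    forall y, Omega y -> exists k, F k y = 1.
Proof.
move=> h.
have /choice[G hG] : forall x, exists p : R * ('rV[R]_N -> R), closure Omega x ->
    [/\ 0 < p.1, P p.2 & forall y : 'rV[R]_N, `|y - x| < p.1 -> p.2 y = 1].
  move=> x.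
  have [cx|nx] := pselect (closure Omega x); last by exists (0, cst 0).
  by have [e e0 [chi Pc hc]] := h x cx; exists (e, chi).
have := bounded_closure_compact bO; rewrite compact_cover => cc.
have [||D DO cov] := cc _ (closure Omega) (fun x => [set y | `|y - x| < (G x).1]).
- move=> x cx; have [g0 _ _] := hG x cx.
  have -> : [set y | `|y - x| < (G x).1] = ball x (G x).1.
    by apply/seteqP; split=> y; rewrite -ball_normE /= distrC.
  exact: ball_open.
- by move=> x cx; exists x => //=; rewrite subrr normr0; have [] := hG x cx.
pose l := in_tuple (finmap.enum_fset D).
exists (size (finmap.enum_fset D)), (fun k => (G (tnth l k)).2); split=> [k|y Oy].
  have kD := DO (tnth l k) (mem_tnth k l).
  by have [] := hG _ (set_mem kD).
have [x /= xD yx] := cov y (subset_closure Oy).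
have /tnthP[k E] : x \in l by exact: xD.
by exists k; rewrite -E; have [_ _ ->] := hG _ (set_mem (DO _ xD)).
Qed.

End covering.

(** * Leibniz rule for weak derivatives *)

Section leibniz.
Context {R : realType} {N : nat} (Omega : set 'rV[R]_N).
Hypothesis oO : open Omega.
Hypothesis bO : bounded_set Omega.
Implicit Types (u v w f g phi c : 'rV[R]_N -> R) (i j : 'I_N).
Local Notation L2 := (L2 Omega).
Local Notation n2 := (n2 Omega).
Local Notation ip := (ip Omega).

Let mO : measurable Omega. Proof. exact: measurable_rV_open. Qed.

Lemma closed_ge f (c : R) : continuous f -> closed [set x | c <= f x].
Proof.
move=> cf; rewrite (_ : mkset _ = f @^-1` `[c, +oo[).
  by apply: preimage_closed => //; exact: interval_closed.
by apply/seteqP; split=> t; rewrite /= in_itv/= andbT.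
Qed.

Lemma pderiv_cst_on i f (A : set 'rV[R]_N) (l : R) : open A -> Ck 1 f ->
  (forall x, A x -> f x = l) -> forall x, A x -> pderiv i f x = 0.
Proof.
move=> oA cf fl x Ax; have h := hasdD (Ck_hasd i cf) (@hasd_cst R _ i (- l)).
have := @pderiv_out _ _ i (f \+ cst (- l)) A oA _ x Ax.
rewrite (hasd_pderiv h) /= addr0; apply => y Ay.
by rewrite /= fl// subrr.
Qed.

Lemma pderivM i f g : Ck 1 f -> Ck 1 g ->
  pderiv i (f \* g) = (pderiv i f \* g) \+ (f \* pderiv i g).
Proof. by move=> cf cg; exact: (hasd_pderiv (hasdM (Ck_hasd i cf) (Ck_hasd i cg))). Qed.

Lemma ipM c u v : ip (fun x => c x * u x) v = ip u (fun x => c x * v x).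
Proof. by apply: eq_Rintegral => x _; rewrite mulrCA mulrA. Qed.

(** The product of [c] with a test function is only C^1, so the weak identity is applied in the form
    [wd_C1]. *)
Lemma wdM i c u v : Ck 1 c -> L2 u -> L2 v -> wd Omega i u v ->
  wd Omega i (fun x => c x * u x) (fun x => c x * v x + pderiv i c x * u x).
Proof.
move=> cc Lu Lv h phi tp; have [K [cK KO pK]] := test_supp tp.
have cp := test_continuous tp; have cq := test_continuous (test_pderiv i tp).
have c0 := Ck_continuous cc; have c1 := Ck_continuous (Ck_pderiv i cc).
have Lp := test_L2 oO bO tp; have Lq := test_L2 oO bO (test_pderiv i tp).
have := wd_C1 oO bO Lu Lv h (hasdM (Ck_hasd i cc) (test_hasd i tp)) (rV_continuousM c0 cp)
  (rV_continuousD (rV_continuousM c1 cp) (rV_continuousM c0 cq)) cK KO.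
move=> E.
have {}E : ip u (fun x => pderiv i c x * phi x + c x * pderiv i phi x) = - ip v (fun x => c x * phi x).
  by apply: E => y nK /=; rewrite pK ?mulr0.
rewrite (ipDl mO) ?(ipM _ _ phi) ?ipM//; try exact: (L2_continuousM oO bO).
move: E; rewrite (ipDr mO)//; try exact: (L2_continuousM oO bO).
by move=> E; lra.
Qed.

Lemma wd0M i c u v : Ck 1 c -> L2 u -> L2 v -> wd0 Omega i u v ->
  wd0 Omega i (fun x => c x * u x) (fun x => c x * v x + pderiv i c x * u x).
Proof.
move=> cc Lu Lv h f f' df cf cf'.
have c0 := Ck_continuous cc; have c1 := Ck_continuous (Ck_pderiv i cc).
have Lp := L2_continuous oO bO cf; have Lq := L2_continuous oO bO cf'.
have E : ip u (fun x => pderiv i c x * f x + c x * f' x) = - ip v (fun x => c x * f x).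
  apply: (h _ _ (hasdM (Ck_hasd i cc) df) (rV_continuousM c0 cf)).
  exact: (rV_continuousD (rV_continuousM c1 cf) (rV_continuousM c0 cf')).
rewrite (ipDl mO) ?(ipM _ _ f) ?ipM//; try exact: (L2_continuousM oO bO).
move: E; rewrite (ipDr mO)//; try exact: (L2_continuousM oO bO).
by move=> E; lra.
Qed.

Lemma wdD i u v u' v' : L2 u -> L2 v -> L2 u' -> L2 v' -> wd Omega i u u' -> wd Omega i v v' ->
  wd Omega i (fun x => u x + v x) (fun x => u' x + v' x).
Proof.
move=> Lu Lv Lu' Lv' h h' phi tp.
have Lp := test_L2 oO bO tp; have Lq := test_L2 oO bO (test_pderiv i tp).
by rewrite !(ipDl mO)// h// h'// opprD.
Qed.

(** Both are weak derivatives for the same word, since partial derivatives of test functions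
    commute; uniqueness concludes. *)
Lemma sobolev2_sym w (w1 : 'I_N -> _) (w2 : 'I_N -> 'I_N -> _) : sobolev2 Omega w w1 w2 -> forall i j, aeq Omega (w2 i j) (w2 j i).
Proof.
move=> [Lw L1 L2_ h1 h2] i j.
have E a b phi : test_function Omega phi -> ip w (pderiv a (pderiv b phi)) = ip (w2 a b) phi.
  by move=> tp; rewrite (h1 a _ (test_pderiv b tp)) (h2 a b _ tp) opprK.
apply: (@weak_deriv_unique _ _ _ oO bO [:: i; j] w).
  by apply: wds_weak => // phi tp; rewrite /= E// sqrrN expr1n mul1r.
apply: wds_weak => // phi tp; have [sp _ _] := tp.
by rewrite /= (pderivC i j (sp 2%N)) E// sqrrN expr1n mul1r.
Qed.

End leibniz.

(** * Tangential derivatives of zero-trace functions have zero trace *)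

Lemma tang_algebra (R : comPzRingType) (p q u1 u2 v1 v2 v3 f c : R) : 0 = p + (q * u1 + c * u2) ->
  p * f + v1 * v2 + (0 * (v1 * f) + c * (u2 * f + v1 * v3)) = v1 * (v2 + c * v3) - u1 * (q * f).
Proof. by move=> /esym/eqP; rewrite addr_eq0 => /eqP->; ring. Qed.

Lemma transpose_algebra (V : zmodType) (a b x : V) : - x + a = - b -> a + b = x.
Proof. by move=> h; apply/eqP; rewrite -subr_eq0 addrC addrA h addNr. Qed.

Section zero_trace.
Context {R : realType} {N : nat} (Omega : set 'rV[R]_N).
Hypothesis oO : open Omega.
Hypothesis bO : bounded_set Omega.
Variables (x0 : 'rV[R]_N) (r : R) (i : 'I_N) (s : R) (theta : 'rV[R]_N -> R).
Hypothesis ch : chart Omega x0 r i s theta.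
Variables (w : 'rV[R]_N -> R) (w1 : 'I_N -> 'rV[R]_N -> R) (w2 : 'I_N -> 'I_N -> 'rV[R]_N -> R).
Hypothesis sw : sobolev2 Omega w w1 w2.
Hypothesis w0 : forall a, wd0 Omega a w (w1 a).
Hypothesis supw : forall y, ~ (`|y - x0| <= r / 8) ->
  [/\ w y = 0, forall a, w1 a y = 0 & forall a b, w2 a b y = 0].

Local Notation L2 := (L2 Omega).
Local Notation n2 := (n2 Omega).
Local Notation ip := (ip Omega).
Let mO : measurable Omega. Proof. exact: measurable_rV_open. Qed.
Let Lw : L2 w. Proof. by case: sw. Qed.
Let Lw1 a : L2 (w1 a). Proof. by case: sw => _ /(_ a). Qed.
Let Lw2 a b : L2 (w2 a b). Proof. by case: sw => _ _ /(_ a b). Qed.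
Let r0 : 0 < r. Proof. by case: ch. Qed.
Let ct : Ck 4 theta. Proof. by case: ch. Qed.

(** The field e_j + slope_j e_i annihilates [theta] and is thus tangent to its level sets. For j = i
    the slope is -1 and the field is zero. The slope does not vary in the direction [i]
    ([pderiv_slope]), which removes several terms below. *)
Definition slope j (x : 'rV[R]_N) : R := - s * pderiv j theta x.

Lemma Ck_slope j : Ck 3 (slope j).
Proof. by apply: (@CkM _ _ _ (cst (- s))); [exact: Ck_cst|exact: Ck_pderiv]. Qed.

Lemma slope_normal j x : pderiv j theta x + slope j x * pderiv i theta x = 0.
Proof. by case: ch => _ _ -> s2 _; rewrite /slope mulrAC mulNr -expr2 s2 mulN1r subrr. Qed.

Lemma slope_i x : slope i x = -1.
Proof. by case: ch => _ _ ts s2 _; rewrite /slope ts mulNr -expr2 s2. Qed.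

Lemma pderiv_slope j : pderiv i (slope j) = cst 0.
Proof.
have ti : pderiv i theta = cst s by apply/funext; case: ch.
rewrite (hasd_pderiv (hasdZ (- s) (Ck_hasd i (Ck_pderiv j ct)))).
rewrite (pderivC i j (CkW _ ct))// ti (hasd_pderiv (@hasd_cst R _ j s)).
by apply/funext => x; rewrite mulr0.
Qed.

Definition tang j (x : 'rV[R]_N) : R := w1 j x + slope j x * w1 i x.
Definition dtang j b (x : 'rV[R]_N) : R :=
  w2 j b x + (slope j x * w2 i b x + pderiv b (slope j) x * w1 i x).

Let c1 j : Ck 1 (slope j). Proof. by apply: CkW (Ck_slope j). Qed.
Let cc j : continuous (slope j). Proof. exact: Ck_continuous (c1 j). Qed.
Let cd j b : continuous (pderiv b (slope j)). Proof. exact: Ck_continuous (Ck_pderiv b (c1 j)). Qed.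

Lemma L2_tang j : L2 (tang j).
Proof. by apply: (L2D mO) => //; exact: (L2_continuousM oO bO). Qed.

Lemma L2_dtang j b : L2 (dtang j b).
Proof. by apply: (L2D mO) => //; apply: (L2D mO); exact: (L2_continuousM oO bO). Qed.

Lemma wd_tang j b : wd Omega b (tang j) (dtang j b).
Proof.
have [_ _ _ _ h2] := sw.
apply: (wdD oO bO) => //; [exact: (L2_continuousM oO bO)| |exact: (wdM oO bO)].
by apply: (L2D mO); exact: (L2_continuousM oO bO).
Qed.

(** A cutoff near the boundary: zero where k theta <= 1, one where k theta >= 2. Being a function of
    [theta] alone, it is annihilated by the tangential fields. *)
Let zeta (k : nat) (x : 'rV[R]_N) : R := step (k%:R * theta x + -1).

Let Ck_zeta k : Ck 4 (zeta k).
Proof.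
apply: (@Ck_comp _ _ 4 (fun t => step (k%:R * t + -1))) => //.
by apply: (smooth1_affine (f := step)); exact: smooth1_step.
Qed.

Let pderiv_zeta k a x : pderiv a (zeta k) x =
  (k%:R * derive1 step (k%:R * theta x + -1)) * pderiv a theta x.
Proof.
have := hasd_comp (smooth1_comp_derive k%:R (-1) (@smooth1_step R)) (Ck_hasd a ct).
by move=> /hasd_pderiv E; rewrite -[LHS]/(pderiv a ((fun t => step (k%:R * t + -1)) \o theta) x) E.
Qed.

Let zeta_lim v H : L2 v -> (forall y, ~ (`|y - x0| <= r / 8) -> v y = 0) -> continuous H ->
  ip v (zeta k \* H) @[k --> \oo] --> ip v H.
Proof.
move=> Lv v0 cH; have LH := L2_continuous oO bO cH.
have cz k := Ck_continuous (Ck_zeta k).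
have czm k : continuous (fun x => zeta k x - 1).
  by move=> x; apply: continuousB; [exact: cz|exact: cst_continuous].
apply: cvgn_eps => e e0; pose h k x := (zeta k x - 1) * v x.
have Lh k : L2 (h k) by exact: (L2_continuousM oO bO).
have D0 : 0 < n2 H + 1 by rewrite ltr_wpDl// n2_ge0.
have [|||K hK] := @L2_dominated _ _ _ mO h v _ Lv _ _ _ (divr_gt0 e0 D0).
- by move=> k; exact: L2_measurable.
- move=> k x _; rewrite /h normrM ler_piMl// ler_norml; apply/andP; split.
    by rewrite lerBDr addNr step_ge0.
  by have := step_le1 (k%:R * theta x + -1); rewrite /zeta; lra.
- move=> x Ox; have [xr|/v0 vx] := pselect (`|x - x0| <= r / 8); last first.
    by rewrite /h vx; under eq_fun do rewrite mulr0; exact: cvg_cst.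
  have tx : 0 < theta x by case: ch => _ _ _ _ /(_ x) [|-> //]; apply: le_trans xr _; move: r0; lra.
  apply: cvgn_eps => e' e'0; exists (Num.truncn (2 / theta x)).+1 => k hk.
  rewrite subr0 /h /zeta step_eq1 ?subrr ?mul0r ?normr0//.
  rewrite lerBrDr -ler_pdivrMr//; apply: ltW.
  by apply: lt_le_trans (truncnS_gt _) _; rewrite ler_nat.
exists K => k /hK; rewrite ltr_pdivlMr// => hk.
rewrite (_ : ip v _ - _ = ip (h k) H).
  apply: le_lt_trans (cauchy_schwarz mO (Lh k) LH) _; apply: le_lt_trans hk.
  by rewrite ler_wpM2l ?n2_ge0// lerDl.
rewrite -(ipBr mO) ?ipM//; last exact: (L2_continuousM oO bO).
by apply: eq_ip => // x _ /=; ring.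
Qed.

(** Although the derivatives of [zeta k] blow up, the zero trace of [w] rewrites the pairing as - ip
    w_a (zeta G) - ip w (zeta d_a G). The limit of this is zero by the zero-trace identity for [G]
    itself. *)
Let zeta_boundary (G : 'rV[R]_N -> R) a : Ck 1 G ->
  ip w (pderiv a (zeta k) \* G) @[k --> \oo] --> 0.
Proof.
move=> cG; have cG0 := Ck_continuous cG; have cG1 := Ck_continuous (Ck_pderiv a cG).
have sw0 y : ~ (`|y - x0| <= r / 8) -> w y = 0 by move=> /supw[].
have sw1 y : ~ (`|y - x0| <= r / 8) -> w1 a y = 0 by move=> /supw[].
have E k : ip w (pderiv a (zeta k) \* G) = - ip (w1 a) (zeta k \* G) - ip w (zeta k \* pderiv a G).
  have z1 : Ck 1 (zeta k) by apply: CkW (Ck_zeta k).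
  have z0 := Ck_continuous z1; have z2 := Ck_continuous (Ck_pderiv a z1).
  have := @w0 a (zeta k \* G) _ (hasdM (Ck_hasd a z1) (Ck_hasd a cG)) (rV_continuousM z0 cG0)
    (rV_continuousD (rV_continuousM z2 cG0) (rV_continuousM z0 cG1)).
  rewrite (ipDr mO)//; try (apply: (L2_continuous oO bO); exact: rV_continuousM).
  by move=> h; lra.
have l1 := zeta_lim (Lw1 a) sw1 cG0; have l2 := zeta_lim Lw sw0 cG1.
have z : - ip (w1 a) G - ip w (pderiv a G) = 0.
  by rewrite (w0 (Ck_hasd a cG) cG0 cG1) opprK addNr.
have l3 := cvgB (cvgN l1) l2; rewrite z in l3.
by rewrite (funext E); exact: l3.
Qed.

(** With [zeta k] inserted the identity is exact up to the pairing of [tang j] with (d_b zeta) F.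
    The zero trace of [w] moves the tangential derivative onto that product. Second derivatives of
    [zeta k] then occur only through the derivative of its tangential derivative, which is zero, and
    the first-order terms left over vanish in the limit by [zeta_boundary]. *)
Let tang_trace_supp j b (F : 'rV[R]_N -> R) : Ck 2 F -> (forall y, ~ (`|y - x0| <= r / 2) -> F y = 0) ->
  ip (tang j) (pderiv b F) = - ip (dtang j b) F.
Proof.
move=> cF F0; have cF0 := Ck_continuous cF; have cF1 a := Ck_continuous (Ck_pderiv a cF).
have cF' : Ck 1 F := CkW (isT : (1 <= 2)%N) cF.
pose G1 := pderiv b (slope j) \* F; pose G2 := pderiv j F \+ (slope j \* pderiv i F).
have cG1 : Ck 1 G1 by apply: CkM => //; apply: CkW (Ck_pderiv b (Ck_slope j)).
have cG2 : Ck 1 G2 by apply: CkD; [exact: Ck_pderiv|apply: CkM => //; exact: Ck_pderiv].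
have E k : ip (tang j) (zeta k \* pderiv b F) + ip (dtang j b) (zeta k \* F) =
    ip w (pderiv b (zeta k) \* G2) - ip w (pderiv i (zeta k) \* G1).
  have z1 : Ck 1 (zeta k) by apply: CkW (Ck_zeta k).
  have z0 := Ck_continuous z1; have zc a := Ck_continuous (Ck_pderiv a z1).
  have zb : Ck 1 (pderiv b (zeta k)) by apply: CkW (Ck_pderiv b (Ck_zeta k)).
  pose K := [set x : 'rV[R]_N | `|x - x0| <= r / 2] `&` [set x | 1 <= k%:R * theta x].
  have cK : compact K.
    apply: compact_closedI; first exact: rV_ball_compact.
    apply: (@closed_ge _ _ (fun x => k%:R * theta x)).
    by apply: (rV_continuousM (f := cst k%:R)); [exact: cst_continuous|exact: Ck_continuous ct].
  have KO : K `<=` Omega.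
    move=> x [xr /= kx]; case: ch => _ _ _ _ /(_ x) h; apply/h.
      by apply: le_trans xr _; move: r0; lra.
    have k0 : 0 < k%:R :> R.
      by rewrite lt_def ler0n andbT; apply/eqP => k0; move: kx; rewrite k0 mul0r ler10.
    by rewrite -(pmulr_rgt0 _ k0); apply: lt_le_trans kx.
  have F0K x : ~ K x -> (zeta k \* F) x = 0.
    move=> nK; have [xr|/F0 Fx] := pselect (`|x - x0| <= r / 2); last by rewrite /= Fx mulr0.
    rewrite /= [zeta k x]step_eq0 ?mul0r// lerBlDr add0r leNgt; apply/negP => h.
    by apply: nK; split=> //=; exact: ltW.
  have := wd_C1 oO bO (L2_tang j) (L2_dtang j b) (@wd_tang j b) (hasdM (Ck_hasd b z1) (Ck_hasd b cF'))
    (rV_continuousM z0 cF0) (rV_continuousD (rV_continuousM (zc b) cF0) (rV_continuousM z0 (cF1 b))) cK KO F0K.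
  have Lc (f g : 'rV[R]_N -> R) : continuous f -> continuous g -> L2 (f \* g).
    by move=> cf cg; apply: (L2_continuous oO bO); exact: rV_continuousM.
  rewrite (ipDr mO (Lc _ _ (zc b) cF0) (Lc _ _ z0 (cF1 b)) (L2_tang j)) => E1.
  have zbc a : continuous (pderiv a (pderiv b (zeta k))) := Ck_continuous (Ck_pderiv a zb).
  have E2 := w0 (hasdM (Ck_hasd j zb) (Ck_hasd j cF')) (rV_continuousM (zc b) cF0)
    (rV_continuousD (rV_continuousM (zbc j) cF0) (rV_continuousM (zc b) (cF1 j))).
  have zF : Ck 1 (pderiv b (zeta k) \* F) by exact: CkM.
  have zF1 := Ck_continuous (Ck_pderiv i zF).
  have E3 := w0 (hasdM (Ck_hasd i (c1 j)) (Ck_hasd i zF)) (rV_continuousM (@cc j) (rV_continuousM (zc b) cF0))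
    (rV_continuousD (rV_continuousM (@cd j i) (rV_continuousM (zc b) cF0)) (rV_continuousM (@cc j) zF1)).
  have E4 : ip (tang j) (pderiv b (zeta k) \* F) =
      - (ip w ((pderiv j (pderiv b (zeta k)) \* F) \+ (pderiv b (zeta k) \* pderiv j F)) +
         ip w ((pderiv i (slope j) \* (pderiv b (zeta k) \* F)) \+ (slope j \* pderiv i (pderiv b (zeta k) \* F)))).
    rewrite E2 E3 /tang (ipDl mO) ?ipM//; first by rewrite opprD !opprK.
      exact: (L2_continuousM oO bO).
    exact: (Lc _ _ (zc b) cF0).
  have E5 : ip (tang j) (pderiv b (zeta k) \* F) =
      - (ip w (pderiv b (zeta k) \* G2) - ip w (pderiv i (zeta k) \* G1)).
    rewrite E4 -(ipDr mO) ?Lw//; last first.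
    - apply: (L2_continuous oO bO); apply: rV_continuousD; apply: rV_continuousM => //.
        exact: rV_continuousM.
    - by apply: (L2_continuous oO bO); apply: rV_continuousD; exact: rV_continuousM.
    rewrite -(ipBr mO) ?Lw//; last first.
    - by apply: Lc => //; exact: (Ck_continuous cG1).
    - by apply: Lc => //; exact: (Ck_continuous cG2).
    congr (- _); apply: eq_ip => // x _; rewrite /= (pderivM i zb cF') pderiv_slope /=.
    rewrite (pderivC j b (CkW (isT : (2 <= 4)%N) (Ck_zeta k))) (pderivC i b (CkW (isT : (2 <= 4)%N) (Ck_zeta k))).
    have z3 a : Ck 1 (pderiv a (zeta k)) by apply: CkW (Ck_pderiv a (Ck_zeta k)).
    (* Differentiating this identity in the direction [b] trades the second derivatives of [zeta k]
       for first ones. *)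
    have zz : pderiv j (zeta k) \+ (slope j \* pderiv i (zeta k)) = cst 0.
      apply/funext => y; rewrite /= !pderiv_zeta.
      transitivity (k%:R * derive1 step (k%:R * theta y - 1) * (pderiv j theta y + slope j y * pderiv i theta y)).
        by ring.
      by rewrite slope_normal mulr0.
    have := hasd_pderiv (hasdD (Ck_hasd b (z3 j)) (hasdM (Ck_hasd b (c1 j)) (Ck_hasd b (z3 i)))).
    rewrite zz (hasd_pderiv (@hasd_cst R _ b 0)) => /(congr1 (fun f => f x)) /= E6.
    rewrite /G1 /G2 /=.
    exact: tang_algebra E6.
  by apply: transpose_algebra; rewrite -E5.
have tz y : ~ (`|y - x0| <= r / 8) -> tang j y = 0.
  by move=> /supw[_ q _]; rewrite /tang !q mulr0 addr0.
have dz y : ~ (`|y - x0| <= r / 8) -> dtang j b y = 0.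
  by move=> /supw[_ q q']; rewrite /dtang !q !q' !mulr0 !addr0.
have l1 : ip (tang j) (zeta k \* pderiv b F) + ip (dtang j b) (zeta k \* F) @[k --> \oo] -->
    ip (tang j) (pderiv b F) + ip (dtang j b) F.
  apply: cvgD; [exact: (zeta_lim (L2_tang j) tz (cF1 b))|exact: (zeta_lim (L2_dtang j b) dz cF0)].
have l2 : ip (tang j) (zeta k \* pderiv b F) + ip (dtang j b) (zeta k \* F) @[k --> \oo] --> 0.
  have l3 := cvgB (@zeta_boundary _ b cG2) (@zeta_boundary _ i cG1); rewrite subr0 in l3.
  by rewrite (funext E); exact: l3.
have : ip (tang j) (pderiv b F) + ip (dtang j b) F = 0 by exact: (cvg_unique _ l1 l2).
by move=> /eqP; rewrite addr_eq0 => /eqP.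
Qed.

(** The support condition on [F] is removed by a cutoff equal to one around the support of [w],
    which changes neither side. *)
Lemma tang_trace j b (f : 'rV[R]_N -> R) : Ck 2 f ->
  ip (tang j) (pderiv b f) = - ip (dtang j b) f.
Proof.
move=> cf; have [eta [ce e1 e0]] := cutoff x0 (divr_gt0 r0 (ltr0n R 2)).
have cF : Ck 2 (eta \* f) by exact: CkM.
have oA : open [set y : 'rV[R]_N | `|y - x0| < r / 4].
  rewrite (_ : mkset _ = ball x0 (r / 4)); first exact: ball_open.
  by apply/seteqP; split=> y; rewrite -ball_normE /= distrC.
have rr : r / 8 < r / 4 by move: r0; lra.
have := @tang_trace_supp j b (eta \* f) cF _.
rewrite (pderivM b (ce 1%N) (CkW (isT : (1 <= 2)%N) cf)) => E.
have {}E := E _; rewrite (_ : ip (tang j) (pderiv b f) = ip (tang j) ((pderiv b eta \* f) \+ (eta \* pderiv b f))).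
  rewrite E; last by move=> y ny /=; rewrite (_ : eta y = 0) ?mul0r//; apply: contrapT => /eqP/e0.
  congr (- _); apply: eq_Rintegral => y _ /=.
  have [yr|/supw[_ q q']] := pselect (`|y - x0| <= r / 8).
    by rewrite e1 ?mul1r//; apply: le_trans yr _; move: r0; lra.
  by rewrite /dtang !q !q' !mulr0 !addr0 !mul0r.
apply: eq_Rintegral => y _ /=.
have [yr|/supw[_ q _]] := pselect (`|y - x0| <= r / 8); last by rewrite /tang !q mulr0 addr0 !mul0r.
rewrite e1 ?mul1r; last by apply: le_trans yr _; move: r0; lra.
have e1' z : `|z - x0| < r / 4 -> eta z = 1.
  by move=> zr; apply: e1; apply: le_trans (ltW zr) _; move: r0; lra.
rewrite (@pderiv_cst_on R N b eta _ 1 oA (ce 1%N) e1' y) ?mul0r ?add0r//.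
exact: le_lt_trans yr rr.
Qed.

End zero_trace.

(** Completing squares: the sum of (q_b - Q)^2 is at most n Q^2. *)
Lemma quadratic_sum_le (R : realFieldType) n (q : 'I_n -> R) (Q : R) : 0 <= Q -> (forall b, 0 <= q b) ->
  \sum_b q b ^+ 2 <= Q * \sum_b q b -> forall b, q b <= n.+1%:R * Q.
Proof.
move=> Q0 q0 h b; have nQ : (1 : R) <= n%:R by rewrite ler1n (leq_ltn_trans _ (ltn_ord b)).
have S0 : 0 <= \sum_b q b by apply: sumr_ge0.
have e : \sum_b (q b - Q) ^+ 2 <= n%:R * Q ^+ 2.
  rewrite (_ : \sum_b _ = \sum_b q b ^+ 2 + (- 2 * Q * \sum_b q b + n%:R * Q ^+ 2)); last first.
    have -> : n%:R * Q ^+ 2 = \sum_(b < n) Q ^+ 2 by rewrite sumr_const card_ord mulr_natl.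
    rewrite mulr_sumr -!big_split/=.
    by apply: eq_bigr => c _; ring.
  by have := mulr_ge0 Q0 S0; lra.
have {}e : (q b - Q) ^+ 2 <= (n%:R * Q) ^+ 2.
  apply: (@le_trans _ _ (n%:R * Q ^+ 2)).
    apply: le_trans e; rewrite (bigD1 b)//= lerDl; apply: sumr_ge0 => c _; exact: sqr_ge0.
  by rewrite exprMn ler_wpM2r ?sqr_ge0// expr2 ler_peMl// ler0n.
have nQ0 : 0 <= n%:R * Q by rewrite mulr_ge0.
have : `|q b - Q| <= n%:R * Q.
  by rewrite -(ler_pXn2r (n := 2)) ?nnegrE// real_normK ?num_real.
by rewrite ler_norml => /andP[_]; rewrite -natr1 mulrDl mul1r lerBlDr.
Qed.

Lemma eq_subl (V : zmodType) (x y a b c : V) : x = a + b -> x = y -> y = c -> b = c - a.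
Proof. by move=> -> <- <-; rewrite addrAC subrr add0r. Qed.

Lemma eq_addl (V : zmodType) (x y z u v : V) : x = z - u -> u = - v -> x + y = z + (y + v).
Proof. by move=> -> ->; rewrite opprK -addrA (addrC v). Qed.

(** * Second-order estimate in one chart *)

Section cone_box.
Context {R : realType} {N : nat} (i : 'I_N) (s A : R).

(** For s = 1 or -1 the box consists of the z with |z_j| <= 1 for j != i and A <= s z_i <= A + 1;
    after scaling it lies in the cone of [chart_cone]. *)
Definition box_lo (j : 'I_N) : R := if j == i then s * (A + 2^-1) - 2^-1 else -1.
Definition box_hi (j : 'I_N) : R := if j == i then s * (A + 2^-1) + 2^-1 else 1.

Lemma box_lt j : box_lo j < box_hi j.
Proof. by rewrite /box_lo /box_hi; case: ifP => _; lra. Qed.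

Lemma box_cone (l : R) (z : 'rV[R]_N) : 0 < l -> s ^+ 2 = 1 ->
  (forall j, box_lo j <= l * z ord0 j <= box_hi j) ->
  (forall j, j != i -> `|z ord0 j| <= l^-1) /\ A * l^-1 <= s * z ord0 i.
Proof.
move=> l0 s2 h; split=> [j ne|].
  have := h j; rewrite /box_lo /box_hi (negPf ne) => /andP[h1 h2].
  by rewrite -(ler_pM2l l0) divff ?lt0r_neq0// -{1}(gtr0_norm l0) -normrM ler_norml h1.
have := h i; rewrite /box_lo /box_hi eqxx => /andP[h1 h2].
rewrite ler_pdivrMr// mulrAC -mulrA.
have : s = 1 \/ s = -1 by move/eqP: s2; rewrite sqrf_eq1 => /orP[]/eqP; [left|right].
by move=> [] E; rewrite E in h1 h2 *; lra.
Qed.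

End cone_box.

Opaque pderiv.

Section chart_estimate.
Context {R : realType} {N : nat} (Omega : set 'rV[R]_N).
Hypothesis oO : open Omega.
Hypothesis bO : bounded_set Omega.

Local Notation L2 := (L2 Omega).
Local Notation n2 := (n2 Omega).
Local Notation ip := (ip Omega).
Let mO : measurable Omega. Proof. exact: measurable_rV_open. Qed.

Lemma convol_neq0 F u (x : 'rV[R]_N) : convol Omega F u x != 0 ->
  exists y, [/\ Omega y, u y != 0 & prodf F (x - y) != 0].
Proof.
apply: contra_neqP => h; rewrite /convol /Submission.ip /Rintegral integral0_eq// => y Oy.
have [->|ny] := eqVneq (prodf (shiftf F x) y) 0; first by rewrite mul0r.
have [->|nu] := eqVneq (u y) 0; first by rewrite mulr0.
by case: h; exists y; split=> //; rewrite -prodf_shiftE.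
Qed.

Lemma ip_suml (I : Type) (l : seq I) (F : I -> 'rV[R]_N -> R) v : (forall a, L2 (F a)) -> L2 v ->
  ip (fun x => \sum_(a <- l) F a x) v = \sum_(a <- l) ip (F a) v.
Proof.
move=> LF Lv; elim: l => [|a l IH].
  by rewrite big_nil /Submission.ip; under eq_Rintegral do rewrite big_nil mul0r; rewrite /Rintegral integral0.
rewrite big_cons -IH -(ipDl mO)//; last exact: (L2_sum mO).
by congr ip; apply/funext => x; rewrite big_cons.
Qed.

Variables (x0 : 'rV[R]_N) (r : R) (i : 'I_N) (s : R) (theta : 'rV[R]_N -> R).
Hypothesis ch : chart Omega x0 r i s theta.
Variables (M : R).
Local Notation sl := (slope s theta).
Hypothesis M0 : 0 <= M.
Hypothesis slM : forall j x, Omega x -> `|sl j x| <= M.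
Hypothesis dslM : forall j b x, Omega x -> `|pderiv b (sl j) x| <= M.

Variables (w : 'rV[R]_N -> R) (w1 : 'I_N -> 'rV[R]_N -> R) (w2 : 'I_N -> 'I_N -> 'rV[R]_N -> R).
Hypothesis sw : sobolev2 Omega w w1 w2.
Hypothesis w0 : forall a, wd0 Omega a w (w1 a).
Hypothesis supw : forall y, ~ (`|y - x0| <= r / 8) ->
  [/\ w y = 0, forall a, w1 a y = 0 & forall a b, w2 a b y = 0].

Let Lw1 a : L2 (w1 a). Proof. by case: sw => _ /(_ a). Qed.
Let Lw2 a b : L2 (w2 a b). Proof. by case: sw => _ _ /(_ a b). Qed.
Let r0 : 0 < r. Proof. by case: ch. Qed.
Let s2 : s ^+ 2 = 1. Proof. by case: ch. Qed.

Local Notation tg := (tang i s theta w1).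
Local Notation dtg := (dtang i s theta w1 w2).
Let Ltg j : L2 (tg j). Proof. exact: (L2_tang oO bO ch sw). Qed.
Let Ldtg j b : L2 (dtg j b). Proof. exact: (L2_dtang oO bO ch sw). Qed.
Let csl j : Ck 3 (sl j). Proof. exact: (Ck_slope ch). Qed.

(** A kernel supported in the inward cone moves the support to {theta >= 1 / scale}, a compact part
    of [Omega] near [x0]. *)
Lemma tang_test : exists A : R, exists k0, forall k, (k0 <= k)%N -> forall j,
  test_function Omega (convol Omega (moll (box_lo i s A) (box_hi i s A) k) (tg j)).
Proof.
have [A A1 hA] := chart_cone ch; exists A.
have ab := @box_lt R N i s A.
have [k0 hk0] := scale_large (mrad (box_lo i s A) (box_hi i s A) / (r / 8)).
exists k0 => k /hk0 hk j; have sk := @scale_gt0 R k.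
have r8 : 0 < r / 8 by rewrite divr_gt0.
pose K := [set x : 'rV[R]_N | `|x - x0| <= r / 2] `&` [set x | (@scale R k)^-1 <= theta x].
have ct : continuous theta by case: ch => _ ct _ _ _; exact: Ck_continuous ct.
apply: (@testfP _ _ Omega _ K).
- by move=> l; apply: (Ck_conv oO bO) => //; exact: moll_kernel.
- by apply: compact_closedI; [exact: rV_ball_compact|exact: closed_ge].
- move=> x [xr tx]; case: ch => _ _ _ _ /(_ x) h; apply/h.
    by apply: le_trans xr _; move: r0; lra.
  by apply: lt_le_trans tx; rewrite invr_gt0.
move=> x nK; apply: contrapT => /eqP /convol_neq0[y [Oy ny nz]]; apply: nK.
have yr : `|y - x0| <= r / 8.
  by apply: contrapT => /supw[_ q _]; move: ny; rewrite /tang !q mulr0 addr0 eqxx.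
have zs := prodf_moll_small ab nz.
have zr : `|x - y| <= r / 8.
  rewrite -(ler_pM2l sk); apply: le_trans zs _.
  by rewrite -ler_pdivrMr// ltW.
have [z1 z2] := box_cone sk s2 (prodf_moll_supp ab nz).
split.
  rewrite /= -(subrKA y); apply: le_trans (ler_normD _ _) _.
  by move: r0 zr yr; lra.
have := hA y (x - y) (@scale R k)^-1; rewrite (addrC y (x - y)) subrK => h.
have {}h : theta y + (@scale R k)^-1 <= theta x.
  apply: h => //; first by rewrite invr_ge0 ltW.
    by apply: le_trans yr _; move: r0; lra.
  by apply: le_trans zr _; move: r0; lra.
apply: le_trans h; rewrite /= lerDr ltW//.
by case: ch => _ _ _ _ /(_ y) [|-> //]; apply: le_trans yr _; move: r0; lra.
Qed.

(** As a function of y the kernel does not vanish on the boundary, so integrating by parts against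
    it is legitimate precisely because of the zero trace in [tang_trace]. *)
Lemma tang_convol_pderiv F j b : smooth_kernel F ->
  pderiv b (convol Omega F (tg j)) = convol Omega F (dtg j b).
Proof.
move=> kF; have [sF _] := kF; rewrite (pderiv_conv oO bO b kF (Ltg j)).
apply/funext => x; have cf : Ck 2 (prodf (shiftf F x)) by apply: Ck_prodf; exact: smooth1_shift.
have := tang_trace oO bO ch sw w0 supw j b cf.
rewrite (hasd_pderiv (hasd_shift x b sF)) => E.
rewrite /convol [RHS]ipC -[RHS]opprK -E ipC.
have [sF' _] := kernel_upd b kF.
by rewrite (ipNr mO)// ?opprK//; exact: (L2_shift oO bO).
Qed.

(** Both sides equal minus the pairing of [w1 b] with the second derivative of [Phi] in [a] and
    [b]. *)
Let ip_hessian a b (Phi : 'rV[R]_N -> R) (K : set 'rV[R]_N) : Ck 2 Phi -> compact K -> K `<=` Omega ->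
  (forall y, ~ K y -> Phi y = 0) -> ip (w2 a b) (pderiv b Phi) = ip (w2 b b) (pderiv a Phi).
Proof.
move=> cP cK KO P0; have [_ _ _ _ h2] := sw.
have c1 a' := Ck_pderiv a' cP; have c0 a' := Ck_continuous (c1 a').
have c2 a' b' := Ck_continuous (Ck_pderiv a' (c1 b')).
have LP a' := L2_continuous oO bO (c0 a').
have P1 a' := @pderiv_supp _ _ a' Phi K (rV_compact_closed cK) P0.
rewrite (aeq_ip mO (Lw2 a b) (LP b) (Lw2 b a) (LP b) (sobolev2_sym oO bO sw a b) (aeq_refl _ _)).
have E1 := wd_C1 oO bO (Lw1 b) (Lw2 b a) (h2 b a) (Ck_hasd a (c1 b)) (c0 b) (c2 a b) cK KO (P1 b).
have E2 := wd_C1 oO bO (Lw1 b) (Lw2 b b) (h2 b b) (Ck_hasd b (c1 a)) (c0 a) (c2 b a) cK KO (P1 a).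
apply: oppr_inj; apply: (etrans (esym E1)); apply: (etrans _ E2).
by rewrite (pderivC a b cP).
Qed.

(** [ip_hessian] replaces the mixed second derivatives by w_bb, which sum to the Laplacian over [b].
    The remaining terms contain first derivatives of [w] only, and no second derivative of the slope
    since the slope is constant in the direction [i]. *)
Let key_identity j b psi : test_function Omega psi ->
  ip (dtg j b) (pderiv b psi) = ip (w2 b b) (fun x => pderiv j psi x + sl j x * pderiv i psi x) +
    (ip (w1 i) (fun x => pderiv b (sl j) x * pderiv b psi x) +
     ip (w1 b) (fun x => pderiv b (sl j) x * pderiv i psi x)).
Proof.
move=> tp; have [sp _ _] := tp; have [K [cK KO pK]] := test_supp tp.
have [_ _ _ _ h2] := sw.
have cp := test_continuous tp; have cq a := test_continuous (test_pderiv a tp).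
have csl0 := Ck_continuous (csl j); have cdsl := Ck_continuous (Ck_pderiv b (csl j)).
have L a := L2_continuous oO bO (cq a).
have Ls a : L2 (fun x => sl j x * pderiv a psi x) by exact: (L2_continuousM oO bO).
have Ld a : L2 (fun x => pderiv b (sl j) x * pderiv a psi x) by exact: (L2_continuousM oO bO).
have LD : L2 (fun x => pderiv b (sl j) x * psi x).
  by apply: (L2_continuousM oO bO) => //; exact: test_L2.
have La : L2 (fun x => sl j x * w2 i b x) by exact: (L2_continuousM oO bO).
have Lb : L2 (fun x => pderiv b (sl j) x * w1 i x) by exact: (L2_continuousM oO bO).
rewrite (ipDl mO (Lw2 j b) (L2D mO La Lb) (L b)) (ipDl mO La Lb (L b)).
rewrite (ipM Omega (sl j) (w2 i b)) (ipM Omega (pderiv b (sl j)) (w1 i)).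
rewrite (ip_hessian j b (sp 2%N) cK KO pK) (ipDr mO (L j) (Ls i) (Lw2 b b)) -!addrA; congr (_ + _).
have csp : Ck 2 (sl j \* psi) by apply: CkM => //; apply: CkW (csl j).
have spK y : ~ K y -> (sl j \* psi) y = 0 by move=> nK; rewrite /= pK// mulr0.
have dslp : Ck 1 (pderiv b (sl j) \* psi) by apply: CkM => //; apply: CkW (Ck_pderiv b (csl j)).
have dslK y : ~ K y -> (pderiv b (sl j) \* psi) y = 0 by move=> nK; rewrite /= pK// mulr0.
have c1sl : Ck 1 (sl j) by apply: CkW (csl j).
have E1 := ip_hessian i b csp cK KO spK.
rewrite (pderivM b c1sl (sp 1%N)) (pderivM i c1sl (sp 1%N)) (pderiv_slope ch) in E1.
have {}E1 : ip (w2 i b) (fun x => sl j x * pderiv b psi x) =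
    ip (w2 b b) (fun x => sl j x * pderiv i psi x) - ip (w2 i b) (fun x => pderiv b (sl j) x * psi x).
  have Q1 : ip (w2 i b) (pderiv b (sl j) \* psi \+ sl j \* pderiv b psi) =
      ip (w2 i b) (fun x => pderiv b (sl j) x * psi x) + ip (w2 i b) (fun x => sl j x * pderiv b psi x).
    exact: (ipDr mO LD (Ls b) (Lw2 i b)).
  have Q2 : ip (w2 b b) (cst 0 \* psi \+ sl j \* pderiv i psi) = ip (w2 b b) (fun x => sl j x * pderiv i psi x).
    by apply: (eq_ip (fun x _ => erefl (w2 b b x))) => x _; rewrite /= mul0r add0r.
  exact: (eq_subl Q1 E1 Q2).
have E2 : ip (w2 i b) (fun x => pderiv b (sl j) x * psi x) = - ip (w1 b) (fun x => pderiv b (sl j) x * pderiv i psi x).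
  rewrite (aeq_ip mO (Lw2 i b) LD (Lw2 b i) LD (sobolev2_sym oO bO sw i b) (aeq_refl _ _)).
  have := wd_C1 oO bO (Lw1 b) (Lw2 b i) (h2 b i) (Ck_hasd i dslp) (Ck_continuous dslp)
    (Ck_continuous (Ck_pderiv i dslp)) cK KO dslK.
  have c2sl : Ck 2 (sl j) by apply: CkW (csl j).
  have cd1 : Ck 1 (pderiv b (sl j)) by exact: Ck_pderiv.
  rewrite (pderivM i cd1 (sp 1%N)) (pderivC i b c2sl) (pderiv_slope ch).
  rewrite (hasd_pderiv (@hasd_cst R _ b 0)) => h; apply: oppr_inj; apply: (etrans (esym h)).
  by rewrite opprK; apply: (eq_ip (fun x _ => erefl (w1 b x))) => x _; rewrite /= mul0r add0r.
exact: (eq_addl _ E1 E2).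
Qed.

Local Notation lap := (fun x => \sum_b w2 b b x).
Let Llap : L2 lap. Proof. exact: (L2_sum mO). Qed.
Let P : R := n2 lap.
Let W : R := \sum_b n2 (w1 b).
Let Q : R := (1 + 2 * M) * (P + W).
Let P0 : 0 <= P. Proof. exact: n2_ge0. Qed.
Let W0 : 0 <= W. Proof. by apply: sumr_ge0 => b _; exact: n2_ge0. Qed.
Let Wb b : n2 (w1 b) <= W.
Proof. by rewrite /W (bigD1 b)//= lerDl; apply: sumr_ge0 => c _; exact: n2_ge0. Qed.
Let Q0 : 0 <= Q. Proof. by rewrite mulr_ge0 ?addr_ge0 ?mulr_ge0. Qed.

(** The weak equation satisfied by the tangential derivative: the Laplacian and first derivatives of
    [w] bound its Dirichlet pairing with any test function. *)
Let ip_bound j (q : 'I_N -> R) psi : test_function Omega psi -> (forall b, n2 (pderiv b psi) <= q b) ->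
  \sum_b ip (dtg j b) (pderiv b psi) <= Q * \sum_b q b.
Proof.
move=> tp hq; have q0 b : 0 <= q b := le_trans (n2_ge0 _ _) (hq b).
have qG b : q b <= \sum_b q b by rewrite (bigD1 b)//= lerDl; apply: sumr_ge0.
set G := \sum_b q b in qG *; have G0 : 0 <= G by apply: sumr_ge0.
have cp := test_continuous tp; have cq a := test_continuous (test_pderiv a tp).
have csl0 := Ck_continuous (csl j); have cdsl b := Ck_continuous (Ck_pderiv b (csl j)).
have L a := L2_continuous oO bO (cq a).
have Ls a : L2 (fun x => sl j x * pderiv a psi x) by exact: (L2_continuousM oO bO).
have Ld b a : L2 (fun x => pderiv b (sl j) x * pderiv a psi x) by exact: (L2_continuousM oO bO).
have nd b a : n2 (fun x => pderiv b (sl j) x * pderiv a psi x) <= M * q a.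
  apply: (@le_trans _ _ (M * n2 (pderiv a psi))); last by apply: ler_wpM2l.
  apply: (n2M mO) => //; first exact: measurable_continuous_on.
  by move=> x Ox; exact: dslM.
rewrite (eq_bigr _ (fun b _ => key_identity j b tp)) !big_split/= -ip_suml//; last exact: (L2D mO).
have b1 : ip lap (fun x => pderiv j psi x + sl j x * pderiv i psi x) <= P * ((1 + M) * G).
  apply: le_trans (ler_norm _) _; apply: le_trans (cauchy_schwarz mO Llap (L2D mO (L j) (Ls i))) _.
  rewrite ler_wpM2l//; apply: le_trans (n2D mO (L j) (Ls i)) _.
  rewrite mulrDl mul1r; apply: lerD; first exact: le_trans (hq j) (qG j).
  apply: (@le_trans _ _ (M * n2 (pderiv i psi))).
    apply: (n2M mO) => //; first exact: measurable_continuous_on.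
    by move=> x Ox; exact: slM.
  by apply: ler_wpM2l => //; exact: le_trans (hq i) (qG i).
have b2 : \sum_b ip (w1 i) (fun x => pderiv b (sl j) x * pderiv b psi x) <= W * (M * G).
  rewrite /G !mulr_sumr; apply: ler_sum => b _; apply: le_trans (ler_norm _) _.
  apply: le_trans (cauchy_schwarz mO (Lw1 i) (Ld b b)) _.
  by apply: ler_pM; rewrite ?n2_ge0.
have b3 : \sum_b ip (w1 b) (fun x => pderiv b (sl j) x * pderiv i psi x) <= W * (M * G).
  rewrite {1}/W mulr_suml; apply: ler_sum => b _; apply: le_trans (ler_norm _) _.
  apply: le_trans (cauchy_schwarz mO (Lw1 b) (Ld b i)) _.
  rewrite ler_wpM2l ?n2_ge0//; apply: le_trans (nd b i) _; exact: ler_wpM2l.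
apply: le_trans (lerD b1 (lerD b2 b3)) _; rewrite /Q.
rewrite -subr_ge0 (_ : _ - _ = P * M * G + W * G); last by ring.
by rewrite addr_ge0// !mulr_ge0.
Qed.

(** Test with the mollification of [tg j], whose derivatives are the mollifications of [dtg j]. In
    the limit the sum of ||dtg||^2 is at most Q times the sum of ||dtg||, up to [e'], and
    [quadratic_sum_le] applies. *)
Lemma dtang_bound j b : n2 (dtg j b) <= N.+1%:R * Q.
Proof.
apply/ler_addgt0Pr => e e0; have N0 : 0 < N.+1%:R :> R by rewrite ltr0n.
pose e' := e / N.+1%:R; have e'0 : 0 < e' by rewrite divr_gt0.
have -> : N.+1%:R * Q + e = N.+1%:R * (Q + e').
  by rewrite mulrDr; congr (_ + _); rewrite /e' mulrC divfK// gt_eqF.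
apply: (@quadratic_sum_le R N (fun b => n2 (dtg j b))); last 1 first.
- have [A [k0 hk0]] := tang_test; have ab := @box_lt R N i s A.
  pose T k := convol Omega (moll (box_lo i s A) (box_hi i s A) k).
  have /choice[K hK] : forall b, exists K, forall k, (K <= k)%N -> n2 (fun x => T k (dtg j b) x - dtg j b x) < e'.
    by move=> c; have [_ h] := moll_cvg_L2 oO bO ab (Ldtg j c); exact: h.
  pose k := maxn k0 (\max_b K b)%N; have tp := hk0 k (leq_maxl _ _) j.
  have kk := moll_kernel ab k.
  have LT c : L2 (T k (dtg j c)) := L2_moll oO bO ab k (Ldtg j c).
  have h1 : \sum_b ip (dtg j b) (T k (dtg j b)) <= Q * \sum_b n2 (dtg j b).
    have := @ip_bound j (fun b => n2 (dtg j b)) _ tp.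
    under eq_bigr do rewrite (tang_convol_pderiv _ _ kk); apply => c.
    by rewrite (tang_convol_pderiv _ _ kk); exact: (n2_moll oO bO ab).
  rewrite mulrDl; apply: le_trans (lerD h1 (lexx _)); rewrite mulr_sumr -big_split/=.
  apply: ler_sum => c _; rewrite n2_sqr addrC -lerBlDr -(ipBr mO)//.
  apply: le_trans (ler_norm _) _; have LB := L2B mO (Ldtg j c) (LT c).
  apply: le_trans (cauchy_schwarz mO (Ldtg j c) LB) _.
  rewrite mulrC ler_wpM2r ?n2_ge0// n2_subC ltW//; apply: hK.
  exact: leq_trans (leq_bigmax c) (leq_maxr _ _).
- by rewrite addr_ge0// ltW.
- by move=> c; exact: n2_ge0.
Qed.

(** The second-order part of [dtg j b]; what is dropped has order one in [w], so the bound carries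
    over. *)
Let h j b (x : 'rV[R]_N) : R := w2 j b x + sl j x * w2 i b x.
Let c0 j : continuous (sl j) := Ck_continuous (csl j).
Let Lh j b : L2 (h j b). Proof. by apply: (L2D mO) => //; exact: (L2_continuousM oO bO). Qed.
Let C1 : R := N.+2%:R * (1 + 2 * M).

Let h_bound j b : n2 (h j b) <= C1 * (P + W).
Proof.
have Ld : L2 (fun x => pderiv b (sl j) x * w1 i x).
  by apply: (L2_continuousM oO bO) => //; exact: Ck_continuous (Ck_pderiv b (csl j)).
rewrite (@eq_n2 _ _ _ (h j b) (fun x => dtg j b x - pderiv b (sl j) x * w1 i x)); last first.
  by move=> x _; rewrite /dtang /h addrA addrK.
apply: le_trans (n2B mO (Ldtg j b) Ld) _.
have b1 : n2 (fun x => pderiv b (sl j) x * w1 i x) <= Q.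
  apply: (@le_trans _ _ (M * n2 (w1 i))).
    apply: (n2M mO) => //; first by apply: measurable_continuous_on => //; exact: Ck_continuous (Ck_pderiv b (csl j)).
    by move=> x Ox; exact: dslM.
  apply: (@le_trans _ _ (M * W)); first by apply: ler_wpM2l.
  by have := mulr_ge0 M0 W0; have := mulr_ge0 M0 P0; move: P0 W0; rewrite /Q; lra.
apply: le_trans (lerD (dtang_bound j b) b1) _.
by rewrite /C1 -[N.+2%:R]natr1 mulrDl mul1r mulrDl -/Q mulrA.
Qed.

Let n2_slM j v : L2 v -> n2 (fun x => sl j x * v x) <= M * n2 v.
Proof.
move=> Lv; apply: (n2M mO) => //; first exact: measurable_continuous_on.
by move=> x Ox; exact: slM.
Qed.

Let C2 : R := 1 + N%:R * ((1 + M) * C1).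

(** From h_bb - sl_b h_bi = w_bb - sl_b^2 w_ii, summation over b expresses (sum sl_b^2) w_ii through
    the Laplacian and the controlled functions [h]. The coefficient is at least sl_i^2 = 1. *)
Let hessian_ii : n2 (w2 i i) <= C2 * (P + W).
Proof.
pose Y x := (\sum_b sl b x ^+ 2) * w2 i i x.
pose X x := (\sum_b w2 b b x) - \sum_b (h b b x - sl b x * h b i x).
have Lsh b : L2 (fun x => sl b x * h b i x) by exact: (L2_continuousM oO bO).
have LX : L2 X by apply: (L2B mO) => //; apply: (L2_sum mO) => b; exact: (L2B mO).
have cS : continuous (fun x => \sum_b sl b x ^+ 2).
  have : Ck 0 (fun x => \sum_b (sl b \* sl b) x).
    by apply: Ck_sum => b; apply: CkM; apply: CkW (csl b).
  by move=> /Ck_continuous; under [in X in _ -> X]eq_fun do under eq_bigr do rewrite expr2.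
have LY : L2 Y by exact: (L2_continuousM oO bO).
have YX : aeq Omega Y X.
  have : {ae lebesgue_rV R N, forall x, forall b, Omega x -> w2 i b x = w2 b i x}.
    by apply: filter_forall => b; exact: (sobolev2_sym oO bO sw).
  apply: filterS => x q Ox; rewrite /Y /X mulr_suml -sumrB; apply: eq_bigr => b _.
  by rewrite /h (q b Ox); ring.
apply: (@le_trans _ _ (n2 Y)).
  rewrite -[leRHS]mul1r; apply: (n2_le mO) => //; first exact: L2_measurable.
  move=> x _; rewrite mul1r normrM ler_peMl// ger0_norm; last by apply: sumr_ge0 => b _; exact: sqr_ge0.
  rewrite (bigD1 i)//= (slope_i ch) sqrrN expr1n lerDl.
  by apply: sumr_ge0 => b _; exact: sqr_ge0.
rewrite (aeq_n2 mO LY LX YX).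
have LS : L2 (fun x => \sum_b (h b b x - sl b x * h b i x)).
  by apply: (L2_sum mO) => b; exact: (L2B mO).
apply: le_trans (n2B mO Llap LS) _; rewrite /C2 mulrDl mul1r; apply: lerD; first by rewrite lerDl.
apply: le_trans (n2_sum mO _ (fun b => L2B mO (Lh b b) (Lsh b))) _.
rewrite -mulrA mulr_natl -[X in _ *+ X](card_ord N) -sumr_const; apply: ler_sum => b _.
apply: le_trans (n2B mO (Lh b b) (Lsh b)) _; rewrite -mulrA mulrDl mul1r; apply: lerD; first exact: h_bound.
by apply: le_trans (n2_slM b (Lh b i)) _; apply: ler_wpM2l.
Qed.

Definition chart_const : R := C1 + M * (C1 + M * C2).

(** Every entry reduces to the previous bounds through w_ab = h_ab - sl_a w_ib and w_ib = h_bi -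
    sl_b w_ii. *)
Lemma chart_hessian a b : n2 (w2 a b) <= chart_const * (P + W).
Proof.
pose X x := h a b x - sl a x * (h b i x - sl b x * w2 i i x).
have L1 : L2 (fun x => sl b x * w2 i i x) by exact: (L2_continuousM oO bO).
have L2' := L2B mO (Lh b i) L1.
have L3 : L2 (fun x => sl a x * (h b i x - sl b x * w2 i i x)) by exact: (L2_continuousM oO bO).
have E : aeq Omega (w2 a b) X.
  move: (sobolev2_sym oO bO sw i b); apply: filterS => x q Ox.
  by rewrite /X /h (q Ox); ring.
rewrite (aeq_n2 mO (Lw2 a b) (L2B mO (Lh a b) L3) E).
apply: le_trans (n2B mO (Lh a b) L3) _; rewrite /chart_const mulrDl; apply: lerD; first exact: h_bound.
apply: le_trans (n2_slM a L2') _; rewrite -mulrA; apply: ler_wpM2l => //.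
apply: le_trans (n2B mO (Lh b i) L1) _; rewrite mulrDl; apply: lerD; first exact: h_bound.
by apply: le_trans (n2_slM b (Lw2 i i)) _; rewrite -mulrA; apply: ler_wpM2l.
Qed.

End chart_estimate.

(** * Localization and the global Hessian estimate *)

Section localization.
Context {R : realType} {N : nat} (Omega : set 'rV[R]_N).
Hypothesis oO : open Omega.
Hypothesis bO : bounded_set Omega.
Implicit Types (u chi : 'rV[R]_N -> R) (i j a b : 'I_N).

Local Notation L2 := (L2 Omega).
Local Notation n2 := (n2 Omega).
Local Notation ip := (ip Omega).
Let mO : measurable Omega. Proof. exact: measurable_rV_open. Qed.

Lemma finite_bound (I : finType) (f : I -> 'rV[R]_N -> R) : (forall k, continuous (f k)) ->
  exists2 M : R, 0 <= M & forall k x, Omega x -> `|f k x| <= M.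
Proof.
move=> cf; have /choice[M hM] : forall k, exists m : R, 0 < m /\ forall x, Omega x -> `|f k x| <= m.
  by move=> k; have [C C0 hC] := continuous_bounded_O bO (cf k); exists C.
exists (\sum_k M k) => [|k x Ox]; first by apply: sumr_ge0 => k _; case: (hM k) => /ltW.
apply: (le_trans ((hM k).2 x Ox)); rewrite (bigD1 k)//= lerDl; apply: sumr_ge0 => l _.
by case: (hM l) => /ltW.
Qed.

Section localize.
Variables (chi u : 'rV[R]_N -> R) (d1 : 'I_N -> 'rV[R]_N -> R) (d2 : 'I_N -> 'I_N -> 'rV[R]_N -> R).

Definition loc1 i (x : 'rV[R]_N) : R := chi x * d1 i x + pderiv i chi x * u x.
(** The part of the Hessian of [chi u] in which at most one derivative falls on [u], absorbed as
    lower-order. *)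
Definition loc_rest i j (x : 'rV[R]_N) : R :=
  pderiv j chi x * d1 i x + (pderiv i chi x * d1 j x + pderiv j (pderiv i chi) x * u x).
Definition loc2 i j (x : 'rV[R]_N) : R := chi x * d2 i j x + loc_rest i j x.

Hypothesis cchi : forall k, Ck k chi.
Hypothesis su : sobolev2 Omega u d1 d2.
Hypothesis u0 : forall a, wd0 Omega a u (d1 a).

Let Lu : L2 u. Proof. by case: su. Qed.
Let L1 a : L2 (d1 a). Proof. by case: su => _ /(_ a). Qed.
Let Ld2 a b : L2 (d2 a b). Proof. by case: su => _ _ /(_ a b). Qed.
Let c0 : continuous chi := Ck_continuous (@cchi 0%N).
Let c1 a : continuous (pderiv a chi) := Ck_continuous (Ck_pderiv a (@cchi 1%N)).
Let c2 a b : continuous (pderiv b (pderiv a chi)) := Ck_continuous (Ck_pderiv b (Ck_pderiv a (@cchi 2%N))).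

Let LM (c v : 'rV[R]_N -> R) : continuous c -> L2 v -> L2 (fun x => c x * v x).
Proof. by move=> cc Lv; exact: (L2_continuousM oO bO). Qed.

Lemma L2_rest i j : L2 (loc_rest i j).
Proof. by apply: (L2D mO); [|apply: (L2D mO)]; exact: LM. Qed.

Lemma sobolev2_loc : sobolev2 Omega (fun x => chi x * u x) loc1 loc2.
Proof.
have [_ _ _ h1 h2] := su; split=> [|i|i j|i|i j].
- exact: LM.
- by apply: (L2D mO); exact: LM.
- by apply: (L2D mO); [exact: LM|exact: L2_rest].
- exact: (wdM oO bO (@cchi 1%N) Lu (L1 i) (h1 i)).
have e1 := wdM oO bO (@cchi 1%N) (L1 i) (Ld2 i j) (h2 i j).
have e2 := wdM oO bO (Ck_pderiv i (@cchi 2%N)) Lu (L1 j) (h1 j).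
have := wdD oO bO (LM c0 (L1 i)) (LM (@c1 i) Lu) (L2D mO (LM c0 (Ld2 i j)) (LM (@c1 j) (L1 i)))
   (L2D mO (LM (@c1 i) (L1 j)) (LM (@c2 i j) Lu)) e1 e2.
have <- : loc2 i j = (fun x => chi x * d2 i j x + pderiv j chi x * d1 i x + (pderiv i chi x * d1 j x + pderiv j (pderiv i chi) x * u x)) => //.
by apply/funext => x; rewrite /loc2 /loc_rest addrA.
Qed.

Lemma wd0_loc a : wd0 Omega a (fun x => chi x * u x) (loc1 a).
Proof. exact: (wd0M oO bO (@cchi 1%N) Lu (L1 a) (@u0 a)). Qed.

Lemma loc_support x0 (r : R) : 0 < r -> (forall y, chi y != 0 -> `|y - x0| <= r / 2) ->
  forall y, ~ (`|y - x0| <= r) ->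
  [/\ chi y * u y = 0, forall a, loc1 a y = 0 & forall a b, loc2 a b y = 0].
Proof.
move=> r0 sc y ny; pose A := [set z : 'rV[R]_N | r / 2 < `|z - x0|].
have oA : open A.
  rewrite (_ : A = ~` [set z : 'rV[R]_N | `|z - x0| <= r / 2]).
    by apply: closed_openC; apply: rV_compact_closed; exact: rV_ball_compact.
  by apply/seteqP; split=> z /=; rewrite /A /= ltNge => /negP.
have chi0 z : A z -> chi z = 0.
  by move=> Az; apply: contrapT => /eqP/sc; rewrite leNgt => /negP.
have chi1 a z : A z -> pderiv a chi z = 0.
  exact: (@pderiv_cst_on R N a chi A 0 oA (@cchi 1%N) chi0).
have chi2 a b z : A z -> pderiv b (pderiv a chi) z = 0.
  exact: (@pderiv_cst_on R N b _ A 0 oA (Ck_pderiv a (@cchi 2%N)) (chi1 a)).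
have Ay : A y by rewrite /A /= ltNge; apply/negP => h; apply: ny; apply: le_trans h _; lra.
split=> [|a|a b]; rewrite /loc1 /loc2 /loc_rest ?chi0// ?chi1// ?chi2// !mul0r ?addr0//.
Qed.

Variable M : R.
Hypothesis M0 : 0 <= M.
Hypothesis chiM : forall x, Omega x -> `|chi x| <= M.
Hypothesis dchiM : forall a x, Omega x -> `|pderiv a chi x| <= M.
Hypothesis ddchiM : forall a b x, Omega x -> `|pderiv b (pderiv a chi) x| <= M.

Local Notation lap := (fun x => \sum_a d2 a a x).
Let S : R := n2 lap + (\sum_a n2 (d1 a) + n2 u).
Let D1 : R := \sum_a n2 (d1 a).
Let D10 : 0 <= D1. Proof. by apply: sumr_ge0 => a _; exact: n2_ge0. Qed.
Let D1a a : n2 (d1 a) <= D1.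
Proof. by rewrite /D1 (bigD1 a)//= lerDl; apply: sumr_ge0 => c _; exact: n2_ge0. Qed.
Let Ll : L2 lap. Proof. exact: (L2_sum mO). Qed.

Let n2c (c v : 'rV[R]_N -> R) : continuous c -> (forall x, Omega x -> `|c x| <= M) -> L2 v ->
  n2 (fun x => c x * v x) <= M * n2 v.
Proof. by move=> cc hc Lv; apply: (n2M mO) => //; exact: measurable_continuous_on. Qed.

Let restS a b : n2 (loc_rest a b) <= 2 * M * S.
Proof.
have q1 := n2c (@c1 b) (@dchiM b) (L1 a); have q2 := n2c (@c1 a) (@dchiM a) (L1 b).
have q3 := n2c (@c2 a b) (@ddchiM a b) Lu.
have p1 := n2D mO (LM (@c1 b) (L1 a)) (L2D mO (LM (@c1 a) (L1 b)) (LM (@c2 a b) Lu)).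
have p2 := n2D mO (LM (@c1 a) (L1 b)) (LM (@c2 a b) Lu).
apply: le_trans p1 _; apply: le_trans (lerD q1 (le_trans p2 (lerD q2 q3))) _.
have a1 := ler_wpM2l M0 (D1a a); have a2 := ler_wpM2l M0 (D1a b).
have a3 := mulr_ge0 M0 (n2_ge0 Omega u); have a4 := mulr_ge0 M0 (n2_ge0 Omega lap).
rewrite /S -/D1; lra.
Qed.

Let lapS : n2 (fun x => \sum_a loc2 a a x) <= M * S + N%:R * (2 * M * S).
Proof.
have -> : (fun x => \sum_a loc2 a a x) = (fun x => chi x * lap x + \sum_a loc_rest a a x).
  by apply/funext => x; rewrite mulr_sumr -big_split.
have LR : L2 (fun x => \sum_a loc_rest a a x) by apply: (L2_sum mO) => a; exact: L2_rest.
apply: le_trans (n2D mO (LM c0 Ll) LR) _; apply: lerD.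
  apply: le_trans (n2c c0 chiM Ll) _; apply: ler_wpM2l => //.
  by rewrite /S lerDl addr_ge0 ?n2_ge0.
apply: le_trans (n2_sum mO _ (fun a => L2_rest a a)) _.
have -> : N%:R * (2 * M * S) = \sum_(a < N) (2 * M * S) by rewrite sumr_const card_ord mulr_natl.
by apply: ler_sum => a _; exact: restS.
Qed.

Let loc1S : \sum_a n2 (loc1 a) <= N%:R * (M * S).
Proof.
have -> : N%:R * (M * S) = \sum_(a < N) (M * S) by rewrite sumr_const card_ord mulr_natl.
apply: ler_sum => a _; have q1 := n2c c0 chiM (L1 a); have q2 := n2c (@c1 a) (@dchiM a) Lu.
apply: le_trans (n2D mO (LM c0 (L1 a)) (LM (@c1 a) Lu)) _; apply: le_trans (lerD q1 q2) _.
rewrite -mulrDr; apply: ler_wpM2l => //; have := D1a a; have := n2_ge0 Omega lap.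
by rewrite /S -/D1; lra.
Qed.

Lemma loc_hessian (c : R) a b : 0 <= c ->
  n2 (loc2 a b) <= c * (n2 (fun x => \sum_a loc2 a a x) + \sum_a n2 (loc1 a)) ->
  n2 (fun x => chi x * d2 a b x) <= (c * (M + N%:R * (2 * M) + N%:R * M) + 2 * M) * S.
Proof.
move=> c0' h; have L2' : L2 (loc2 a b) by case: sobolev2_loc => _ _ /(_ a b).
rewrite (@eq_n2 _ _ _ _ (fun x => loc2 a b x - loc_rest a b x)); last first.
  by move=> x _; rewrite /loc2 addrK.
apply: le_trans (n2B mO L2' (L2_rest a b)) _; apply: le_trans (lerD h (restS a b)) _.
rewrite [leRHS]mulrDl lerD2r -mulrA; apply: ler_wpM2l => //.
apply: le_trans (lerD lapS loc1S) _.
by move: (S) => z; rewrite (_ : M * z + N%:R * (2 * M * z) + N%:R * (M * z) = (M + N%:R * (2 * M) + N%:R * M) * z)//; ring.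
Qed.

End localize.

(** All constants come from sup bounds on [Omega] for the slopes, [chi] and their derivatives, so
    [C] does not depend on [u]. *)
Lemma local_hessian x0 (r : R) i (s : R) theta chi : chart Omega x0 r i s theta ->
  (forall k, Ck k chi) -> (forall y, chi y != 0 -> `|y - x0| <= r / 8 / 2) ->
  exists C : R, forall u d1 d2, sobolev2 Omega u d1 d2 -> (forall a, wd0 Omega a u (d1 a)) ->
  forall a b, n2 (fun x => chi x * d2 a b x) <=
    C * (n2 (fun x => \sum_a d2 a a x) + (\sum_a n2 (d1 a) + n2 u)).
Proof.
move=> ch cchi schi; have r0 : 0 < r by case: ch.
have csl j := Ck_slope ch j.
have [M1 M10 h1] := finite_bound (fun j => Ck_continuous (csl j)).
have [M2 M20 h2] := finite_bound (fun p : 'I_N * 'I_N => Ck_continuous (Ck_pderiv p.2 (csl p.1))).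
have [M3 M30 h3] := finite_bound (fun _ : unit => Ck_continuous (@cchi 0%N)).
have [M4 M40 h4] := finite_bound (fun a => Ck_continuous (Ck_pderiv a (@cchi 1%N))).
have [M5 M50 h5] := finite_bound (fun p : 'I_N * 'I_N => Ck_continuous (Ck_pderiv p.2 (Ck_pderiv p.1 (@cchi 2%N)))).
pose M : R := M1 + M2 + (M3 + M4 + M5).
have M0 : 0 <= M by rewrite /M; lra.
exists (@chart_const R N M * (M + N%:R * (2 * M) + N%:R * M) + 2 * M) => u d1 d2 su u0 a b.
have r8 : 0 < r / 8 by rewrite divr_gt0.
apply: loc_hessian => //.
- by move=> x Ox; apply: le_trans (h3 tt x Ox) _; rewrite /M; lra.
- by move=> c x Ox; apply: le_trans (h4 c x Ox) _; rewrite /M; lra.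
- by move=> c d x Ox; apply: le_trans (h5 (c, d) x Ox) _; rewrite /M; lra.
- by rewrite /chart_const; repeat first [exact: M0|exact: ler0n|exact: ler01|apply: addr_ge0|apply: mulr_ge0].
apply: (chart_hessian oO bO ch M0) => //.
- by move=> j x Ox; apply: le_trans (h1 j x Ox) _; rewrite /M; lra.
- by move=> j c x Ox; apply: le_trans (h2 (j, c) x Ox) _; rewrite /M; lra.
- exact: sobolev2_loc.
- by move=> c; apply: wd0_loc => //; exact: su.
- exact: loc_support.
Qed.

End localization.

(** The local estimates bound the Hessian by the Laplacian and lower-order terms. Green's identity
    gives ||d_a u||^2 <= ||u|| P, and Poincare gives ||u|| <= Cp ||d_0 u||; together they bound the
    lower-order terms by P alone. *)
Lemma hessian_estimate (R : realType) n (Omega : set 'rV[R]_n.+1) (eta : R) :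
  open Omega -> bounded_set Omega -> Ck_holder_boundary 4 eta Omega ->
  exists2 C : R, 0 < C & forall u d1 d2, sobolev2 Omega u d1 d2 -> h10 Omega u d1 ->
  let P := n2 Omega (fun x => \sum_a d2 a a x) in
  [/\ n2 Omega u <= C * P, forall a, n2 Omega (d1 a) <= C * P &
      forall a b, n2 Omega (d2 a b) <= C * P].
Proof.
move=> oO bO hreg; have mO : measurable Omega by exact: measurable_rV_open.
pose Good (chi : 'rV[R]_n.+1 -> R) := continuous chi /\ exists C : R, forall u d1 d2, sobolev2 Omega u d1 d2 ->
  (forall a, wd0 Omega a u (d1 a)) -> forall a b, n2 Omega (fun x => chi x * d2 a b x) <=
    C * (n2 Omega (fun x => \sum_a d2 a a x) + (\sum_a n2 Omega (d1 a) + n2 Omega u)).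
have [|m [F [gF cov]]] := @cover_cutoffs _ _ Omega bO Good.
  move=> x cx; have [r [i [s [theta ch]]]] := chart_exists oO bO hreg cx.
  have r0 : 0 < r by case: ch.
  have r16 : 0 < r / 8 / 2 by rewrite !divr_gt0.
  have [chi [cchi c1 c0]] := cutoff x r16.
  exists (r / 8 / 2 / 2); first exact: divr_gt0.
  exists chi; last by move=> y yx; apply: c1; exact: ltW.
  split; first exact: Ck_continuous (@cchi 0%N).
  exact: (local_hessian oO bO ch cchi c0).
have /choice[K hK] : forall k, exists C : R, 0 <= C /\ forall u d1 d2, sobolev2 Omega u d1 d2 ->
  (forall a, wd0 Omega a u (d1 a)) -> forall a b, n2 Omega (fun x => F k x * d2 a b x) <=
    C * (n2 Omega (fun x => \sum_a d2 a a x) + (\sum_a n2 Omega (d1 a) + n2 Omega u)).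
  move=> k; have [_ [C hC]] := gF k; exists `|C|; split=> // u d1 d2 su u0 a b.
  apply: le_trans (hC u d1 d2 su u0 a b) _; apply: ler_wpM2r (ler_norm _).
  by rewrite !addr_ge0 ?n2_ge0//; apply: sumr_ge0 => c _; exact: n2_ge0.
have [Cp Cp0 hp] := h10_poincare oO bO ord0.
pose CK : R := \sum_k K k; have CK0 : 0 <= CK by apply: sumr_ge0 => k _; case: (hK k).
pose C : R := Cp ^+ 2 + Cp + CK * (1 + (n.+1%:R * Cp + Cp ^+ 2)).
have nC : 0 <= n.+1%:R * Cp + Cp ^+ 2 by rewrite addr_ge0 ?mulr_ge0 ?ltW// exprn_gt0.
have C3 : 0 <= CK * (1 + (n.+1%:R * Cp + Cp ^+ 2)) := mulr_ge0 CK0 (addr_ge0 ler01 nC).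
have C2 : 0 < Cp ^+ 2 by rewrite exprn_gt0.
exists C => [|u d1 d2 su hu P]; first by rewrite /C; lra.
have [Lu L1 Ld2 _ _] := su.
have P0 : 0 <= P by exact: n2_ge0.
have LP : L2 Omega (fun x => \sum_a d2 a a x) by exact: (L2_sum mO).
have p0 := hp u d1 Lu L1 hu.
have grad a : n2 Omega (d1 a) ^+ 2 <= n2 Omega u * P.
  apply: (@le_trans _ _ (\sum_a ip Omega (d1 a) (d1 a))).
    rewrite n2_sqr (bigD1 a)//= lerDl; apply: sumr_ge0 => c _; exact: ip_ge0.
  rewrite (h10_ip_laplacian oO bO su hu); apply: le_trans (ler_norm _) _; rewrite normrN.
  exact: (cauchy_schwarz mO).
(* ||d_0 u||^2 <= ||u|| P <= Cp ||d_0 u|| P, and one factor cancels. *)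
have g0 : n2 Omega (d1 ord0) <= Cp * P.
  have := n2_ge0 Omega (d1 ord0); rewrite le_eqVlt => /orP[/eqP<-|q0]; first by rewrite mulr_ge0// ltW.
  rewrite -(ler_pM2l q0) -expr2; apply: le_trans (grad ord0) _.
  by rewrite mulrA (mulrC _ Cp); apply: ler_wpM2r.
have gU : n2 Omega u <= Cp ^+ 2 * P.
  by apply: le_trans p0 _; rewrite expr2 -mulrA; apply: ler_wpM2l => //; exact: ltW.
have gD a : n2 Omega (d1 a) <= Cp * P.
  rewrite -(ler_pXn2r (n := 2)) ?nnegrE ?n2_ge0 ?(mulr_ge0 (ltW Cp0) P0)//.
  apply: le_trans (grad a) _; rewrite exprMn [P ^+ 2]expr2 mulrA.
  by apply: ler_wpM2r.
split=> [|a|a b].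
- apply: le_trans gU _; apply: ler_wpM2r => //; rewrite /C; lra.
- apply: le_trans (gD a) _; apply: ler_wpM2r => //; rewrite /C; lra.
have u0 c : wd0 Omega c u (d1 c) := h10_wd0 oO bO Lu L1 hu.
have cF k : continuous (F k) by case: (gF k).
have LF k : L2 Omega (fun x => F k x * d2 a b x) by exact: (L2_continuousM oO bO).
have LFn k : L2 Omega (fun x => `|F k x * d2 a b x|).
  apply: (@L2_le _ _ _ mO 1 _ _ (LF k)) => [|x _]; last by rewrite mul1r normr_id.
  by apply: measurableT_comp => //; exact: L2_measurable.
have nFn k : n2 Omega (fun x => `|F k x * d2 a b x|) = n2 Omega (fun x => F k x * d2 a b x).
  by congr Num.sqrt; apply: eq_Rintegral => x _; rewrite -normrM -!expr2 ger0_norm// sqr_ge0.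
(* At each point of [Omega] some [F k] equals one, so the sum of the absolute values dominates the
   Hessian entry. *)
apply: (@le_trans _ _ (\sum_k n2 Omega (fun x => F k x * d2 a b x))).
  under eq_bigr do rewrite -nFn.
  apply: le_trans (n2_sum mO _ LFn); rewrite -[leRHS]mul1r; apply: (n2_le mO) => //.
  - exact: (L2_sum mO).
  - exact: L2_measurable.
  move=> x Ox; rewrite mul1r [X in _ <= X]ger0_norm; last by apply: sumr_ge0.
  have [k Fk] := cov x Ox; rewrite (bigD1 k)//= Fk mul1r lerDl.
  by apply: sumr_ge0.
apply: (@le_trans _ _ (CK * (P + (\sum_a n2 Omega (d1 a) + n2 Omega u)))).
  by rewrite mulr_suml; apply: ler_sum => k _; exact: (hK k).2.
apply: (@le_trans _ _ (CK * (1 + (n.+1%:R * Cp + Cp ^+ 2)) * P)); last first.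
  apply: ler_wpM2r => //; rewrite /C; lra.
rewrite -mulrA; apply: ler_wpM2l => //; rewrite mulrDl mul1r lerD2l mulrDl; apply: lerD => //.
have -> : n.+1%:R * Cp * P = \sum_(a < n.+1) Cp * P by rewrite sumr_const card_ord -mulrA mulr_natl.
by apply: ler_sum => c _; exact: gD.
Qed.

(** * The L^4 norm *)

Section L4_norm.
Context {R : realType} {N : nat} (Omega : set 'rV[R]_N).
Hypothesis mO : measurable Omega.
Implicit Types (f g : 'rV[R]_N -> R).
Local Notation L2 := (L2 Omega).
Local Notation n2 := (n2 Omega).
Local Notation ip := (ip Omega).

Definition L4 f := measurable_fun Omega f /\ L2 (fun x => f x ^+ 2).
(** The L^4 norm, written through the L^2 norm of the square so that its properties reduce to those
    of L^2. *)
Definition n4 f : R := Num.sqrt (n2 (fun x => f x ^+ 2)).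

Lemma n4_ge0 f : 0 <= n4 f. Proof. exact: sqrtr_ge0. Qed.

Lemma n4_sqr f : n4 f ^+ 2 = n2 (fun x => f x ^+ 2).
Proof. by rewrite sqr_sqrtr// n2_ge0. Qed.

Lemma L4_mul f g : L4 f -> L4 g -> L2 (fun x => f x * g x) /\
  n2 (fun x => f x * g x) <= n4 f * n4 g.
Proof.
move=> [mf Lf] [mg Lg].
have L : L2 (fun x => f x * g x).
  apply: (L2_le (C := 1) mO (L2D mO Lf Lg)); first exact: measurable_funM.
  move=> x _; rewrite mul1r [leRHS]ger0_norm ?addr_ge0 ?sqr_ge0//.
  rewrite ler_norml; apply/andP; split.
    by have := sqr_ge0 (f x + g x); have := sqr_ge0 (f x); have := sqr_ge0 (g x); lra.
  by have := sqr_ge0 (f x - g x); have := sqr_ge0 (f x); have := sqr_ge0 (g x); lra.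
split=> //; rewrite -(ler_pXn2r (n := 2)) ?nnegrE ?n2_ge0 ?(mulr_ge0 (n4_ge0 f) (n4_ge0 g))//.
rewrite exprMn !n4_sqr n2_sqr.
have -> : ip (fun x => f x * g x) (fun x => f x * g x) = ip (fun x => f x ^+ 2) (fun x => g x ^+ 2).
  by apply: eq_Rintegral => x _; ring.
by apply: le_trans (ler_norm _) _; exact: (cauchy_schwarz mO).
Qed.

Lemma L4D f g : L4 f -> L4 g -> L4 (fun x => f x + g x) /\ n4 (fun x => f x + g x) <= n4 f + n4 g.
Proof.
move=> Lf Lg; have [Lfg hfg] := L4_mul Lf Lg; have [mf Lf2] := Lf; have [mg Lg2] := Lg.
have E : (fun x => (f x + g x) ^+ 2) = (fun x => (f x ^+ 2 + 2 * (f x * g x)) + g x ^+ 2).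
  by apply/funext => x; ring.
have LS := L2D mO Lf2 (L2Z mO 2 Lfg).
have L : L2 (fun x => (f x + g x) ^+ 2) by rewrite E; exact: (L2D mO).
split; first by split=> //; exact: measurable_funD.
rewrite -(ler_pXn2r (n := 2)) ?nnegrE ?n4_ge0 ?(addr_ge0 (n4_ge0 f) (n4_ge0 g))//.
rewrite n4_sqr sqrrD !n4_sqr E; apply: le_trans (n2D mO LS Lg2) _; rewrite lerD2r.
apply: le_trans (n2D mO Lf2 (L2Z mO 2 Lfg)) _; rewrite lerD2l (n2Z mO)// ger0_norm//.
by rewrite -[leRHS]mulr_natl; apply: ler_wpM2l.
Qed.

Lemma L4_le f g : L4 g -> measurable_fun Omega f -> (forall x, Omega x -> `|f x| <= `|g x|) ->
  L4 f /\ n4 f <= n4 g.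
Proof.
move=> [mg Lg] mf fg; have h x : Omega x -> `|f x ^+ 2| <= 1 * `|g x ^+ 2|.
  by move=> Ox; rewrite mul1r !normrX ler_pXn2r ?nnegrE// fg.
have mf2 : measurable_fun Omega (fun x => f x ^+ 2) by exact: measurable_funX.
split; first by split=> //; exact: (L2_le mO Lg mf2 h).
by rewrite /n4 ler_wsqrtr// -[leRHS]mul1r; exact: (n2_le mO).
Qed.

Lemma L4_0 : L4 (fun=> 0) /\ n4 (fun=> 0) = 0.
Proof.
have E : (fun _ : 'rV[R]_N => (0 : R) ^+ 2) = (fun=> 0) by apply/funext => x; rewrite expr0n.
by rewrite /L4 /n4 E n2_0 sqrtr0; split=> //; split; [exact: measurable_cst|exact: L20].
Qed.

Lemma L4_sum (I : Type) (l : seq I) (F : I -> 'rV[R]_N -> R) : (forall a, L4 (F a)) ->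
  L4 (fun x => \sum_(a <- l) F a x) /\ n4 (fun x => \sum_(a <- l) F a x) <= \sum_(a <- l) n4 (F a).
Proof.
move=> LF; elim: l => [|a l [IH1 IH2]].
  by rewrite big_nil; under eq_fun do rewrite big_nil; have [h ->] := L4_0.
have [h1 h2] := L4D (LF a) IH1; rewrite big_cons; under eq_fun do rewrite big_cons.
by split=> //; apply: le_trans h2 _; rewrite lerD2l.
Qed.

(** Interpolation: the square of the L^4 norm is at most the sup norm times the L^2 norm. *)
Lemma n4_bound f (B0 B1 : R) : L2 f -> 0 <= B0 -> (forall x, Omega x -> `|f x| <= B0) ->
  n2 f <= B1 -> L4 f /\ n4 f ^+ 2 <= B0 * B1.
Proof.
move=> Lf B00 fB fB1; have mf := L2_measurable Lf; split.
  by split=> //; under eq_fun do rewrite expr2; exact: (L2M mO mf fB).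
rewrite n4_sqr; apply: le_trans (ler_wpM2l B00 fB1).
under [leLHS]eq_n2 do rewrite expr2.
exact: (n2M mO).
Qed.

End L4_norm.

(** * Differences of consecutive mollifiers as derivatives of small kernels *)

Section telescoping_kernels.
Context {R : realType} {N : nat}.
Variables (a b : 'I_N -> R).
Hypothesis ab : forall i, a i + 1 <= b i.
Implicit Types (i j : 'I_N) (l : nat).

Let ab' i : a i < b i. Proof. by have := ab i; lra. Qed.

(** An antiderivative of the difference of two consecutive one-variable mollifiers; it has compact
    support because both have mass one. *)
Definition dramp l j (t : R) : R := ramp (a j) (b j) (scale l.+1) t - ramp (a j) (b j) (scale l) t.

(** The kernel whose derivative in the direction [i] is the i-th term of the telescoped difference
    of product mollifiers; see [telk_telescope]. *)
Definition telk l i : 'I_N -> R -> R := fun j =>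
  if (j < i)%N then moll a b l.+1 j else if j == i then dramp l i else moll a b l j.

Lemma smooth1_dramp l j : smooth1 (dramp l j).
Proof.
have -> : dramp l j = ramp (a j) (b j) (scale l.+1) \+ (cst (-1) \* ramp (a j) (b j) (scale l)).
  by apply/funext => t; rewrite /dramp /= mulN1r.
apply: smooth1D; first exact: smooth1_ramp.
by apply: smooth1M; [exact: smooth1_cst|exact: smooth1_ramp].
Qed.

Lemma derive1_dramp l j : derive1 (dramp l j) = (fun t => moll a b l.+1 j t - moll a b l j t).
Proof.
apply/funext => t; rewrite derive1E; have h : is_derive t 1 (dramp l j) (moll a b l.+1 j t - moll a b l j t).
  by apply: is_deriveB; exact: is_derive_ramp.
by case: h.
Qed.

Lemma scaleS l : @scale R l.+1 = 16 * scale l. Proof. exact: exprS. Qed.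

(** The support lies in the hull of the intervals of the two levels, whence the comparison with 0.
    The last two clauses retain that an interval on one side of the origin keeps the support away
    from it. *)
Lemma dramp_supp l j t : dramp l j t != 0 ->
  [/\ Num.min (a j) 0 <= scale l * t <= Num.max (b j) 0,
      0 < a j -> a j <= scale l.+1 * t & b j < 0 -> scale l.+1 * t <= b j].
Proof.
have s0 := @scale_gt0 R l; have s1 := @scale_gt0 R l.+1; have ss := scaleS l.
have mono : (0 <= t -> scale l * t <= scale l.+1 * t) /\ (t <= 0 -> scale l.+1 * t <= scale l * t).
  by split=> ht; have := mulr_ge0 (ltW s0) (normr_ge0 t); rewrite ?(ger0_norm ht) ?(ler0_norm ht) ss; lra.
have [m1 m2] := mono; have sg : 0 <= t -> 0 <= scale l * t by move=> ht; exact: (mulr_ge0 (ltW s0) ht).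
have sn : t <= 0 -> scale l * t <= 0 by move=> ht; exact: (mulr_ge0_le0 (ltW s0) ht).
have aj := ab' j.
have lo : scale l * t <= a j -> scale l.+1 * t <= a j -> dramp l j t = 0.
  by move=> h1 h2; rewrite /dramp !ramp_eq0// subrr.
have hi : b j <= scale l * t -> b j <= scale l.+1 * t -> dramp l j t = 0.
  by move=> h1 h2; rewrite /dramp !ramp_eq1// subrr.
move=> nz; have t0 := le_total 0 t; split.
- rewrite ge_min le_max; apply/andP; split.
    apply: contraNT nz; rewrite negb_or -!ltNge => /andP[h1 h2].
    have tn : t <= 0 by rewrite leNgt; apply/negP => /ltW/sg; lra.
    by apply/eqP/lo; [exact: ltW|apply: le_trans (m2 tn) (ltW h1)].
  apply: contraNT nz; rewrite negb_or -!ltNge => /andP[h1 h2].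
  have tp : 0 <= t by rewrite leNgt; apply/negP => /ltW/sn; lra.
  by apply/eqP/hi; [exact: ltW|apply: le_trans (ltW h1) (m1 tp)].
- move=> a0; rewrite leNgt; apply: contra nz => h; apply/eqP/lo; last exact: ltW.
  by case/orP: t0 => [/m1|/sn]; lra.
move=> b0; rewrite leNgt; apply: contra nz => h; apply/eqP/hi; last exact: ltW.
by case/orP: t0 => [/sg|/m2]; lra.
Qed.

Lemma telk_supp l i j t : telk l i j t != 0 ->
  [/\ Num.min (a j) 0 <= scale l * t <= Num.max (b j) 0,
      0 < a j -> a j <= scale l.+1 * t & b j < 0 -> scale l.+1 * t <= b j].
Proof.
rewrite /telk; have s0 := @scale_gt0 R l; have ss := scaleS l.
case: ifP => [_|_].
  move=> /(moll_supp ab') /andP[h1 h2]; split=> //; rewrite ge_min le_max; apply/andP; split.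
    by have [a0|a0] := leP (a j) (scale l * t) => //=; move: h1 a0; rewrite ss; lra.
  by have [a0|a0] := leP (scale l * t) (b j) => //=; move: h2 a0; rewrite ss; lra.
have [->|_] := eqVneq j i; first exact: dramp_supp.
move=> /(moll_supp ab') /andP[h1 h2]; rewrite ge_min le_max h1 h2; split=> // h.
  by rewrite ss; lra.
by rewrite ss; lra.
Qed.

Lemma smooth1_telk l i j : smooth1 (telk l i j).
Proof.
rewrite /telk; case: ifP => _; first exact: moll_smooth.
by case: ifP => _; [exact: smooth1_dramp|exact: moll_smooth].
Qed.

Lemma telk_kernel l i : smooth_kernel (telk l i).
Proof.
split=> [j|]; first exact: smooth1_telk.
exists (\sum_j (`|Num.min (a j) 0| + `|Num.max (b j) 0|)) => j t; have s1 := @scale_ge1 R l.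
apply: contraTeq => /telk_supp[/andP[h1 h2] _ _]; rewrite -leNgt.
apply: (@le_trans _ _ `|scale l * t|).
  by rewrite normrM ler_peMl// ger0_norm// ltW// scale_gt0.
rewrite (bigD1 j)//=; have S0 : 0 <= \sum_(k | k != j) (`|Num.min (a k) 0| + `|Num.max (b k) 0|).
  by apply: sumr_ge0 => k _; rewrite addr_ge0.
rewrite ler_norml; have := ler_norm (Num.max (b j) 0); have := ler_norm (- Num.min (a j) 0).
rewrite normrN; have := normr_ge0 (Num.max (b j) 0); have := normr_ge0 (Num.min (a j) 0).
by move=> *; apply/andP; split; lra.
Qed.

Lemma telk_telescope l (x : 'rV[R]_N) : prodf (moll a b l.+1) x - prodf (moll a b l) x =
  \sum_i prodf (updf (telk l i) i (derive1 (telk l i i))) x.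
Proof.
rewrite /prodf prod_telescope; apply: eq_bigr => i _; apply: eq_bigr => j _.
rewrite /updf; have [->|ne] := eqVneq j i.
  by rewrite ltnn [telk l i i](_ : _ = dramp l i) ?derive1_dramp// /telk ltnn eqxx.
by rewrite /telk (negPf ne); case: ifP.
Qed.

Lemma telk_bound : exists2 D : R, 1 <= D & forall l i j t,
  `|telk l i j t| <= if j == i then 1 else scale l * (16 * D).
Proof.
have [D D0 hD] := @derive1_step_bound R; exists (D + 1) => [|l i j t]; first by lra.
have s0 := @scale_gt0 R l.
have hm l' t' : `|moll a b l' j t'| <= scale l' * D.
  have sl' := @scale_gt0 R l'.
  apply: le_trans (bumpeta_le t' (ab' j) sl' hD) _; apply: ler_wpM2r; first exact: ltW.
  by rewrite ler_pdivrMr ?subr_gt0// ler_peMr ?(ltW sl')//; have := ab j; lra.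
have sD := mulr_ge0 (ltW s0) (ltW D0).
rewrite /telk; case: ifP => [ji|_].
  rewrite -val_eqE /= (ltn_eqF ji); apply: le_trans (hm l.+1 t) _; rewrite scaleS; lra.
case: ifP => [/eqP ji|_]; last by apply: le_trans (hm l t) _; lra.
rewrite /dramp ler_norml.
have := ramp_ge0 (a i) (b i) (scale l.+1) t; have := ramp_le1 (a i) (b i) (scale l.+1) t.
have := ramp_ge0 (a i) (b i) (scale l) t; have := ramp_le1 (a i) (b i) (scale l) t.
by move=> *; apply/andP; split; lra.
Qed.

End telescoping_kernels.

Section telescope_estimate.
Context {R : realType} {n : nat} (Omega : set 'rV[R]_n.+1).
Hypothesis n2' : (n <= 2)%N.
Hypothesis oO : open Omega.
Hypothesis bO : bounded_set Omega.
Variables (a b : 'I_n.+1 -> R).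
Hypothesis ab : forall i, a i + 1 <= b i.
Let mO : measurable Omega. Proof. exact: measurable_rV_open. Qed.

(** Let q = 16^l. The kernel is O(q^n) on a box of volume O(q^(-n-1)), so its rows and columns have
    mass O(1/q). The L^2 to L^2 norm is thus O(1/q) and, as n <= 2, the L^2 to sup norm is
    O(q^(1/2)). Interpolating gives O(q^(-1/4)) = O(2^(-l)). *)
Lemma telk_n4 : exists2 C : R, 0 <= C & forall l i h, L2 Omega h ->
  L4 Omega (convol Omega (telk a b l i) h) /\ n4 Omega (convol Omega (telk a b l i) h) <= C * 2^-1 ^+ l * n2 Omega h.
Proof.
have [D D1 hD] := telk_bound ab.
pose E : R := (16 * D) ^+ n; have E0 : 0 <= E by rewrite exprn_ge0//; lra.
pose wd j : R := Num.max (b j) 0 - Num.min (a j) 0.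
have wd0 j : 0 <= wd j.
  by rewrite /wd subr_ge0 ge_min; apply/orP; right; rewrite le_max lexx orbT.
pose Wd : R := \prod_j wd j; have Wd0 : 0 <= Wd by apply: prodr_ge0.
pose K : R := E * E * Wd * Num.sqrt Wd; have K0 : 0 <= K by rewrite !mulr_ge0 ?sqrtr_ge0.
exists (Num.sqrt K) => [|l i h Lh]; first exact: sqrtr_ge0.
have q0 := @scale_gt0 R l; have q1 := @scale_ge1 R l; set q := @scale R l in q0 q1.
pose Cj (j : 'I_n.+1) : R := if j == i then 1 else q * (16 * D).
have prodC : \prod_j Cj j = E * q ^+ n.
  rewrite (bigD1 i)//= /Cj eqxx mul1r (eq_bigr (fun=> q * (16 * D))); last by move=> j /negPf ->.
  by rewrite prodr_const cardC1 card_ord /= exprMn mulrC.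
have kk := telk_kernel ab l i; have [sk _] := kk.
pose lo j := Num.min (a j) 0 / q; pose hi j := Num.max (b j) 0 / q.
have prodW : \prod_j (hi j - lo j) = Wd / q ^+ n.+1.
  rewrite /Wd -[q ^+ n.+1](_ : \prod_(j < n.+1) q = _); last by rewrite prodr_const card_ord.
  by rewrite -prodf_div; apply: eq_bigr => j _; rewrite /hi /lo -mulrBl.
have lohi j : lo j <= hi j by rewrite -subr_ge0 /hi /lo -mulrBl; apply: mulr_ge0 (wd0 j) _; rewrite invr_ge0 ltW.
have [|row col] := mass_box oO sk lohi _ (fun j t => hD l i j t).
  move=> j t /(telk_supp ab)[/andP[h1 h2] _ _].
  by rewrite /lo /hi ler_pdivrMr// ler_pdivlMr// (mulrC t) h1.
pose A : R := E * Wd / q.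
have EA : \prod_j Cj j * \prod_j (hi j - lo j) = A.
  rewrite prodC prodW /A exprS; field.
  by have qn0 : q != 0 := lt0r_neq0 q0; rewrite qn0 expf_neq0.
have A0 : 0 <= A by rewrite !mulr_ge0// invr_ge0 ltW.
rewrite -[\prod_i0 (if i0 == i then 1 else _)]/(\prod_j Cj j) EA in row col.
have sup x y : `|prodf (shiftf (telk a b l i) x) y| <= E * q ^+ n.
  by rewrite prodf_shiftE /prodf normr_prod -prodC; apply: ler_prod => j _; rewrite normr_ge0 hD.
(* The bound on the dimension n + 1 enters here. *)
have qn : q ^+ n <= q ^+ 2 by rewrite ler_weXn2l.
have Lc : L2 Omega (convol Omega (telk a b l i) h).
  by apply: (L2_continuous oO bO); exact: (continuous_conv oO bO).
pose B0 : R := E * Num.sqrt Wd * 4 ^+ l * n2 Omega h.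
have B00 : 0 <= B0 by rewrite !mulr_ge0 ?sqrtr_ge0 ?n2_ge0// exprn_ge0.
(* 4^l is the square root of q occurring in [B0]. *)
have q4 : q = 4 ^+ l * 4 ^+ l by rewrite /q /scale -exprMn; congr (_ ^+ _); lra.
have hB0 x : Omega x -> `|convol Omega (telk a b l i) h x| <= B0.
  move=> _; rewrite -(ler_pXn2r (n := 2)) ?nnegrE// real_normK ?num_real// -lee_fin.
  apply: le_trans (conv_sqr_le oO bO kk Lh (row x)) _.
  apply: (@le_trans _ _ (A%:E * ((E * q ^+ n)%:E * (n2 Omega h ^+ 2)%:E))%E).
    apply: lee_wpmul2l; first by rewrite lee_fin.
    rewrite -(integral_sqr_n2 mO Lh) -ge0_integralZl//.
    - apply: ge0_le_integral => //.
      + by move=> y _; rewrite lee_fin mulr_ge0// sqr_ge0.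
      + apply/measurable_EFinP; apply: measurable_funM; last by apply: measurable_funX; exact: L2_measurable.
        apply: measurable_funS (measurable_normr_continuous _) => //.
        exact/continuous_prodf/smooth1_shift.
      + apply/(measurable_EFinP _ (fun y => E * q ^+ n * h y ^+ 2)); apply: measurable_funM => //.
        by apply: measurable_funX; exact: L2_measurable.
      by move=> y _; rewrite -EFinM lee_fin; apply: ler_wpM2r; [exact: sqr_ge0|exact: sup].
    - by apply/(measurable_EFinP _ (fun y => h y ^+ 2)); apply: measurable_funX; exact: L2_measurable.
    - by move=> y _; rewrite lee_fin sqr_ge0.
    by rewrite lee_fin mulr_ge0// exprn_ge0// ltW.
  rewrite -!EFinM lee_fin.
  apply: (@le_trans _ _ (A * (E * q ^+ 2 * n2 Omega h ^+ 2))).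
    apply: ler_wpM2l => //; apply: ler_wpM2r; first exact: sqr_ge0.
    exact: ler_wpM2l.
  have k1 (e t f m : R) : (e * t * f * m) ^+ 2 = e ^+ 2 * t ^+ 2 * (f * f) * m ^+ 2 by ring.
  rewrite /B0 (k1 E (Num.sqrt Wd) (4 ^+ l) (n2 Omega h)) (sqr_sqrtr Wd0) -q4 /A.
  have k2 (e t m p : R) : p != 0 -> e * t / p * (e * p ^+ 2 * m) = e ^+ 2 * t * p * m.
    by move=> p0; field.
  by rewrite (k2 E Wd (n2 Omega h ^+ 2) q) ?gt_eqF.
have [L4c h4] := n4_bound mO Lc B00 hB0 (schur oO bO kk A0 row col Lh).
split=> //; rewrite -(ler_pXn2r (n := 2)) ?nnegrE ?n4_ge0//; last first.
  by rewrite !mulr_ge0 ?sqrtr_ge0 ?n2_ge0// exprn_ge0// invr_ge0.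
apply: le_trans h4 _.
have p2 : 2^-1 ^+ l ^+ 2 = (4 ^+ l)^-1 :> R.
  by rewrite exprAC -[RHS]exprVn; congr (_ ^+ _); field.
have p0 : 4 ^+ l != 0 :> R by rewrite expf_neq0.
have k3 (e t f m z : R) : f != 0 -> e * t ^+ 2 = e * z ->
    e * t * f * m * (e * z / (f * f) * m) = e * e * z * t * f^-1 * m ^+ 2.
  by move=> f0 _; field.
have k4 (e t m : R) : (e * t * m) ^+ 2 = e ^+ 2 * t ^+ 2 * m ^+ 2 by ring.
rewrite (k4 (Num.sqrt K) (2^-1 ^+ l) (n2 Omega h)) (sqr_sqrtr K0) p2 /B0 /A q4.
by rewrite (k3 E (Num.sqrt Wd) _ (n2 Omega h) Wd)// (sqr_sqrtr Wd0).
Qed.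

End telescope_estimate.

(** * Compact embedding of W^{1,2} into L^4 *)

Lemma half_pow_small (R : realType) (c e : R) (l0 : nat) : 0 <= c -> 0 < e ->
  exists2 l, (l0 <= l)%N & c * 2^-1 ^+ l <= e.
Proof.
move=> c0 e0; exists (maxn l0 (Num.truncn (c / e)).+1); first exact: leq_maxl.
set l := maxn _ _; have p0 : 0 < 2 ^+ l :> R by rewrite exprn_gt0.
rewrite exprVn ler_pdivrMr// mulrC -ler_pdivrMr//; apply: ltW.
apply: lt_le_trans (truncnS_gt _) _.
apply: (@le_trans _ _ l%:R); first by rewrite ler_nat leq_maxr.
by rewrite -natrX ler_nat ltnW// ltn_expl.
Qed.

Lemma transpose_algebra' (V : zmodType) (a b c : V) : c - a = - b -> a = b + c.
Proof. by move=> h; rewrite -[b]opprK -h opprB subrK. Qed.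

Lemma eq_le_norm (R : numDomainType) (x y : R) : x = y -> `|x| <= `|y|.
Proof. by move=> ->. Qed.

Section chart_L4.
Context {R : realType} {n : nat} (Omega : set 'rV[R]_n.+1).
Hypothesis n_le2 : (n <= 2)%N.
Hypothesis oO : open Omega.
Hypothesis bO : bounded_set Omega.
Variables (x0 : 'rV[R]_n.+1) (r : R) (i : 'I_n.+1) (s : R) (theta chi : 'rV[R]_n.+1 -> R).
Hypothesis ch : chart Omega x0 r i s theta.
Hypothesis cchi : forall k, Ck k chi.
Hypothesis schi : forall y, chi y != 0 -> `|y - x0| <= r / 8.

Local Notation L2 := (L2 Omega).
Local Notation n2 := (n2 Omega).
Local Notation ip := (ip Omega).
Let mO : measurable Omega. Proof. exact: measurable_rV_open. Qed.
Let r0 : 0 < r. Proof. by case: ch. Qed.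
Let s2 : s ^+ 2 = 1. Proof. by case: ch. Qed.
Let c0 : continuous chi := Ck_continuous (@cchi 0%N).
Let c1 a : continuous (pderiv a chi) := Ck_continuous (Ck_pderiv a (@cchi 1%N)).

Let LM (c v : 'rV[R]_n.+1 -> R) : continuous c -> L2 v -> L2 (fun x => c x * v x).
Proof. by move=> cc Lv; exact: (L2_continuousM oO bO). Qed.

Variable A : R.
Hypothesis A1 : 1 <= A.
Hypothesis hA : forall (x z : 'rV[R]_n.+1) (t : R), 0 <= t -> `|x - x0| <= r / 2 -> `|z| <= r / 2 ->
    (forall j, j != i -> `|z ord0 j| <= t) -> A * t <= s * z ord0 i ->
    theta x + t <= theta (x + z).

Section data.
Variables (v : 'rV[R]_n.+1 -> R) (dv : 'I_n.+1 -> 'rV[R]_n.+1 -> R).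
Hypothesis Lv : L2 v.
Hypothesis Ldv : forall k, L2 (dv k).
Hypothesis hv : forall k, wd Omega k v (dv k).
Local Notation g := (fun x => chi x * v x).
Local Notation dg := (loc1 chi v dv).
Let Lg : L2 g. Proof. exact: LM. Qed.
Let Ldg k : L2 (dg k). Proof. by apply: (L2D mO); exact: LM. Qed.

(** For x in [Omega], the kernel seen from x times [chi] is supported where theta >= t, hence it is
    a test function. The derivative can therefore be moved to [v] without a boundary term, although
    no trace condition is imposed on [v]. *)
Lemma cone_ibp F (t : R) k x : smooth_kernel F -> 0 < t ->
  (forall z, prodf F z != 0 -> [/\ `|z| <= r / 8, forall j, j != i -> `|z ord0 j| <= t &
    A * t <= s * (- z ord0 i)]) -> Omega x ->
  convol Omega (updf F k (derive1 (F k))) g x = convol Omega F (dg k) x.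
Proof.
move=> kF t0 hF Ox; have [sF _] := kF; have [sF' _] := kernel_upd k kF.
pose S := prodf (shiftf F x); pose S' := prodf (shiftf (updf F k (derive1 (F k))) x).
have cS m : Ck m S by apply: Ck_prodf; exact: smooth1_shift.
have cS' : continuous S' by apply: continuous_prodf; exact: smooth1_shift.
have dS : hasd k S (fun y => - S' y) := hasd_shift x k sF.
have tphi : test_function Omega (chi \* S).
  apply: (@testfP _ _ Omega _ ([set y : 'rV[R]_n.+1 | `|y - x0| <= r / 2] `&` [set y | t <= theta y])).
  - by move=> m; apply: CkM.
  - apply: compact_closedI; first exact: rV_ball_compact.
    by apply: closed_ge; case: ch => _ ct _ _ _; exact: Ck_continuous ct.
  - move=> y [yr ty]; case: ch => _ _ _ _ /(_ y) h; apply/h.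
      by apply: le_trans yr _; move: r0; lra.
    exact: lt_le_trans ty.
  move=> y nK; apply: contrapT => /eqP; rewrite /= mulf_eq0 negb_or => /andP[cy Sy]; apply: nK.
  have yr := schi cy; move: Sy; rewrite /S prodf_shiftE => /hF[z1 z2 z3].
  have xr : `|x - x0| <= r / 4.
    by rewrite -(subrKA y); apply: le_trans (ler_normD _ _) _; lra.
  split; first by apply: le_trans yr _; move: r0; lra.
  have := @hA x (y - x) t (ltW t0); rewrite (addrC x (y - x)) subrK => h.
  have {}h : theta x + t <= theta y.
    apply: h.
    - by apply: le_trans xr _; move: r0; lra.
    - by rewrite distrC; apply: le_trans z1 _; move: r0; lra.
    - by move=> j ne; have := z2 j ne; rewrite !rVE distrC.
    - by move: z3; rewrite !rVE opprB.
  apply: le_trans h; rewrite lerDr ltW//.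
  by case: ch => _ _ _ _ /(_ x) [|-> //]; apply: le_trans xr _; move: r0; lra.
have E := hv k tphi; have cS0 := Ck_continuous (cS 0%N).
rewrite (hasd_pderiv (hasdM (Ck_hasd k (@cchi 1%N)) dS)) in E.
have LS := L2_continuous oO bO cS0; have LS' := L2_continuous oO bO cS'.
have L1 : L2 (pderiv k chi \* S) by exact: LM.
have L3 : L2 (fun y => chi y * S' y) by exact: LM.
have L4' : L2 (chi \* (fun y => - S' y)).
  have := L2N mO L3; congr (L2 _).
  by apply/funext => y /=; rewrite mulrN.
have E1 : ip v (pderiv k chi \* S) + ip v (chi \* (fun y => - S' y)) = - ip (dv k) (chi \* S).
  by rewrite -(ipDr mO L1 L4' Lv); exact: E.
have E2 : ip v (chi \* (fun y => - S' y)) = - ip S' g.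
  rewrite -(ipNr mO Lg LS') ipC; apply: eq_Rintegral => y _ /=; ring.
have E3 : ip v (pderiv k chi \* S) = ip S (fun y => pderiv k chi y * v y).
  by apply: eq_Rintegral => y _ /=; ring.
have E4 : ip (dv k) (chi \* S) = ip S (fun y => chi y * dv k y).
  by apply: eq_Rintegral => y _ /=; ring.
rewrite E2 E3 E4 in E1; rewrite /convol -/S -/S' (ipDr mO (LM c0 (Ldv k)) (LM (@c1 k) Lv) LS).
by apply: transpose_algebra'; exact: E1.
Qed.

Local Notation lo := (box_lo i (- s) (16 * A)).
Local Notation hi := (box_hi i (- s) (16 * A)).
Local Notation T := (fun l => convol Omega (moll lo hi l)).

Let lohi j : lo j + 1 <= hi j.
Proof. by rewrite /box_lo /box_hi; case: ifP => _; lra. Qed.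
Let lohi' j : lo j < hi j. Proof. by have := lohi j; lra. Qed.

(** The sign - s puts x - y on the outward side, so that y lies inward from x. The factor 16 absorbs
    the smaller box of the next level: 16 A / scale(l+1) = A / scale(l). *)
Lemma telk_cone l k z : mrad lo hi / (r / 8) < scale l -> prodf (telk lo hi l k) z != 0 ->
  [/\ `|z| <= r / 8, forall j, j != i -> `|z ord0 j| <= (scale l)^-1 & A * (scale l)^-1 <= s * (- z ord0 i)].
Proof.
move=> hl nz; have r8 : 0 < r / 8 by rewrite divr_gt0.
have q0 := @scale_gt0 R l; have qS := @scaleS R l; set q := @scale R l in q0 qS hl *.
have nj j : telk lo hi l k j (z ord0 j) != 0.
  by apply: contraNneq nz => z0; rewrite /prodf (bigD1 j)//= z0 mul0r.
split.
- apply/rV_norm_le; first exact: ltW.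
  move=> j; have [/andP[h1 h2] _ _] := telk_supp lohi (nj j).
  have jm : `|lo j| + `|hi j| <= mrad lo hi.
    by rewrite /mrad (bigD1 j)//= lerDl; apply: sumr_ge0 => m _; rewrite addr_ge0.
  have b1 : `|q * z ord0 j| <= `|lo j| + `|hi j|.
    rewrite ler_norml; apply/andP; split.
      apply: le_trans h1; rewrite le_min; apply/andP; split; last by have := normr_ge0 (lo j); have := normr_ge0 (hi j); lra.
      by have := normr_ge0 (hi j); have := ler_norm (- lo j); rewrite normrN; lra.
    apply: le_trans h2 _; rewrite ge_max; apply/andP; split; last by rewrite addr_ge0.
    by have := normr_ge0 (lo j); have := ler_norm (hi j); lra.
  have {}b1 := le_trans b1 jm; rewrite normrM (gtr0_norm q0) in b1.
  rewrite -(ler_pM2l q0); apply: le_trans b1 _.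
  by rewrite -ler_pdivrMr// ltW.
- move=> j ne; have [/andP[h1 h2] _ _] := telk_supp lohi (nj j).
  move: h1 h2; rewrite /box_lo /box_hi (negPf ne) => h1 h2.
  rewrite -(ler_pM2l q0) divff ?lt0r_neq0// -{1}(gtr0_norm q0) -normrM ler_norml; apply/andP; split.
    by apply: le_trans h1; rewrite le_min lexx; lra.
  by apply: le_trans h2 _; rewrite ge_max lexx; lra.
have [_ h1 h2] := telk_supp lohi (nj i).
rewrite ler_pdivrMr//; move: h1 h2; rewrite /box_lo /box_hi eqxx qS.
have : s = 1 \/ s = -1 by move/eqP: s2; rewrite sqrf_eq1 => /orP[]/eqP; [left|right].
move=> [] E; rewrite !E => h1 h2.
  have : - 1 * (16 * A + 2^-1) + 2^-1 < 0 by move: A1; lra.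
  by move=> /h2; lra.
have : 0 < - (- 1) * (16 * A + 2^-1) - 2^-1 by move: A1; lra.
by move=> /h1; lra.
Qed.

(** [telk_telescope] writes the difference of kernels as a sum of derivatives, and [cone_ibp] moves
    each derivative to the function. *)
Lemma telescope_convol l x : mrad lo hi / (r / 8) < scale l -> Omega x ->
  T l.+1 g x - T l g x = \sum_k convol Omega (telk lo hi l k) (dg k) x.
Proof.
move=> hl Ox; have q0 := @scale_gt0 R l.
have sm l' : L2 (prodf (shiftf (moll lo hi l') x)).
  by apply: (L2_shift oO bO); have [] := moll_kernel lohi' l'.
rewrite /convol -(ipBl mO (sm _) (sm _) Lg).
have E : (fun y => prodf (shiftf (moll lo hi l.+1) x) y - prodf (shiftf (moll lo hi l) x) y) =
   (fun y => \sum_k prodf (shiftf (updf (telk lo hi l k) k (derive1 (telk lo hi l k k))) x) y).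
  apply/funext => y; rewrite !prodf_shiftE telk_telescope.
  by apply: eq_bigr => k _; rewrite prodf_shiftE.
have kk k := telk_kernel lohi l k.
rewrite E (ip_suml oO) => [|k|//]; last first.
  by apply: (L2_shift oO bO); have [] := kernel_upd k (kk k).
apply: eq_bigr => k _.
apply: (cone_ibp (t := (scale l)^-1) k (kk k) _ _ Ox); first by rewrite invr_gt0.
by move=> z nz; exact: telk_cone nz.
Qed.

Variable C : R.
Hypothesis C0 : 0 <= C.
Hypothesis hC : forall l k h, L2 h -> L4 Omega (convol Omega (telk lo hi l k) h) /\
  n4 Omega (convol Omega (telk lo hi l k) h) <= C * 2^-1 ^+ l * n2 h.
Local Notation G := (\sum_k n2 (dg k)).
Let G0 : 0 <= G. Proof. by apply: sumr_ge0 => k _; exact: n2_ge0. Qed.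
Variable l : nat.
Hypothesis hl : forall m, (l <= m)%N -> mrad lo hi / (r / 8) < scale m.

Let LT m : L2 (T m g). Proof. exact: (L2_moll oO bO lohi'). Qed.

Let step_n4 m : (l <= m)%N -> L4 Omega (fun x => T m.+1 g x - T m g x) /\
  n4 Omega (fun x => T m.+1 g x - T m g x) <= C * 2^-1 ^+ m * G.
Proof.
move=> lm; have [h1 h2] := L4_sum mO (index_enum _) (fun k => (hC m k (Ldg k)).1).
have mB : measurable_fun Omega (fun x => T m.+1 g x - T m g x).
  by apply: measurable_funB; exact: L2_measurable (LT _).
have [h3 h4] := L4_le mO h1 mB (fun x Ox => eq_le_norm (telescope_convol (hl lm) Ox)).
split=> //; apply: le_trans h4 (le_trans h2 _); rewrite mulr_sumr; apply: ler_sum => k _.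
exact: (hC m k (Ldg k)).2.
Qed.

Let tele_n4 m : L4 Omega (fun x => T (l + m)%N g x - T l g x) /\
  n4 Omega (fun x => T (l + m)%N g x - T l g x) <= 2 * C * 2^-1 ^+ l * (1 - 2^-1 ^+ m) * G.
Proof.
elim: m => [|m [IH1 IH2]].
  rewrite addn0 expr0 subrr mulr0 mul0r; under eq_fun do rewrite subrr.
  by have [h E] := @L4_0 R n.+1 Omega; rewrite E.
have [h1 h2] := step_n4 (leq_addr m l); have [h3 h4] := L4D mO h1 IH1.
have E : (fun x => T (l + m)%N.+1 g x - T (l + m)%N g x + (T (l + m)%N g x - T l g x)) =
  (fun x => T (l + m.+1)%N g x - T l g x).
  by apply/funext => x; rewrite addnS subrKA.
rewrite E in h3 h4; split=> //; apply: le_trans h4 _; apply: le_trans (lerD h2 IH2) _.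
by rewrite exprD exprS le_eqVlt; apply/orP; left; apply/eqP; move: (2^-1 ^+ m) (2^-1 ^+ l) (G) => u w z; field.
Qed.

(** The geometric series of the bounds on consecutive differences, carried to the limit by Fatou
    along a subsequence of mollifications converging almost everywhere. *)
Lemma convol_n4 : L4 Omega (fun x => g x - T l g x) /\
  n4 Omega (fun x => g x - T l g x) <= 2 * C * 2^-1 ^+ l * G.
Proof.
pose B : R := 2 * C * 2^-1 ^+ l * G.
have hp : 0 <= 2^-1 ^+ l :> R by rewrite exprn_ge0.
have B0 : 0 <= B by rewrite !mulr_ge0.
have hT m : (l <= m)%N -> L4 Omega (fun x => T m g x - T l g x) /\ n4 Omega (fun x => T m g x - T l g x) <= B.
  move=> /subnKC <-; have [h1 h2] := tele_n4 (m - l); split=> //; apply: le_trans h2 _.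
  rewrite /B; apply: ler_wpM2r => //; rewrite -[leRHS]mulr1; apply: ler_wpM2l; first by rewrite !mulr_ge0.
  by rewrite lerBlDr lerDl exprn_ge0.
have [_ hcv] := moll_cvg_L2 oO bO lohi' Lg.
have [phi [phiS aephi]] := @L2_ae_subseq _ _ Omega mO (fun m => T m g) g LT Lg hcv.
have phige k : (k <= phi k)%N.
  by elim: k => // k IH; exact: leq_ltn_trans IH (phiS k).
have mB m : measurable_fun Omega (fun x => T m g x - T l g x).
  by apply: measurable_funB; exact: L2_measurable (LT _).
have mg : measurable_fun Omega (fun x => g x - T l g x).
  by apply: measurable_funB; [exact: L2_measurable Lg|exact: L2_measurable (LT _)].
have mg2 : measurable_fun Omega (fun x => (g x - T l g x) ^+ 2) by exact: measurable_funX.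
have fb : (\int[lebesgue_rV R n.+1]_(x in Omega) (((g x - T l g x) ^+ 2) ^+ 2)%:E <= ((B ^+ 2) ^+ 2)%:E)%E.
  apply: (@fatou_bound _ _ Omega mO (fun k x => ((T (phi k) g x - T l g x) ^+ 2) ^+ 2) _ _ l).
  - by move=> k; apply: measurable_funX; exact: measurable_funX.
  - exact: measurable_funX.
  - by move=> k x _; exact: sqr_ge0.
  - by move=> x _; exact: sqr_ge0.
  - move: aephi; apply: filterS => x q Ox.
    have q1 : T (phi k) g x - T l g x @[k --> \oo] --> g x - T l g x.
      by apply: cvgB; [exact: q|exact: cvg_cst].
    have sq (f : nat -> R) (b : R) : f @ \oo --> b -> (fun k => f k ^+ 2) @ \oo --> b ^+ 2.
      by move=> h; exact: (cvgM h h).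
    exact: (sq _ _ (sq _ _ q1)).
  move=> k lk; have [h1 h2] := hT (phi k) (leq_trans lk (phige k)).
  rewrite (integral_sqr_n2 mO h1.2) lee_fin -n4_sqr.
  by rewrite !ler_pXn2r ?nnegrE ?sqr_ge0 ?n4_ge0.
have [h1 h2] := L2_n2_le mO (sqr_ge0 B) mg2 fb.
split=> //; rewrite -(ler_pXn2r (n := 2)) ?nnegrE ?n4_ge0//.
by rewrite n4_sqr.
Qed.

End data.

(** The convolution is Lipschitz with a constant O(||v||). Up to d ||v|| it is thus determined by
    its values at a finite net of points, each of which is the inner product of [v] with a fixed
    function. *)
Lemma convol_net F (d : R) : smooth_kernel F -> 0 < d ->
  exists (m : nat) (psi : 'I_m -> 'rV[R]_n.+1 -> R) (C : R), [/\ 0 <= C, forall p, L2 (psi p) &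
    forall v, L2 v -> L4 Omega (convol Omega F (fun x => chi x * v x)) /\
      n4 Omega (convol Omega F (fun x => chi x * v x)) <= d * n2 v + C * \sum_p `|ip (psi p) v|].
Proof.
move=> kF d0; have [sF _] := kF; have [L L0 hL] := prodf_lipschitz kF.
pose one : 'rV[R]_n.+1 -> R := cst 1; pose I1 := n2 one.
have L1 : L2 one by exact: (L2_cst oO bO).
have I10 : 0 <= I1 by exact: n2_ge0.
have [M M0 hM] := continuous_bounded_O bO c0.
pose Q : R := Num.sqrt I1; have Q0 : 0 <= Q by exact: sqrtr_ge0.
pose D : R := Q * (L * I1 * M); have D0 : 0 <= D by rewrite !mulr_ge0// ltW.
pose e : R := d / (D + 1); have e0 : 0 < e by rewrite divr_gt0// ltr_wpDl.
(* The covering lemma applied to indicators of balls of radius [e] yields a finite net. *)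
have [|m [I [hI cov]]] := @cover_cutoffs _ _ Omega bO (fun f => exists p : 'rV[R]_n.+1, forall y, f y = 1 -> `|y - p| < e).
  move=> x _; exists e => //; exists (\1_[set y : 'rV[R]_n.+1 | `|y - x| < e]); last first.
    by move=> y ye; rewrite indicE mem_set.
  exists x => y; rewrite indicE; case: (boolP (y \in _)) => [/set_mem//|_ /= /eqP].
  by rewrite eq_sym oner_eq0.
have /choice[p hp] := hI.
exists m, (fun k x => chi x * prodf (shiftf F (p k)) x), Q; split=> //.
  by move=> k; apply: LM => //; exact: (L2_shift oO bO).
move=> v Lv; pose g x := chi x * v x; have Lg : L2 g by exact: LM.
have ng : n2 g <= M * n2 v.
  by apply: (n2M mO) => //; [exact: ltW|exact: measurable_continuous_on].
pose Z : R := L * e * I1 * (M * n2 v) + \sum_k `|ip (fun x => chi x * prodf (shiftf F (p k)) x) v|.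
have S0 : 0 <= \sum_k `|ip (fun x => chi x * prodf (shiftf F (p k)) x) v| by apply: sumr_ge0.
have Le : 0 <= L * e * I1 := mulr_ge0 (mulr_ge0 L0 (ltW e0)) I10.
have Z0 : 0 <= Z := addr_ge0 (mulr_ge0 Le (mulr_ge0 (ltW M0) (n2_ge0 Omega v))) S0.
have bd x : Omega x -> `|convol Omega F g x| <= Z.
  move=> Ox; have [k Fk] := cov x Ox; have xp := hp k x Fk.
  have E : convol Omega F g (p k) = ip (fun x => chi x * prodf (shiftf F (p k)) x) v.
    by apply: eq_Rintegral => y _; rewrite /g /=; ring.
  have Lx y := L2_shift oO bO y sF.
  have diff : `|convol Omega F g x - convol Omega F g (p k)| <= L * e * I1 * (M * n2 v).
    rewrite /convol -(ipBl mO (Lx _) (Lx _) Lg); have LB := L2B mO (Lx x) (Lx (p k)).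
    apply: le_trans (cauchy_schwarz mO LB Lg) _.
    apply: ler_pM; rewrite ?n2_ge0//.
    apply: (n2_le mO) => //; first exact: (mulr_ge0 L0 (ltW e0)).
      exact: L2_measurable.
    move=> y _; rewrite /one /= normr1 mulr1 !prodf_shiftE; apply: le_trans (hL _ _) _.
    apply: ler_wpM2l => //; rewrite opprB addrA subrK; exact: ltW.
  rewrite -[convol _ _ _ x](subrK (convol Omega F g (p k))); apply: le_trans (ler_normD _ _) _.
  rewrite /Z; apply: lerD => //; rewrite E (bigD1 k)//= lerDl.
  by apply: sumr_ge0.
have mc : measurable_fun Omega (convol Omega F g).
  by apply: measurable_continuous_on => //; exact: (continuous_conv oO bO).
have L4c : L4 Omega (fun _ : 'rV[R]_n.+1 => Z) by split=> //; exact: (L2_cst oO bO).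
have [h1 h2] := L4_le mO L4c mc (fun x Ox => le_trans (bd x Ox) (ler_norm Z)).
split=> //; apply: le_trans h2 _.
have -> : n4 Omega (fun _ : 'rV[R]_n.+1 => Z) = Q * Z.
  rewrite /n4 (_ : (fun _ => Z ^+ 2) = (fun x => Z ^+ 2 * one x)); last first.
    by apply/funext => x; rewrite /one /= mulr1.
  rewrite (n2Z mO)// ger0_norm ?sqr_ge0// sqrtrM ?sqr_ge0// sqrtr_sqr ger0_norm//.
  exact: mulrC.
rewrite /Z mulrDr lerD2r.
have -> : Q * (L * e * I1 * (M * n2 v)) = D * e * n2 v by rewrite /D; ring.
apply: ler_wpM2r; first exact: n2_ge0.
by rewrite /e mulrCA ger_pMr// ler_pdivrMr ?ltr_wpDl// mul1r lerDl.
Qed.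

End chart_L4.

(** Split [chi v] into its distance from a mollification, small by [convol_n4], and the
    mollification itself, handled by [convol_net]. *)
Lemma chart_L4 (R : realType) n (Omega : set 'rV[R]_n.+1) x0 r i s theta chi (d : R) :
  (n <= 2)%N -> open Omega -> bounded_set Omega -> chart Omega x0 r i s theta ->
  (forall k, Ck k chi) -> (forall y, chi y != 0 -> `|y - x0| <= r / 8) -> 0 < d ->
  exists (m : nat) (psi : 'I_m -> 'rV[R]_n.+1 -> R) (C : R), [/\ 0 <= C, forall p, L2 Omega (psi p) &
    forall v dv, L2 Omega v -> (forall k, L2 Omega (dv k)) -> (forall k, wd Omega k v (dv k)) ->
      L4 Omega (fun x => chi x * v x) /\ n4 Omega (fun x => chi x * v x) <=
        d * (n2 Omega v + \sum_k n2 Omega (dv k)) + C * \sum_p `|ip Omega (psi p) v|].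
Proof.
move=> n2' oO bO ch cchi schi d0; have mO : measurable Omega by exact: measurable_rV_open.
have [A A1 hA] := chart_cone ch.
have lohi j : box_lo i (- s) (16 * A) j + 1 <= box_hi i (- s) (16 * A) j.
  by rewrite /box_lo /box_hi; case: ifP => _; lra.
have lohi' j : box_lo i (- s) (16 * A) j < box_hi i (- s) (16 * A) j by have := lohi j; lra.
have [C1 C10 hC] := telk_n4 n2' oO bO lohi.
have c0 := Ck_continuous (cchi 0%N); have c1 a := Ck_continuous (Ck_pderiv a (cchi 1%N)).
have [M1 M10 h1] := finite_bound bO (fun _ : unit => c0).
have [M2 M20 h2] := finite_bound bO c1.
pose M := M1 + M2; have M0 : 0 <= M by rewrite /M; lra.
have [l0 hl0] := scale_large (mrad (box_lo i (- s) (16 * A)) (box_hi i (- s) (16 * A)) / (r / 8)).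
have d2 := divr_gt0 d0 (ltr0n R 2).
have K0 : 0 <= 2 * C1 * (n.+1%:R * M) by rewrite !mulr_ge0.
(* The level is fixed first, so that the remainder costs at most d/2; the net is then built for the
   kernel of that level. *)
have [l ll0 hl] := half_pow_small l0 K0 d2.
have hlm m : (l <= m)%N -> mrad (box_lo i (- s) (16 * A)) (box_hi i (- s) (16 * A)) / (r / 8) < scale m.
  by move=> lm; apply: hl0; exact: leq_trans lm.
have [m [psi [C [C0 Lpsi hnet]]]] := convol_net oO bO cchi (moll_kernel lohi' l) d2.
exists m, psi, C; split=> // v dv Lv Ldv hv.
have [q1 q2] := hnet v Lv.
have [q3 q4] := convol_n4 oO bO ch cchi schi A1 hA Lv Ldv hv C10 hC hlm.
have [q5 q6] := L4D mO q3 q1.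
have E : (fun x => chi x * v x - convol Omega (moll (box_lo i (- s) (16 * A)) (box_hi i (- s) (16 * A)) l)
    (fun x => chi x * v x) x + convol Omega (moll (box_lo i (- s) (16 * A)) (box_hi i (- s) (16 * A)) l)
    (fun x => chi x * v x) x) = (fun x => chi x * v x) by apply/funext => x; rewrite subrK.
rewrite E in q5 q6; split=> //; apply: le_trans q6 _.
set S := n2 Omega v + _; have W0 : 0 <= \sum_k n2 Omega (dv k) by apply: sumr_ge0 => k _; exact: n2_ge0.
have vS : n2 Omega v <= S by rewrite lerDl.
have S0 : 0 <= S := le_trans (n2_ge0 _ _) vS.
have dvS k : n2 Omega (dv k) + n2 Omega v <= S.
  rewrite /S addrC lerD2l (bigD1 k)//= lerDl; apply: sumr_ge0 => j _; exact: n2_ge0.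
have G : \sum_k n2 Omega (loc1 chi v dv k) <= n.+1%:R * M * S.
  have -> : n.+1%:R * M * S = \sum_(k < n.+1) M * S by rewrite sumr_const card_ord -mulrA mulr_natl.
  apply: ler_sum => k _.
  have La := L2_continuousM oO bO c0 (Ldv k); have Lb := L2_continuousM oO bO (c1 k) Lv.
  apply: le_trans (n2D mO La Lb) _; apply: (@le_trans _ _ (M * n2 Omega (dv k) + M * n2 Omega v)).
    apply: lerD; apply: (n2M mO) => //; try exact: measurable_continuous_on.
      by move=> x Ox; apply: le_trans (h1 tt x Ox) _; rewrite /M; lra.
    by move=> x Ox; apply: le_trans (h2 k x Ox) _; rewrite /M; lra.
  by rewrite -mulrDr; apply: ler_wpM2l.
have hp : 0 <= 2^-1 ^+ l :> R by rewrite exprn_ge0.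
have q7 : 2 * C1 * 2^-1 ^+ l * \sum_k n2 Omega (loc1 chi v dv k) <= d / 2 * S.
  apply: (@le_trans _ _ (2 * C1 * 2^-1 ^+ l * (n.+1%:R * M * S))).
    by apply: ler_wpM2l => //; rewrite !mulr_ge0.
  have -> : 2 * C1 * 2^-1 ^+ l * (n.+1%:R * M * S) = 2 * C1 * (n.+1%:R * M) * 2^-1 ^+ l * S by ring.
  exact: ler_wpM2r.
have q8 : d / 2 * n2 Omega v <= d / 2 * S by apply: ler_wpM2l => //; exact: ltW.
apply: le_trans (lerD (le_trans q4 q7) (le_trans q2 (lerD q8 (lexx _)))) _.
by rewrite addrA -mulrDl -splitr.
Qed.

(** Compactness in the form of an Ehrling inequality; local families of functionals are collected
    over a finite covering. *)
Lemma L4_compactness (R : realType) n (Omega : set 'rV[R]_n.+1) (eta d : R) :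
  (n <= 2)%N -> open Omega -> bounded_set Omega -> Ck_holder_boundary 4 eta Omega -> 0 < d ->
  exists (I : finType) (psi : I -> 'rV[R]_n.+1 -> R) (C : R), [/\ 0 <= C, forall p, L2 Omega (psi p) &
    forall v dv, L2 Omega v -> (forall k, L2 Omega (dv k)) -> (forall k, wd Omega k v (dv k)) ->
      L4 Omega v /\ n4 Omega v <=
        d * (n2 Omega v + \sum_k n2 Omega (dv k)) + C * \sum_p `|ip Omega (psi p) v|].
Proof.
move=> n2' oO bO hreg d0; have mO : measurable Omega by exact: measurable_rV_open.
pose Good (chi : 'rV[R]_n.+1 -> R) := continuous chi /\ forall d : R, 0 < d ->
  exists (m : nat) (psi : 'I_m -> 'rV[R]_n.+1 -> R) (C : R), [/\ 0 <= C, forall p, L2 Omega (psi p) &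
    forall v dv, L2 Omega v -> (forall k, L2 Omega (dv k)) -> (forall k, wd Omega k v (dv k)) ->
      L4 Omega (fun x => chi x * v x) /\ n4 Omega (fun x => chi x * v x) <=
        d * (n2 Omega v + \sum_k n2 Omega (dv k)) + C * \sum_p `|ip Omega (psi p) v|].
have [|m [F [gF cov]]] := @cover_cutoffs _ _ Omega bO Good.
  move=> x cx; have [r [i [s [theta ch]]]] := chart_exists oO bO hreg cx.
  have r0 : 0 < r by case: ch.
  have r8 : 0 < r / 8 by rewrite divr_gt0.
  have [chi [cchi c1 c0]] := cutoff x r8.
  exists (r / 8 / 2); first exact: divr_gt0.
  exists chi; last by move=> y yx; apply: c1; exact: ltW.
  split; first exact: Ck_continuous (cchi 0%N).
  by move=> e e0; exact: (chart_L4 n2' oO bO ch cchi c0 e0).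
pose e : R := d / m.+1%:R; have m0 : 0 < m.+1%:R :> R by rewrite ltr0n.
have e0 : 0 < e by rewrite divr_gt0.
have /choice[N hN] := fun k => (gF k).2 e e0.
have [psi hpsi] : exists psi : forall k, 'I_(N k) -> 'rV[R]_n.+1 -> R, forall k, exists C : R, [/\ 0 <= C, forall p, L2 Omega (psi k p) &
    forall v dv, L2 Omega v -> (forall k, L2 Omega (dv k)) -> (forall k, wd Omega k v (dv k)) ->
      L4 Omega (fun x => F k x * v x) /\ n4 Omega (fun x => F k x * v x) <=
        e * (n2 Omega v + \sum_k n2 Omega (dv k)) + C * \sum_p `|ip Omega (psi k p) v|].
  by exists (fun k => sval (cid (hN k))) => k; exact: (svalP (cid (hN k))).
have /choice[C hC] := hpsi.
pose CS : R := \sum_k C k; have Ck0 k : 0 <= C k by case: (hC k).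
have CS0 : 0 <= CS by apply: sumr_ge0.
exists {k : 'I_m & 'I_(N k)}, (fun p => psi (tag p) (tagged p)), CS; split=> // [p|v dv Lv Ldv hv].
  by case: (hC (tag p)).
have h k : L4 Omega (fun x => F k x * v x) /\ n4 Omega (fun x => F k x * v x) <=
    e * (n2 Omega v + \sum_k n2 Omega (dv k)) + C k * \sum_p `|ip Omega (psi k p) v|.
  by have [_ _ q] := hC k; exact: q.
have L4a k : L4 Omega (fun x => `|F k x * v x|) /\ n4 Omega (fun x => `|F k x * v x|) <= n4 Omega (fun x => F k x * v x).
  have [q1 _] := h k; apply: (L4_le mO q1) => [|x _]; last by rewrite normr_id.
  by apply: measurableT_comp => //; case: q1.
have [s1 s2] := L4_sum mO (index_enum 'I_m) (fun k => (L4a k).1).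
have [|t1 t2] := L4_le mO s1 (L2_measurable Lv).
  move=> x Ox; have [k Fk] := cov x Ox; rewrite [leRHS]ger0_norm; last by apply: sumr_ge0.
  rewrite (bigD1 k)//= Fk mul1r lerDl; exact: sumr_ge0.
split=> //; apply: le_trans t2 (le_trans s2 _).
set S := n2 Omega v + _; have S0 : 0 <= S.
  by rewrite addr_ge0 ?n2_ge0//; apply: sumr_ge0 => k _; exact: n2_ge0.
have -> : \sum_(p : {k : 'I_m & 'I_(N k)}) `|ip Omega (psi (tag p) (tagged p)) v| =
   \sum_k \sum_(p < N k) `|ip Omega (psi k p) v|.
  by rewrite sig_big_dep; apply: eq_bigr => -[k p] _.
apply: (@le_trans _ _ (\sum_(k < m) (e * S + CS * \sum_(p < N k) `|ip Omega (psi k p) v|))).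
  apply: ler_sum => k _; apply: le_trans (L4a k).2 (le_trans (h k).2 _); rewrite lerD2l.
  apply: ler_wpM2r; first exact: sumr_ge0.
  by rewrite /CS (bigD1 k)//= lerDl; apply: sumr_ge0.
rewrite big_split/=; apply: lerD; last by rewrite mulr_sumr.
rewrite sumr_const card_ord -mulr_natl mulrA; apply: ler_wpM2r => //.
by rewrite /e mulrA ler_pdivrMr// mulrC ler_wpM2l ?(ltW d0)// ler_nat.
Qed.

(** * The abstract variational argument *)

Lemma squeeze_eq0 (R : realFieldType) (x c : R) :
  (forall t, `|t| <= 1 -> t * x <= t ^+ 2 * c) -> x = 0.
Proof.
move=> h; pose c' := `|c| + `|x| + 1; have c'0 : 0 < c' by rewrite ltr_wpDl ?addr_ge0.
have t1 : `|x / (2 * c')| <= 1.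
  rewrite normrM normfV (gtr0_norm (_ : 0 < 2 * c')) ?mulr_gt0// ler_pdivrMr ?mulr_gt0// mul1r /c'.
  by have := normr_ge0 c; have := normr_ge0 x; lra.
have := h _ t1; have E1 : x / (2 * c') * x = 2 * (x / (2 * c')) ^+ 2 * c'.
  by field; rewrite gt_eqF.
rewrite E1 => h2; have y0 := sqr_ge0 (x / (2 * c')); move: h2 y0.
set y := (x / (2 * c')) ^+ 2 => h2 y0.
have y1 : y * (2 * c' - c) <= 0 by lra.
have cc : 0 < 2 * c' - c by rewrite /c'; have := ler_norm c; have := normr_ge0 c; have := normr_ge0 x; lra.
have : y = 0 by apply/eqP; rewrite eq_le y0 andbT -(pmulr_lle0 _ cc).
move/eqP; rewrite /y sqrf_eq0 mulf_eq0 invr_eq0 => /orP[/eqP//|].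
by rewrite (gt_eqF (mulr_gt0 _ c'0)).
Qed.

(** The graph of the convex function x^4 lies above its tangents. *)
Lemma quartic_tangent (R : realFieldType) (x y : R) : y ^+ 4 + 4 * y ^+ 3 * (x - y) <= x ^+ 4.
Proof.
rewrite -subr_ge0.
have -> : x ^+ 4 - (y ^+ 4 + 4 * y ^+ 3 * (x - y)) = (x - y) ^+ 2 * ((x + y) ^+ 2 + 2 * y ^+ 2) by ring.
by apply: mulr_ge0 (sqr_ge0 _) (addr_ge0 (sqr_ge0 _) (mulr_ge0 (ler0n R 2) (sqr_ge0 _))).
Qed.

Section mountain_pass.
Context {R : realType} {V : zmodType}.
(** In the application [sc] is scalar multiplication, [m] the L^4 norm of the gradient, [a] the
    quadratic part of the energy with polar form [B], [l u] the derivative of the quartic part at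
    [u], and [Z] vanishing almost everywhere. The hypothesis [compactness] says that [m] is compact
    relative to [nrm]. *)
Variables (sc : R -> V -> V) (X : set V) (nrm m a E : V -> R) (B l : V -> V -> R) (kappa C K : R).
Variable Z : V -> Prop.
Implicit Types (u v w h : V).

Let b u : R := kappa * m u ^+ 4.

Hypothesis sc1 : forall u, sc 1 u = u.
Hypothesis scN : forall u, sc (-1) u = - u.
Hypothesis scD : forall t u, u + sc t u = sc (1 + t) u.
Hypothesis XD : forall u v, X u -> X v -> X (u + v).
Hypothesis XZ : forall t u, X u -> X (sc t u).
Hypothesis kappa0 : 0 < kappa.
Hypothesis C0 : 0 < C.
Hypothesis K0 : 0 <= K.
Hypothesis nrm0 : forall u, X u -> 0 <= nrm u.
Hypothesis nrmZ : forall t u, X u -> nrm (sc t u) = `|t| * nrm u.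
Hypothesis m0 : forall u, X u -> 0 <= m u.
Hypothesis mD : forall u v, X u -> X v -> m (u + v) <= m u + m v.
Hypothesis mZ : forall t u, X u -> m (sc t u) = `|t| * m u.
Hypothesis m_nrm : forall u, X u -> m u <= C * nrm u.
Hypothesis nrm_a : forall u, X u -> nrm u ^+ 2 <= a u.
Hypothesis a_nrm : forall u, X u -> a u <= C * nrm u ^+ 2.
Hypothesis aD : forall u h, X u -> X h -> a (u + h) = a u + 2 * B u h + a h.
Hypothesis aZ : forall t u, X u -> a (sc t u) = t ^+ 2 * a u.
Hypothesis BZ : forall t u h, X u -> X h -> B u (sc t h) = t * B u h.
Hypothesis BZl : forall t u h, X u -> X h -> B (sc t u) h = t * B u h.
Hypothesis lZ : forall t u h, X u -> X h -> l u (sc t h) = t * l u h.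
Hypothesis bD : forall u h, X u -> X h ->
  `|b (u + h) - b u - l u h| <= K * m h ^+ 2 * (m u + m h) ^+ 2.
Hypothesis EE : forall u, X u -> E u = a u / 2 - b u / 4.
Hypothesis complete : forall u : nat -> V, (forall n, X (u n)) ->
  (forall e : R, 0 < e -> exists k, forall p q, (k <= p)%N -> (k <= q)%N -> nrm (u p - u q) < e) ->
  exists2 w, X w & forall e : R, 0 < e -> exists k, forall p, (k <= p)%N -> nrm (u p - w) < e.
Hypothesis compactness : forall u : nat -> V, (forall n, X (u n)) -> (forall n, nrm (u n) <= 1) ->
  exists phi : nat -> nat, (forall n, (phi n < phi n.+1)%N) /\
  forall e : R, 0 < e -> exists k, forall p q, (k <= p)%N -> (k <= q)%N -> m (u (phi p) - u (phi q)) < e.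
Hypothesis nontrivial : exists2 u, X u & 0 < m u.
Hypothesis separated : exists f : nat -> V, [/\ forall n, X (f n), forall n, nrm (f n) <= 1 &
  forall p q, p != q -> 1 <= nrm (f p - f q)].
Hypothesis ZP : forall u, X u -> (Z u <-> nrm u = 0).

Let XB u v : X u -> X v -> X (u - v).
Proof. by move=> Xu Xv; rewrite -scN; apply: XD => //; exact: XZ. Qed.

Let a0 u : X u -> 0 <= a u.
Proof. by move=> Xu; apply: le_trans (nrm_a Xu); exact: sqr_ge0. Qed.

Let bZ t u : X u -> b (sc t u) = t ^+ 4 * b u.
Proof.
move=> Xu; rewrite /b mZ// exprMn -normrX ger0_norm; last by rewrite (exprM _ 2 2) sqr_ge0.
by rewrite mulrCA.
Qed.

Let b0 u : X u -> 0 <= b u.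
Proof. by move=> Xu; rewrite mulr_ge0 ?(ltW kappa0)// exprn_ge0// m0. Qed.

Let mB u v : X u -> X v -> m u <= m v + m (u - v).
Proof.
by move=> Xu Xv; rewrite -{1}(subrK v u) addrC; apply: mD => //; exact: XB.
Qed.

Let values := [set t : R | exists2 u, X u & a u = 1 /\ b u = t].

Let scale_unit u : X u -> 0 < a u -> a (sc (Num.sqrt (a u))^-1 u) = 1 /\
  b (sc (Num.sqrt (a u))^-1 u) = b u / a u ^+ 2.
Proof.
move=> Xu au; have s0 : Num.sqrt (a u) != 0 by rewrite sqrtr_eq0 -ltNge.
rewrite aZ// bZ// exprVn sqr_sqrtr ?(ltW au)// mulVf ?gt_eqF//; split=> //.
by rewrite exprVn (exprM _ 2 2) sqr_sqrtr ?(ltW au)// mulrC.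
Qed.

Let values_sup : has_sup values.
Proof.
split.
  have [u Xu mu] := nontrivial; have nu : 0 < nrm u.
    by rewrite -(pmulr_rgt0 _ C0); apply: lt_le_trans mu (m_nrm Xu).
  have au : 0 < a u by apply: lt_le_trans (nrm_a Xu); rewrite exprn_gt0.
  have [q1 q2] := scale_unit Xu au.
  by exists (b u / a u ^+ 2), (sc (Num.sqrt (a u))^-1 u) => //; exact: XZ.
exists (kappa * C ^+ 4) => _ [u Xu [au <-]]; rewrite /b ler_pM2l// ler_pXn2r ?nnegrE ?m0 ?(ltW C0)//.
apply: le_trans (m_nrm Xu) _; rewrite ger_pMr//.
have := nrm_a Xu; rewrite au -[X in _ <= X](expr1n R 2) ler_pXn2r ?nnegrE ?nrm0//.
Qed.

Let S := sup values.

(** Homogeneity reduces to a = 1; if a u = 0, then [nrm u] and [m u] are zero and so is b u. *)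
Let S_ge u : X u -> b u <= S * a u ^+ 2.
Proof.
move=> Xu; have := a0 Xu; rewrite le_eqVlt => /orP[/eqP au|au]; last first.
  have [q1 q2] := scale_unit Xu au; rewrite -ler_pdivrMr ?exprn_gt0//.
  apply: sup_upper_bound; first exact: values_sup.
  by exists (sc (Num.sqrt (a u))^-1 u); [exact: XZ|].
have nu : nrm u = 0.
  by apply/eqP; rewrite -sqrf_eq0 eq_le sqr_ge0 andbT; apply: le_trans (nrm_a Xu) _; rewrite -au.
have mu : m u = 0 by apply/eqP; rewrite eq_le m0// andbT; apply: le_trans (m_nrm Xu) _; rewrite nu mulr0.
by rewrite /b mu -au !expr0n /= !mulr0.
Qed.

Let S0 : 0 < S.
Proof.
have [u Xu mu] := nontrivial; have := S_ge Xu; have bu : 0 < b u by rewrite mulr_gt0// exprn_gt0.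
move=> /(lt_le_trans bu); rewrite ltNge => h; rewrite ltNge; apply: contra h => h.
by rewrite mulr_le0_ge0// sqr_ge0.
Qed.

Let unit_m u : X u -> a u = 1 -> nrm u <= 1 /\ m u <= C.
Proof.
move=> Xu au; have n1 : nrm u <= 1.
  by have := nrm_a Xu; rewrite au -[X in _ <= X](expr1n R 2) ler_pXn2r ?nnegrE ?nrm0.
by split=> //; apply: le_trans (m_nrm Xu) _; rewrite ger_pMr.
Qed.

Let parallelogram u v : X u -> X v -> a (u + v) + a (u - v) = 2 * a u + 2 * a v.
Proof. by move=> Xu Xv; rewrite -scN !aD ?BZ ?aZ//; try exact: XZ; ring. Qed.

(** Let d = a(u - v). The parallelogram identity gives a(u + v) = 4 - d, hence b(u + v) <= S (4 -
    d)^2 <= S (16 - 4 d). As u + v is close to 2u for [m], b(u + v) is also nearly 16 S. The two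
    bounds leave little room for d. *)
Let midpoint u v (e : R) : X u -> X v -> a u = 1 -> a v = 1 -> 0 <= e -> S - e <= b u ->
  m (u - v) <= e -> a (u - v) <= (4 + 8 * kappa * C ^+ 3) / S * e.
Proof.
move=> Xu Xv au av e0 be me; have [nu mu] := unit_m Xu au.
have XBuv := XB Xu Xv; have XDuv := XD Xu Xv.
have P := parallelogram Xu Xv; rewrite au av in P.
set d := a (u - v) in P *; have d0 : 0 <= d by exact: a0.
have h1 := S_ge XDuv; have aE : a (u + v) = 4 - d by lra.
have d4 : d <= 4 by have := a0 XDuv; lra.
have m2 : 2 * m u - e <= m (u + v).
  have : m (sc (1 + 1) u) <= m (u + v) + m (u - v).
    by rewrite -scD sc1 (_ : u + u = (u + v) + (u - v)) ?mD// addrACA subrr addr0.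
  by rewrite mZ// ger0_norm; lra.
have mu0 := m0 Xu.
have t1 : 16 * m u ^+ 4 - 32 * C ^+ 3 * e <= m (u + v) ^+ 4.
  apply: le_trans (quartic_tangent _ (2 * m u)).
  have c3 : m u ^+ 3 <= C ^+ 3 by rewrite ler_pXn2r ?nnegrE// ltW.
  have c4 : 0 <= m u ^+ 3 by rewrite exprn_ge0.
  have x1 : 0 <= m u ^+ 3 * (m (u + v) - 2 * m u + e) by rewrite mulr_ge0//; lra.
  have x2 : m u ^+ 3 * e <= C ^+ 3 * e by apply: ler_wpM2r.
  have -> : (2 * m u) ^+ 4 + 4 * (2 * m u) ^+ 3 * (m (u + v) - 2 * m u) =
    16 * m u ^+ 4 + 32 * (m u ^+ 3 * (m (u + v) - 2 * m u + e)) - 32 * (m u ^+ 3 * e) by ring.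
  by lra.
have t2 : 16 * b u - 32 * kappa * C ^+ 3 * e <= b (u + v).
  have := ler_wpM2l (ltW kappa0) t1; rewrite /b => h.
  by have -> : 16 * (kappa * m u ^+ 4) - 32 * kappa * C ^+ 3 * e = kappa * (16 * m u ^+ 4 - 32 * C ^+ 3 * e) by ring.
rewrite aE in h1; have q : (4 - d) ^+ 2 <= 16 - 4 * d.
  by rewrite -subr_ge0 (_ : _ - _ = d * (4 - d)); [rewrite mulr_ge0// subr_ge0|ring].
have h2 : b (u + v) <= S * (16 - 4 * d) by apply: le_trans h1 _; rewrite ler_pM2l.
rewrite mulrAC ler_pdivlMr//; lra.
Qed.

Let kC : 0 <= kappa * C ^+ 3 := mulr_ge0 (ltW kappa0) (exprn_ge0 3 (ltW C0)).

(** Compactness extracts from a maximising sequence a subsequence Cauchy for [m]; [midpoint] makes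
    it Cauchy for [nrm], and completeness gives the limit. *)
Let maximizer : exists u, [/\ X u, a u = 1 & b u = S].
Proof.
have [u hu] : exists u : nat -> V, forall n, [/\ X (u n), a (u n) = 1 & S - n.+1%:R^-1 < b (u n)].
  have /choice[u hu] : forall n, exists u, [/\ X u, a u = 1 & S - n.+1%:R^-1 < b u].
    move=> n; have e0 : 0 < n.+1%:R^-1 :> R by rewrite invr_gt0 ltr0n.
    by have [_ [u Xu [au <-]] h] := sup_adherent e0 values_sup; exists u.
  by exists u.
have [phi [phiS mC]] := compactness (fun n => let: And3 x _ _ := hu n in x)
  (fun n => let: And3 x y _ := hu n in (unit_m x y).1).
have phige k : (k <= phi k)%N by elim: k => // k IH; exact: leq_ltn_trans IH (phiS k).
pose w n := u (phi n); have Xw n : X (w n) by case: (hu (phi n)).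
have aw n : a (w n) = 1 by case: (hu (phi n)).
have bw (e : R) : 0 < e -> exists k, forall n, (k <= n)%N -> S - e <= b (w n).
  move=> e0; exists (Num.truncn e^-1) => n kn; have [_ _ h] := hu (phi n).
  apply: ltW; apply: le_lt_trans h; rewrite lerD2l lerN2 invf_ple ?posrE ?ltr0n//.
  by apply: le_trans (ltW (truncnS_gt _)) _; rewrite ler_nat ltnS (leq_trans kn).
pose D : R := (4 + 8 * kappa * C ^+ 3) / S.
have D0 : 0 < D.
  by rewrite divr_gt0//; have := kC; lra.
have [||v Xv hv] := complete (u := w) => //.
  (* With this choice the bound of [midpoint] becomes e^2 / 2. *)
  move=> e e0; pose e' : R := e ^+ 2 / (2 * D).
  have e'0 : 0 < e' by rewrite divr_gt0 ?exprn_gt0// mulr_gt0.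
  have [k1 h1] := bw _ e'0; have [k2 h2] := mC _ e'0.
  exists (maxn k1 k2) => p q; rewrite !geq_max => /andP[p1 p2] /andP[q1 q2].
  have h := midpoint (Xw p) (Xw q) (aw p) (aw q) (ltW e'0) (h1 p p1) (ltW (h2 p q p2 q2)).
  have XB' := XB (Xw p) (Xw q).
  rewrite -(ltr_pXn2r (n := 2)) ?nnegrE ?nrm0 ?(ltW e0)//.
  apply: le_lt_trans (nrm_a XB') (le_lt_trans h _); rewrite -/D /e'.
  have -> : D * (e ^+ 2 / (2 * D)) = e ^+ 2 / 2 by field; rewrite gt_eqF.
  by have := exprn_gt0 2 e0; lra.
have small (e : R) : 0 < e -> exists n, [/\ a (v - w n) <= e, m (w n - v) <= e & S - e <= b (w n)].
  move=> e0; pose d := Num.min 1 (e / C); have d0 : 0 < d by rewrite lt_min ltr01 divr_gt0.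
  have [k1 h1] := hv d d0; have [k2 h2] := bw e e0; exists (maxn k1 k2).
  have {}h1 := h1 _ (leq_maxl k1 k2); set n := maxn k1 k2 in h1 *.
  have XBv := XB (Xw n) Xv; have n0 := nrm0 XBv.
  have d1 : d <= 1 by rewrite ge_min lexx.
  have de : d <= e / C by rewrite ge_min lexx orbT.
  have Ce : C * nrm (w n - v) <= e.
    by rewrite mulrC -ler_pdivlMr//; exact: le_trans (ltW h1) de.
  split; last exact: h2 _ (leq_maxr _ _).
    have -> : v - w n = sc (-1) (w n - v) by rewrite scN opprB.
    rewrite aZ// sqrrN expr1n mul1r; apply: le_trans (a_nrm XBv) (le_trans _ Ce).
    rewrite ler_pM2l// expr2; apply: ler_piMl => //.
    exact: le_trans (ltW h1) d1.
  exact: le_trans (m_nrm XBv) Ce.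
have bS : S <= b v.
  apply/ler_addgt0Pr => e e0; pose D' : R := 1 + 4 * kappa * C ^+ 3.
  have D'0 : 0 < D'.
    by rewrite /D'; have := kC; lra.
  have [n [_ h2 h3]] := small _ (divr_gt0 e0 D'0); set e' := e / D' in h2 h3.
  have e'0 : 0 < e' by rewrite divr_gt0.
  have [_ mw] := unit_m (Xw n) (aw n).
  have mw0 := m0 (Xw n); have mv := mB (Xw n) Xv.
  have t1 : m (w n) ^+ 4 - 4 * C ^+ 3 * e' <= m v ^+ 4.
    apply: le_trans (quartic_tangent _ (m (w n))).
    have c3 : m (w n) ^+ 3 <= C ^+ 3 by rewrite ler_pXn2r ?nnegrE// ltW.
    have c4 : 0 <= m (w n) ^+ 3 by rewrite exprn_ge0.
    have x1 : 0 <= m (w n) ^+ 3 * (m v - m (w n) + e') by rewrite mulr_ge0//; lra.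
    have x2 : m (w n) ^+ 3 * e' <= C ^+ 3 * e' by apply: ler_wpM2r => //; exact: ltW.
    by lra.
  have t2 := ler_wpM2l (ltW kappa0) t1.
  have t3 : b (w n) - 4 * kappa * C ^+ 3 * e' <= b v.
    by apply: le_trans t2; rewrite /b le_eqVlt; apply/orP; left; apply/eqP; ring.
  have : D' * e' = e by rewrite /e' mulrC divfK// gt_eqF.
  by rewrite /D' => q; lra.
(* Expand [a] around [w n]. The cross term obeys 2 B <= d/2 + (2/d) a(v - w n), which is
   nonnegativity of [a] at (d/2) w_n - (v - w_n). *)
have a1 : a v <= 1.
  apply/ler_addgt0Pr => d d0; pose e : R := d / 2 / (1 + 2 / d).
  have q0 : 0 < 1 + 2 / d by rewrite addr_gt0// divr_gt0.
  have e0 : 0 < e by rewrite !divr_gt0.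
  have [n [h1 _ _]] := small e e0; have XBv := XB Xv (Xw n).
  have := aD (Xw n) XBv; rewrite addrC subrK aw => Ea.
  have XZw := XZ (d / 2) (Xw n).
  have : 0 <= a (sc (d / 2) (w n) + sc (-1) (v - w n)) by apply: a0; apply: XD => //; exact: XZ.
  rewrite aD//; last exact: XZ.
  rewrite BZ// BZl// !aZ// aw sqrrN expr1n mul1r mulr1 => h2.
  have d2 : 0 < d / 2 by rewrite divr_gt0.
  have h3 : 2 * B (w n) (v - w n) <= d / 2 + 2 / d * a (v - w n).
    rewrite -(ler_pM2l d2) mulrDr [d / 2 * (2 / d * _)](_ : _ = a (v - w n)).
      by rewrite -expr2; lra.
    by field; rewrite gt_eqF.
  have h4 : (1 + 2 / d) * a (v - w n) <= d / 2.
    apply: le_trans (ler_wpM2l (ltW q0) h1) _.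
    by rewrite /e mulrC divfK// gt_eqF.
  by lra.
have bSv := S_ge Xv; have av0 := a0 Xv.
have a2 : a v ^+ 2 <= 1 by rewrite -(expr1n R 2) ler_pXn2r ?nnegrE.
have bv : b v = S.
  by apply/eqP; rewrite eq_le bS andbT; apply: le_trans bSv _; rewrite ger_pMr.
exists v; split=> //; apply/eqP; rewrite eq_le a1 /=.
have : 1 <= a v ^+ 2 by rewrite -(ler_pM2l S0) mulr1 -{1}bv.
by rewrite -{1}(expr1n R 2) ler_pXn2r ?nnegrE.
Qed.

Let expansion u h : X u -> X h -> l u h = 4 * B u h ->
  `|E (u + h) - E u - a h / 2| <= K * m h ^+ 2 * (m u + m h) ^+ 2 / 4.
Proof.
move=> Xu Xh lB; have := bD Xu Xh; rewrite !EE//; last exact: XD.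
rewrite aD// lB !ler_norml => /andP[h1 h2]; apply/andP; split; lra.
Qed.

(** Once the linear terms cancel, the energy increment is a(h)/2 up to the quartic remainder, and
    both are quadratic in [nrm h]. *)
Let critical_of_eq u : X u -> (forall h, X h -> l u h = 4 * B u h) -> critical_point X nrm E u.
Proof.
move=> Xu lB; split=> // e e0.
pose M : R := C + K * C ^+ 2 * (m u + C) ^+ 2 + 1.
have mu0 := m0 Xu.
have kk : 0 <= K * C ^+ 2 * (m u + C) ^+ 2 := mulr_ge0 (mulr_ge0 K0 (sqr_ge0 C)) (sqr_ge0 _).
have M0 : 0 < M by rewrite /M; have := C0; lra.
exists (Num.min 1 (e / M)) => [|h Xh]; first by rewrite lt_min ltr01 divr_gt0.
rewrite lt_min => /andP[h1 h2]; have n0 := nrm0 Xh; have mh := m_nrm Xh; have mh0 := m0 Xh.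
have := expansion Xu Xh (lB h Xh) => x1.
have mC : m h <= C by apply: le_trans mh _; rewrite ger_pMr// ltW.
have x2 : K * m h ^+ 2 * (m u + m h) ^+ 2 <= K * C ^+ 2 * (m u + C) ^+ 2 * nrm h ^+ 2.
  have q1 : m h ^+ 2 <= C ^+ 2 * nrm h ^+ 2.
    by rewrite -exprMn ler_pXn2r ?nnegrE// (mulr_ge0 (ltW C0) n0).
  have q2 : (m u + m h) ^+ 2 <= (m u + C) ^+ 2.
    by rewrite ler_pXn2r ?nnegrE ?lerD2l// addr_ge0// ltW.
  have := ler_pM (mulr_ge0 K0 (sqr_ge0 (m h))) (sqr_ge0 (m u + m h)) (ler_wpM2l K0 q1) q2.
  by rewrite (mulrA K (C ^+ 2)) (mulrAC (K * C ^+ 2)).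
have x3 := a_nrm Xh; have ah := a0 Xh.
have x4 : M * nrm h ^+ 2 <= e * nrm h.
  rewrite expr2 mulrA; apply: ler_wpM2r => //.
  by rewrite mulrC -ler_pdivlMr// ltW.
have s0 := sqr_ge0 (nrm h).
have x5 : M * nrm h ^+ 2 = C * nrm h ^+ 2 + K * C ^+ 2 * (m u + C) ^+ 2 * nrm h ^+ 2 + nrm h ^+ 2.
  by rewrite /M; ring.
rewrite -[_ - E u](subrK (a h / 2)); apply: le_trans (ler_normD _ _) _.
have p0 := mulr_ge0 kk s0.
by rewrite [X in _ + X <= _]ger0_norm; lra.
Qed.

(** The energy at (1 + t) v differs from that at v by t (a - b) + O(t^2), while criticality makes
    the difference o(t). *)
Let critical_a_b v : critical_point X nrm E v -> a v = b v.
Proof.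
move=> [Xv hv]; apply/eqP; rewrite -subr_eq0 -normr_eq0 eq_le normr_ge0 andbT.
have n0 := nrm0 Xv; have av := a0 Xv; have bv := b0 Xv.
apply/ler_addgt0Pr => e e0; rewrite add0r.
have N0 : 0 < 2 * (nrm v + 1) by rewrite mulr_gt0// ltr_wpDl.
have [d d0 hd] := hv _ (divr_gt0 e0 N0).
pose Q : R := a v + 3 * b v + 1; have Q0 : 0 < Q by rewrite /Q; lra.
pose t : R := Num.min 1 (Num.min (d / (2 * (nrm v + 1))) (e / (2 * Q))).
have t0 : 0 < t by rewrite !lt_min ltr01 !divr_gt0// mulr_gt0.
have t1 : t <= 1 by rewrite ge_min lexx.
have t2 : t <= d / (2 * (nrm v + 1)) by rewrite !ge_min lexx orbT.
have t3 : t <= e / (2 * Q) by rewrite !ge_min lexx !orbT.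
have XZv := XZ t Xv.
have := hd _ XZv; rewrite nrmZ// gtr0_norm// scD.
have tn : t * nrm v < d.
  move: t2; rewrite ler_pdivlMr// => t2; have := mulr_ge0 (ltW t0) n0; lra.
move=> /(_ tn); rewrite !EE//; last exact: XZ.
rewrite aZ// bZ//.
have -> : (1 + t) ^+ 2 * a v / 2 - (1 + t) ^+ 4 * b v / 4 - (a v / 2 - b v / 4) =
  t * ((a v - b v) + t * (a v / 2 - (6 + 4 * t + t ^+ 2) / 4 * b v)) by field.
rewrite normrM (gtr0_norm t0) (mulrCA (e / _)) ler_pM2l// => h.
set y := a v / 2 - _ in h.
have tt : t ^+ 2 <= 1 by rewrite -(expr1n R 2) ler_pXn2r ?nnegrE// ltW.
have yQ : `|y| <= Q.
  have c0 : 0 <= (6 + 4 * t + t ^+ 2) / 4 by have := sqr_ge0 t; lra.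
  have c1 : (6 + 4 * t + t ^+ 2) / 4 * b v <= 3 * b v by apply: ler_wpM2r => //; lra.
  have c2 : 0 <= (6 + 4 * t + t ^+ 2) / 4 * b v by rewrite mulr_ge0.
  by rewrite ler_norml /y /Q; apply/andP; split; lra.
have ty : `|t * y| <= e / 2.
  rewrite normrM gtr0_norm//; apply: (@le_trans _ _ (t * Q)); first by rewrite ler_pM2l.
  by move: t3; rewrite ler_pdivlMr ?mulr_gt0//; lra.
have ne : e / (2 * (nrm v + 1)) * nrm v <= e / 2.
  have -> : e / (2 * (nrm v + 1)) * nrm v = e / 2 * (nrm v / (nrm v + 1)).
    by field; rewrite gt_eqF// ltr_wpDl.
  rewrite ger_pMr ?divr_gt0// ler_pdivrMr ?ltr_wpDl// mul1r lerDl//.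
have -> : a v - b v = (a v - b v + t * y) - t * y by rewrite addrK.
by apply: le_trans (ler_normB _ _) _; rewrite (splitr e) lerD// (le_trans h).
Qed.

Lemma ground_state_saddle : exists u, [/\ [/\ critical_point X nrm E u, ~ Z u &
    forall v, critical_point X nrm E v -> ~ Z v -> E u <= E v], 0 < E u & saddle_type X nrm E u].
Proof.
have [u1 [Xu1 au1 bu1]] := maximizer.
(* S^(-1/2) is the factor for which the quadratic and the quartic part coincide: both become 1/S. *)
pose u := sc (Num.sqrt S)^-1 u1; have Xu : X u by exact: XZ.
have au : a u = S^-1 by rewrite aZ// exprVn sqr_sqrtr ?(ltW S0)// au1 mulr1.
have bu : b u = S^-1.
  rewrite bZ// exprVn (exprM _ 2 2) sqr_sqrtr ?(ltW S0)// bu1; field; rewrite gt_eqF//.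
have Si : 0 < S^-1 by rewrite invr_gt0.
have SS : S * S^-1 = 1 by rewrite mulfV// gt_eqF.
(* b <= S a^2 along u + t h, with equality at t = 0. Comparing the terms linear in t for both signs
   of t forces l = 4 B. *)
have lB h : X h -> l u h = 4 * B u h.
  move=> Xh; apply/eqP; rewrite -subr_eq0; apply/eqP.
  have mu0 := m0 Xu; have mh0 := m0 Xh; have ah := a0 Xh.
  pose c : R := K * m h ^+ 2 * (m u + m h) ^+ 2 + 2 * a h + S * (2 * `|B u h| + a h) ^+ 2.
  apply: (@squeeze_eq0 _ _ c) => t t1; have XZh := XZ t Xh.
  have := bD Xu XZh; rewrite lZ// mZ// ler_norml => /andP[h1 _].
  have h2 := S_ge (XD Xu XZh); rewrite aD// BZ// aZ// au in h2.
  have tt0 := sqr_ge0 t; have tt1 : t ^+ 2 <= 1.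
    by rewrite -real_normK ?num_real// -(expr1n R 2) ler_pXn2r ?nnegrE.
  have e1 : K * (`|t| * m h) ^+ 2 * (m u + `|t| * m h) ^+ 2 <= t ^+ 2 * (K * m h ^+ 2 * (m u + m h) ^+ 2).
    have q : (m u + `|t| * m h) ^+ 2 <= (m u + m h) ^+ 2.
      by rewrite ler_pXn2r ?nnegrE ?addr_ge0 ?mulr_ge0// lerD2l ler_piMl.
    rewrite exprMn real_normK ?num_real// (mulrCA K) -(mulrA (t ^+ 2)).
    exact: (ler_wpM2l tt0 (ler_wpM2l (mulr_ge0 K0 (sqr_ge0 (m h))) q)).
  pose x : R := 2 * (t * B u h) + t ^+ 2 * a h.
  have e2 : x ^+ 2 <= t ^+ 2 * (2 * `|B u h| + a h) ^+ 2.
    rewrite -exprMn -real_normK ?num_real// -[(t * _) ^+ 2]real_normK ?num_real//.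
    rewrite ler_pXn2r ?nnegrE// normrM [X in _ <= _ * X]ger0_norm ?addr_ge0 ?mulr_ge0//.
    have p1 : `|2 * (t * B u h)| = `|t| * (2 * `|B u h|).
      by rewrite (normrM 2) (normrM t) (ger0_norm (ler0n R 2)) mulrCA.
    have p2 : `|t ^+ 2 * a h| <= `|t| * a h.
      rewrite normrM (ger0_norm tt0) (ger0_norm ah) -(real_normK (num_real t)) expr2.
      exact: (ler_wpM2r ah (ler_piMl (normr_ge0 t) t1)).
    by rewrite /x mulrDr; apply: le_trans (ler_normD _ _) _; rewrite p1 lerD2l.
  have e3 := ler_wpM2l (ltW S0) e2.
  have e4 : S * (S^-1 + 2 * (t * B u h) + t ^+ 2 * a h) ^+ 2 = S^-1 + 2 * x + S * x ^+ 2.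
    have -> : S^-1 + 2 * (t * B u h) + t ^+ 2 * a h = S^-1 + x by rewrite /x addrA.
    by field; rewrite gt_eqF.
  rewrite e4 in h2; rewrite bu in h1.
  have -> : t * (l u h - 4 * B u h) = t * l u h - 2 * x + t ^+ 2 * (2 * a h) by rewrite /x; ring.
  have -> : t ^+ 2 * c = t ^+ 2 * (K * m h ^+ 2 * (m u + m h) ^+ 2) + t ^+ 2 * (2 * a h) +
     S * (t ^+ 2 * (2 * `|B u h| + a h) ^+ 2) by rewrite /c; ring.
  by lra.
have crit := critical_of_eq Xu lB.
have Eu : E u = S^-1 / 4 by rewrite EE// au bu; field; rewrite gt_eqF.
have nu : 0 < nrm u.
  rewrite lt_def nrm0// andbT; apply/eqP => n0; have := a_nrm Xu.
  by rewrite n0 expr0n mulr0 au leNgt Si.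
exists u; split.
- split=> //; first by move/(ZP Xu) => n0; rewrite n0 ltxx in nu.
  move=> v cv nZ; have Xv : X v by case: cv.
  have ab := critical_a_b cv; have nv : 0 < nrm v.
    by rewrite lt_def nrm0// andbT; apply/eqP => n0; apply: nZ; apply/(ZP Xv).
  have av : 0 < a v by apply: lt_le_trans (nrm_a Xv); rewrite exprn_gt0.
  have := S_ge Xv; rewrite -ab expr2 mulrA -{1}[a v]mul1r ler_pM2r// => h.
  have {}h : S^-1 <= a v by rewrite -(ler_pM2l S0) SS.
  by rewrite Eu EE// -ab; lra.
- by rewrite Eu divr_gt0.
split=> // r r0.
pose t : R := r / (2 * nrm u); have t0 : 0 < t by rewrite divr_gt0// mulr_gt0.
have mu0 := m0 Xu.
pose W : R := K * (m u + 1) ^+ 2 + 1; have W0 : 0 < W by rewrite ltr_wpDl// mulr_ge0// sqr_ge0.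
have W1 : 1 <= W by rewrite lerDr mulr_ge0// sqr_ge0.
(* W is chosen so that K (m u + 1)^2 eps^2 <= 1. The remainder then costs at most a quarter of
   nrm(h)^2, against the half provided by a(h)/2. *)
pose eps : R := W^-1; have eps0 : 0 < eps by rewrite invr_gt0.
have eps1 : eps <= 1 by rewrite invf_le1.
(* Compactness finds two members of the separated family whose difference is below [eps] for [m] yet
   at least one for [nrm]. *)
have [f [Xf nf sf]] := separated; have [phi [phiS hphi]] := compactness Xf nf.
have [k hk] := hphi _ eps0.
pose g := f (phi k.+1) - f (phi k); have Xg : X g by exact: XB.
have mg : m g < eps by apply: hk.
have ng : 1 <= nrm g by apply: sf; rewrite neq_ltn (phiS k) orbT.
have ng0 : 0 < nrm g by lra.
pose rr := Num.min r 1; have rr0 : 0 < rr by rewrite lt_min r0 ltr01.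
have rrr : rr <= r by rewrite ge_min lexx.
have rr1 : rr <= 1 by rewrite ge_min lexx orbT.
pose tau : R := rr / (2 * nrm g); have tau0 : 0 < tau by rewrite divr_gt0// mulr_gt0.
pose h := sc tau g; have Xh : X h by exact: XZ.
have nh : nrm h = rr / 2.
  by rewrite nrmZ// gtr0_norm// /tau; field; rewrite gt_eqF.
have mh : m h <= eps * nrm h.
  rewrite mZ// nrmZ// gtr0_norm// mulrCA ler_pM2l//; apply: le_trans (ltW mg) _.
  by rewrite ler_peMr// ltW.
(* Along the ray the energy changes by -(1/S) t^2 (2 + t)^2 / 4; along [h] the quadratic part
   dominates. *)
exists (sc (1 + t) u), (u + h); split.
  split; [exact: XZ| |exact: XD|].
    rewrite -scD addrAC subrr add0r nrmZ// gtr0_norm// /t.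
    have -> : r / (2 * nrm u) * nrm u = r / 2 by field; rewrite gt_eqF.
    by lra.
  by rewrite addrAC subrr add0r nh; lra.
apply/andP; split.
  rewrite !EE//; last exact: XZ.
  rewrite aZ// bZ// au bu -subr_gt0.
  have -> : S^-1 / 2 - S^-1 / 4 - ((1 + t) ^+ 2 * S^-1 / 2 - (1 + t) ^+ 4 * S^-1 / 4) =
     S^-1 * (t ^+ 2 * (2 + t) ^+ 2) / 4 by field; rewrite gt_eqF.
  by rewrite divr_gt0// mulr_gt0// mulr_gt0 ?exprn_gt0// ltr_wpDl// ltW.
have := expansion Xu Xh (lB h Xh); rewrite ler_norml => /andP[h1 _].
have mh0 := m0 Xh; have mh1 : m h <= 1.
  by apply: le_trans mh _; rewrite nh mulr_ile1 ?(ltW eps0)//; lra.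
have nh0 : 0 < nrm h by rewrite nh divr_gt0.
have h2 : K * m h ^+ 2 * (m u + m h) ^+ 2 <= nrm h ^+ 2.
  apply: (@le_trans _ _ (K * (eps * nrm h) ^+ 2 * (m u + 1) ^+ 2)).
    have q1 : m h ^+ 2 <= (eps * nrm h) ^+ 2.
      by rewrite ler_pXn2r ?nnegrE// (mulr_ge0 (ltW eps0) (ltW nh0)).
    have q2 : (m u + m h) ^+ 2 <= (m u + 1) ^+ 2 by rewrite ler_pXn2r ?nnegrE ?addr_ge0// lerD2l.
    exact: (ler_pM (mulr_ge0 K0 (sqr_ge0 (m h))) (sqr_ge0 (m u + m h)) (ler_wpM2l K0 q1) q2).
  have -> : K * (eps * nrm h) ^+ 2 * (m u + 1) ^+ 2 = (K * (m u + 1) ^+ 2 * eps) * eps * nrm h ^+ 2 by ring.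
  apply: ler_piMl; first exact: sqr_ge0.
  have q : K * (m u + 1) ^+ 2 * eps <= 1.
    by rewrite /eps ler_pdivrMr// mul1r /W lerDl.
  exact: (mulr_ile1 (mulr_ge0 (mulr_ge0 K0 (sqr_ge0 (m u + 1))) (ltW eps0)) (ltW eps0) q eps1).
have h3 := nrm_a Xh; have h4 : 0 < nrm h ^+ 2 by rewrite exprn_gt0.
by lra.
Qed.

End mountain_pass.

Opaque weak_deriv.

(** * Vector fields in L^4 and the quartic form *)

Section gradient_fields.
Context {R : realType} {N : nat} (Omega : set 'rV[R]_N).
Hypothesis mO : measurable Omega.
Implicit Types (F G : 'I_N -> 'rV[R]_N -> R).
Local Notation L2 := (L2 Omega).
Local Notation L4 := (L4 Omega).
Local Notation n2 := (n2 Omega).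
Local Notation n4 := (n4 Omega).
Local Notation ip := (ip Omega).

Definition fnorm F (x : 'rV[R]_N) : R := Num.sqrt (\sum_i F i x ^+ 2).
Definition fdot F G (x : 'rV[R]_N) : R := \sum_i F i x * G i x.

Lemma fnorm_ge0 F x : 0 <= fnorm F x. Proof. exact: sqrtr_ge0. Qed.

Lemma fdotE F x : fdot F F x = fnorm F x ^+ 2.
Proof.
rewrite sqr_sqrtr; last by apply: sumr_ge0 => i _; exact: sqr_ge0.
by apply: eq_bigr => i _; rewrite expr2.
Qed.

Lemma fdot_le F G x : `|fdot F G x| <= fnorm F x * fnorm G x.
Proof.
have q0 H : 0 <= fdot H H x by rewrite fdotE sqr_ge0.
rewrite -(ler_pXn2r (n := 2)) ?nnegrE ?(mulr_ge0 (fnorm_ge0 F x) (fnorm_ge0 G x))//.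
rewrite real_normK ?num_real// exprMn -!fdotE; apply: quadratic_discriminant => // t.
have := q0 (fun i y => F i y + t * G i y); congr (_ <= _); rewrite /fdot.
by rewrite !mulr_sumr -!big_split/=; apply: eq_bigr => i _; ring.
Qed.

Lemma fnormD F G x : fnorm (fun i y => F i y + G i y) x <= fnorm F x + fnorm G x.
Proof.
rewrite -(ler_pXn2r (n := 2)) ?nnegrE ?fnorm_ge0 ?(addr_ge0 (fnorm_ge0 F x) (fnorm_ge0 G x))//.
rewrite sqrrD -!fdotE (_ : fdot _ _ x = fdot F F x + 2 * fdot F G x + fdot G G x); last first.
  by rewrite /fdot !mulr_sumr -!big_split/=; apply: eq_bigr => i _; ring.
have := le_trans (ler_norm _) (fdot_le F G x); lra.
Qed.

Lemma fnormZ F (t : R) x : fnorm (fun i y => t * F i y) x = `|t| * fnorm F x.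
Proof.
rewrite /fnorm (eq_bigr (fun i => t ^+ 2 * F i x ^+ 2)); last by move=> i _; rewrite exprMn.
by rewrite -mulr_sumr sqrtrM ?sqr_ge0// sqrtr_sqr.
Qed.

Lemma fnorm_comp F x i : `|F i x| <= fnorm F x.
Proof.
rewrite -sqrtr_sqr ler_wsqrtr// (bigD1 i)//= lerDl; apply: sumr_ge0 => j _; exact: sqr_ge0.
Qed.

Lemma fnorm_sum F x : fnorm F x <= \sum_i `|F i x|.
Proof.
have S0 : 0 <= \sum_i `|F i x| by apply: sumr_ge0.
rewrite -(ger0_norm S0) -sqrtr_sqr ler_wsqrtr// expr2 mulr_suml; apply: ler_sum => i _.
rewrite -real_normK ?num_real// expr2; apply: ler_wpM2l => //.
by rewrite (bigD1 i)//= lerDl; apply: sumr_ge0.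
Qed.

Lemma measurable_fnorm F : (forall i, measurable_fun Omega (F i)) -> measurable_fun Omega (fnorm F).
Proof.
move=> mF; apply: (measurableT_comp (f := @Num.sqrt R)).
  by apply: continuous_measurable_fun; exact: sqrt_continuous.
by apply: measurable_sum => i; exact: measurable_funX.
Qed.

Lemma L4_fnorm F : (forall i, L4 (F i)) -> L4 (fnorm F) /\ n4 (fnorm F) <= \sum_i n4 (F i).
Proof.
move=> LF; have mF i : measurable_fun Omega (F i) by case: (LF i).
have La i : L4 (fun x => `|F i x|) /\ n4 (fun x => `|F i x|) <= n4 (F i).
  by apply: (L4_le mO (LF i)) => [|x _]; [exact: measurableT_comp|rewrite normr_id].
have [s1 s2] := L4_sum mO (index_enum 'I_N) (fun i => (La i).1).
have [|t1 t2] := L4_le mO s1 (measurable_fnorm mF).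
  move=> x _; rewrite !ger0_norm ?fnorm_ge0 ?fnorm_sum//; exact: sumr_ge0.
split=> //; apply: le_trans t2 (le_trans s2 _); apply: ler_sum => i _; exact: (La i).2.
Qed.

Lemma fnorm_aeq F G : (forall i, aeq Omega (F i) (G i)) -> aeq Omega (fnorm F) (fnorm G).
Proof.
move=> h; have := filter_forall (ae_filter_ringOfSetsType (lebesgue_rV R N)) h.
apply: filterS => x q Ox; congr Num.sqrt; apply: eq_bigr => i _; by rewrite q.
Qed.

Lemma fdot_aeq F G F' G' : (forall i, aeq Omega (F i) (F' i)) -> (forall i, aeq Omega (G i) (G' i)) ->
  aeq Omega (fdot F G) (fdot F' G').
Proof.
move=> h h'; have := filter_forall (ae_filter_ringOfSetsType (lebesgue_rV R N)) h.
have := filter_forall (ae_filter_ringOfSetsType (lebesgue_rV R N)) h'.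
by apply: filterS2 => x q q' Ox; apply: eq_bigr => i _; rewrite q ?q'.
Qed.

Lemma n4_fnorm_aeq F G : (forall i, L4 (F i)) -> (forall i, L4 (G i)) ->
  (forall i, aeq Omega (F i) (G i)) -> n4 (fnorm F) = n4 (fnorm G).
Proof.
move=> LF LG h; congr Num.sqrt; apply: (aeq_n2 mO (L4_fnorm LF).1.2 (L4_fnorm LG).1.2).
by have := fnorm_aeq h; apply: filterS => x q Ox; rewrite q.
Qed.

Lemma L2_fdot F G : (forall i, L4 (F i)) -> (forall i, L4 (G i)) -> L2 (fdot F G).
Proof. by move=> LF LG; apply: (L2_sum mO) => i; exact: (L4_mul mO (LF i) (LG i)).1. Qed.

Lemma L2_fnorm2 F : (forall i, L4 (F i)) -> L2 (fun x => fnorm F x ^+ 2).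
Proof. by move=> LF; exact: (L4_fnorm LF).1.2. Qed.

(* Writing |F + G|^2 = |F|^2 + T with T = 2 F.G + |G|^2, the remainder of the
   quartic form is |T|^2 + 2 |F|^2 |G|^2, and |T| <= 2 |G| (|F| + |G|). *)
Lemma quartic_expansion F G : (forall i, L4 (F i)) -> (forall i, L4 (G i)) ->
  `|n4 (fnorm (fun i x => F i x + G i x)) ^+ 4 - n4 (fnorm F) ^+ 4 -
    4 * ip (fun x => fnorm F x ^+ 2) (fdot F G)| <=
  6 * n4 (fnorm G) ^+ 2 * (n4 (fnorm F) + n4 (fnorm G)) ^+ 2.
Proof.
move=> LF LG; have [LnF _] := L4_fnorm LF; have [LnG _] := L4_fnorm LG.
have LFG i : L4 (fun x => F i x + G i x) by exact: (L4D mO (LF i) (LG i)).1.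
have LP := L2_fnorm2 LF; have LQ := L2_fnorm2 LG; have Ld := L2_fdot LF LG.
pose T x := 2 * fdot F G x + fnorm G x ^+ 2.
have LT : L2 T by apply: (L2D mO) => //; exact: (L2Z mO).
have n44 H : n4 (fnorm H) ^+ 4 = ip (fun x => fnorm H x ^+ 2) (fun x => fnorm H x ^+ 2).
  by rewrite (exprM _ 2 2) n4_sqr n2_sqr.
have W x : fnorm (fun i y => F i y + G i y) x ^+ 2 = fnorm F x ^+ 2 + T x.
  rewrite -!fdotE /T -fdotE /fdot !mulr_sumr -!big_split/=; apply: eq_bigr => i _; ring.
rewrite [n4 (fnorm (fun i x => F i x + G i x)) ^+ 4]n44.
rewrite (eq_ip (fun x _ => W x) (fun x _ => W x)) (ipDl mO LP LT (L2D mO LP LT)).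
rewrite (ipDr mO LP LT LP) (ipDr mO LP LT LT) -n44.
have E1 : ip (fun x => fnorm F x ^+ 2) T = 2 * ip (fun x => fnorm F x ^+ 2) (fdot F G) +
    ip (fun x => fnorm F x ^+ 2) (fun x => fnorm G x ^+ 2).
  by rewrite (ipDr mO (L2Z mO 2 Ld) LQ LP) (ipZr mO 2 Ld LP).
rewrite (ipC _ T) E1 -n2_sqr.
have [LS hS] := L4D mO LnF LnG; have [LM hM] := L4_mul mO LnG LS.
have g0 := n4_ge0 Omega (fnorm G); have f0 := n4_ge0 Omega (fnorm F).
have b1 : n2 T <= 2 * (n4 (fnorm G) * (n4 (fnorm F) + n4 (fnorm G))).
  apply: (@le_trans _ _ (2 * n2 (fun x => fnorm G x * (fnorm F x + fnorm G x)))).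
    apply: (n2_le mO) => //; first exact: L2_measurable.
    move=> x _; have p0 := fnorm_ge0 F x; have q0 := fnorm_ge0 G x.
    rewrite [X in _ <= 2 * X]ger0_norm ?mulr_ge0 ?addr_ge0//.
    apply: le_trans (ler_normD _ _) _; rewrite normrM (ger0_norm (ler0n R 2)) (ger0_norm (sqr_ge0 (fnorm G x))).
    by have := fdot_le F G x; have := sqr_ge0 (fnorm G x); lra.
  by apply: ler_wpM2l => //; apply: le_trans hM _; apply: ler_wpM2l.
have b2 : n2 T ^+ 2 <= 4 * n4 (fnorm G) ^+ 2 * (n4 (fnorm F) + n4 (fnorm G)) ^+ 2.
  have -> : 4 * n4 (fnorm G) ^+ 2 * (n4 (fnorm F) + n4 (fnorm G)) ^+ 2 =
    (2 * (n4 (fnorm G) * (n4 (fnorm F) + n4 (fnorm G)))) ^+ 2 by ring.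
  by rewrite ler_pXn2r ?nnegrE ?n2_ge0// (mulr_ge0 (ler0n R 2) (mulr_ge0 g0 (addr_ge0 f0 g0))).
have b3 : `|ip (fun x => fnorm F x ^+ 2) (fun x => fnorm G x ^+ 2)| <=
    n4 (fnorm G) ^+ 2 * (n4 (fnorm F) + n4 (fnorm G)) ^+ 2.
  apply: le_trans (cauchy_schwarz mO LP LQ) _; rewrite -!n4_sqr mulrC; apply: ler_wpM2l.
    exact: sqr_ge0.
  by rewrite ler_pXn2r ?nnegrE ?addr_ge0// lerDl.
have key (f p q t : R) : f + (2 * p + q) + (2 * p + q + t) - f - 4 * p = t + 2 * q by ring.
rewrite key.
apply: le_trans (ler_normD _ _) _; rewrite (normrM 2) (ger0_norm (ler0n R 2)) (ger0_norm (sqr_ge0 (n2 T))); lra.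
Qed.

End gradient_fields.

(** * Limits along ultrafilters *)

Section ultrafilters.

(** The image filter has a cluster point in the compact interval [-M, M], and an ultrafilter
    converges to its cluster points. *)
Lemma ultra_lim (R : realType) (G : set_system nat) (x : nat -> R) (M : R) : UltraFilter G ->
  (forall n, `|x n| <= M) -> exists c : R, forall e : R, 0 < e -> G [set n | `|x n - c| < e].
Proof.
move=> uG hx; have FF : ProperFilter (x @ G) by exact: fmap_proper_filter.
have cI : compact (`[- M, M] : set R) by exact: segment_compact.
have FI : fmap x G [set` `[- M, M]].
  rewrite /fmap /= (_ : _ @^-1` _ = setT); first exact: filterT.
  by apply/seteqP; split=> n //= _; rewrite in_itv /= -ler_norml.
have [c [_ cl]] := cI _ FF FI; exists c => e e0.
have [//|nA] := in_ultra_setVsetC [set n | `|x n - c| < e] uG.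
have [|y [/= h1]] := cl [set y : R | ~ `|y - c| < e] (ball c e) _ (nbhsx_ballx c e e0); first exact: nA.
by rewrite /ball /= distrC.
Qed.

(** A sequence that is Cauchy along a filter containing all tails has a Cauchy subsequence: its k-th
    index is taken from the first k + 1 sets of a decreasing tolerance. *)
Lemma ultra_subsequence (R : realType) (d : nat -> nat -> R) (G : set_system nat) : ProperFilter G ->
  (forall q, G [set n | (q < n)%N]) ->
  (forall e : R, 0 < e -> exists2 A, G A & forall p q, A p -> A q -> d p q < e) ->
  exists phi : nat -> nat, (forall n, (phi n < phi n.+1)%N) /\
  forall e : R, 0 < e -> exists k, forall p q, (k <= p)%N -> (k <= q)%N -> d (phi p) (phi q) < e.
Proof.
move=> pG Goo h.
have /choice[A hA] : forall j, exists A, G A /\ forall p q, A p -> A q -> d p q < j.+1%:R^-1.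
  move=> j; have e0 : 0 < j.+1%:R^-1 :> R by rewrite invr_gt0 ltr0n.
  by have [A GA hA] := h _ e0; exists A.
(* [pick (q, k)] lies beyond [q] and in the sets [A j] for j <= k. *)
have /choice[pick hpick] : forall qk : nat * nat, exists n, (qk.1 < n)%N /\ forall j : 'I_qk.2.+1, A j n.
  move=> [q k] /=; have GA : G [set n | forall j : 'I_k.+1, A j n].
    by apply: filter_forall => j; exact: (hA j).1.
  by have [n [n1 n2]] := filter_ex (filterI (Goo q) GA); exists n.
pose phi := fix phi k := if k is k'.+1 then pick (phi k', k'.+1) else pick (0%N, 0%N).
have phiA k : forall j : 'I_k.+1, A j (phi k) by case: k => [|k]; [exact: (hpick (0%N, 0%N)).2|exact: (hpick (phi k, k.+1)).2].
exists phi; split=> [k|e e0]; first by have [q _] := hpick (phi k, k.+1).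
exists (Num.truncn e^-1) => p q kp kq.
have kl p' : (Num.truncn e^-1 <= p')%N -> A (Num.truncn e^-1) (phi p').
  by rewrite -ltnS => kp'; exact: (phiA p' (Ordinal kp')).
apply: lt_le_trans ((hA _).2 _ _ (kl p kp) (kl q kq)) _.
rewrite invf_ple ?posrE ?ltr0n//; exact: ltW (truncnS_gt _).
Qed.

End ultrafilters.

(** * Closedness of weak derivatives and disjoint bumps *)

Lemma wd_limit (R : realType) N (Omega : set 'rV[R]_N) i (F F' : nat -> 'rV[R]_N -> R) W W' :
  open Omega -> bounded_set Omega -> (forall k, L2 Omega (F k)) -> (forall k, L2 Omega (F' k)) ->
  L2 Omega W -> L2 Omega W' ->
  (forall e : R, 0 < e -> exists K, forall k, (K <= k)%N -> n2 Omega (fun x => F k x - W x) < e) ->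
  (forall e : R, 0 < e -> exists K, forall k, (K <= k)%N -> n2 Omega (fun x => F' k x - W' x) < e) ->
  (forall k, wd Omega i (F k) (F' k)) -> wd Omega i W W'.
Proof.
move=> oO bO LF LF' LW LW' h h' hw phi tp; have mO : measurable Omega by exact: measurable_rV_open.
apply/eqP; rewrite -subr_eq0 opprK; apply/eqP; apply: small_eq0 => e e0.
have Lp := test_L2 oO bO tp; have Lq := test_L2 oO bO (test_pderiv i tp).
pose M := n2 Omega phi + n2 Omega (pderiv i phi) + 1.
have M0 : 0 < M by rewrite /M; have := n2_ge0 Omega phi; have := n2_ge0 Omega (pderiv i phi); lra.
have [K1 h1] := h _ (divr_gt0 e0 M0); have [K2 h2] := h' _ (divr_gt0 e0 M0).
pose k := maxn K1 K2; have {}h1 := h1 k (leq_maxl _ _); have {}h2 := h2 k (leq_maxr _ _).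
have E : ip Omega W (pderiv i phi) + ip Omega W' phi =
    - ip Omega (fun x => F k x - W x) (pderiv i phi) - ip Omega (fun x => F' k x - W' x) phi.
  by rewrite !(ipBl mO)// (hw k phi tp); ring.
rewrite E -opprD normrN; apply: le_trans (ler_normD _ _) _.
have q1 := cauchy_schwarz mO (L2B mO (LF k) LW) Lq.
have q2 := cauchy_schwarz mO (L2B mO (LF' k) LW') Lp.
apply: le_trans (lerD q1 q2) _.
apply: (@le_trans _ _ (e / M * n2 Omega (pderiv i phi) + e / M * n2 Omega phi)).
  by apply: lerD; apply: ler_wpM2r; rewrite ?n2_ge0 ?(ltW h1) ?(ltW h2).
rewrite -mulrDr mulrAC ler_pdivrMr// ler_wpM2l ?(ltW e0)// /M.
by rewrite (addrC (n2 Omega (pderiv i phi))) lerDl.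
Qed.

Lemma ip0l (R : realType) N (Omega : set 'rV[R]_N) w : ip Omega (fun=> 0) w = 0.
Proof. by rewrite /ip; under eq_Rintegral do rewrite mul0r; rewrite /Rintegral integral0. Qed.

Lemma n2_lin_sqr (R : realType) N (Omega : set 'rV[R]_N) u v (c d : R) : measurable Omega ->
  L2 Omega u -> L2 Omega v -> n2 Omega (fun x => c * u x + d * v x) ^+ 2 =
  c ^+ 2 * ip Omega u u + 2 * c * d * ip Omega u v + d ^+ 2 * ip Omega v v.
Proof.
move=> mO Lu Lv; have Lc := L2Z mO c Lu; have Ld := L2Z mO d Lv; have LS := L2D mO Lc Ld.
rewrite n2_sqr (ipDl mO Lc Ld LS) (ipDr mO Lc Ld Lc) (ipDr mO Lc Ld Ld).
rewrite (ipZl mO c Lu Lc) (ipZr mO c Lu Lu) (ipZl mO c Lu Ld) (ipZr mO d Lv Lu).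
rewrite (ipZl mO d Lv Lc) (ipZr mO c Lu Lv) (ipZl mO d Lv Ld) (ipZr mO d Lv Lv).
have sym : ip Omega v u = ip Omega u v by exact: ipC.
by rewrite sym; ring.
Qed.

Lemma n2_lin_le (R : realType) N (Omega : set 'rV[R]_N) u v (c d : R) : measurable Omega ->
  L2 Omega u -> L2 Omega v ->
  n2 Omega (fun x => c * u x + d * v x) <= `|c| * n2 Omega u + `|d| * n2 Omega v.
Proof.
move=> mO Lu Lv; rewrite -(n2Z mO c Lu) -(n2Z mO d Lv).
exact: (n2D mO (L2Z mO c Lu) (L2Z mO d Lv)).
Qed.

Lemma norm_sub_lt (R : realType) (x y z d : R) : `|x - z| < d -> `|y - z| < d -> `|x - y| <= 2 * d.
Proof. by rewrite !ltr_norml ler_norml => /andP[? ?] /andP[? ?]; apply/andP; split; lra. Qed.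

Lemma net_bound (R : realType) (x y c t e d : R) : 0 < d -> 0 <= c -> 0 <= t ->
  d * (4 * ((c + 1) * (t + 1))) = e -> x <= e / 4 * 2 -> y <= t * (2 * d) -> x + c * y < e.
Proof.
move=> d0 c0 t0 E hx hy; have b := ler_wpM2l c0 hy.
have p1 := mulr_ge0 (ltW d0) (mulr_ge0 c0 t0); have p2 := mulr_ge0 (ltW d0) c0.
have p3 := mulr_ge0 (ltW d0) t0.
have E' : d * (4 * ((c + 1) * (t + 1))) = 4 * (d * (c * t)) + 4 * (d * c) + 4 * (d * t) + 4 * d by ring.
have E3 : c * (t * (2 * d)) = 2 * (d * (c * t)) by ring.
by rewrite E3 in b; rewrite E in E'; lra.
Qed.

Lemma separated_bumps (R : realType) n (Omega : set 'rV[R]_n.+1) : open Omega -> bounded_set Omega ->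
  Omega !=set0 -> exists chi : nat -> 'rV[R]_n.+1 -> R, exists K : nat -> set 'rV[R]_n.+1,
  [/\ forall k, test_function Omega (chi k), forall k, 0 < n2 Omega (chi k),
      forall k, closed (K k), forall k y, ~ K k y -> chi k y = 0 &
      forall p q y, p != q -> K p y -> ~ K q y].
Proof.
move=> oO bO [x0 Ox0]; have mO : measurable Omega by exact: measurable_rV_open.
have [e e0 he] := (rV_openP _).1 oO x0 Ox0.
(* The centres are x0 + d_k e_0 and the radii d_k / 4. For p < q the centres are at least d_p / 2
   apart, while the radii add up to at most 3 d_p / 8. *)
pose d k : R := e / 2 * 2^-1 ^+ k; have d0 k : 0 < d k by rewrite mulr_gt0 ?divr_gt0// exprn_gt0// invr_gt0.
have dS p q : (p < q)%N -> d q <= d p / 2.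
  move=> pq; have -> : d p / 2 = e / 2 * 2^-1 ^+ p.+1 by rewrite /d exprSr mulrA.
  apply: ler_wpM2l; first by rewrite divr_ge0// ltW.
  by apply: ler_wiXn2l => //; lra.
have de k : d k <= e / 2 by rewrite ger_pMr ?divr_gt0// exprn_ile1 ?invr_ge0// invf_le1// ler1n.
pose c k : 'rV[R]_n.+1 := x0 + d k *: delta_mx ord0 ord0.
have /choice[chi hchi] : forall k, exists chi : 'rV[R]_n.+1 -> R, [/\ forall l, Ck l chi,
    forall y, `|y - c k| <= d k / 4 / 2 -> chi y = 1 & forall y, chi y != 0 -> `|y - c k| <= d k / 4].
  by move=> k; exact: (cutoff (c k) (divr_gt0 (d0 k) (ltr0n R 4))).
pose K k := [set y : 'rV[R]_n.+1 | `|y - c k| <= d k / 4].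
have KO k : K k `<=` Omega.
  move=> y yK; apply: he; have cx : `|c k - x0| <= d k.
    apply/rV_norm_le; first exact: ltW.
    move=> j; rewrite /c !rVE addrAC subrr add0r normrM (gtr0_norm (d0 k)) ger_pMr//.
    by case: (j == ord0); rewrite ?normr1 ?normr0.
  rewrite -(subrKA (c k)); apply: le_lt_trans (ler_normD _ _) _.
  by have := d0 k; have := de k; move: yK; rewrite /K /=; lra.
have chi0 k y : ~ K k y -> chi k y = 0.
  by move=> nK; apply: contrapT => /eqP; have [_ _ q] := hchi k; move/q.
have cK k : compact (K k) by exact: rV_ball_compact.
have tchi k : test_function Omega (chi k).
  by have [q _ _] := hchi k; exact: (testfP q (cK k) (@KO k) (chi0 k)).
exists chi, K; split=> // [k|k|p q y pq Kp Kq].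
- rewrite lt_def n2_ge0 andbT; apply/eqP => n0.
  have [A [mA A0 sA]] := n2_eq0 mO (test_L2 oO bO (tchi k)) n0.
  (* On this cube of positive measure the bump equals one, so it cannot vanish almost everywhere. *)
  pose rr := d k / 4 / 2; have rr0 : 0 < rr by rewrite !divr_gt0.
  pose Q := [set y : 'rV[R]_n.+1 | forall i, - rr <= y ord0 i - c k ord0 i <= rr].
  have Ey y j : (y - c k) ord0 j = y ord0 j - c k ord0 j by rewrite !rVE.
  have QE : Q = [set y | `|y - c k| <= rr].
    apply/seteqP; split=> y /= h.
      by apply/rV_norm_le => [|j]; [exact: ltW|rewrite Ey ler_norml; exact: (h j)].
    by move=> j; have := (rV_norm_le _ (ltW rr0)).1 h j; rewrite Ey ler_norml.
  have mQ : measurable Q by rewrite QE; apply: measurable_rV_compact; exact: rV_ball_compact.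
  have QA : Q `<=` A.
    rewrite QE => y yr; apply: sA => /= h; have [_ q _] := hchi k.
    have Oy : Omega y by apply: (KO k); rewrite /K /=; apply: le_trans yr _; rewrite /rr; have := d0 k; lra.
    by have := h Oy; rewrite q// => /eqP; rewrite oner_eq0.
  have : (lebesgue_rV R n.+1 Q <= 0)%E by rewrite -A0; apply: le_measure; rewrite ?inE.
  rewrite /Q (lebesgue_rV_cube (c k) (a := fun=> - rr) (b := fun=> rr)); last by move=> j; lra.
  rewrite lee_fin leNgt => /negP; apply; apply: prodr_gt0 => j _; lra.
- by apply: rV_compact_closed.
wlog lpq : p q pq Kp Kq / (p < q)%N.
  move=> h; case: (ltngtP p q) => // [lt|lt|E]; [exact: (h p q)|apply: (h q p) => //|by rewrite E eqxx in pq].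
  by rewrite eq_sym.
have := le_trans (rV_coord_le _ ord0) Kp; have := le_trans (rV_coord_le _ ord0) Kq.
rewrite /c !rVE eqxx !mulr1 !ler_norml => /andP[a1 a2] /andP[a3 a4].
by have := dS p q lpq; have := d0 p; lra.
Qed.

(** * The energy space satisfies the abstract hypotheses *)

Section energy_space.
Context {R : realType} {n : nat} (Omega : set 'rV[R]_n.+1) (eta : R).
Hypothesis n_le2 : (n <= 2)%N.
Hypothesis oO : open Omega.
Hypothesis bO : bounded_set Omega.
Hypothesis O0 : Omega !=set0.
Hypothesis hreg : Ck_holder_boundary 4 eta Omega.
Variables (bc : boundary_condition) (omega kappa : R).
Hypothesis kappa0 : 0 < kappa.

Implicit Types (u v w h : 'rV[R]_n.+1 -> R) (i j : 'I_n.+1).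
Local Notation L2 := (L2 Omega).
Local Notation L4 := (L4 Omega).
Local Notation n2 := (n2 Omega).
Local Notation n4 := (n4 Omega).
Local Notation ip := (ip Omega).
Local Notation aeq := (aeq Omega).
Local Notation D i := (weak_deriv Omega [:: i]).
Local Notation DD i j := (weak_deriv Omega [:: i; j]).
Local Notation Du u := (fun i => D i u).
Local Notation lap := (laplacian Omega).
Local Notation X := (energy_space Omega bc).
Local Notation nrm := (energy_norm Omega).
Local Notation lin c u d v := (fun x => c * u x + d * v x).

Let mO : measurable Omega. Proof. exact: measurable_rV_open. Qed.

Let XW u : X u -> W2 Omega 2 u.
Proof. by rewrite /energy_space; case: bc => [[]|[]]. Qed.

Let XW0 u : X u -> W2_0 Omega 1 u.
Proof. by rewrite /energy_space; case: bc => [/(W2_0W oO bO)|[]]. Qed.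

Let X_lin u v (c d : R) : X u -> X v -> X (lin c u d v).
Proof.
rewrite /energy_space; case: bc => [hu hv|[hu1 hu2] [hv1 hv2]]; first exact: (W2_0_lin oO bO).
by split; [exact: (W2_lin oO bO)|exact: (W2_0_lin oO bO)].
Qed.

Let X_test phi : test_function Omega phi -> X phi.
Proof.
rewrite /energy_space => tp; case: bc; first exact: (test_W2_0 oO bO).
by split; [exact: (test_W2 oO bO)|exact: (test_W2_0 oO bO)].
Qed.

Let addE u v : u + v = lin 1 u 1 v.
Proof. by apply/funext => x; rewrite !mul1r. Qed.

Let subE u v : u - v = lin 1 u (-1) v.
Proof. by apply/funext => x; rewrite mul1r mulN1r. Qed.

Let scE (t : R) u : (fun x => t * u x) = lin t u 0 u.
Proof. by apply/funext => x; rewrite mul0r addr0. Qed.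

Let XB u v : X u -> X v -> X (u - v).
Proof. by move=> Xu Xv; rewrite subE; exact: X_lin. Qed.

Let nrmE u : nrm u = n2 (lap u).
Proof. by congr Num.sqrt; apply: eq_Rintegral => x _; rewrite expr2. Qed.

Let LD i u : X u -> L2 (D i u).
Proof. by move=> /XW W; exact: (W2_wds oO bO W (isT : (size [:: i] <= 2)%N)).1. Qed.

Let LDD i j u : X u -> L2 (DD i j u).
Proof. by move=> /XW W; exact: (W2_wds oO bO W (isT : (size [:: i; j] <= 2)%N)).1. Qed.

Let Llap u : X u -> L2 (lap u).
Proof. by move=> Xu; apply: (L2_sum mO) => i; exact: LDD. Qed.

Let D_lin i u v c d : X u -> X v -> aeq (D i (lin c u d v)) (lin c (D i u) d (D i v)).
Proof. by move=> /XW W1 /XW W2; exact: (weak_deriv_lin oO bO c d W1 W2 (isT : (size [:: i] <= 2)%N)). Qed.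

Let lap_lin u v c d : X u -> X v -> aeq (lap (lin c u d v)) (lin c (lap u) d (lap v)).
Proof.
move=> /XW W1 /XW W2.
have := filter_forall (ae_filter_ringOfSetsType (lebesgue_rV R n.+1))
  (fun i => weak_deriv_lin oO bO c d W1 W2 (isT : (size [:: i; i] <= 2)%N)).
apply: filterS => x q Ox; rewrite /laplacian !mulr_sumr -big_split/=.
by apply: eq_bigr => i _; exact: q.
Qed.

(** For either boundary condition the space consists of W^{2,2} functions with zero trace, so the
    norm of the Laplacian controls the full W^{2,2} norm. *)
Let estimate : exists2 C : R, 0 < C & forall u, X u -> [/\ n2 u <= C * nrm u,
  forall i, n2 (D i u) <= C * nrm u & forall i j, n2 (DD i j u) <= C * nrm u].
Proof.
have [C C0 hC] := hessian_estimate oO bO hreg; exists C => // u Xu; rewrite nrmE.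
exact: (hC _ _ _ (W2_sobolev2 oO bO (XW Xu)) (W2_0_h10 oO bO (XW0 Xu))).
Qed.

Let hess_wd i k u : X u -> wd Omega k (D i u) (DD i k u).
Proof. by move=> /XW W; have [_ _ _ _ q] := W2_sobolev2 oO bO W; exact: q. Qed.

Let LD4 i u : X u -> L4 (D i u).
Proof.
move=> Xu; have [I [psi [C0 [_ _ h]]]] := L4_compactness n_le2 oO bO hreg (@ltr01 R).
exact: (h _ _ (LD i Xu) (fun k => LDD i k Xu) (fun k => hess_wd i k Xu)).1.
Qed.

Let m u : R := n4 (fnorm (Du u)).

(** [L4_compactness] applied to the components of the gradient, whose own gradients are rows of the
    Hessian. *)
Let m_net (e : R) : 0 < e -> exists (I : finType) (psi : I -> 'rV[R]_n.+1 -> R) (C0 : R),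
  [/\ 0 <= C0, forall p, L2 (psi p) & forall w, X w ->
    m w <= e * nrm w + C0 * \sum_i \sum_p `|ip (psi p) (D i w)|].
Proof.
move=> e0; have [C Cp hC] := estimate.
(* A component and its n + 1 derivatives cost (n + 2) C nrm(w), and there are n + 1 components. *)
pose d : R := e / (n.+1%:R * (n.+2%:R * C)); have dp : 0 < d by rewrite divr_gt0// !mulr_gt0// ltr0n.
have [I [psi [C0 [C00 Lpsi h]]]] := L4_compactness n_le2 oO bO hreg dp.
exists I, psi, C0; split=> // w Xw; have [_ q1 q2] := hC w Xw.
apply: le_trans (L4_fnorm mO (fun i => LD4 i Xw)).2 _.
apply: (@le_trans _ _ (\sum_i (d * (n.+2%:R * (C * nrm w)) + C0 * \sum_p `|ip (psi p) (D i w)|))).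
  apply: ler_sum => i _; apply: le_trans (h _ _ (LD i Xw) (fun k => LDD i k Xw) (fun k => hess_wd i k Xw)).2 _.
  rewrite lerD2r; apply: ler_wpM2l; first exact: ltW.
  rewrite -[n.+2%:R]natr1 mulrDl mul1r addrC; apply: lerD => //.
  have -> : n.+1%:R * (C * nrm w) = \sum_(k < n.+1) C * nrm w by rewrite sumr_const card_ord mulr_natl.
  by apply: ler_sum => k _.
rewrite big_split/= -[X in _ + X <= _]mulr_sumr lerD2r.
have -> : \sum_(i < n.+1) d * (n.+2%:R * (C * nrm w)) = n.+1%:R * (d * (n.+2%:R * (C * nrm w))).
  by rewrite sumr_const card_ord; apply/esym; exact: mulr_natl.
have key (a b c d' x : R) : a * (d' * (b * (c * x))) = d' * (a * (b * c)) * x by ring.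
have Q0 : n.+1%:R * (n.+2%:R * C) != 0 :> R := lt0r_neq0 (mulr_gt0 (ltr0Sn R n) (mulr_gt0 (ltr0Sn R n.+1) Cp)).
by rewrite key /d (divfK Q0).
Qed.

Let nrm_sub u v : X u -> X v -> nrm (u - v) <= nrm u + nrm v.
Proof.
move=> Xu Xv; rewrite !nrmE subE; have Lu := Llap Xu; have Lv := Llap Xv.
have LL := L2D mO (L2Z mO 1 Lu) (L2Z mO (-1) Lv).
rewrite (aeq_n2 mO (Llap (X_lin 1 (-1) Xu Xv)) LL (lap_lin 1 (-1) Xu Xv)).
have key (a b c : R) : c <= `|1| * a + `|-1| * b -> c <= a + b by rewrite normrN normr1 !mul1r.
exact: (key _ _ _ (n2_lin_le 1 (-1) mO Lu Lv)).
Qed.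

Let m_nrm : exists2 C : R, 0 < C & forall u, X u -> m u <= C * nrm u.
Proof.
have [C Cp hC] := estimate; have [I [psi [C0 [C00 Lpsi h]]]] := m_net (@ltr01 R).
pose S : R := \sum_(i < n.+1) \sum_p n2 (psi p) * C.
have S0 : 0 <= S by apply: sumr_ge0 => i _; apply: sumr_ge0 => p _; rewrite mulr_ge0 ?n2_ge0 ?(ltW Cp).
exists (1 + C0 * S) => [|u Xu]; first by have := mulr_ge0 C00 S0; lra.
apply: le_trans (h u Xu) _; rewrite [leRHS]mulrDl lerD2l -mulrA; apply: ler_wpM2l => //.
rewrite /S mulr_suml; apply: ler_sum => i _; rewrite mulr_suml; apply: ler_sum => p _.
apply: le_trans (cauchy_schwarz mO (Lpsi p) (LD i Xu)) _; rewrite -mulrA; apply: ler_wpM2l; first exact: n2_ge0.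
by have [_ q _] := hC u Xu.
Qed.

(** One ultrafilter makes all inner products converge simultaneously, so the finite family of
    [m_net] may depend on [e] without a diagonal argument. *)
Let compactness (u : nat -> 'rV[R]_n.+1 -> R) : (forall k, X (u k)) -> (forall k, nrm (u k) <= 1) ->
  exists phi : nat -> nat, (forall k, (phi k < phi k.+1)%N) /\
  forall e : R, 0 < e -> exists k, forall p q, (k <= p)%N -> (k <= q)%N -> m (u (phi p) - u (phi q)) < e.
Proof.
move=> Xu nu; have [G [uG Goo]] := ultraFilterLemma eventually_filter.
apply: (@ultra_subsequence R (fun p q => m (u p - u q)) G).
  by move=> q; apply: Goo; exists q.+1.
move=> e e0; have [C Cp hC] := estimate.
have [I [psi [C0 [C00 Lpsi h]]]] := m_net (divr_gt0 e0 (ltr0n R 4)).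
have /choice[c hc] : forall ip' : 'I_n.+1 * I, exists c : R, forall e : R, 0 < e ->
    G [set k | `|ip (psi ip'.2) (D ip'.1 (u k)) - c| < e].
  move=> [i p] /=; apply: (@ultra_lim R G _ (n2 (psi p) * C) uG) => k.
  apply: le_trans (cauchy_schwarz mO (Lpsi p) (LD i (Xu k))) _; apply: ler_wpM2l; first exact: n2_ge0.
  have [_ q _] := hC _ (Xu k); apply: le_trans (q i) _.
  by rewrite ger_pMr.
pose T : R := \sum_(i < n.+1) \sum_(p : I) 1.
have T0 : 0 <= T by apply: sumr_ge0 => i _; apply: sumr_ge0.
pose d : R := e / (4 * ((C0 + 1) * (T + 1))).
have d4 : 0 < 4 * ((C0 + 1) * (T + 1)) by rewrite !mulr_gt0// ltr_wpDl.
have d0 : 0 < d by rewrite divr_gt0.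
exists [set k | forall ip' : 'I_n.+1 * I, `|ip (psi ip'.2) (D ip'.1 (u k)) - c ip'| < d].
  by apply: filter_forall => ip'; exact: hc.
move=> k l /= hk hl; have Xw := XB (Xu k) (Xu l); apply: le_lt_trans (h _ Xw) _.
have b1 : e / 4 * nrm (u k - u l) <= e / 4 * 2.
  apply: ler_wpM2l; first by rewrite divr_ge0// ltW.
  apply: le_trans (nrm_sub (Xu k) (Xu l)) _; exact: (lerD (nu k) (nu l) : _ <= 1 + 1).
have b2 : \sum_i \sum_p `|ip (psi p) (D i (u k - u l))| <= T * (2 * d).
  rewrite /T mulr_suml; apply: ler_sum => i _; rewrite mulr_suml; apply: ler_sum => p _; rewrite mul1r.
  have Lk := LD i (Xu k); have Ll := LD i (Xu l).
  have LL := L2D mO (L2Z mO 1 Lk) (L2Z mO (-1) Ll).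
  have Lw : L2 (D i (lin 1 (u k) (-1) (u l))) by apply: LD; exact: X_lin.
  rewrite subE (aeq_ip mO (Lpsi p) Lw (Lpsi p) LL (aeq_refl _ _) (D_lin i 1 (-1) (Xu k) (Xu l))).
  rewrite (ipDr mO (L2Z mO 1 Lk) (L2Z mO (-1) Ll) (Lpsi p)).
  rewrite (ipZr mO 1 Lk (Lpsi p)) (ipZr mO (-1) Ll (Lpsi p)) mul1r mulN1r.
  have := hk (i, p); have := hl (i, p) => /= a1 a2.
  exact: (norm_sub_lt a2 a1).
exact: (net_bound d0 C00 T0 (divfK (lt0r_neq0 d4) e) b1 b2).
Qed.

(** By [estimate] the functions and their derivatives up to order two are Cauchy in L^2. Weak
    derivatives pass to the limit, and so does approximation by test functions. *)
Let complete (u : nat -> 'rV[R]_n.+1 -> R) : (forall k, X (u k)) ->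
  (forall e : R, 0 < e -> exists k, forall p q, (k <= p)%N -> (k <= q)%N -> nrm (u p - u q) < e) ->
  exists2 w, X w & forall e : R, 0 < e -> exists k, forall p, (k <= p)%N -> nrm (u p - w) < e.
Proof.
move=> Xu cu; have [C Cp hC] := estimate.
have lim (F : nat -> 'rV[R]_n.+1 -> R) : (forall k, L2 (F k)) ->
    (forall p q, n2 (fun x => F p x - F q x) <= C * nrm (u p - u q)) ->
    exists W, L2 W /\ forall e : R, 0 < e -> exists K, forall k, (K <= k)%N -> n2 (fun x => F k x - W x) < e.
  move=> LF hF; have [|W LW [_ [_ _ q]]] := L2_cauchy_complete mO LF; last by exists W.
  move=> e e0; have [K hK] := cu _ (divr_gt0 e0 Cp); exists K => p q Kp Kq.
  apply: le_lt_trans (hF p q) _; have := hK p q Kp Kq.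
  by rewrite ltr_pdivlMr// mulrC.
have Wu k := XW (Xu k).
have [U [LU hU]] : exists W, L2 W /\ forall e : R, 0 < e -> exists K, forall k, (K <= k)%N -> n2 (fun x => u k x - W x) < e.
  by apply: lim => [k|p q]; [exact: (W2_L2 oO bO (Wu k))|have [q1 _ _] := hC _ (XB (Xu p) (Xu q))].
have /choice[U1 hU1] : forall i, exists W, L2 W /\ forall e : R, 0 < e -> exists K, forall k, (K <= k)%N -> n2 (fun x => D i (u k) x - W x) < e.
  move=> i; apply: lim => [k|p q]; first exact: LD.
  rewrite -(n2_weak_derivB oO bO (Wu p) (Wu q) (isT : (size [:: i] <= 2)%N)).
  by have [_ q1 _] := hC _ (XB (Xu p) (Xu q)).
have /choice[U2 hU2] : forall ij : 'I_n.+1 * 'I_n.+1, exists W, L2 W /\ forall e : R, 0 < e -> exists K, forall k, (K <= k)%N -> n2 (fun x => DD ij.1 ij.2 (u k) x - W x) < e.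
  move=> [i j]; apply: lim => [k|p q]; first exact: LDD.
  rewrite -(n2_weak_derivB oO bO (Wu p) (Wu q) (isT : (size [:: i; j] <= 2)%N)).
  by have [_ _ q1] := hC _ (XB (Xu p) (Xu q)).
have LU1 i := (hU1 i).1; have LU2 ij := (hU2 ij).1.
have sU : sobolev2 Omega U U1 (fun i j => U2 (i, j)).
  split=> // [i|i j].
    apply: (wd_limit oO bO (fun k => W2_L2 oO bO (Wu k)) (fun k => LD i (Xu k)) LU (LU1 i) hU (hU1 i).2) => k.
    by have [_ _ _ q _] := W2_sobolev2 oO bO (Wu k).
  apply: (wd_limit oO bO (fun k => LD i (Xu k)) (fun k => LDD i j (Xu k)) (LU1 i) (LU2 (i, j)) (hU1 i).2 (hU2 (i, j)).2) => k.
  exact: hess_wd.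
have [WU E1 E2] := sobolev2_W2 oO bO sU.
have conv (d : R) : 0 < d -> exists K, forall k, (K <= k)%N -> forall s, (size s <= 2)%N ->
    n2 (fun x => weak_deriv Omega s U x - weak_deriv Omega s (u k) x) < d.
  move=> d0; have [K0 h0] := hU d d0.
  have /choice[K1 h1] := fun i => (hU1 i).2 d d0; have /choice[K2 h2] := fun ij => (hU2 ij).2 d d0.
  exists (maxn K0 (maxn (\max_i K1 i) (\max_ij K2 ij))) => k; rewrite !geq_max => /and3P[k0 k1 k2] s sm.
  have LsU := (W2_wds oO bO WU sm).1; have Lsu := (W2_wds oO bO (Wu k) sm).1; rewrite n2_subC.
  have fin F W : L2 F -> L2 W -> aeq (weak_deriv Omega s (u k)) F -> aeq (weak_deriv Omega s U) W ->
      n2 (fun x => F x - W x) < d -> n2 (fun x => weak_deriv Omega s (u k) x - weak_deriv Omega s U x) < d.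
    move=> LF LW q1 q2; rewrite -(aeq_n2 mO (L2B mO Lsu LsU) (L2B mO LF LW))//.
    by move: q1 q2; apply: filterS2 => x q1 q2 Ox; rewrite q1// q2.
  case: s sm LsU Lsu fin => [|i [|j [|//]]] _ _ _ fin.
  - have E w : L2 w -> aeq (weak_deriv Omega [::] w) w.
      by move=> Lw; apply: (wds_aeq oO bO) => // psi tq; rewrite expr0 mul1r.
    by apply: (fin _ _ (W2_L2 oO bO (Wu k)) LU (E _ (W2_L2 oO bO (Wu k))) (E _ LU)); exact: h0.
  - apply: (fin _ _ (LD i (Xu k)) (LU1 i) (aeq_refl _ _) (E1 i)); apply: h1.
    exact: leq_trans (leq_bigmax i) k1.
  apply: (fin _ _ (LDD i j (Xu k)) (LU2 (i, j)) (aeq_refl _ _) (E2 i j)); apply: (h2 (i, j)).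
  exact: leq_trans (leq_bigmax (i, j)) k2.
have XU : X U.
  move: Xu; rewrite /energy_space; case: bc => Xu'.
    apply: (W2_0_closed oO bO WU) => d /conv[K hK]; exists (u K) => // s; exact: hK.
  split=> //; apply: (W2_0_closed oO bO) => [s sm|d /conv[K hK]].
    by apply: WU; exact: leqW.
  exists (u K); first exact: (Xu' K).2.
  by move=> s sm; apply: hK => //; exact: leqW.
exists U => // e e0; pose d : R := e / n.+2%:R.
have d0 : 0 < d by rewrite divr_gt0// ltr0n.
have [K hK] := conv d d0; exists K => k Kk; rewrite nrmE.
have Xw := XB (Xu k) XU.
apply: le_lt_trans (n2_sum mO (index_enum 'I_n.+1) (fun i => LDD i i Xw)) _.
apply: (@le_lt_trans _ _ (\sum_(i < n.+1) d)).
  apply: ler_sum => i _.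
  rewrite (n2_weak_derivB oO bO (Wu k) WU (isT : (size [:: i; i] <= 2)%N)) n2_subC.
  by apply: ltW; exact: hK.
rewrite sumr_const card_ord -mulr_natl /d mulrCA gtr_pMr// ltr_pdivrMr ?ltr0n// mul1r ltr_nat.
exact: ltnSn.
Qed.

Let B u h : R := ip (lap u) (lap h) + omega ^+ 2 * \sum_i ip (D i u) (D i h).

Let B_sym u h : B u h = B h u.
Proof. by rewrite /B ipC; congr (_ + _ * _); apply: eq_bigr => i _; rewrite ipC. Qed.

Let B_lin u v h c d : X u -> X v -> X h -> B (lin c u d v) h = c * B u h + d * B v h.
Proof.
move=> Xu Xv Xh; have Xl := X_lin c d Xu Xv.
have ipl F G H E : L2 E -> L2 F -> L2 G -> L2 H -> aeq E (lin c F d G) ->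
    ip E H = c * ip F H + d * ip G H.
  move=> LE LF LG LH q; have Lc := L2Z mO c LF; have Ld := L2Z mO d LG.
  rewrite (aeq_ip mO LE LH (L2D mO Lc Ld) LH q (aeq_refl _ _)) (ipDl mO Lc Ld LH).
  by rewrite (ipZl mO c LF LH) (ipZl mO d LG LH).
have S : \sum_i ip (D i (lin c u d v)) (D i h) = c * (\sum_i ip (D i u) (D i h)) + d * \sum_i ip (D i v) (D i h).
  apply: (etrans (eq_bigr (fun i => c * ip (D i u) (D i h) + d * ip (D i v) (D i h))
    (fun i _ => ipl _ _ _ _ (LD i Xl) (LD i Xu) (LD i Xv) (LD i Xh) (D_lin i c d Xu Xv)))).
  by rewrite big_split/=; congr (_ + _); apply/esym/mulr_sumr.
have key (p q r s w : R) : c * p + d * q + w * (c * r + d * s) = c * (p + w * r) + d * (q + w * s) by ring.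
exact: (etrans (congr2 (fun x y => x + omega ^+ 2 * y)
  (ipl _ _ _ _ (Llap Xl) (Llap Xu) (Llap Xv) (Llap Xh) (lap_lin c d Xu Xv)) S) (key _ _ _ _ _)).
Qed.

Let m_lin u v c d : X u -> X v -> m (lin c u d v) = n4 (fnorm (fun i x => c * D i u x + d * D i v x)).
Proof.
move=> Xu Xv; apply: (n4_fnorm_aeq mO) => i; [exact/LD4/X_lin| |exact: D_lin].
have Z (t : R) w : X w -> L4 (fun x => t * D i w x).
  move=> Xw; have [mw Lw] := LD4 i Xw; split; first exact: measurable_funM.
  have := L2Z mO (t ^+ 2) Lw; congr (L2 _).
  by apply/funext => x; rewrite exprMn.
exact: (L4D mO (Z c u Xu) (Z d v Xv)).1.
Qed.

(** The derivative at [u], in the direction [h], of kappa int |grad u|^4. *)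
Let l u h : R := 4 * kappa * ip (fun x => fnorm (Du u) x ^+ 2) (fdot (Du u) (Du h)).

Let n4_fnorm u : n4 (fnorm (Du u)) ^+ 4 = \int[lebesgue_rV R n.+1]_(x in Omega) (grad_norm Omega u x ^+ 4).
Proof.
rewrite (exprM _ 2 2) n4_sqr n2_sqr; apply: eq_Rintegral => x _.
exact: (esym (exprD _ 2 2)).
Qed.

Let one_L2 : L2 (fun=> 1).
Proof.
have h x : Omega x -> `|1 : R| <= 1 by rewrite normr1.
exact: (L2_bounded oO bO (measurable_cst _) h).
Qed.

Let energyE u : X u -> energy Omega omega kappa u = B u u / 2 - kappa * m u ^+ 4 / 4.
Proof.
move=> Xu; have E1 : \int[lebesgue_rV R n.+1]_(x in Omega) (grad_norm Omega u x ^+ 2) = \sum_i ip (D i u) (D i u).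
  apply: (etrans (y := ip (fun x => \sum_i D i u x ^+ 2) (fun=> 1))).
    apply: eq_Rintegral => x _; rewrite mulr1 sqr_sqrtr//; apply: sumr_ge0 => i _; exact: sqr_ge0.
  apply: (etrans (ip_suml oO (index_enum 'I_n.+1) (fun i => (LD4 i Xu).2) one_L2)).
  by apply: eq_bigr => i _; apply: eq_Rintegral => x _; rewrite mulr1 expr2.
have E2 : \int[lebesgue_rV R n.+1]_(x in Omega) (laplacian Omega u x ^+ 2) = ip (lap u) (lap u).
  by apply: eq_Rintegral => x _; rewrite expr2.
rewrite /energy E1 E2 -n4_fnorm /B /m.
set p := ip _ _; set q := \sum_i _; set r := Submission.n4 _ _.
by field.
Qed.

Let zero_L2 : L2 (fun=> 0). Proof. exact: L20. Qed.

(** If [u] vanishes almost everywhere, zero is one of its weak second derivatives; the converse is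
    [estimate]. *)
Let ZP u : X u -> (ae_zero Omega u <-> nrm u = 0).
Proof.
move=> Xu; have Lu := W2_L2 oO bO (XW Xu); rewrite nrmE; split=> [z|z].
  have qi i : aeq (DD i i u) (fun=> 0).
    apply: (wds_aeq oO bO Lu zero_L2) => phi tp.
    have Lp := test_L2 oO bO (test_pderivs [:: i; i] tp).
    apply: (etrans (aeq_ip mO Lu Lp zero_L2 Lp (z : aeq u (fun=> 0)) (aeq_refl _ _))).
    apply: (etrans (ip0l _ _)); apply: esym; apply: (etrans (congr1 _ (ip0l _ _))); exact: mulr0.
  have q : aeq (lap u) (fun=> 0).
    have := filter_forall (ae_filter_ringOfSetsType (lebesgue_rV R n.+1)) qi.
    apply: filterS => x h Ox; rewrite /laplacian big1// => i _; exact: h.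
  by rewrite (aeq_n2 mO (Llap Xu) zero_L2 q); exact: n2_0.
have [C Cp hC] := estimate; have [h _ _] := hC u Xu; rewrite nrmE z mulr0 in h.
apply: (n2_eq0 mO Lu); apply: le_anti; apply/andP; split; first exact: h.
exact: n2_ge0.
Qed.

Let XD u v : X u -> X v -> X (u + v).
Proof. by move=> Xu Xv; rewrite addE; exact: X_lin. Qed.

Let XZ (t : R) u : X u -> X (fun x => t * u x).
Proof. by move=> Xu; rewrite scE; exact: X_lin. Qed.

Let nrmZ (t : R) u : X u -> nrm (fun x => t * u x) = `|t| * nrm u.
Proof.
move=> Xu; rewrite !nrmE scE; have Lt := L2Z mO t (Llap Xu); have L0 := L2Z mO 0 (Llap Xu).
rewrite (aeq_n2 mO (Llap (X_lin t 0 Xu Xu)) (L2D mO Lt L0) (lap_lin t 0 Xu Xu)).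
by rewrite -(scE t (lap u)); exact: (n2Z mO t (Llap Xu)).
Qed.

Let m_add u v : X u -> X v -> m (u + v) = n4 (fnorm (fun i x => D i u x + D i v x)).
Proof.
move=> Xu Xv; rewrite addE; apply: (etrans (m_lin 1 1 Xu Xv)).
by congr (n4 (fnorm _)); apply/funext => i; apply/funext => x; rewrite !mul1r.
Qed.

Let mD u v : X u -> X v -> m (u + v) <= m u + m v.
Proof.
move=> Xu Xv; rewrite (m_add Xu Xv).
have mf := (L4_fnorm mO (fun i => (L4D mO (LD4 i Xu) (LD4 i Xv)).1)).1.1.
have [LS hS] := L4D mO (L4_fnorm mO (fun i => LD4 i Xu)).1 (L4_fnorm mO (fun i => LD4 i Xv)).1.
apply: le_trans hS; refine (L4_le mO LS mf _).2 => x _.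
by rewrite (ger0_norm (fnorm_ge0 _ _)); apply: le_trans (fnormD _ _ x) (ler_norm _).
Qed.

Let mZ (t : R) u : X u -> m (fun x => t * u x) = `|t| * m u.
Proof.
move=> Xu; rewrite scE; apply: (etrans (m_lin t 0 Xu Xu)).
have n4E f : n4 f = Num.sqrt (n2 (fun x => f x ^+ 2)) by [].
have Lf := (L4_fnorm mO (fun i => LD4 i Xu)).1.2.
rewrite /m !n4E; have -> : (fun x => fnorm (fun i y => t * D i u y + 0 * D i u y) x ^+ 2) =
    (fun x => t ^+ 2 * fnorm (Du u) x ^+ 2).
  apply/funext => x; have -> : (fun i y => t * D i u y + 0 * D i u y) = (fun i y => t * D i u y).
    by apply/funext => i; apply/funext => y; rewrite mul0r addr0.
  by rewrite fnormZ exprMn real_normK ?num_real.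
by rewrite (n2Z mO (t ^+ 2) Lf) (ger0_norm (sqr_ge0 t)) (sqrtrM _ (sqr_ge0 t)) sqrtr_sqr.
Qed.

Let lZ (t : R) u h : X u -> X h -> l u (fun x => t * h x) = t * l u h.
Proof.
move=> Xu Xh; rewrite scE /l; have Xl := X_lin t 0 Xh Xh.
have Lf := L2_fnorm2 mO (fun i => LD4 i Xu).
have L1 := L2_fdot mO (fun i => LD4 i Xu) (fun i => LD4 i Xl).
have Lh := L2_fdot mO (fun i => LD4 i Xu) (fun i => LD4 i Xh).
have q : aeq (fdot (Du u) (Du (lin t h 0 h))) (fun x => t * fdot (Du u) (Du h) x).
  have := fdot_aeq (fun i => aeq_refl Omega (D i u)) (fun i => D_lin i t 0 Xh Xh).
  apply: filterS => x e Ox; rewrite (e Ox) /fdot mulr_sumr; apply: eq_bigr => i _; ring.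
rewrite (aeq_ip mO Lf L1 Lf (L2Z mO t Lh) (aeq_refl _ _) q) (ipZr mO t Lh Lf); ring.
Qed.

Let bD u h : X u -> X h -> `|kappa * m (u + h) ^+ 4 - kappa * m u ^+ 4 - l u h| <=
  6 * kappa * m h ^+ 2 * (m u + m h) ^+ 2.
Proof.
move=> Xu Xh; rewrite (m_add Xu Xh).
have := quartic_expansion mO (fun i => LD4 i Xu) (fun i => LD4 i Xh).
rewrite /l /m; set P := n4 (fnorm (fun i x => _ + _)); set Q := ip _ _; set p := n4 _; set q := n4 _ => e.
have -> : kappa * P ^+ 4 - kappa * p ^+ 4 - 4 * kappa * Q = kappa * (P ^+ 4 - p ^+ 4 - 4 * Q) by ring.
have -> : 6 * kappa * q ^+ 2 * (p + q) ^+ 2 = kappa * (6 * q ^+ 2 * (p + q) ^+ 2) by ring.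
by rewrite normrM (gtr0_norm kappa0); exact: (ler_wpM2l (ltW kappa0) e).
Qed.

Let BZl (t : R) u h : X u -> X h -> B (fun x => t * u x) h = t * B u h.
Proof. by move=> Xu Xh; rewrite scE (B_lin t 0 Xu Xu Xh); ring. Qed.

Let BZ (t : R) u h : X u -> X h -> B u (fun x => t * h x) = t * B u h.
Proof. by move=> Xu Xh; rewrite B_sym (BZl t Xh Xu) B_sym. Qed.

Let aZ (t : R) u : X u -> B (fun x => t * u x) (fun x => t * u x) = t ^+ 2 * B u u.
Proof. by move=> Xu; rewrite (BZl t Xu (XZ t Xu)) (BZ t Xu Xu) mulrA -expr2. Qed.

Let aD u h : X u -> X h -> B (u + h) (u + h) = B u u + 2 * B u h + B h h.
Proof.
move=> Xu Xh; rewrite addE; have Xl := X_lin 1 1 Xu Xh.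
have key (x y z p q r s : R) : x = 1 * y + 1 * z -> y = 1 * p + 1 * q -> z = 1 * r + 1 * s -> q = r ->
    x = p + 2 * r + s by lra.
exact: (key _ _ _ _ _ _ _ (B_lin 1 1 Xu Xh Xl) (etrans (B_sym _ _) (B_lin 1 1 Xu Xh Xu))
  (etrans (B_sym _ _) (B_lin 1 1 Xu Xh Xh)) (B_sym h u)).
Qed.

Let nrm_a u : X u -> nrm u ^+ 2 <= B u u.
Proof.
move=> Xu; rewrite nrmE n2_sqr /B lerDl; apply: (mulr_ge0 (sqr_ge0 omega)).
by apply: sumr_ge0 => i _; exact: ip_ge0.
Qed.

Let a_nrm : exists2 C : R, 0 < C & forall u, X u -> B u u <= C * nrm u ^+ 2.
Proof.
have [C Cp hC] := estimate; pose c : R := omega ^+ 2 * (n.+1%:R * C ^+ 2).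
have c0 : 0 <= c := mulr_ge0 (sqr_ge0 omega) (mulr_ge0 (ler0n R n.+1) (sqr_ge0 C)).
exists (1 + c) => [|u Xu]; first by lra.
have [_ q _] := hC u Xu; have e : nrm u ^+ 2 = ip (lap u) (lap u) by rewrite nrmE n2_sqr.
have -> : (1 + c) * nrm u ^+ 2 = nrm u ^+ 2 + omega ^+ 2 * (n.+1%:R * (C * nrm u) ^+ 2).
  by rewrite mulrDl mul1r /c exprMn !mulrA.
rewrite /B; apply: lerD; first by rewrite e.
apply: (ler_wpM2l (sqr_ge0 omega)).
have -> : n.+1%:R * (C * nrm u) ^+ 2 = \sum_(i < n.+1) (C * nrm u) ^+ 2.
  by rewrite sumr_const card_ord mulr_natl.
apply: ler_sum => i _; rewrite -n2_sqr; have q0 := n2_ge0 Omega (D i u); have := q i.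
by move=> h; apply: lerXn2r => //; rewrite nnegrE//; exact: le_trans q0 h.
Qed.

(** Normalised bumps with disjoint supports are orthonormal for the inner product of Laplacians,
    hence at distance sqrt 2. If [m] vanished at a bump, so would its first derivative, and by
    Poincare the bump itself. *)
Let bumps : (exists f : nat -> 'rV[R]_n.+1 -> R, [/\ forall k, X (f k), forall k, nrm (f k) <= 1 &
    forall p q, p != q -> 1 <= nrm (f p - f q)]) /\ exists2 u, X u & 0 < m u.
Proof.
have [chi [K [tchi chi0 cK Kz Kd]]] := separated_bumps oO bO O0.
have [C Cp hC] := estimate; have Xc k := X_test (tchi k).
split; last first.
  have Xu := Xc 0%N; have [C' C'0 hp] := h10_poincare oO bO (ord0 : 'I_n.+1).
  exists (chi 0%N) => //; rewrite lt_def n4_ge0 andbT; apply/eqP => m00.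
  have d4 : n4 (D ord0 (chi 0%N)) = 0.
    apply: le_anti; apply/andP; split; last exact: n4_ge0.
    rewrite -m00; refine (L4_le mO (L4_fnorm mO (fun i => LD4 i Xu)).1 (L2_measurable (LD ord0 Xu)) _).2 => x _.
    by apply: le_trans (fnorm_comp (Du (chi 0%N)) x ord0) (ler_norm _).
  have d2 : n2 (fun x => D ord0 (chi 0%N) x ^+ 2) = 0 by rewrite -n4_sqr d4 expr0n.
  have q' : aeq (D ord0 (chi 0%N)) (fun=> 0).
    have := n2_eq0 mO (LD4 ord0 Xu).2 d2.
    by apply: filterS => x h Ox; apply/eqP; rewrite -sqrf_eq0; apply/eqP; exact: h.
  have := hp _ _ (W2_L2 oO bO (XW Xu)) (fun i => LD i Xu) (W2_0_h10 oO bO (XW0 Xu)).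
  rewrite (aeq_n2 mO (LD ord0 Xu) zero_L2 q') n2_0 mulr0; have := chi0 0%N; lra.
have n0 k : 0 < nrm (chi k).
  by have [q _ _] := hC _ (Xc k); have := lt_le_trans (chi0 k) q; rewrite (pmulr_rgt0 _ Cp).
pose g k x := \sum_i pderiv i (pderiv i (chi k)) x.
have gE k : aeq (lap (chi k)) (g k).
  have := filter_forall (ae_filter_ringOfSetsType (lebesgue_rV R n.+1))
    (fun i => weak_deriv_test oO bO [:: i; i] (tchi k)).
  apply: filterS => x q Ox; apply: eq_bigr => i _; exact: (q i Ox).
have Lg k : L2 (g k).
  by apply: (L2_sum mO) => i; exact: (test_L2 oO bO (test_pderiv i (test_pderiv i (tchi k)))).
have g0 k x : ~ K k x -> g k x = 0.
  move=> nK; rewrite /g big1// => i _.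
  exact: (pderiv_supp i (cK k) (pderiv_supp i (cK k) (Kz k)) nK).
have ipg p q : p != q -> ip (g p) (g q) = 0.
  move=> pq; apply: (etrans _ (ip0l _ (fun=> 0))); apply: eq_Rintegral => x _; rewrite mul0r.
  have [Kx|nK] := pselect (K p x); last by rewrite (g0 p x nK) mul0r.
  by rewrite (g0 q x (Kd p q x pq Kx)) mulr0.
have ng k : ip (g k) (g k) = nrm (chi k) ^+ 2.
  by rewrite nrmE (aeq_n2 mO (Llap (Xc k)) (Lg k) (gE k)) n2_sqr.
pose f k : 'rV[R]_n.+1 -> R := fun x => (nrm (chi k))^-1 * chi k x.
exists f; split=> [k|k|p q pq]; first exact: XZ.
  by rewrite (nrmZ _ (Xc k)) (gtr0_norm (_ : 0 < (nrm (chi k))^-1)) ?invr_gt0// mulVf ?gt_eqF.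
pose c := (nrm (chi p))^-1; pose d := - (nrm (chi q))^-1.
have E : f p - f q = lin c (chi p) d (chi q) by apply/funext => x; rewrite /c /d mulNr.
have Lc := L2Z mO c (Lg p); have Ld := L2Z mO d (Lg q); have LS := L2D mO Lc Ld.
have q2 : aeq (lap (lin c (chi p) d (chi q))) (lin c (g p) d (g q)).
  have := lap_lin c d (Xc p) (Xc q); move: (gE p) (gE q).
  by apply: filterS3 => x h1 h2 h3 Ox; rewrite (h3 Ox) (h1 Ox) (h2 Ox).
rewrite nrmE E (aeq_n2 mO (Llap (X_lin c d (Xc p) (Xc q))) LS q2).
have e : n2 (lin c (g p) d (g q)) ^+ 2 = 2.
  have key (P Q z gp gq : R) : P != 0 -> Q != 0 -> z = 0 -> gp = P ^+ 2 -> gq = Q ^+ 2 ->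
      P^-1 ^+ 2 * gp + 2 * P^-1 * (- Q^-1) * z + (- Q^-1) ^+ 2 * gq = 2.
    by move=> P0 Q0 -> -> ->; rewrite mulr0 addr0 sqrrN -!exprMn !mulVf// expr1n.
  exact: (etrans (n2_lin_sqr c d mO (Lg p) (Lg q)) (key _ _ _ _ _ (lt0r_neq0 (n0 p)) (lt0r_neq0 (n0 q))
    (ipg p q pq) (ng p) (ng q))).
rewrite leNgt; apply/negP => lt1.
by have := exprn_ile1 2 (n2_ge0 Omega (lin c (g p) d (g q))) (ltW lt1); rewrite e; lra.
Qed.

Lemma energy_ground_state_saddle : exists u, [/\ ground_state Omega bc omega kappa u,
  0 < energy Omega omega kappa u & saddle_type X nrm (energy Omega omega kappa) u].
Proof.
have [C1 C10 h1] := m_nrm; have [C2 C20 h2] := a_nrm; have [sep ntr] := bumps.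
have sc1 u : (fun x => 1 * u x) = u by apply/funext => x; rewrite mul1r.
have scN u : (fun x => -1 * u x) = - u by apply/funext => x; rewrite mulN1r.
have scD (t : R) u : u + (fun x => t * u x) = (fun x => (1 + t) * u x).
  by apply/funext => x; rewrite mulrDl mul1r.
have C0 : 0 < C1 + C2 by exact: addr_gt0.
have K0 : 0 <= 6 * kappa by exact: (mulr_ge0 (ler0n R 6) (ltW kappa0)).
have nrm0 u : X u -> 0 <= nrm u by move=> _; exact: sqrtr_ge0.
have m0 u : X u -> 0 <= m u by move=> _; exact: n4_ge0.
have m_nrm' u : X u -> m u <= (C1 + C2) * nrm u.
  move=> Xu; apply: le_trans (h1 u Xu) _; apply: (ler_wpM2r (nrm0 u Xu)).
  by rewrite lerDl; exact: ltW.
have a_nrm' u : X u -> B u u <= (C1 + C2) * nrm u ^+ 2.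
  move=> Xu; apply: le_trans (h2 u Xu) _; apply: (ler_wpM2r (sqr_ge0 _)).
  by rewrite lerDr; exact: ltW.
exact: (@ground_state_saddle R _ (fun t u x => t * u x) X nrm m (fun u => B u u)
  (energy Omega omega kappa) B l kappa (C1 + C2) (6 * kappa) (ae_zero Omega)
  sc1 scN scD XD XZ kappa0 C0 K0 nrm0 nrmZ m0 mD mZ m_nrm' nrm_a a_nrm' aD aZ BZ BZl lZ bD energyE
  complete compactness ntr sep ZP).
Qed.

End energy_space.

Theorem proposition6p1 (R : realType) (N : nat)
    (hN1 : (1 <= N)%N) (hN3 : (N <= 3)%N)
    (Omega : set 'rV[R]_N) (hOmega : bounded_domain Omega)
    (eta : R) (heta : 0 < eta < 1)
    (hreg : Ck_holder_boundary 4 eta Omega)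
    (bc : boundary_condition)
    (hbc : bc = Navier -> uniform_outer_ball Omega)
    (omega kappa : R) (hkappa : 0 < kappa) :
  exists u : 'rV[R]_N -> R,
    [/\ ground_state Omega bc omega kappa u,
        0 < energy Omega omega kappa u &
        saddle_type (energy_space Omega bc) (energy_norm Omega)
          (energy Omega omega kappa) u].
Proof.
case: N hN1 hN3 Omega hOmega hreg hbc; first by [].
move=> n _ n3 Omega [hne oO _ bO] hreg hbc.
exact: (energy_ground_state_saddle n3 oO bO hne hreg bc omega hkappa).
Qed.
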